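(* Let $N<p<\infty$, let $\mathbf{t}=(t_1,\dots,t_N)\in\mathbb{R}^N$ with $t_i>0$ for every $i$, let $K\subsetneq\overline{Q_{1/2}}$ be a compact set with $\mathrm{cap}_p(K;Q_1)>0$, and let $\Omega\subseteq\mathbb{R}^N$ be the $\mathbf{t}$-periodically perforated open set generated by $K$. For every $p<q<\infty$, let $u_q\in W^{1,p}_0(\Omega)\cap L^\infty(\Omega)$ be a non-negative function such that $$\|u_q\|_{L^q(\Omega)}=1,\qquad \int_\Omega|\nabla u_q|^p\,dx=\lambda_{p,q}(\Omega),\qquad \|u_q\|_{L^\infty(D_{\mathbf{t}}(Q_{1/2}\setminus K))}=\|u_q\|_{L^\infty(\Omega)}$$ (such functions exist). Then the family $\{u_q\}_{q>p}$ is precompact in $W^{1,p}_0(\Omega)$ as $q\to\infty$ (i.e. for every sequence $q_n\to+\infty$ there is a subsequence along which $u_{q_n}$ converges in the norm of $W^{1,p}(\Omega)$), and every accumulation point as $q\to\infty$ is an extremal of $\lambda_{p,\infty}(\Omega)$. Moreover, if for some diverging sequence $\{q_n\}_{n\in\mathbb{N}}$ and a function $u_\infty\in W^{1,p}_0(\Omega)$ it holds $$\lim_{n\to\infty}\|u_{q_n}-u_\infty\|_{W^{1,p}(\Omega)}=0,$$ then we also have $$u_{q_n}^{q_n-1}\ \rightharpoonup\ \delta_{z_\infty}\quad\text{in }\mathscr{D}'(\Omega),\ \text{as } n\to\infty,$$ where $z_\infty$ is the (unique) maximum point of $u_\infty$.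
   Context: The dimension is $N\ge 2$. $Q_r=(-r,r)^N$, so $Q_{1/2}=(-\tfrac12,\tfrac12)^N$ and $Q_1=(-1,1)^N$. For $\mathbf{t}=(t_1,\dots,t_N)$ with $t_i>0$, $D_{\mathbf{t}}(x)=(t_1x_1,\dots,t_Nx_N)$. For a nonempty compact set $K\subsetneq\overline{Q_{1/2}}$, the $\mathbf{t}$-periodically perforated open set generated by $K$ is $$\Omega=\mathbb{R}^N\setminus\Big(\bigcup_{\mathbf{i}\in\mathbb{Z}^N}D_{\mathbf{t}}(\mathbf{i}+K)\Big).$$ For $E\subseteq\mathbb{R}^N$ open and $K\subseteq E$ compact, $\mathrm{cap}_p(K;E)=\inf\{\int_E|\nabla u|^p\,dx: u\in C^\infty_0(E),\ u\ge 1\text{ on }K\}$. $W^{1,p}_0(\Omega)$ is the closure of $C^\infty_0(\Omega)$ in $W^{1,p}(\Omega)$. For $p<q\le\infty$, $$\lambda_{p,q}(\Omega)=\inf_{\varphi\in C^\infty_0(\Omega)}\Big\{\int_\Omega|\nabla\varphi|^p\,dx:\ \|\varphi\|_{L^q(\Omega)}=1\Big\}.$$ An extremal for $\lambda_{p,\infty}(\Omega)$ is a function $u\in W^{1,p}_0(\Omega)\setminus\{0\}$ with $\int_\Omega|\nabla u|^p\,dx=\lambda_{p,\infty}(\Omega)\,\|u\|_{L^\infty(\Omega)}^p$. Since $p>N$, functions in $W^{1,p}_0(\Omega)$ are identified with their continuous representatives. $\delta_z$ is the Dirac mass at $z$. *)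

(* Defs.v *)
From HB Require Import structures.
From mathcomp Require Import all_boot all_order all_algebra.
From mathcomp Require Import all_classical all_reals all_analysis.

Set Implicit Arguments.
Unset Strict Implicit.
Unset Printing Implicit Defensive.

Import Order.TTheory GRing.Theory Num.Theory.
Import numFieldNormedType.Exports.

Local Open Scope classical_set_scope.
Local Open Scope ring_scope.

(* The sigma-algebra put on 'rV[R]_n is the one generated by the coordinates,
   as the library does for n.-tuple T; it is the Borel sigma-algebra of R^n. *)

Definition measure_rV_display : measure_display -> measure_display.
Proof. exact. Qed.

Section measurable_rV.
Context {R : realType} {n : nat}.

Let coords : 'I_n -> 'rV[R]_n -> R := fun i x => x 0 i.

Let rV_set0 : g_sigma_preimage coords set0.
Proof. exact: sigma_algebra0. Qed.

Let rV_setC A : g_sigma_preimage coords A -> g_sigma_preimage coords (~` A).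
Proof. exact: sigma_algebraC. Qed.

Let rV_bigcup (F : _^nat) : (forall i, g_sigma_preimage coords (F i)) ->
  g_sigma_preimage coords (\bigcup_i (F i)).
Proof. exact: sigma_algebra_bigcup. Qed.

HB.instance Definition _ :=
  @isMeasurable.Build (measure_rV_display default_measure_display)
    'rV[R]_n (g_sigma_preimage coords) rV_set0 rV_setC rV_bigcup.

End measurable_rV.

Lemma measurable_coord (R : realType) n (i : 'I_n) :
  measurable_fun [set: 'rV[R]_n] (fun x : 'rV[R]_n => x 0 i).
Proof.
move=> _ Y mY; rewrite setTI; apply: sub_sigma_algebra => /=.
rewrite -bigcup_seq/=; exists i => /=; first by rewrite mem_index_enum.
by exists Y => //; rewrite setTI.
Qed.

Lemma measurable_fun_rV (R : realType) n d (T : measurableType d)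
    (f : T -> 'rV[R]_n) :
  (forall i, measurable_fun [set: T] (fun x => f x 0 i)) ->
  measurable_fun [set: T] f.
Proof.
move=> mf.
apply: (@measurability _ _ _ _ _ _ (\big[setU/set0]_(i < n)
  preimage_set_system setT (fun x : 'rV[R]_n => x 0 i) measurable)) => //.
move=> _ [A + <-]; rewrite -bigcup_seq => -[i _ [B mB <-]].
rewrite setTI preimage_setI preimage_setT setTI.
by rewrite -[X in measurable X]setTI; exact: (mf i).
Qed.

(* Lebesgue measure on R^n: the iterated product of the one-dimensional
   Lebesgue measure, transported along R * 'rV_n -> 'rV_n.+1. *)
Section lebesgue_rV.
Context {R : realType}.

Definition rV_cons (n : nat) (z : measurableTypeR R * 'rV[R]_n) :
    'rV[R]_n.+1 :=
  \row_i oapp (fun j => z.2 0 j) z.1 (unlift 0 i).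

Definition rV_uncons (n : nat) (v : 'rV[R]_n.+1) :
    measurableTypeR R * 'rV[R]_n :=
  (v 0 0, \row_j v 0 (lift 0 j)).

Lemma rV_consK n : cancel (@rV_cons n) (@rV_uncons n).
Proof.
move=> [x v]; congr pair; first by rewrite mxE unlift_none.
by apply/rowP => j; rewrite !mxE liftK.
Qed.

Lemma measurable_rV_cons n : measurable_fun setT (@rV_cons n).
Proof.
apply: measurable_fun_rV => i.
under eq_fun do rewrite mxE.
case: unliftP => [j _|_] /=; last exact: measurable_fst.
exact: (measurableT_comp (@measurable_coord R n j) measurable_snd).
Qed.

Lemma measurable_rV_uncons n : measurable_fun setT (@rV_uncons n).
Proof.
apply: measurable_fun_pair; first exact: measurable_coord.
apply: measurable_fun_rV => i; under eq_fun do rewrite mxE.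
exact: measurable_coord.
Qed.

Section step.
Variables (n : nat) (mu : {sigma_finite_measure set 'rV[R]_n -> \bar R}).

Definition lebesgue_cons : set 'rV[R]_n.+1 -> \bar R :=
  pushforward (@lebesgue_measure R \x mu)%E (@rV_cons n).

Let lebesgue_cons0 : lebesgue_cons set0 = 0%E.
Proof. by rewrite /lebesgue_cons /pushforward preimage_set0 measure0. Qed.

Let lebesgue_cons_ge0 A : (0 <= lebesgue_cons A)%E.
Proof. by rewrite /lebesgue_cons /pushforward measure_ge0. Qed.

Let lebesgue_cons_sigma_additive : semi_sigma_additive lebesgue_cons.
Proof.
exact: (@measure_semi_sigma_additive _ _ _
  (measure_function_pushforward__canonical__measure_function_Measure
    (@lebesgue_measure R \x mu)%E (@measurable_rV_cons n))).
Qed.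

HB.instance Definition _ := isMeasure.Build _ _ _ lebesgue_cons
  lebesgue_cons0 lebesgue_cons_ge0 lebesgue_cons_sigma_additive.

Let lebesgue_cons_sigma_finite : sigma_finite setT lebesgue_cons.
Proof.
have /sigma_finiteP[F [TF ndF Foo]] := sigma_finiteT (@lebesgue_measure R).
have /sigma_finiteP[G [TG ndG Goo]] := sigma_finiteT mu.
exists (fun k => @rV_uncons n @^-1` (F k `*` G k)).
  apply/seteqP; split=> // v _.
  have [i _ Fi] : (\bigcup_i F i) (rV_uncons v).1 by rewrite -TF.
  have [j _ Gj] : (\bigcup_j G j) (rV_uncons v).2 by rewrite -TG.
  exists (maxn i j) => //; split.
    by move: Fi; exact/subsetPset/ndF/leq_maxl.
  by move: Gj; exact/subsetPset/ndG/leq_maxr.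
move=> k; have [mF Fk] := Foo k; have [mG Gk] := Goo k; split.
  rewrite -[X in measurable X]setTI.
  by apply: measurable_rV_uncons => //; exact: measurableX.
rewrite /lebesgue_cons /pushforward -comp_preimage (_ : _ \o _ = id).
  by rewrite preimage_id product_measure1E// lte_mul_pinfty// ge0_fin_numE.
by apply/funext => z /=; rewrite rV_consK.
Qed.

HB.instance Definition _ := @Measure_isSigmaFinite.Build _ _ _ lebesgue_cons
  lebesgue_cons_sigma_finite.

End step.

Fixpoint lebesgue_rV (n : nat) : {sigma_finite_measure set 'rV[R]_n -> \bar R} :=
  if n is m.+1 then lebesgue_cons (lebesgue_rV m) else dirac (0 : 'rV[R]_0).

Lemma lebesgue_rV_box n (a b : 'rV[R]_n) : (forall i, a 0 i <= b 0 i) ->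
  lebesgue_rV n [set x | forall i, a 0 i <= x 0 i <= b 0 i] =
  (\prod_i (b 0 i - a 0 i))%:E.
Proof.
elim: n a b => [|n IHn] a b ab.
  rewrite big_ord0 /= diracE mem_set// => -[].
  by [].
rewrite /= /lebesgue_cons /pushforward.
have -> : @rV_cons n @^-1` [set x | forall i, a 0 i <= x 0 i <= b 0 i] =
    ([set` `[a 0 0, b 0 0]] : set (measurableTypeR R)) `*`
    [set x : 'rV[R]_n | forall i, (rV_uncons a).2 0 i <= x 0 i <= (rV_uncons b).2 0 i].
  apply/seteqP; split=> [[y x] /= h|[y x] /= [h0 h] i].
    split; first by have := h 0; rewrite !mxE unlift_none/= in_itv.
    by move=> i; have := h (lift 0 i); rewrite !mxE liftK.
  rewrite !mxE; case: unliftP => [j ->|->] /=; last by move: h0; rewrite in_itv.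
  by have := h j; rewrite !mxE.
rewrite product_measure1E//; last first.
  rewrite (_ : [set x : 'rV[R]_n | _] = \bigcap_(i in [set: 'I_n]) ((fun x : 'rV[R]_n =>
      x 0 i) @^-1` [set` `[(rV_uncons a).2 0 i, (rV_uncons b).2 0 i]])).
    apply: fin_bigcap_measurable; first exact: finite_finset.
    move=> i _; rewrite -[X in measurable X]setTI.
    by apply: measurable_coord => //; exact: measurable_itv.
  apply/seteqP; split=> x /= h i; first by move=> _; rewrite /= in_itv; exact: h.
  by have := h i Logic.I; rewrite /= in_itv.
rewrite [X in (_ * X)%E]IHn; last by move=> i; rewrite !mxE.
rewrite [X in (X * _)%E](_ : _ = (b 0 0 - a 0 0)%:E); last first.
  rewrite [LHS]lebesgue_measure_itv /= lte_fin -EFinD.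
  by case: ltgtP (ab 0) => // ->; rewrite subrr.
rewrite -EFinM big_ord_recl; congr (_ * _)%:E.
by apply: eq_bigr => i _; rewrite !mxE.
Qed.

End lebesgue_rV.

Section sobolev.
Context {R : realType} {N : nat}.
Local Notation V := 'rV[R]_N.
Local Notation leb := (@lebesgue_rV R N).
Implicit Types (E : set V) (f u phi : V -> R) (g : V -> V) (p : R).

(* The norm `|x| of the library on row vectors is the sup norm. *)
Definition enorm (x : V) : R := Num.sqrt (\sum_i x 0 i ^+ 2).

Definition partial (i : 'I_N) f : V -> R := fun x => 'D_(delta_mx 0 i) f x.

Definition grad f : V -> V := fun x => \row_i partial i f x.

Definition smooth f : Prop := forall s : seq 'I_N,
  continuous (foldr partial f s) /\
  forall x i, derivable (foldr partial f s) x (delta_mx 0 i).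

(* C^\infty_0(E), with functions extended by 0 outside E *)
Definition test_fun E phi : Prop :=
  [/\ smooth phi, compact (closure [set x | phi x != 0]) &
      closure [set x | phi x != 0] `<=` E].

Definition Lq_norm E (q : \bar R) f : \bar R :=
  'N[leb]_q [(EFin \o f) \_ E].

Definition in_Lq E (q : \bar R) f : Prop :=
  measurable_fun E f /\ (Lq_norm E q f < +oo)%E.

Definition L1loc E f : Prop := measurable_fun E f /\
  forall C, compact C -> C `<=` E -> (\int[leb]_(x in C) `|f x|%:E < +oo)%E.

Definition weak_gradient E u g : Prop :=
  [/\ L1loc E u, forall i, L1loc E (fun x => g x 0 i) &
      forall phi i, test_fun E phi ->
        (\int[leb]_(x in E) (u x * partial i phi x)%:E =
         - \int[leb]_(x in E) (g x 0 i * phi x)%:E)%E].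

(* A chosen weak gradient; it is unique up to null sets when it exists. *)
Definition wgrad E u : V -> V := get [set g | weak_gradient E u g].

Definition energy p E g : \bar R :=
  \int[leb]_(x in E) (enorm (g x) `^ p)%:E.

Definition sobolev p E u : Prop :=
  in_Lq E p%:E u /\
  exists2 g, weak_gradient E u g & forall i, in_Lq E p%:E (fun x => g x 0 i).

Definition sobolev_norm p E u : \bar R :=
  ((\int[leb]_(x in E) (`|u x| `^ p)%:E + energy p E (wgrad E u)) `^ p^-1)%E.

(* W^{1,p}_0(E); only the values of u on E matter *)
Definition sobolev0 p E u : Prop :=
  sobolev p E u /\
  forall e : R, 0 < e -> exists2 phi, test_fun E phi &
    (sobolev_norm p E (u \- phi)%R < e%:E)%E.

(* For p > N, elements of W^{1,p}_0(E) are identified with their continuous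
   representatives. *)
Definition csobolev0 p E u : Prop :=
  sobolev0 p E u /\ forall x, E x -> {for x, continuous u}.

Definition cap p (K E : set V) : \bar R :=
  ereal_inf [set energy p E (grad u) |
    u in [set u | test_fun E u /\ forall x, K x -> 1 <= u x]].

Definition lambda p (q : \bar R) E : \bar R :=
  ereal_inf [set energy p E (grad phi) |
    phi in [set phi | test_fun E phi /\ Lq_norm E q phi = 1%E]].

Definition extremal_infty p E u : Prop :=
  [/\ csobolev0 p E u, exists2 x, E x & u x != 0 &
      energy p E (wgrad E u) =
        (lambda p +oo E * Lq_norm E +oo u `^ p)%E].

Definition max_points E f : set V :=
  [set z | E z /\ forall x, E x -> f x <= f z].

Definition cube (r : R) : set V := [set x | forall i, - r < x 0 i < r].

Definition dilation (t x : V) : V := \row_i (t 0 i * x 0 i).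

Definition perforated (t : V) (K : set V) : set V :=
  ~` \bigcup_(i in [set: 'rV[int]_N])
       (dilation t @` [set map_mx intr i + x | x in K]).

(* Normalized non-negative minimizer of lambda_{p,q}(Omega) whose supremum is
   seen in the reference cell. *)
Definition cell_minimizer (t : V) (K : set V) p (q : R) u : Prop :=
  let Omega := perforated t K in
  [/\ csobolev0 p Omega u /\ in_Lq Omega +oo u,
      forall x, Omega x -> 0 <= u x,
      Lq_norm Omega q%:E u = 1%E,
      energy p Omega (wgrad Omega u) = lambda p q%:E Omega &
      Lq_norm (dilation t @` (cube 2^-1 `\` K)) +oo u = Lq_norm Omega +oo u].

End sobolev.

(* Main.v *)
(** As [p > N], Morrey's inequality holds on the tiles of the lattice, and every tile has a
corner at which all test functions vanish; so [|u|] and [||u||_p] are bounded by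
[||grad u||_p], and bounded energy gives equicontinuity. Put [Lam q = lambda_{p,q}^(1/p)].

Precompactness: the maximum points lie in the compact cell, and [Lam q --> Lam oo],
[max u_q --> 1]. If the maximum points of [u_q] and [u_q'] are close, then
[(u_q + u_q') / 2] is almost 1 there, so its gradient has norm almost [Lam oo], and
Clarkson's inequality ([p >= 2]) makes the gradients close.

Concentration: comparing [u_q] with [u_q + e phi], and the limit [v] with [v - e phi] at a
maximum point [z] of [v], gives [1 + e \int u_q^(q-1) phi <= ||grad u_q + e grad phi||_p / Lam q]
and [1 - e phi z <= ||grad v - e grad phi||_p / Lam oo]. The energy being second-order smooth
([p >= 2]), the sum yields [limsup \int u_q^(q-1) phi <= phi z]; apply this to [- phi] too.
As [z] is an arbitrary maximum point, the maximum point is unique.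

Existence for fixed [q]: translate near-minimizers so that their maximum lies in the cell.
As [p < q], mass split in two by a cutoff would cost more energy, so no mass escapes to
infinity; along an ultrafilter the sequence is Cauchy in [L^q], hence, by Clarkson, in energy. *)
Require Import Defs.
From HB Require Import structures.
From mathcomp Require Import all_boot all_order all_algebra.
From mathcomp Require Import all_classical all_reals all_analysis.
From mathcomp Require Import measurable_realfun ess_sup_inf.
From mathcomp Require Import ring lra.

Set Implicit Arguments.
Unset Strict Implicit.
Unset Printing Implicit Defensive.

Import Order.TTheory GRing.Theory Num.Theory.
Import numFieldNormedType.Exports.

Local Open Scope classical_set_scope.
Local Open Scope ring_scope.

(** * Lebesgue measure on row vectors *)

(** No Euler-Lagrange equation is derived and no weak compactness is used: Rayleigh quotients are
    compared at explicit competitors. The [L^q] side is controlled by the supporting functional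
    [u^(q-1)], whose dual norm is at most 1, and the energy side by inequalities for [enorm ^ 2]
    raised to the power [p / 2]. Since [2 <= N < p], this exponent is at least 1, so the
    parallelogram identity and the convexity of one-variable powers suffice.

    What the perforation contributes to the analysis is condensed into [admissible]: openness, one
    constant [C] for the sup and Poincare bounds, and equicontinuity. Existence also uses the
    lattice translations, which bring any point into a compact cell.

    Sobolev functions are handled as pairs [W0 u g], a continuous function vanishing off the open
    set together with its gradient, because [wgrad] is only a choice among weak gradients and the
    functions of the statement are arbitrary off the domain. Uniqueness of weak gradients and
    continuity reconcile the two descriptions. *)

Section rV_geometry.
Context {R : realType} {N : nat}.
Local Notation V := 'rV[R]_N.
Implicit Types (x y a b : V) (r : R).

Lemma ler_coord_norm x i : `|x 0 i| <= `|x|.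
Proof.
rewrite {2}/Num.Def.normr /= mx_normrE.
by rewrite (bigD1 (ord0, i)) //= le_max lexx.
Qed.

Lemma ler_norm_coord x r : 0 <= r -> (forall i, `|x 0 i| <= r) -> `|x| <= r.
Proof.
move=> r0 xr; rewrite /Num.Def.normr /= mx_normrE.
by apply/bigmax_leP; split=> // -[i j] _ /=; rewrite ord1.
Qed.

Lemma ltr_norm_coord x r : 0 < r -> (forall i, `|x 0 i| < r) -> `|x| < r.
Proof.
move=> r0 xr; rewrite /Num.Def.normr /= mx_normrE.
by apply/bigmax_ltP; split=> // -[i j] _ /=; rewrite ord1.
Qed.

Definition prod_set (A : 'I_N -> set R) : set V := [set x | forall i, A i (x 0 i)].

Lemma measurable_prod_set (A : 'I_N -> set R) :
  (forall i, measurable (A i)) -> measurable (prod_set A).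
Proof.
move=> mA; rewrite (_ : prod_set A =
    \bigcap_(i in [set: 'I_N]) ((fun x : V => x 0 i) @^-1` A i)).
  apply: fin_bigcap_measurable; first exact: finite_finset.
  move=> i _; rewrite -[X in measurable X]setTI.
  exact: measurable_coord.
by apply/seteqP; split=> x /= h i; [move=> _; exact: h|exact: h].
Qed.

End rV_geometry.

(** Products of arbitrary measurable sets, rather than closed boxes, serve both as the pi-system in
    [lebesgue_rV_affine] and for the volume of the half-open tiles. *)
Lemma lebesgue_rV_prod_set (R : realType) N (A : 'I_N -> set R) :
  (forall i, measurable (A i)) ->
  (lebesgue_rV N (prod_set A) = \prod_i (@lebesgue_measure R (A i)))%E.
Proof.
elim: N A => [|n IHn] A mA.
  rewrite big_ord0 /= diracE mem_set// => -[].
  by [].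
rewrite /= /lebesgue_cons /pushforward.
have -> : @rV_cons R n @^-1` prod_set A =
    (A 0 : set (measurableTypeR R)) `*` prod_set (fun i => A (lift 0 i)).
  apply/seteqP; split=> [[y x] /= h|[y x] /= [h0 h] i].
    split; first by have := h 0; rewrite !mxE unlift_none.
    by move=> i; have := h (lift 0 i); rewrite !mxE liftK.
  by rewrite !mxE; case: unliftP => [j ->|->] //=; exact: h.
rewrite product_measure1E//; last exact: measurable_prod_set.
rewrite [X in (_ * X)%E]IHn; last by move=> i; exact: mA.
  by rewrite big_ord_recl.
exact: (mA 0).
Qed.

Section boxes.
Context {R : realType} {N : nat}.
Local Notation V := 'rV[R]_N.
Local Notation leb := (@lebesgue_rV R N).

(** Half-open, so that the translates of a box along a lattice cover the space without overlap, and
    each contains its lower corner. *)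
Definition cbox (c r : V) : set V :=
  [set x : V | forall i, c 0 i <= x 0 i < c 0 i + r 0 i].

Lemma cboxE c r : cbox c r = prod_set (fun i => `[c 0 i, c 0 i + r 0 i[%classic).
Proof. by apply/seteqP; split=> x h i; have := h i; rewrite /= in_itv. Qed.

Lemma measurable_cbox c r : measurable (cbox c r).
Proof. by rewrite cboxE; apply: measurable_prod_set => i; exact: measurable_itv. Qed.

Lemma lebesgue_cbox (c r : V) : (forall i, 0 <= r 0 i) ->
  leb (cbox c r) = (\prod_i (r 0 i))%:E.
Proof.
move=> r0; rewrite cboxE lebesgue_rV_prod_set; last by move=> i; exact: measurable_itv.
rewrite -prodEFin; apply: eq_bigr => i _.
rewrite [LHS]lebesgue_measure_itv /= lte_fin ltrDl -EFinD addrC addKr.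
by case: ltgtP (r0 i) => // <-.
Qed.

Lemma norm_bounded_lebesgue (A : set V) (r : R) : measurable A ->
  A `<=` [set x | `|x| <= r] -> (leb A < +oo)%E.
Proof.
move=> mA Ar; pose c : V := \row__ (- `|r|); pose d : V := \row__ (`|r| + `|r| + 1).
have Acd : A `<=` cbox c d.
  move=> x /Ar /= xr i; rewrite !mxE.
  have : `|x 0 i| <= `|r| by apply: le_trans (ler_coord_norm _ _) (le_trans xr (ler_norm r)).
  by rewrite ler_norml; lra.
apply: le_lt_trans (le_measure _ _ _ Acd) _; rewrite ?inE//; first exact: measurable_cbox.
rewrite [X in (X < _)%E]lebesgue_cbox ?ltry// => i; rewrite mxE; have := normr_ge0 r; lra.
Qed.

End boxes.

Section affine.
Context {R : realType}.

Let aff (a s : R) : measurableTypeR R -> measurableTypeR R := fun x => a + s * x.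

Let measurable_aff a s : measurable_fun setT (aff a s).
Proof. by apply: measurable_funD => //; apply: measurable_funM. Qed.

(** The pushforward under [a + s x], multiplied by [s], agrees with Lebesgue measure on half-open
    intervals, hence on all measurable sets. *)
Lemma lebesgue_measure_affine (a s : R) (A : set R) : 0 < s -> measurable A ->
  @lebesgue_measure R ((fun x => a + s * x) @^-1` A) =
  (s^-1%:E * @lebesgue_measure R A)%E.
Proof.
move=> s0 mA.
pose m : {measure set (measurableTypeR R) -> \bar R} :=
  mscale (NngNum (ltW s0)) (measure_function_pushforward__canonical__measure_function_Measure
    (@lebesgue_measure R) (measurable_aff a s)).
have mE B : m B = (s%:E * @lebesgue_measure R ((fun x => (a + s * x)%R) @^-1` B))%E by [].
have H : (@lebesgue_measure R A = m A)%E.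
  apply: lebesgue_measure_unique => // _ [[c d]] _ <-.
  rewrite mE (_ : (fun x : R => _) @^-1` _ = [set` `](c - a) / s, (d - a) / s]]); last first.
    apply/seteqP; split=> x /=; rewrite !in_itv /= ltr_pdivrMr// ler_pdivlMr//; lra.
  rewrite !lebesgue_measure_itv/= !lte_fin ltr_pM2r ?invr_gt0// ltrD2r.
  case: ifPn => // _; last by rewrite mule0.
  by rewrite -!EFinD -EFinM -mulrBl; congr EFin; field; rewrite gt_eqF.
by rewrite H mE muleA -EFinM mulVf ?gt_eqF// mul1e.
Qed.

End affine.

Section affine_rV.
Context {R : realType} {N : nat}.
Local Notation V := 'rV[R]_N.
Local Notation leb := (@lebesgue_rV R N).

Lemma measurable_affine (a : V) (s : R) :
  measurable_fun [set: V] (fun x : V => a + s *: x).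
Proof.
apply: measurable_fun_rV => i.
rewrite (_ : (fun x : V => _) = (fun x : V => a 0 i + s * x 0 i)); last first.
  by apply/funext => x; rewrite !mxE.
apply: measurable_funD => //; apply: measurable_funM => //.
exact: measurable_coord.
Qed.

Lemma g_sigma_prod_set :
  (@measurable _ V) = <<s [set prod_set A | A in [set A : 'I_N -> set R | forall i, measurable (A i)]] >>.
Proof.
apply/seteqP; split; last first.
  apply: smallest_sub; first exact: sigma_algebra_measurable.
  by move=> _ [A mA <-]; exact: measurable_prod_set.
apply: smallest_sub; first exact: smallest_sigma_algebra.
move=> X; rewrite -bigcup_seq => -[i _ [B mB <-]]; apply: sub_sigma_algebra; exists (fun j => if j == i then B else setT).
  by move=> j; case: ifP.
rewrite setTI; apply/seteqP; split=> x /=.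
  by move=> /(_ i); rewrite eqxx.
by move=> Bx j; case: eqP => // ->.
Qed.

Lemma setI_closed_prod_set :
  setI_closed [set prod_set A | A in [set A : 'I_N -> set R | forall i, measurable (A i)]].
Proof.
move=> _ _ [A mA <-] [B mB <-]; exists (fun i => A i `&` B i).
  by move=> i; exact: measurableI.
by apply/seteqP; split=> x /=; [move=> h; split=> i; case: (h i)|move=> [h k] i; split].
Qed.

(** On product sets the claim is the one-dimensional scaling in each coordinate. These sets are
    stable under intersection and generate the sigma-algebra, and the cubes [Q k] of finite measure
    exhaust the space, so the two measures coincide. *)
Lemma lebesgue_rV_affine (a : V) (s : R) (A : set V) : 0 < s -> measurable A ->
  leb ((fun x => a + s *: x) @^-1` A) = ((s ^- N)%:E * leb A)%E.
Proof.
move=> s0 mA; have sN0 : 0 <= s ^- N by rewrite invr_ge0 exprn_ge0 ?ltW.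
pose m1 := (measure_function_pushforward__canonical__measure_function_Measure
    leb (measurable_affine a s)).
pose m2 : {measure set V -> \bar R} := mscale (NngNum sN0) leb.
suff : m1 A = m2 A by [].
pose Q (k : nat) := prod_set (fun _ : 'I_N => [set` `[- k%:R, k%:R] : interval R]).
have mi (i : interval R) : measurable [set` i] by exact: measurable_itv.
have prodE B : (forall i, measurable (B i)) -> m1 (prod_set B) = m2 (prod_set B).
  move=> mB; rewrite /m1 /m2 /mscale /= /pushforward.
  rewrite (_ : _ @^-1` _ = prod_set (fun i => (fun x => a 0 i + s * x) @^-1` B i)); last first.
    by apply/seteqP; split=> x h i; have := h i; rewrite /= !mxE.
  rewrite !lebesgue_rV_prod_set//; last first.
    move=> i; rewrite -[X in measurable X]setTI.
    by apply: (@measurable_funD _ _ _ _ (cst (a 0 i)) ( *%R s)) => //; apply: measurable_funM.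
  under eq_bigr do rewrite lebesgue_measure_affine//.
  rewrite big_split /= prodEFin prodr_const card_ord exprVn.
  by rewrite /m2 /mscale /= lebesgue_rV_prod_set.
apply: (measure_unique [set prod_set A | A in [set A : 'I_N -> set R | forall i, measurable (A i)]]
  Q g_sigma_prod_set setI_closed_prod_set) => //.
- by move=> k; exists (fun=> [set` `[- k%:R, k%:R] : interval R]) => //= i; exact: mi.
- apply/seteqP; split=> // x _.
  exists (Num.bound `|x|) => //; rewrite /Q /prod_set /= => i; rewrite in_itv/= -ler_norml.
  by apply: le_trans (ler_coord_norm _ _) _; exact/ltW/archi_boundP.
- by move=> _ [B mB <-]; exact: prodE.
- move=> k; rewrite /Q prodE// /m2 /mscale/= lte_mul_pinfty//.
  apply: (norm_bounded_lebesgue (r := k%:R)) => //; first exact: measurable_prod_set.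
  by move=> x /= h; apply: ler_norm_coord => // i; have := h i; rewrite /= in_itv/= -ler_norml.
Qed.

Lemma ge0_integral_affine (a : V) (s : R) (f : V -> \bar R) : 0 < s ->
  measurable_fun setT f -> (forall x, 0 <= f x)%E ->
  (\int[leb]_x f (a + s *: x)%R = (s ^- N)%:E * \int[leb]_x f x)%E.
Proof.
move=> s0 mf f0; have sN0 : 0 <= s ^- N by rewrite invr_ge0 exprn_ge0 ?ltW.
have := @ge0_integral_pushforward _ _ V V R _ (measurable_affine a s) leb setT f.
rewrite preimage_setT => <-//.
transitivity (\int[mscale (NngNum sN0) leb]_x f x)%E.
  apply: eq_measure_integral => /= [|? A mA _]; first exact: measurable_affine.
  by rewrite /pushforward lebesgue_rV_affine.
by rewrite ge0_integral_mscale.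
Qed.

Lemma ge0_integral_shift (a : V) (f : V -> \bar R) :
  measurable_fun setT f -> (forall x, 0 <= f x)%E ->
  (\int[leb]_x f (a + x)%R = \int[leb]_x f x)%E.
Proof.
move=> mf f0; rewrite -[RHS]mul1e.
have := ge0_integral_affine a ltr01 mf f0; rewrite expr1n invr1 => <-.
by under [RHS]eq_integral do rewrite scale1r.
Qed.

Lemma integral_shift (a : V) (f : V -> \bar R) : measurable_fun setT f ->
  (\int[leb]_x f (a + x)%R = \int[leb]_x f x)%E.
Proof.
move=> mf; have := ge0_integral_shift a (measurable_funepos mf) (fun x => funepos_ge0 f x).
have := ge0_integral_shift a (measurable_funeneg mf) (fun x => funeneg_ge0 f x).
move=> n1 p1; rewrite [LHS]integralE [RHS]integralE.
by rewrite -n1 -p1; congr (_ - _)%E; apply: eq_integral => x _; rewrite ?funeposE ?funenegE.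
Qed.

End affine_rV.

(** * Borel sets and measurability of continuous functions *)

Section borel.
Context {R : realType} {N : nat}.
Local Notation V := 'rV[R]_N.
Local Notation leb := (@lebesgue_rV R N).

Lemma nbhs_cubeP (x : V) (A : set V) : nbhs x A <->
  exists2 r : R, 0 < r & forall y : V, `|x - y| < r -> A y.
Proof.
split=> [/nbhs_ballP[r /= r0]|[r r0 h]].
  by rewrite -ball_normE => h; exists r.
apply/nbhs_ballP; exists r => // y; rewrite -ball_normE; exact: h.
Qed.

(** The sigma-algebra is generated by the coordinates, so an open set is exhibited as a countable
    union of open boxes with rational corners. *)
Lemma measurable_open_rV (U : set V) : open U -> measurable U.
Proof.
move=> oU.
pose F (c : 'rV[rat]_N * 'rV[rat]_N) : set V :=
  let B := prod_set (fun i => `]ratr (c.1 0 i), ratr (c.2 0 i)[%classic) in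
  if `[< B `<=` U >] then B else set0.
rewrite (_ : U = \bigcup_c F c).
  apply: countable_bigcupT_measurable => // c; rewrite /F; case: ifPn => // _.
  by apply: measurable_prod_set => i; exact: measurable_itv.
apply/seteqP; split=> [x Ux|x [c _]]; last by rewrite /F; case: asboolP => // h /h.
have /nbhs_cubeP[r r0 xr] : nbhs x U by exact: open_nbhs_nbhs.
have /choice[a ha] : forall i, exists q : rat, ratr q \in `](x 0 i - r / 2)%R, x 0 i[.
  by move=> i; apply: rat_in_itvoo; lra.
have /choice[b hb] : forall i, exists q : rat, ratr q \in `](x 0 i)%R, (x 0 i + r / 2)%R[.
  by move=> i; apply: rat_in_itvoo; lra.
exists (\row_i a i, \row_i b i) => //; rewrite /F; case: asboolP => [_ i|].
  rewrite /= !mxE in_itv /=; move: (ha i) (hb i); rewrite !in_itv /=; lra.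
case=> y /= yab; apply: xr; apply: le_lt_trans (_ : r / 2 < r); last lra.
apply: ler_norm_coord => [|i]; first lra.
rewrite !mxE; move: (yab i) (ha i) (hb i); rewrite /= !mxE !in_itv /= ler_norml; lra.
Qed.

Lemma measurable_closed_rV (U : set V) : closed U -> measurable U.
Proof.
by move=> cU; rewrite -[U]setCK; apply: measurableC; apply: measurable_open_rV; exact: closed_openC.
Qed.

Lemma measurable_fun_open_cont (U : set V) (f : V -> R) : open U ->
  (forall x, U x -> {for x, continuous f}) -> measurable_fun U f.
Proof.
move=> oU cf mU; apply: (measurability _ (RGenOInfty.measurableE R)) => //.
move=> _ [_ [r ->] <-]; apply: measurable_open_rV.
rewrite openE => x /= [Ux rx]; apply: filterI; first exact: open_nbhs_nbhs.
apply: cf => //; apply: open_nbhs_nbhs; split=> //.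
Qed.

Lemma continuous_measurable_rV (f : V -> R) : continuous f -> measurable_fun setT f.
Proof. by move=> cf; apply: measurable_fun_open_cont => [|x _]; [exact: openT|exact: cf]. Qed.

Lemma compact_norm_bounded (A : set V) : compact A -> exists r : R, A `<=` [set x | `|x| <= r].
Proof.
by move=> /compact_bounded[M [_ hM]]; exists (M + 1) => x Ax; apply: hM => //; rewrite ltrDl.
Qed.

Lemma compact_lebesgue_rV (A : set V) : compact A -> (leb A < +oo)%E.
Proof.
move=> cA; have [r Ar] := compact_norm_bounded cA.
apply: norm_bounded_lebesgue Ar; apply: measurable_closed_rV.
by apply: compact_closed => //; exact: norm_hausdorff.
Qed.

Lemma open_norm_ball (x : V) (r : R) : open [set y : V | `|x - y| < r].
Proof.
rewrite openE => y /= yr; apply/nbhs_cubeP.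
exists (r - `|x - y|) => [|z yz]; first by rewrite subr_gt0.
by apply: le_lt_trans (ler_distD y _ _) _; rewrite -ltrBrDl.
Qed.

Lemma lebesgue_ball_gt0 (x : V) (r : R) : 0 < r -> (0 < leb [set y : V | (`|x - y|%R < r :> R)%R])%E.
Proof.
move=> r0; pose s : V := \row__ (r / 2).
have : cbox x s `<=` [set y | `|x - y| < r].
  move=> y h; apply: ltr_norm_coord => // i; have := h i; rewrite !mxE ltr_norml; lra.
move=> /(le_measure leb); rewrite !inE => /(_ (measurable_cbox _ _)) h.
apply: lt_le_trans (h _).
  rewrite [X in (_ < X)%E]lebesgue_cbox => [|i]; last by rewrite mxE; lra.
  by rewrite lte_fin prodr_gt0// => i _; rewrite mxE; lra.
by apply: measurable_open_rV; exact: open_norm_ball.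
Qed.

Lemma lebesgue_open_gt0 (U : set V) x : open U -> U x -> (0 < leb U)%E.
Proof.
move=> oU Ux; have /nbhs_cubeP[r r0 xr] : nbhs x U by exact: open_nbhs_nbhs.
apply: lt_le_trans (lebesgue_ball_gt0 x r0) _; apply: le_measure; rewrite ?inE.
- by apply: measurable_open_rV; exact: open_norm_ball.
- exact: measurable_open_rV.
- by move=> y; exact: xr.
Qed.

End borel.

(** * Smooth functions and bumps *)

Lemma scaleRE (R : realType) (a b : R) : a *: b = a * b :> R.
Proof. by []. Qed.

Lemma is_derive_mulr (R : realType) (s k : R) : is_derive s (1 : R) (fun x => x * k) k.
Proof.
have := is_deriveM (is_derive_id s (1 : R)) (is_derive_cst k s (1 : R)).
by rewrite !scaleRE mulr0 add0r mulr1.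
Qed.

Section smooth_algebra.
Context {R : realType} {N : nat}.
Local Notation V := 'rV[R]_N.
Local Notation e_ := (fun i : 'I_N => delta_mx 0 i : V).
Implicit Types (f g : V -> R).

(** [smooth] speaks of all iterated partial derivatives; a class closed under partial derivatives is
    a certificate for all of them at once. *)
Lemma smooth_coind (P : (V -> R) -> Prop) f :
  (forall g, P g -> [/\ continuous g, forall x i, derivable g x (e_ i) &
     forall i, P (partial i g)]) ->
  P f -> smooth f.
Proof.
move=> hP Pf s; have : P (foldr (@partial R N) f s).
  by elim: s => //= i s /hP[_ _]; exact.
by move=> /hP[].
Qed.

Lemma smooth_partial f i : smooth f -> smooth (partial i f).
Proof. by move=> sf s; have := sf (rcons s i); rewrite foldr_rcons. Qed.

Lemma smooth_cont f : smooth f -> continuous f.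
Proof. by move=> /(_ [::])[]. Qed.

Lemma smooth_derivable f : smooth f -> forall x i, derivable f x (e_ i).
Proof. by move=> /(_ [::])[]. Qed.

Lemma continuous_at_normP f (x : V) : {for x, continuous f} <->
  forall e : R, 0 < e -> exists2 r : R, 0 < r & forall y : V, `|x - y| < r -> `|f x - f y| < e.
Proof.
split=> [/cvgrPdist_lt cf e e0|cf]; first exact/nbhs_cubeP/cf.
move=> A /nbhs_ballP[e /= e0 he]; apply/nbhs_cubeP; have [r r0 h] := cf e e0.
by exists r => // y xy; apply: he; exact: h.
Qed.

Lemma continuousD_rV f g : continuous f -> continuous g -> continuous (f \+ g).
Proof. by move=> cf cg x; exact: (continuousD (cf x) (cg x)). Qed.

Lemma continuousM_rV f g : continuous f -> continuous g -> continuous (f \* g).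
Proof. by move=> cf cg x; exact: (continuousM (cf x) (cg x)). Qed.

Lemma continuous_affine (a : V) (s : R) : continuous (fun x : V => a + s *: x).
Proof.
move=> x A /nbhs_cubeP[r r0 h]; apply/nbhs_cubeP.
have s0 : 0 < `|s| + 1 by rewrite ltr_wpDl.
exists (r / (`|s| + 1)) => [|y]; first by rewrite divr_gt0.
rewrite ltr_pdivlMr// => xy; apply: h; rewrite opprD addrACA subrr add0r -scalerBr normrZ.
by apply: le_lt_trans xy; rewrite mulrC ler_wpM2l// lerDl.
Qed.

Arguments smooth_derivable [f] _ _ _.

(** The algebra generated by [G]. It is closed under partial derivatives as soon as it contains
    those of its generators, which settles functions whose derivatives are polynomials in themselves
    and in known smooth functions. *)
Inductive alg_closure (G : (V -> R) -> Prop) : (V -> R) -> Prop :=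
| alg_gen g : G g -> alg_closure G g
| alg_cst c : alg_closure G (cst c)
| alg_add f g : alg_closure G f -> alg_closure G g -> alg_closure G (f \+ g)
| alg_mul f g : alg_closure G f -> alg_closure G g -> alg_closure G (f \* g).

Lemma alg_closure_smooth (G : (V -> R) -> Prop) f :
  (forall g, G g -> [/\ continuous g, forall x i, derivable g x (e_ i) &
     forall i, alg_closure G (partial i g)]) ->
  alg_closure G f -> smooth f.
Proof.
move=> hG; apply: smooth_coind => {}f; elim=> {f}[g /hG//|c|f g af [cf df pf] ag [cg dg pg]
    |f g af [cf df pf] ag [cg dg pg]].
- split=> [|x i|i]; first exact: cst_continuous.
    exact: derivable_cst.
  rewrite (_ : partial i (cst c) = cst 0); first exact: alg_cst.
  by apply/funext => x; rewrite /partial derive_cst.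
- split=> [|x i|i]; first exact: continuousD_rV.
    by apply: derivableD.
  rewrite (_ : partial i _ = partial i f \+ partial i g); first exact: alg_add.
  by apply/funext => x; rewrite /partial deriveD.
- split=> [|x i|i]; first exact: continuousM_rV.
    by apply: derivableM.
  rewrite (_ : partial i _ = (f \* partial i g) \+ (g \* partial i f)).
    by apply: alg_add; exact: alg_mul.
  by apply/funext => x; rewrite /partial deriveM.
Qed.

Lemma smooth_alg f : alg_closure smooth f -> smooth f.
Proof.
apply: alg_closure_smooth => g sg; split; [exact: smooth_cont|exact: smooth_derivable|].
by move=> i; apply: alg_gen; exact: smooth_partial.
Qed.

Lemma smooth_cst c : smooth (cst c : V -> R).
Proof. by apply: smooth_alg; exact: alg_cst. Qed.

Lemma smoothD f g : smooth f -> smooth g -> smooth (f \+ g).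
Proof. by move=> sf sg; apply: smooth_alg; apply: alg_add; exact: alg_gen. Qed.

Lemma smoothM f g : smooth f -> smooth g -> smooth (f \* g).
Proof. by move=> sf sg; apply: smooth_alg; apply: alg_mul; exact: alg_gen. Qed.

Lemma smoothZ c f : smooth f -> smooth (fun x => c * f x).
Proof. by move=> sf; exact: (smoothM (smooth_cst c) sf). Qed.

Lemma smoothB f g : smooth f -> smooth g -> smooth (f \- g).
Proof.
move=> sf /(smoothZ (-1)) sg; rewrite (_ : f \- g = f \+ (fun x => -1 * g x)); first exact: smoothD.
by apply/funext => x /=; rewrite mulN1r.
Qed.

Lemma smooth_prod (I : Type) (s : seq I) (F : I -> V -> R) :
  (forall i, smooth (F i)) -> smooth (fun x => \prod_(i <- s) F i x).
Proof.
move=> sF; elim: s => [|i s IH].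
  rewrite (_ : (fun _ => _) = cst 1); first exact: smooth_cst.
  by apply/funext => x; rewrite big_nil.
rewrite (_ : (fun _ => _) = F i \* (fun x => \prod_(i <- s) F i x)).
  exact: (smoothM (sF i) IH).
by apply/funext => x; rewrite big_cons.
Qed.

Lemma partial_cst i c : partial i (cst c : V -> R) = cst 0.
Proof. by apply/funext => x; rewrite /partial derive_cst. Qed.

Lemma partialD i f g : smooth f -> smooth g ->
  partial i (f \+ g) = partial i f \+ partial i g.
Proof.
move=> /smooth_derivable sf /smooth_derivable sg.
by apply/funext => x; rewrite /partial deriveD.
Qed.

Lemma partialM i f g : smooth f -> smooth g ->
  partial i (f \* g) = (f \* partial i g) \+ (g \* partial i f).
Proof.
move=> /smooth_derivable sf /smooth_derivable sg.
by apply/funext => x; rewrite /partial deriveM.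
Qed.

Lemma partialZ i c f : smooth f -> partial i (fun x => c * f x) = fun x => c * partial i f x.
Proof.
move=> sf; rewrite (partialM i (smooth_cst c) sf) partial_cst.
by apply/funext => x /=; rewrite mulr0 addr0.
Qed.

Lemma partialB i f g : smooth f -> smooth g ->
  partial i (f \- g) = partial i f \- partial i g.
Proof.
move=> /smooth_derivable sf /smooth_derivable sg.
by apply/funext => x; rewrite /partial deriveB.
Qed.

Lemma is_derive_line f (x v : V) d :
  is_derive x v f d <-> is_derive (0 : R) (1 : R) (fun h => f (x + h *: v)) d.
Proof.
have E : (fun h : R => h^-1 *: (f (h *: v + x) - f x)) =
    (fun h : R => h^-1 *: ((fun h => f (x + h *: v)) (h *: 1 + 0) - f (x + 0 *: v))).
  apply/funext => h; rewrite scale0r !addr0 [x + _]addrC.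
  by rewrite (_ : h%:A = h)//; exact: mulr1.
by split=> -[dv vE]; apply: DeriveDef; move: dv vE; rewrite /derivable /derive /= E.
Qed.

Lemma is_derive_line_at f (x v : V) t : derivable f (x + t *: v) v ->
  is_derive t (1 : R) (fun h => f (x + h *: v)) ('D_v f (x + t *: v)).
Proof.
move=> df; have /is_derive_line h : is_derive (x + t *: v) v f ('D_v f (x + t *: v)).
  exact: DeriveDef.
have E : (fun h : R => h^-1 *: (f (x + t *: v + (h *: 1 + 0) *: v) - f (x + t *: v + 0 *: v))) =
    (fun h : R => h^-1 *: ((fun h => f (x + h *: v)) (h *: 1 + t) - f (x + t *: v))).
  apply/funext => k; rewrite scale0r !addr0 -addrA -scalerDl.
  by rewrite [t + _]addrC.
by case: h => dv vE; apply: DeriveDef; move: dv vE; rewrite /derivable /derive /= E.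
Qed.

(* [w = g^(-1/2)] solves [d_i w = - (d_i g) w^3 / 2]; [g * w] and [w * w] then
   give the square root and the inverse. *)
Lemma smooth_rsqrt f : smooth f -> (forall x, 0 < f x) ->
  smooth (fun x => (Num.sqrt (f x))^-1) /\
  forall i, partial i (fun x => (Num.sqrt (f x))^-1) =
    (fun x => - 2^-1 * partial i f x * (Num.sqrt (f x))^-1 ^+ 3).
Proof.
move=> sf f0; set w := (fun x => _).
have dw x i : is_derive x (e_ i) w (- 2^-1 * partial i f x * w x ^+ 3).
  apply/is_derive_line.
  have /is_derive_line h : is_derive x (e_ i) f (partial i f x).
    by apply: DeriveDef => //; exact: smooth_derivable.
  have f00 : 0 < f (x + 0 *: e_ i) by [].
  have s0 : Num.sqrt (f (x + 0 *: e_ i)) != 0 by rewrite gt_eqF// sqrtr_gt0.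
  have := is_deriveV (f := fun k => Num.sqrt (f (x + k *: e_ i))) s0 (is_derive1_comp (is_derive1_sqrt f00) h).
  move=> D; apply: (is_derive_eq D).
  rewrite scale0r addr0 /w scaleRE.
  have s1 : Num.sqrt (f x) != 0 by rewrite gt_eqF// sqrtr_gt0.
  by field.
have pw i : partial i w = (fun x => - 2^-1 * partial i f x * w x ^+ 3).
  by apply/funext => x; have [] := dw x i.
have cw : continuous w.
  move=> x; apply: (continuous_comp (f := fun x => Num.sqrt (f x)) (g := GRing.inv)).
    apply: (continuous_comp (f := f) (g := @Num.sqrt R)); first exact: smooth_cont.
    exact: sqrt_continuous.
  by apply: inv_continuous; rewrite gt_eqF// sqrtr_gt0.
split; [|exact: pw]; pose G (g : V -> R) := smooth g \/ g = w.
apply: (@alg_closure_smooth G); last by apply: alg_gen; right.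
move=> g [sg|->].
  split; [exact: smooth_cont|exact: smooth_derivable|].
  by move=> i; apply: alg_gen; left; exact: smooth_partial.
split=> [//|x i|i]; first by case: (dw x i).
rewrite pw (_ : (fun x => _) = (cst (- 2^-1) \* partial i f) \* (w \* (w \* w))); last first.
  by apply/funext => x /=; rewrite -[3%N]/(2.+1) !exprS expr0 mulr1.
have aw : alg_closure G w by apply: alg_gen; right.
apply: alg_mul; last by do ?apply: alg_mul.
by apply: alg_mul; [exact: alg_cst|apply: alg_gen; left; exact: smooth_partial].
Qed.

Lemma smooth_sqrt f : smooth f -> (forall x, 0 < f x) ->
  smooth (fun x => Num.sqrt (f x)) /\
  forall i x, partial i (fun x => Num.sqrt (f x)) x = 2^-1 * partial i f x / Num.sqrt (f x).
Proof.
move=> sf f0; have [sw pw] := smooth_rsqrt sf f0.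
have E : (fun x => Num.sqrt (f x)) = f \* (fun x => (Num.sqrt (f x))^-1).
  apply/funext => x /=; rewrite -{2}(sqr_sqrtr (ltW (f0 x))) expr2 mulfK//.
  by rewrite gt_eqF// sqrtr_gt0.
rewrite E; split=> [|i x]; first exact: smoothM.
rewrite partialM// pw /= -{1}(sqr_sqrtr (ltW (f0 x))).
have s1 : Num.sqrt (f x) != 0 by rewrite gt_eqF// sqrtr_gt0.
by field.
Qed.

Lemma smoothV f : smooth f -> (forall x, 0 < f x) -> smooth (fun x => (f x)^-1).
Proof.
move=> sf f0; have [sw pw] := smooth_rsqrt sf f0.
rewrite (_ : (fun x => _) = (fun x => (Num.sqrt (f x))^-1) \* (fun x => (Num.sqrt (f x))^-1)).
  exact: smoothM.
by apply/funext => x /=; rewrite -invfM -expr2 sqr_sqrtr// ltW.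
Qed.

Lemma partial_shift i (a : V) f x : partial i (fun x => f (a + x)) x = partial i f (a + x).
Proof.
rewrite /partial /derive; set g := (X in lim (X @ _)); set k := (X in _ = lim (X @ _)).
by rewrite (_ : g = k)//; apply/funext => h; rewrite /g /k /= addrCA.
Qed.

Lemma smooth_shift (a : V) f : smooth f -> smooth (fun x => f (a + x)).
Proof.
move=> sf; apply: (smooth_coind (P := fun g => exists2 f, smooth f & g = (fun x => f (a + x)))).
  move=> _ [h sh ->]; split=> [x|x i|i].
  - apply: (continuous_comp (f := fun x => a + x) (g := h)); last exact: smooth_cont.
    by have := @continuous_affine a 1 x; under eq_fun do rewrite scale1r.
  - have := smooth_derivable sh (a + x) i; rewrite /derivable /=.
    rewrite (_ : (fun h0 => h0^-1 *: (h (h0 *: _ + (a + x)) - _)) =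
      (fun h0 => h0^-1 *: (h (a + (h0 *: delta_mx 0 i + x)) - h (a + x))))//.
    by apply/funext => k; rewrite addrCA.
  - exists (partial i h); first exact: smooth_partial.
    by apply/funext => x; rewrite partial_shift.
by exists f.
Qed.

End smooth_algebra.
Arguments smooth_derivable {R N} [f] _ _ _.

(** * Directional derivatives of smooth functions *)

Section directional.
Context {R : realType} {N : nat}.
Local Notation V := 'rV[R]_N.
Local Notation e_ := (fun i : 'I_N => delta_mx 0 i : V).
Implicit Types (f g : V -> R).

Lemma is_derive_cvg f (x v : V) (d : R) :
  h^-1 *: (f (h *: v + x) - f x) @[h --> (0 : R)^'] --> d -> is_derive x v f d.
Proof.
move=> H; apply: DeriveDef; first by apply/cvg_ex; exists d.
by apply/cvg_lim => //; exact: norm_hausdorff.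
Qed.

Lemma partial_MVT f i (y : V) (k : R) : smooth f ->
  exists2 xi, 0 <= xi <= 1 & f (y + k *: e_ i) - f y = k * partial i f (y + (xi * k) *: e_ i).
Proof.
move=> sf.
pose g s := f (y + (s * k) *: e_ i).
have dg s : is_derive s (1 : R) g (partial i f (y + (s * k) *: e_ i) * k).
  have h := is_derive_line_at (smooth_derivable sf (y + (s * k) *: e_ i) i).
  have := is_derive1_comp (f := fun h => f (y + h *: e_ i)) (g := fun s : R => s * k)
    (x := s) (b := k) h.
  by apply; exact: is_derive_mulr.
have cg : {within `[(0 : R), 1], continuous g}.
  by apply: derivable_within_continuous => s _; case: (dg s).
have [xi xi01] := MVT_segment ler01 (fun s _ => dg s) cg.
rewrite /g mul1r mul0r scale0r addr0 subr0 mulr1 => E.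
by exists xi; [move: xi01; rewrite in_itv|rewrite E mulrC].
Qed.

(** Smoothness is given by partial derivatives only, so directions are built up one coordinate at a
    time. The extra increment along [e_i] is a value of [partial i f] at a nearby point by the mean
    value theorem, and continuity of [partial i f] gives its limit. *)
Lemma is_derive_add_coord f (x w : V) c d i : smooth f -> is_derive x w f d ->
  is_derive x (w + c *: e_ i) f (d + c * partial i f x).
Proof.
move=> sf [dw <-]; apply: is_derive_cvg.
have /choice[xi hxi] : forall h : R, exists xi, 0 <= xi <= 1 /\
   f ((h *: w + x) + (h * c) *: e_ i) - f (h *: w + x) =
   (h * c) * partial i f (h *: w + x + (xi * (h * c)) *: e_ i).
  by move=> h; have [xi] := partial_MVT i (h *: w + x) (h * c) sf; exists xi.
pose Q h := c * partial i f (h *: w + x + (xi h * (h * c)) *: e_ i).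
have E : {near (0 : R)^', (fun h => h^-1 *: (f (h *: w + x) - f x) + Q h) =1
   (fun h : R => h^-1 *: (f (h *: (w + c *: e_ i) + x) - f x))}.
  near=> h; have h0 : h != 0 by near: h; exact: nbhs_dnbhs_neq.
  have -> : h *: (w + c *: e_ i) + x = (h *: w + x) + (h * c) *: e_ i.
    by rewrite scalerDr scalerA addrAC.
  rewrite -[f (_ + (h * c) *: _) - f x](subrKA (f (h *: w + x))) (hxi h).2.
  rewrite [RHS]scalerDr [RHS]addrC; congr (_ + _).
  by rewrite /Q scaleRE mulrA mulrA mulVf// mul1r.
apply: (cvg_trans (near_eq_cvg E)).
apply: cvgD; first exact: dw.
apply: cvgMr.
apply/cvgrPdist_lt => eps eps0.
have /continuous_at_normP /(_ _ eps0)[r r0 hr] := @smooth_cont _ _ _ (smooth_partial i sf) x.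
have M0 : 0 < `|w| + `|c| * `|e_ i| + 1 by rewrite ltr_wpDl// addr_ge0// mulr_ge0.
near=> h; apply: hr.
have [/andP[xi0 xi1] _] := hxi h.
have -> : x - (h *: w + x + (xi h * (h * c)) *: e_ i) = - (h *: w + (xi h * (h * c)) *: e_ i).
  by rewrite addrAC [_ + x]addrC opprD addrA subrr add0r.
rewrite normrN.
have nE : `|xi h * (h * c)| = xi h * (`|h| * `|c|) by rewrite !normrM (ger0_norm xi0).
apply: le_lt_trans (ler_normD _ _) _; rewrite [X in X + _]normrZ [X in _ + X]normrZ nE.
have hh : `|h| < r / (`|w| + `|c| * `|e_ i| + 1).
  near: h; apply: dnbhs0_lt; exact: divr_gt0.
move: hh; rewrite ltr_pdivlMr// => hh; apply: le_lt_trans hh.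
rewrite !mulrDr mulr1 -addrA lerD2l; apply: le_trans (_ : `|h| * (`|c| * `|e_ i|) <= _).
  rewrite -!mulrA ler_piMl//; do ?apply: mulr_ge0; exact: normr_ge0.
by rewrite lerDl normr_ge0.
Unshelve. all: by end_near.
Qed.

Lemma smooth_directional f (x v : V) : smooth f ->
  is_derive x v f (\sum_i v 0 i * partial i f x).
Proof.
move=> sf; rewrite {1}(row_sum_delta v); elim/big_rec2: _ => [|i d w _ IH].
  apply: is_derive_cvg; rewrite (_ : (fun h => _) = cst 0); first exact: cvg_cst.
  by apply/funext => h; rewrite scaler0 add0r subrr scaler0.
rewrite addrC [X in is_derive _ _ _ X]addrC; exact: is_derive_add_coord.
Qed.

End directional.

(** * Flat exponentials and smooth steps *)

Section exp_flat.
Context {R : realType}.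

(* The functions [x^-k exp(-1/x)], extended by 0: a family closed under derivation. *)
Definition expflat (k : nat) (x : R) : R :=
  if 0 < x then x^-1 ^+ k * expR (- x^-1) else 0.

Lemma expflat_ge0 k x : 0 <= expflat k x.
Proof.
rewrite /expflat; case: ifPn => // x0; apply: mulr_ge0; last exact: expR_ge0.
by rewrite exprn_ge0// invr_ge0 ltW.
Qed.

Lemma expflat_gt0 k x : 0 < x -> 0 < expflat k x.
Proof.
by move=> x0; rewrite /expflat x0 mulr_gt0 ?expR_gt0// exprn_gt0// invr_gt0.
Qed.

Lemma expflat_le0 k x : x <= 0 -> expflat k x = 0.
Proof. by move=> x0; rewrite /expflat ltNge x0. Qed.

(** Quadratic decay at the origin makes the difference quotient at 0 vanish; this is the one point
    where the derivative is not given by a formula. *)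
Lemma expflat_bound k : exists2 C : R, 0 < C & forall x, expflat k x <= C * x ^+ 2.
Proof.
(* With [y = 1/x] the claim reads [y^(k+2) <= C exp y]; raise [y/(k+2) <= exp (y/(k+2))] to the
   power [k+2]. *)
exists (k.+2%:R ^+ k.+2); first by rewrite exprn_gt0.
move=> x; rewrite /expflat; case: ifPn => x0; last by apply: mulr_ge0; [exact: exprn_ge0|exact: sqr_ge0].
rewrite -(ler_pM2r (expR_gt0 x^-1)) -mulrA -expRD addNr expR0 mulr1.
set y := x^-1; have y0 : 0 < y by rewrite invr_gt0.
have yx : y * x = 1 by rewrite mulVf// gt_eqF.
have -> : y ^+ k = y ^+ k.+2 * x ^+ 2.
  by rewrite -[k.+2]addn2 exprD -mulrA -exprMn yx expr1n mulr1.
rewrite [X in _ <= X]mulrAC ler_pM2r ?exprn_gt0//.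
have : (y / k.+2%:R) ^+ k.+2 <= expR (y / k.+2%:R) ^+ k.+2.
  rewrite lerXn2r ?nnegrE ?expR_ge0 ?divr_ge0 ?ltW//.
  by apply: lt_le_trans (expR_ge1Dx _); rewrite ltrDr.
rewrite -expRM_natr divfK// expr_div_n ler_pdivrMr ?exprn_gt0//.
by rewrite mulrC.
Qed.

Lemma is_derive_expflat k x :
  is_derive x (1 : R) (expflat k) (- k%:R * expflat k.+1 x + expflat k.+2 x).
Proof.
have [x0|x0|->] := ltgtP x 0.
- rewrite !expflat_le0 ?ltW// mulr0 addr0.
  have E : {near x, cst 0 =1 expflat k}.
    near=> y; rewrite expflat_le0//; apply: ltW; near: y.
    exact: lt_nbhsl.
  by apply: DeriveDef; [apply: near_eq_derivable E _ => //|rewrite -(near_eq_derive _ E)// derive_cst].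
- pose g (x : R) := x^-1 ^+ k * expR (- x^-1).
  have E : {near x, g =1 expflat k}.
    near=> y; rewrite /expflat ifT//; near: y; exact: lt_nbhsr.
  have xN0 : x != 0 by rewrite gt_eqF.
  have dV : is_derive x (1 : R) (fun y => y^-1) (- x ^- 2).
    have := is_deriveV xN0 (is_derive_id x (1 : R)).
    by rewrite scaleRE mulr1.
  have dE : is_derive x (1 : R) (fun y => expR (- y^-1)) (expR (- x^-1) * x ^- 2).
    have := is_derive1_comp (f := expR) (g := fun y => - y^-1) (is_derive_expR _) (is_deriveN dV).
    by rewrite opprK.
  have dg : is_derive x (1 : R) g (- k%:R * expflat k.+1 x + expflat k.+2 x).
    have := is_deriveM (is_deriveX k dV) dE.
    rewrite exprfctE (_ : _ * _ = g)// => D; apply: (is_derive_eq D); rewrite !scaleRE /expflat x0.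
    case: (k) => [|m]; first by rewrite -exprVn mulr0n !mul0r /= !exprS; ring.
    rewrite -exprVn /= !exprS; ring.
  case: dg => dg1 dg2; apply: DeriveDef; first exact: near_eq_derivable E dg1.
  by rewrite -(near_eq_derive _ E).
- rewrite !expflat_le0 ?lexx// mulr0 addr0.
  have [C C0 hC] := expflat_bound k.
  suff H : h^-1 *: (expflat k (h *: 1 + 0) - expflat k 0) @[h --> (0 : R)^'] --> (0 : R).
    apply: DeriveDef; first by apply/cvg_ex; exists 0.
    by apply/cvg_lim => //; exact: norm_hausdorff.
  apply/cvgrPdist_lt => e e0; near=> h.
  have h0 : h != 0 by near: h; exact: nbhs_dnbhs_neq.
  have hn : 0 < `|h| by rewrite normr_gt0.
  rewrite sub0r normrN (expflat_le0 k (lexx 0)) subr0 addr0 !scaleRE mulr1 normrM normfV.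
  rewrite ger0_norm ?expflat_ge0// mulrC ltr_pdivrMr//.
  apply: le_lt_trans (hC h) _; rewrite -real_normK ?num_real// expr2 mulrA ltr_pM2r//.
  rewrite mulrC -ltr_pdivlMr//; near: h; apply: dnbhs0_lt; exact: divr_gt0.
Unshelve. all: by end_near. Qed.

Lemma expflat_continuous k : continuous (expflat k).
Proof.
move=> x; apply: differentiable_continuous; apply/derivable1_diffP.
by case: (is_derive_expflat k x).
Qed.

End exp_flat.

Section coord_compose.
Context {R : realType} {N : nat}.
Local Notation V := 'rV[R]_N.
Local Notation e_ := (fun i : 'I_N => delta_mx 0 i : V).

Lemma is_derive_coord (F : R -> R) (dF : R) (c d : R) (j i : 'I_N) (x : V) :
  is_derive (c * x 0 j + d) (1 : R) F dF ->
  is_derive x (e_ i) (fun x : V => F (c * x 0 j + d)) (dF * (c * (j == i)%:R)).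
Proof.
move=> DF; apply/is_derive_line.
pose g (h : R) := h * (c * (j == i)%:R) + (c * x 0 j + d).
have gE : (fun h : R => F (c * (x + h *: e_ i) 0 j + d)) = F \o g.
  apply/funext => h; rewrite /= /g !mxE eqxx /=; congr F; ring.
rewrite [X in is_derive _ _ X _]gE; apply: is_derive1_comp.
  by rewrite /g mul0r add0r.
have := is_deriveD (is_derive_mulr 0 (c * (j == i)%:R)) (is_derive_cst (c * x 0 j + d) (0 : R) (1 : R)).
by rewrite addr0.
Qed.

Lemma smooth_expflat k (c d : R) (j : 'I_N) :
  smooth (fun x : V => expflat k (c * x 0 j + d)).
Proof.
pose G (g : V -> R) := exists k, g = (fun x : V => expflat k (c * x 0 j + d)).
apply: (@alg_closure_smooth _ _ G); last by apply: alg_gen; exists k.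
move=> _ [{}k ->]; split=> [x|x i|i].
- apply: (continuous_comp (f := fun x : V => c * x 0 j + d) (g := expflat k)).
    apply: (@continuousD_rV _ _ (fun x : V => c * x 0 j) (cst d)); last exact: cst_continuous.
    apply: (@continuousM_rV _ _ (cst c) (fun x : V => x 0 j)); first exact: cst_continuous.
    exact: coord_continuous.
  exact: expflat_continuous.
- by case: (is_derive_coord i (is_derive_expflat k (c * x 0 j + d))).
- rewrite (_ : partial i _ = ((cst (- k%:R) \* (fun x : V => expflat k.+1 (c * x 0 j + d))) \+
     (fun x : V => expflat k.+2 (c * x 0 j + d))) \* cst (c * (j == i)%:R)).
    apply: alg_mul; last exact: alg_cst.
    apply: alg_add; last by apply: alg_gen; exists k.+2.
    by apply: alg_mul; [exact: alg_cst|apply: alg_gen; exists k.+1].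
  by apply/funext => x; case: (is_derive_coord i (is_derive_expflat k (c * x 0 j + d))).
Qed.

Definition step (s : R) : R := expflat 0 s / (expflat 0 s + expflat 0 (1 - s)).

Lemma step_den_gt0 s : 0 < expflat 0 s + expflat 0 (1 - s) :> R.
Proof.
have [s0|s0] := ltP 0 s; first by rewrite ltr_pwDl ?expflat_ge0// expflat_gt0.
by rewrite ltr_wpDl ?expflat_ge0// expflat_gt0//; lra.
Qed.

Lemma step_ge0 s : 0 <= step s.
Proof. by rewrite divr_ge0 ?expflat_ge0// ltW// step_den_gt0. Qed.

Lemma step_le1 s : step s <= 1.
Proof. by rewrite ler_pdivrMr ?step_den_gt0// mul1r lerDl expflat_ge0. Qed.

Lemma step_le0 s : s <= 0 -> step s = 0.
Proof. by move=> s0; rewrite /step expflat_le0// mul0r. Qed.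

Lemma step_ge1 s : 1 <= s -> step s = 1.
Proof.
move=> s1; rewrite /step [expflat 0 (1 - s)]expflat_le0; last lra.
by rewrite addr0 divff// gt_eqF// expflat_gt0//; lra.
Qed.

Lemma smooth_step (c d : R) (j : 'I_N) : smooth (fun x : V => step (c * x 0 j + d)).
Proof.
apply: (smoothM (f := fun x : V => expflat 0 (c * x 0 j + d))
  (g := fun x : V => (expflat 0 (c * x 0 j + d) + expflat 0 (1 - (c * x 0 j + d)))^-1)).
  exact: smooth_expflat.
apply: (smoothV (f := fun x : V => expflat 0 (c * x 0 j + d) + expflat 0 (1 - (c * x 0 j + d)))) => [|x].
  apply: (smoothD (f := fun x : V => expflat 0 (c * x 0 j + d)) (g := fun x : V => expflat 0 (1 - (c * x 0 j + d)))).
    exact: smooth_expflat.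
  rewrite (_ : (fun _ => _) = (fun x : V => expflat 0 ((- c) * x 0 j + (1 - d)))); first exact: smooth_expflat.
  by apply/funext => x; congr expflat; ring.
exact: step_den_gt0.
Qed.

End coord_compose.

(** * Test functions *)

Lemma integrable_indic_lty d (T : measurableType d) (R : realType)
    (mu : {measure set T -> \bar R}) (A : set T) :
  measurable A -> (mu A < +oo)%E -> mu.-integrable setT (EFin \o \1_A).
Proof.
move=> mA Afin; apply/integrableP; split; first exact/measurable_EFinP.
under eq_integral do rewrite /= ger0_norm//.
by rewrite integral_indic// setIT.
Qed.

Section test_functions.
Context {R : realType} {N : nat}.
Local Notation V := 'rV[R]_N.
Local Notation leb := (@lebesgue_rV R N).
Implicit Types (E C : set V) (f g phi : V -> R).

Lemma compact_closed_rV C : compact C -> closed C.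
Proof. by apply: compact_closed; exact: norm_hausdorff. Qed.

(** Any compact subset of [E] off which [phi] vanishes can stand for the closed support, so sums and
    products need no computation of supports. *)
Lemma test_funP E phi : test_fun E phi <-> smooth phi /\
  exists C, [/\ compact C, C `<=` E & forall x, ~ C x -> phi x = 0].
Proof.
split=> [[sp cs sE]|[sp [C [cC CE pC]]]].
  split=> //; exists (closure [set x | phi x != 0]); split=> // x.
  by move=> /(contra_not (@subset_closure _ _ x)) /= /negP; rewrite negbK => /eqP.
have sC : closure [set x | phi x != 0] `<=` C.
  move: (compact_closed_rV cC) => /closure_id ->.
  by apply: closureS => x /=; apply: contraPP => /pC ->; rewrite eqxx.
split=> //; last exact: subset_trans sC CE.
by apply: subclosed_compact cC sC; exact: closed_closure.
Qed.

Lemma test_fun_smooth E phi : test_fun E phi -> smooth phi.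
Proof. by case. Qed.

Lemma test_fun_off E phi x : test_fun E phi -> ~ E x -> phi x = 0.
Proof. by move=> /test_funP[_ [C [_ CE pC]]] Ex; apply: pC => /CE. Qed.

Lemma test_funS E E' phi : E `<=` E' -> test_fun E phi -> test_fun E' phi.
Proof.
move=> EE' /test_funP[sp [C [cC CE pC]]]; apply/test_funP; split=> //.
by exists C; split=> //; exact: subset_trans CE EE'.
Qed.

Lemma partial_off C i phi x : closed C -> (forall x, ~ C x -> phi x = 0) ->
  ~ C x -> partial i phi x = 0.
Proof.
move=> cC pC Cx; rewrite /partial -(near_eq_derive (delta_mx 0 i : V) (f := cst 0)) ?derive_cst//.
have : nbhs x (~` C) by apply: open_nbhs_nbhs; split=> //; exact: closed_openC.
by apply: filterS => y /pC ->.
Qed.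

Lemma test_fun_partial E phi i : test_fun E phi -> test_fun E (partial i phi).
Proof.
move=> /test_funP[sp [C [cC CE pC]]]; apply/test_funP; split; first exact: smooth_partial.
by exists C; split=> // x; apply: partial_off => //; exact: compact_closed_rV.
Qed.

Lemma test_fun0 E : test_fun E (cst 0).
Proof.
apply/test_funP; split; first exact: smooth_cst.
by exists set0; split=> //; exact: compact0.
Qed.

Lemma test_funD E f g : test_fun E f -> test_fun E g -> test_fun E (f \+ g).
Proof.
move=> /test_funP[sf [C [cC CE fC]]] /test_funP[sg [D [cD DE gD]]].
apply/test_funP; split; first exact: smoothD.
exists (C `|` D); split; [exact: compactU|by move=> x []; [exact: CE|exact: DE]|].
by move=> x /not_orP[/fC + /gD] /= => -> ->; rewrite addr0.
Qed.

Lemma test_funMl E f g : smooth f -> test_fun E g -> test_fun E (f \* g).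
Proof.
move=> sf /test_funP[sg [D [cD DE gD]]]; apply/test_funP; split; first exact: smoothM.
by exists D; split=> // x /gD /= ->; rewrite mulr0.
Qed.

Lemma test_funZ E c f : test_fun E f -> test_fun E (fun x => c * f x).
Proof. by apply: test_funMl; exact: smooth_cst. Qed.

Lemma test_funB E f g : test_fun E f -> test_fun E g -> test_fun E (f \- g).
Proof.
move=> tf /(test_funZ (-1)) tg; rewrite (_ : f \- g = f \+ (fun x => -1 * g x)).
  exact: test_funD.
by apply/funext => x /=; rewrite mulN1r.
Qed.

Lemma test_fun_shift E (a : V) phi : test_fun ((fun x => a + x) @` E) phi ->
  test_fun E (fun x => phi (a + x)).
Proof.
move=> /test_funP[sp [C [cC CE pC]]]; apply/test_funP; split; first exact: smooth_shift.
exists ((fun x => - a + x) @` C); split.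
- apply: continuous_compact => //; apply: continuous_subspaceT => x.
  by have := @continuous_affine _ _ (- a) 1 x; under eq_fun do rewrite scale1r.
- by move=> _ [x /CE[y Ey <-] <-]; rewrite addKr.
- by move=> x Cx; apply: pC => Cax; apply: Cx; exists (a + x) => //; rewrite addKr.
Qed.

Lemma test_fun_bounded E phi : test_fun E phi -> exists2 M : R, 0 < M & forall x, `|phi x| <= M.
Proof.
move=> tp; have [sp [C [cC CE pC]]] := (test_funP _ _).1 tp.
have : compact (phi @` C).
  by apply: continuous_compact => //; apply: continuous_subspaceT; exact: smooth_cont.
move=> /compact_bounded[M [_ hM]]; exists (Num.max 1 (M + 1)).
  by rewrite lt_max ltr01.
move=> x; rewrite le_max; have [Cx|/pC ->] := pselect (C x); last by rewrite normr0 ler01.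
by apply/orP; right; apply: hM; [rewrite ltrDl|exists x].
Qed.

Lemma smooth_measurable phi : smooth phi -> measurable_fun setT phi.
Proof. by move=> sp; apply: continuous_measurable_rV; exact: smooth_cont. Qed.

Lemma bounded_csupp_integrable C f (M : R) : measurable_fun setT f -> compact C ->
  (forall x, ~ C x -> f x = 0) -> (forall x, `|f x| <= M) ->
  leb.-integrable setT (EFin \o f).
Proof.
move=> mf cC fC fM; have mC : measurable C by apply: measurable_closed_rV; exact: compact_closed_rV.
apply: (@le_integrable _ _ _ leb setT measurableT _ (fun x => (M * \1_C x)%:E)).
- exact/measurable_EFinP.
- move=> x _ /=; rewrite lee_fin indicE; case: (asboolP (C x)) => Cx.
    by rewrite mem_set// mulr1; apply: le_trans (fM x) (ler_norm _).
  by rewrite fC// normr0.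
- apply: (@integrableZl _ _ _ leb setT measurableT M (EFin \o \1_C)).
  by apply: integrable_indic_lty => //; exact: compact_lebesgue_rV.
Qed.

Lemma test_fun_integrable E phi : test_fun E phi -> leb.-integrable setT (EFin \o phi).
Proof.
move=> tp; have [sp [C [cC CE pC]]] := (test_funP _ _).1 tp.
have [M M0 hM] := test_fun_bounded tp.
exact: (bounded_csupp_integrable (smooth_measurable sp) cC pC hM).
Qed.

Lemma integral_off E (f : V -> \bar R) : measurable E -> measurable_fun setT f ->
  (forall x, ~ E x -> f x = 0%E) -> (\int[leb]_(x in E) f x = \int[leb]_x f x)%E.
Proof.
move=> mE mf f0; rewrite integral_mkcond; apply: eq_integral => x _.
rewrite patchE; case: ifPn => // /negP h.
by rewrite f0// => Ex; apply: h; rewrite inE.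
Qed.

(* Translation invariance makes the integral of a difference quotient vanish. *)
Lemma integral_partial0 E phi i : test_fun E phi -> (\int[leb]_x (partial i phi x)%:E = 0)%E.
Proof.
move=> tp; have [sp [C [cC CE pC]]] := (test_funP _ _).1 tp.
have [M M0 hM] := test_fun_bounded (test_fun_partial i tp).
pose h (n : nat) : R := n.+1%:R^-1.
have h0 n : 0 < h n by rewrite invr_gt0.
pose e : V := delta_mx 0 i.
pose q n x := (phi (x + h n *: e) - phi x) / h n.
have [r hr] := compact_norm_bounded cC.
(* The steps [h n] are at most 1, so [D] contains the support of every difference quotient. Together
   with the bound [M], which the mean value theorem transfers to the quotients, it provides the
   dominating function. *)
pose D : set V := [set x | `|x| <= r + `|e|].
have mD : measurable D.
  apply: measurable_closed_rV; apply: (closed_comp (D := [set s : R | s <= r + `|e|])).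
    by move=> x _; exact: norm_continuous.
  exact: closed_le.
have qD n x : ~ D x -> q n x = 0.
  move=> Dx; rewrite /q !pC ?subr0 ?mul0r// => /hr /= hx; apply: Dx; rewrite /D /=.
    by apply: le_trans hx _; rewrite lerDl.
  rewrite -[x](addrK (h n *: e)); apply: le_trans (ler_normB _ _) _; apply: lerD => //.
  rewrite normrZ gtr0_norm// ler_piMl//; rewrite /h invf_le1//.
  by rewrite ler1n.
have qM n x : `|q n x| <= M.
  have [xi _ E1] := partial_MVT i x (h n) sp.
  by rewrite /q E1 mulrAC divff ?gt_eqF// mul1r.
have mq n : measurable_fun setT (q n).
  apply: measurable_funM => //; apply: measurable_funB; last exact: smooth_measurable.
  rewrite (_ : (fun x => _) = (fun x => phi (h n *: e + x))).
    by apply: smooth_measurable; exact: smooth_shift.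
  by apply/funext => x; rewrite addrC.
have q0 n : (\int[leb]_x (q n x)%:E = 0)%E.
  have ip : leb.-integrable setT (EFin \o phi) by exact: test_fun_integrable tp.
  have ish : leb.-integrable setT (EFin \o (fun x => phi (x + h n *: e))).
    apply: (test_fun_integrable (E := setT)).
    rewrite (_ : (fun x => _) = (fun x => phi (h n *: e + x))).
      by apply: test_fun_shift; apply: test_funS tp => x _; exists (x - h n *: e) => //; rewrite addrC subrK.
    by apply/funext => x; rewrite addrC.
  rewrite (_ : (fun x => _) = (fun x => (h n)^-1%:E * ((phi (x + h n *: e))%:E - (phi x)%:E))%E); last first.
    by apply/funext => x; rewrite /q -EFinB -EFinM mulrC.
  rewrite integralZl//; last exact: integrableB.
  rewrite integralB//.
  under eq_integral do rewrite addrC.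
  have -> : (\int[leb]_x (phi (h n *: e + x)%R)%:E = \int[leb]_x (phi x)%:E)%E.
    exact: (@integral_shift R N (h n *: e) (EFin \o phi) ((measurable_EFinP _ _).2 (smooth_measurable sp))).
  rewrite subee ?mule0//; exact: integrable_fin_num.
have Dfin : (leb D < +oo)%E by apply: (norm_bounded_lebesgue (r := r + `|e|)).
pose G : V -> \bar R := EFin \o (fun x => M * \1_D x).
have H : (\int[leb]_x (q n x)%:E)%E @[n --> \oo] --> (\int[leb]_x (partial i phi x)%:E)%E.
  apply: (@dominated_cvg _ V R leb setT measurableT (fun n x => (q n x)%:E)
    (fun x => (partial i phi x)%:E) G).
  - by move=> n; exact/measurable_EFinP.
  - move=> x _; apply/cvg_EFin; first by apply: nearW.
    have hq : (fun k : R => k^-1 *: (phi (k *: e + x) - phi x)) @ 0^' --> partial i phi x.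
      exact: (smooth_derivable sp x i).
    have hh : h n @[n --> \oo] --> (0 : R)^'.
      move=> A [d /= d0 hd]; have /cvgrPdist_lt /(_ d d0) [k _ hk] := @cvg_harmonic R.
      exists k => // n /= kn; apply: hd; last by rewrite gt_eqF.
      exact: hk.
    have := cvg_comp _ _ hh hq; apply: cvg_trans; apply: near_eq_cvg; apply: nearW => n /=.
    by rewrite /q scaleRE mulrC [x + _]addrC.
  - by [].
  - apply: (@integrableZl _ _ _ leb setT measurableT M (EFin \o \1_D)).
    exact: integrable_indic_lty.
  - move=> n x _; rewrite lee_fin indicE; have [Dx|Dx] := pselect (D x).
      by rewrite mem_set// mulr1.
    by rewrite qD// normr0 mulr_ge0// ltW.
apply/esym; move: H; under eq_fun do rewrite q0.
by move=> /cvg_lim <- //; rewrite lim_cst.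
Qed.

End test_functions.

(** * Norms of functions and of vector fields *)

Section Lp_norm.
Context d (T : measurableType d) (R : realType).
Variable mu : {measure set T -> \bar R}.
Implicit Types (f g : T -> R) (q r : R).

(** Finiteness is kept apart from the real-valued [nrm], so that estimates can be carried out in
    [R]. *)
Definition Lp q f : Prop :=
  measurable_fun setT f /\ ('N[mu]_q%:E[EFin \o f] < +oo)%E.

Definition nrm q f : R := fine 'N[mu]_q%:E[EFin \o f].

Lemma nrm_ge0 q f : 0 <= nrm q f.
Proof. by apply: fine_ge0; exact: Lnorm_ge0. Qed.

Lemma nrmE q f : Lp q f -> ('N[mu]_q%:E[EFin \o f] = (nrm q f)%:E)%E.
Proof. by move=> [_ fq]; rewrite fineK// ge0_fin_numE ?Lnorm_ge0. Qed.

Lemma LnormE_int q f : ('N[mu]_q%:E[EFin \o f] = (\int[mu]_x (`|f x| `^ q)%:E) `^ q^-1)%E.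
Proof.
by rewrite unlock; congr (_ `^ _)%E; apply: eq_integral => x _; rewrite /= poweR_EFin.
Qed.

Lemma integral_powR_ge0 q f : (0 <= \int[mu]_x (`|f x| `^ q)%:E)%E.
Proof. by apply: integral_ge0 => x _; rewrite lee_fin powR_ge0. Qed.

Lemma measurable_abs_powR q f : measurable_fun setT f ->
  measurable_fun setT (fun x => (`|f x| `^ q)%:E).
Proof.
move=> mf; apply/measurable_EFinP.
apply: (@measurableT_comp _ _ _ _ _ _ (fun y : R => y `^ q)) => //.
exact: measurableT_comp.
Qed.

Lemma LpP q f : 0 < q -> Lp q f <->
  measurable_fun setT f /\ (\int[mu]_x (`|f x| `^ q)%:E < +oo)%E.
Proof.
move=> q0; rewrite /Lp LnormE_int; split=> -[mf fi]; split=> //; last first.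
  by rewrite poweR_lty.
apply: lty_poweRy fi.
by rewrite invr_eq0 gt_eqF.
Qed.

Lemma nrm_powR q f : 0 < q -> Lp q f ->
  (\int[mu]_x (`|f x| `^ q)%:E)%E = (nrm q f `^ q)%:E.
Proof.
move=> q0 fq; have := nrmE fq; rewrite LnormE_int => E.
rewrite -poweR_EFin -E -poweRrM mulVf ?gt_eqF// poweRe1//; exact: integral_powR_ge0.
Qed.

Lemma nrm_le_powR q f c : 0 < q -> 0 <= c -> measurable_fun setT f ->
  (\int[mu]_x (`|f x| `^ q)%:E <= (c `^ q)%:E)%E -> Lp q f /\ nrm q f <= c.
Proof.
move=> q0 c0 mf fc; have fq : Lp q f.
  by apply/(LpP _ q0); split=> //; apply: le_lt_trans fc (ltry _).
split=> //; move: fc; rewrite nrm_powR// lee_fin.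
by apply: contraTT; rewrite -!ltNge => h; apply: gt0_ltr_powR => //; rewrite nnegrE ?nrm_ge0.
Qed.

Lemma Lp_le q f g : 0 < q -> measurable_fun setT f -> (forall x, `|f x| <= `|g x|) ->
  Lp q g -> Lp q f /\ nrm q f <= nrm q g.
Proof.
move=> q0 mf fg gq; apply: nrm_le_powR => //; first exact: nrm_ge0.
rewrite -(nrm_powR q0 gq); apply: ge0_le_integral => //.
- exact: measurable_abs_powR.
- by apply: measurable_abs_powR; case: gq.
- by move=> x _; rewrite lee_fin ge0_ler_powR ?nnegrE// ltW.
Qed.

Lemma nrm_powR_pos q f : 0 < q -> (forall x, 0 <= f x) -> Lp q f ->
  (\int[mu]_x (f x `^ q)%:E)%E = (nrm q f `^ q)%:E.
Proof.
move=> q0 f0 fq; rewrite -(nrm_powR q0 fq); apply: eq_integral => x _.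
by rewrite (ger0_norm (f0 x)).
Qed.

(** Integrates a pointwise inequality between [q]-th powers; Clarkson's inequality and the
    second-order bound are obtained through it. *)
Lemma nrm_ineq q f1 f2 f3 f4 (c3 c4 : R) : 0 < q ->
  Lp q f1 -> Lp q f2 -> Lp q f3 -> Lp q f4 -> 0 <= c3 -> 0 <= c4 ->
  (forall x, `|f1 x| `^ q + `|f2 x| `^ q <= c3 * `|f3 x| `^ q + c4 * `|f4 x| `^ q) ->
  nrm q f1 `^ q + nrm q f2 `^ q <= c3 * nrm q f3 `^ q + c4 * nrm q f4 `^ q.
Proof.
move=> q0 h1 h2 h3 h4 c30 c40 H.
have m f : Lp q f -> measurable_fun setT (fun x => (`|f x| `^ q)%:E).
  by move=> [mf _]; exact: measurable_abs_powR.
have p0 f : forall x, setT x -> (0 <= (`|f x| `^ q)%:E)%E.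
  by move=> x _; rewrite lee_fin powR_ge0.
rewrite -lee_fin !EFinD !EFinM -(nrm_powR q0 h1) -(nrm_powR q0 h2) -(nrm_powR q0 h3) -(nrm_powR q0 h4).
rewrite -(ge0_integralD mu measurableT (p0 f1) (m _ h1) (p0 f2) (m _ h2)).
rewrite -(ge0_integralZl_EFin mu measurableT (p0 f3) (m _ h3) c30).
rewrite -(ge0_integralZl_EFin mu measurableT (p0 f4) (m _ h4) c40).
rewrite -ge0_integralD//; last 4 first.
- by move=> x _; rewrite -EFinM lee_fin mulr_ge0 ?powR_ge0.
- by apply: emeasurable_funM => //; exact: m.
- by move=> x _; rewrite -EFinM lee_fin mulr_ge0 ?powR_ge0.
- by apply: emeasurable_funM => //; exact: m.
apply: ge0_le_integral => //.
- by move=> x _; rewrite -EFinD lee_fin addr_ge0 ?powR_ge0.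
- by apply: emeasurable_funD; exact: m.
- by apply: emeasurable_funD; apply: emeasurable_funM => //; exact: m.
- by move=> x _; rewrite -!EFinM -!EFinD lee_fin.
Qed.

Lemma LpD q f g : 1 <= q -> Lp q f -> Lp q g ->
  Lp q (f \+ g) /\ nrm q (f \+ g) <= nrm q f + nrm q g.
Proof.
move=> q1 fq gq; have [mf _] := fq; have [mg _] := gq.
have := minkowski_EFin mu mf mg q1; rewrite (nrmE fq) (nrmE gq) -EFinD => h.
have fgq : Lp q (f \+ g) by split; [exact: measurable_funD|exact: le_lt_trans h (ltry _)].
by split=> //; rewrite -lee_fin -nrmE.
Qed.

Lemma LpZ q c f : 0 < q -> Lp q f ->
  Lp q (fun x => c * f x) /\ nrm q (fun x => c * f x) = `|c| * nrm q f.
Proof.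
move=> q0 fq; have [mf _] := fq.
have mcf : measurable_fun setT (fun x => c * f x) by exact: measurable_funM.
have E : (\int[mu]_x (`|c * f x| `^ q)%:E)%E = ((`|c| * nrm q f) `^ q)%:E.
  rewrite powRM ?nrm_ge0// EFinM -(nrm_powR q0 fq) -ge0_integralZl//.
  - by apply: eq_integral => x _; rewrite normrM powRM.
  exact: measurable_abs_powR.
have cfq : Lp q (fun x => c * f x) by apply/(LpP _ q0); rewrite E ltry.
split=> //; apply: (@powR_injective _ q); rewrite ?gt_eqF// ?nnegrE ?mulr_ge0 ?nrm_ge0//.
by apply: EFin_inj; rewrite -nrm_powR.
Qed.

Lemma LpB q f g : 1 <= q -> Lp q f -> Lp q g ->
  Lp q (f \- g) /\ nrm q (f \- g) <= nrm q f + nrm q g.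
Proof.
move=> q1 fq gq; have q0 : 0 < q by exact: lt_le_trans q1.
have [gq' E] := LpZ (-1) q0 gq.
have := LpD q1 fq gq'; rewrite E normrN1 mul1r.
by rewrite (_ : f \+ _ = f \- g)//; apply/funext => x /=; rewrite mulN1r.
Qed.

Lemma nrm_hoelder (p q : R) f g : 0 < p -> 0 < q -> p^-1 + q^-1 = 1 ->
  Lp p f -> Lp q g ->
  mu.-integrable setT (EFin \o (f \* g)) /\
  (\int[mu]_x (`|f x * g x|)%:E <= (nrm p f * nrm q g)%:E)%E.
Proof.
move=> p0 q0 pq fp gq; have [mf _] := fp; have [mg _] := gq.
have := hoelder mu mf mg p0 q0 pq; rewrite Lnorm1 (nrmE fp) (nrmE gq) -EFinM => h.
split; last exact: h.
apply/integrableP; split; first exact/measurable_EFinP/measurable_funM.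
by apply: le_lt_trans h (ltry _).
Qed.

(** Pointwise [|f|^q <= M^(q-p) |f|^p]. Applied to a function of unit [L^q] norm, it bounds the
    maximum from below. *)
Lemma nrm_interp (p q : R) f (M : R) : 0 < p -> p <= q -> 0 <= M -> (forall x, `|f x| <= M) ->
  Lp p f -> Lp q f /\ nrm q f `^ q <= M `^ (q - p) * nrm p f `^ p.
Proof.
move=> p0 pq M0 fM fp; have q0 : 0 < q by exact: lt_le_trans pq.
have [mf _] := fp.
have mpow r : measurable_fun setT (fun x => (`|f x| `^ r)%:E) by exact: measurable_abs_powR.
have h : (\int[mu]_x (`|f x| `^ q)%:E <= (M `^ (q - p) * nrm p f `^ p)%:E)%E.
  rewrite EFinM -(nrm_powR p0 fp) -ge0_integralZl//; last by rewrite lee_fin powR_ge0.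
  apply: ge0_le_integral => //.
  - exact: emeasurable_funM.
  - move=> x _; rewrite -EFinM lee_fin.
    have [->|f0] := eqVneq `|f x| 0; first by rewrite powR0 ?gt_eqF// mulr_ge0 ?powR_ge0.
    have -> : `|f x| `^ q = `|f x| `^ (q - p) * `|f x| `^ p by rewrite -powRD ?subrK// f0 implybT.
    rewrite ler_wpM2r ?powR_ge0//.
    by rewrite ge0_ler_powR ?nnegrE ?subr_ge0.
have fq : Lp q f by apply/(LpP _ q0); split=> //; exact: le_lt_trans h (ltry _).
by split=> //; rewrite -lee_fin -nrm_powR.
Qed.

End Lp_norm.

Section enorm.
Context {R : realType} {N : nat}.
Local Notation V := 'rV[R]_N.
Implicit Types (a b : V).

Lemma enorm_ge0 a : 0 <= enorm a.
Proof. exact: sqrtr_ge0. Qed.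

Lemma sqr_enorm a : enorm a ^+ 2 = \sum_i a 0 i ^+ 2.
Proof. by rewrite sqr_sqrtr// sumr_ge0// => i _; exact: sqr_ge0. Qed.

Lemma enorm0 : enorm (0 : V) = 0.
Proof. by rewrite /enorm big1 ?sqrtr0// => i _; rewrite mxE expr0n. Qed.

Lemma enormZ c a : enorm (c *: a) = `|c| * enorm a.
Proof.
rewrite /enorm -sqrtr_sqr -sqrtrM ?sqr_ge0// mulr_sumr.
by under eq_bigr do rewrite mxE exprMn.
Qed.

Lemma enormN a : enorm (- a) = enorm a.
Proof. by rewrite -scaleN1r enormZ normrN1 mul1r. Qed.

Definition dotr (a b : V) : R := \sum_i a 0 i * b 0 i.

Lemma sqr_enormD a b c : enorm (a + c *: b) ^+ 2 =
  enorm a ^+ 2 + 2 * c * dotr a b + c ^+ 2 * enorm b ^+ 2.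
Proof.
rewrite !sqr_enorm /dotr !mulr_sumr -!big_split /=; apply: eq_bigr => i _.
by rewrite !mxE; ring.
Qed.

Lemma dotr_le a b : `|dotr a b| <= enorm a * enorm b.
Proof.
have [->|b0] := eqVneq b 0.
  by rewrite /dotr big1 ?normr0 ?enorm0 ?mulr0// => i _; rewrite mxE mulr0.
have B0 : 0 < enorm b.
  rewrite lt_neqAle enorm_ge0 andbT eq_sym; apply: contra b0 => /eqP e0; apply/eqP/rowP => i.
  rewrite mxE; apply/eqP; rewrite -sqrf_eq0.
  have : \sum_i b 0 i ^+ 2 == 0 by rewrite -sqr_enorm e0 expr0n.
  rewrite psumr_eq0 => [/allP /(_ i (mem_index_enum _))|j _]; first exact.
  exact: sqr_ge0.
(* The nonnegative quadratic polynomial [|a + c b|^2] is evaluated at its minimizer in [c]. *)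
have := sqr_ge0 (enorm (a + (- dotr a b / enorm b ^+ 2) *: b)); rewrite sqr_enormD.
set A := enorm a; set B := enorm b in B0 *; set D := dotr a b => h.
rewrite -ler_sqr ?nnegrE ?mulr_ge0 ?enorm_ge0// real_normK ?num_real// exprMn.
have B2 : 0 < B ^+ 2 by rewrite exprn_gt0.
have : 0 <= (A ^+ 2 + 2 * (- D / B ^+ 2) * D + (- D / B ^+ 2) ^+ 2 * B ^+ 2) * B ^+ 2.
  by rewrite mulr_ge0// ltW.
have -> : (A ^+ 2 + 2 * (- D / B ^+ 2) * D + (- D / B ^+ 2) ^+ 2 * B ^+ 2) * B ^+ 2 =
  A ^+ 2 * B ^+ 2 - D ^+ 2 by field; rewrite gt_eqF.
by rewrite subr_ge0.
Qed.

Lemma enormD a b : enorm (a + b) <= enorm a + enorm b.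
Proof.
rewrite -ler_sqr ?nnegrE ?addr_ge0 ?enorm_ge0//.
have := sqr_enormD a b 1; rewrite scale1r => ->.
have := le_trans (ler_norm _) (dotr_le a b); lra.
Qed.

Lemma coord_le_enorm a i : `|a 0 i| <= enorm a.
Proof.
rewrite -ler_sqr ?nnegrE ?enorm_ge0// sqr_enorm real_normK ?num_real//.
by rewrite (bigD1 i)//= lerDl sumr_ge0// => j _; exact: sqr_ge0.
Qed.

Lemma enorm_le_sum a : enorm a <= \sum_i `|a 0 i|.
Proof.
rewrite {1}(row_sum_delta a); elim/big_ind2: _ => [|x y b c xy bc|i _].
- by rewrite enorm0.
- by apply: le_trans (enormD _ _) _; exact: lerD.
rewrite enormZ -[leRHS]mulr1 ler_wpM2l// -sqrtr1; apply: ler_wsqrtr.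
rewrite (bigD1 i)//= mxE !eqxx big1 ?addr0 ?expr1n// => j /negPf ji.
by rewrite mxE eqxx ji expr0n.
Qed.

End enorm.

(** * Convexity and second-order smoothness of real powers *)

Section powR_inequalities.
Context {R : realType}.
Implicit Types (x y r : R).

Lemma powR_le x y r : 0 <= r -> 0 <= x -> x <= y -> x `^ r <= y `^ r.
Proof.
by move=> r0 x0 xy; apply: ge0_ler_powR; rewrite ?nnegrE//; exact: le_trans xy.
Qed.

Lemma powR_split x r : 0 <= x -> 1 <= r -> x `^ r = x * x `^ (r - 1).
Proof.
move=> x0 r1; have [->|xN0] := eqVneq x 0; first by rewrite powR0 ?mul0r//; lra.
by rewrite -[X in _ = X * _]powRr1// -powRD ?xN0 ?implybT// addrC subrK.
Qed.

Lemma powR_superadd x y r : 0 <= x -> 0 <= y -> 1 <= r -> x `^ r + y `^ r <= (x + y) `^ r.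
Proof.
move=> x0 y0 r1; have xy0 := addr_ge0 x0 y0.
rewrite (powR_split x0 r1) (powR_split y0 r1) (powR_split xy0 r1) mulrDl.
by apply: lerD; rewrite ler_wpM2l// powR_le ?lerDl ?lerDr// subr_ge0.
Qed.

(** The tangent inequality of the convex function [t^r]. Young's inequality for [y] and [x^(r-1)],
    with exponents [r] and [r/(r-1)], yields it without derivatives and also at 0. *)
Lemma powR_tangent x y r : 0 <= x -> 0 <= y -> 1 <= r ->
  x `^ r - y `^ r <= r * x `^ (r - 1) * (x - y).
Proof.
move=> x0 y0; rewrite le_eqVlt => /predU1P[<-|r1].
  by rewrite subrr powRr0 !powRr1// !mul1r.
have r0 : 0 < r by lra.
have q0 : 0 < r / (r - 1) by rewrite divr_gt0// subr_gt0.
have pq : r^-1 + (r / (r - 1))^-1 = 1 by field; rewrite subr_eq0 !gt_eqF.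
have := conjugate_powR y0 (powR_ge0 x (r - 1)) r0 q0 pq.
rewrite -[(x `^ _) `^ _]powRrM.
have -> : (r - 1) * (r / (r - 1)) = r by field; rewrite subr_eq0 gt_eqF.
rewrite invf_div => h.
have : r * (y * x `^ (r - 1)) <= r * (y `^ r / r + x `^ r * ((r - 1) / r)) by rewrite ler_pM2l.
have -> : r * (y `^ r / r + x `^ r * ((r - 1) / r)) = y `^ r + x `^ r * (r - 1).
  by field; rewrite gt_eqF.
have := powR_split x0 (ltW r1); set X := x `^ (r - 1) => ->; nra.
Qed.

Lemma powR_midpoint x y r : 0 <= x -> 0 <= y -> 1 <= r ->
  ((x + y) / 2) `^ r <= (x `^ r + y `^ r) / 2.
Proof.
move=> x0 y0 r1; have m0 : 0 <= (x + y) / 2 by lra.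
have := powR_tangent m0 x0 r1; have := powR_tangent m0 y0 r1.
set c := r * _; have -> : (x + y) / 2 - y = - ((x + y) / 2 - x) by lra.
lra.
Qed.

Lemma exprD1_le (t : R) n : 0 <= t <= 1 -> (1 + t) ^+ n <= 1 + 3 ^+ n * t.
Proof.
move=> t01; elim: n => [|n IH]; first by rewrite !expr0; lra.
have c1 : 1 <= 3 ^+ n :> R by rewrite exprn_ege1//; lra.
rewrite !exprS; move: IH; set A := _ ^+ n; set B := 3 ^+ n in c1 * => IH.
have : (1 + t) * A <= (1 + t) * (1 + B * t) by rewrite ler_wpM2l//; lra.
have : t <= B * t by rewrite ler_peMl//; lra.
have : B * t * t <= B * t by rewrite ler_piMr//; [apply: mulr_ge0|]; lra.
lra.
Qed.

Lemma expr1B_ge (t : R) n : 0 <= t <= 1 -> 1 - n%:R * t <= (1 - t) ^+ n.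
Proof.
move=> t01; elim: n => [|n IH]; first by rewrite expr0; lra.
rewrite exprS -natr1.
have : (1 - t) * (1 - n%:R * t) <= (1 - t) * (1 - t) ^+ n by rewrite ler_wpM2l//; lra.
have : 0 <= n%:R :> R by []; nra.
Qed.

(** Replacing the exponent [r - 1] by an integer [M > r] enlarges the power of [1 + t] and
    diminishes that of [1 - t]; both integer powers are linearly close to 1. *)
Lemma powR_diff_le r : 1 <= r -> exists2 C : R, 0 <= C & forall t, 0 <= t <= 1 ->
  (1 + t) `^ (r - 1) - (1 - t) `^ (r - 1) <= C * t.
Proof.
move=> r1; pose M := Num.bound r; have rM : r < M%:R by apply: archi_boundP; lra.
exists (3 ^+ M + M%:R); first by rewrite addr_ge0// exprn_ge0//; lra.
move=> t t01.
have h1 : (1 + t) `^ (r - 1) <= (1 + t) ^+ M.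
  rewrite -powR_mulrn; last lra.
  by rewrite ler_powR//; lra.
have h2 : (1 - t) ^+ M <= (1 - t) `^ (r - 1).
  have [->|t1] := eqVneq t 1.
    rewrite subrr expr0n; case: (M) rM => [|m _ /=]; last exact: powR_ge0.
    by move=> r0; lra.
  rewrite -powR_mulrn; last lra.
  by rewrite ger_powR//; [lra|move: t1 t01; rewrite neq_lt; lra].
have := exprD1_le M t01; have := expr1B_ge M t01; lra.
Qed.

(* Second-order smoothness of [|.|^p], [p = 2 r], in terms of squared norms. *)
Lemma powR_second_diff r : 1 <= r -> exists2 C : R, 0 <= C &
  forall S B m e : R, 0 <= S -> 0 <= B -> m ^+ 2 <= S * B -> `|e| <= 1 ->
  (S + e ^+ 2 * B + 2 * e * m) `^ r + (S + e ^+ 2 * B - 2 * e * m) `^ r - 2 * S `^ r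
  <= C * e ^+ 2 * (S `^ r + B `^ r).
Proof.
move=> r1; have [C' C'0 hC'] := powR_diff_le r1.
exists ((4 * r * C' + 2 * r) * 2 `^ r); first by rewrite mulr_ge0 ?powR_ge0//; nra.
move=> S B m e S0 B0 mSB e1.
(* The sign of [2 e m] is immaterial: exchanging the two perturbed terms reduces to its absolute
   value [h]. *)
suff main (h : R) : 0 <= h -> h ^+ 2 = 4 * e ^+ 2 * m ^+ 2 ->
    (S + e ^+ 2 * B + h) `^ r + (S + e ^+ 2 * B - h) `^ r - 2 * S `^ r
    <= (4 * r * C' + 2 * r) * 2 `^ r * e ^+ 2 * (S `^ r + B `^ r).
  have [h0|h0] := leP 0 (2 * e * m); first by apply: main => //; ring.
  have := main (- (2 * e * m)); rewrite opprK [X in X - _]addrC; apply; [lra|ring].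
move=> h0 hE; set T := S + e ^+ 2 * B.
have e2 : e ^+ 2 <= 1 by rewrite -real_normK ?num_real// expr_le1.
have e20 : 0 <= e ^+ 2 by exact: sqr_ge0.
have eB : e ^+ 2 * B <= B by nra.
have T0 : 0 <= T by rewrite /T; nra.
have TSB : T <= S + B by rewrite /T; lra.
have h2T : h ^+ 2 <= 4 * e ^+ 2 * B * S by rewrite hE; nra.
(* By the arithmetic-geometric mean inequality [4 S e^2 B <= T^2], so [T - h] is a legitimate
   base. *)
have hT : h <= T.
  rewrite -ler_sqr ?nnegrE//; apply: le_trans h2T _.
  by have := sqr_ge0 (S - e ^+ 2 * B); rewrite /T; nra.
have mid : (S + B) `^ r <= 2 `^ r * (S `^ r + B `^ r).
  have := powR_midpoint S0 B0 r1; rewrite powRM ?addr_ge0// => H.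
  have p2 : 0 < 2 `^ r :> R by rewrite powR_gt0.
  have : (S + B) `^ r * 2^-1 `^ r * 2 `^ r <= (S `^ r + B `^ r) / 2 * 2 `^ r by rewrite ler_pM2r.
  rewrite -mulrA -powRM// mulVf// powR1 mulr1.
  have := powR_ge0 S r; have := powR_ge0 B r; nra.
have BT : B * T `^ (r - 1) <= (S + B) `^ r.
  rewrite (powR_split (addr_ge0 S0 B0) r1); apply: ler_pM => //; rewrite ?powR_ge0//.
    by rewrite lerDr.
  by rewrite powR_le// subr_ge0.
have t1 := powR_tangent (addr_ge0 T0 h0) T0 r1.
have Th0 : 0 <= T - h by rewrite subr_ge0.
have t2 := powR_tangent Th0 T0 r1.
have t3 := powR_tangent T0 S0 r1.
(* The increment of the power is at most a multiple of [h/T], so its product with [h] carries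
   [h^2/T]; with [h^2 <= 4 e^2 B S] and [S <= T] this is of order [e^2]. *)
have key : h * ((T + h) `^ (r - 1) - (T - h) `^ (r - 1)) <= C' * (4 * e ^+ 2 * B * T `^ (r - 1)).
  have [T00|TN0] := eqVneq T 0.
    have -> : h = 0 by apply/eqP; rewrite eq_le h0 andbT -T00.
    rewrite mul0r; apply: mulr_ge0 => //; apply: mulr_ge0; last exact: powR_ge0.
    by apply: mulr_ge0 => //; apply: mulr_ge0.
  have Tp : 0 < T by rewrite lt_neqAle eq_sym TN0.
  have th : 0 <= h / T <= 1 by rewrite divr_ge0//= ler_pdivrMr ?mul1r.
  have := hC' _ th.
  have -> : T + h = T * (1 + h / T) by field.
  have -> : T - h = T * (1 - h / T) by field.
  rewrite !powRM//; last 2 first.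
    lra.
    lra.
  rewrite -mulrBr; set P := T `^ (r - 1); set Q := _ - _ => hQ.
  have P0 : 0 <= P by exact: powR_ge0.
  apply: le_trans (_ : h * (P * (C' * (h / T))) <= _); first by rewrite ler_wpM2l// ler_wpM2l.
  have -> : h * (P * (C' * (h / T))) = C' * (h ^+ 2 / T * P) by field.
  rewrite ler_wpM2l// ler_wpM2r// ler_pdivrMr//; apply: le_trans h2T _.
  rewrite ler_wpM2l//; last by rewrite /T lerDl; nra.
  by apply: mulr_ge0 => //; apply: mulr_ge0.
set P := T `^ (r - 1) in BT t3 key.
have r0 : 0 < r by lra.
have D : (T + h) `^ r + (T - h) `^ r - 2 * T `^ r <= r * (C' * (4 * e ^+ 2 * B * P)).
  apply: le_trans (_ : r * (h * ((T + h) `^ (r - 1) - (T - h) `^ (r - 1))) <= _).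
    by move: t1 t2; lra.
  by rewrite ler_pM2l.
have D2 : T `^ r - S `^ r <= r * P * (e ^+ 2 * B) by move: t3; rewrite /T addrAC subrr add0r.
have E : (T + h) `^ r + (T - h) `^ r - 2 * S `^ r <= (4 * r * C' + 2 * r) * e ^+ 2 * (B * P) by lra.
apply: le_trans E _; set c := 4 * r * C' + 2 * r.
have c0 : 0 <= c by rewrite /c; nra.
have -> : c * 2 `^ r * e ^+ 2 * (S `^ r + B `^ r) = c * e ^+ 2 * (2 `^ r * (S `^ r + B `^ r)) by ring.
by apply: ler_wpM2l; [exact: mulr_ge0|exact: le_trans BT mid].
Qed.

End powR_inequalities.

(** * Norms of vector fields and uniform convexity *)

Section vector_Lp.
Context {R : realType} {N : nat}.
Local Notation V := 'rV[R]_N.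
Local Notation leb := (@lebesgue_rV R N).
Implicit Types (g h : V -> V) (p : R).

Definition vmeas g := forall i, measurable_fun setT (fun x => g x 0 i).

Lemma measurable_enorm g : vmeas g -> measurable_fun setT (fun x => enorm (g x)).
Proof.
move=> mg; apply: (@measurableT_comp _ _ _ _ _ _ (@Num.sqrt R)).
  by apply: continuous_measurable_fun; exact: sqrt_continuous.
apply: measurable_sum => i.
by apply: (@measurableT_comp _ _ _ _ _ _ (fun y : R => y ^+ 2)); [exact: exprn_measurable|exact: mg].
Qed.

Definition vLp p g := vmeas g /\ Lp leb p (fun x => enorm (g x)).
Definition vnrm p g : R := nrm leb p (fun x => enorm (g x)).

Lemma vmeasD g h c : vmeas g -> vmeas h -> vmeas (fun x => g x + c *: h x).
Proof.
move=> mg mh i; rewrite (_ : (fun _ => _) = (fun x => g x 0 i + c * h x 0 i)).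
  by apply: measurable_funD => //; apply: measurable_funM.
by apply/funext => x; rewrite !mxE.
Qed.

Lemma vLpD_scale p g h c : 1 <= p -> vLp p g -> vLp p h ->
  vLp p (fun x => g x + c *: h x) /\
  vnrm p (fun x => g x + c *: h x) <= vnrm p g + `|c| * vnrm p h.
Proof.
move=> p1 [mg gp] [mh hp]; have p0 : 0 < p by exact: lt_le_trans p1.
have mgh := vmeasD c mg mh.
have [chp cE] := LpZ `|c| p0 hp.
have [sp sle] := LpD p1 gp chp.
have [|fp fle] := @Lp_le _ _ _ leb p (fun x => enorm (g x + c *: h x)) _ p0 (measurable_enorm mgh) _ sp.
  move=> x /=; rewrite (ger0_norm (enorm_ge0 _)) ger0_norm; last first.
    by apply: addr_ge0; [exact: enorm_ge0|apply: mulr_ge0; [exact: normr_ge0|exact: enorm_ge0]].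
  by apply: le_trans (enormD _ _) _; rewrite enormZ.
split=> //; apply: le_trans fle _; apply: le_trans sle _.
by rewrite lerD2l cE normr_id.
Qed.

Lemma vLpD p g h : 1 <= p -> vLp p g -> vLp p h ->
  vLp p (fun x => g x + h x) /\ vnrm p (fun x => g x + h x) <= vnrm p g + vnrm p h.
Proof.
move=> p1 gp hp; have := vLpD_scale 1 p1 gp hp; rewrite normr1 mul1r.
by under eq_fun do rewrite scale1r.
Qed.

Lemma vLpB p g h : 1 <= p -> vLp p g -> vLp p h ->
  vLp p (fun x => g x - h x) /\ vnrm p (fun x => g x - h x) <= vnrm p g + vnrm p h.
Proof.
move=> p1 gp hp; have := vLpD_scale (-1) p1 gp hp; rewrite normrN1 mul1r.
by under eq_fun do rewrite scaleN1r.
Qed.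

Lemma vnrmBC p g h : vnrm p (fun x => g x - h x) = vnrm p (fun x => h x - g x).
Proof. by rewrite /vnrm; congr nrm; apply/funext => x; rewrite -enormN opprB. Qed.

Lemma vnrm_ge0 p g : 0 <= vnrm p g.
Proof. exact: nrm_ge0. Qed.

Lemma vLpZ p c g : 0 < p -> vLp p g ->
  vLp p (fun x => c *: g x) /\ vnrm p (fun x => c *: g x) = `|c| * vnrm p g.
Proof.
move=> p0 [mg gp]; have [h E] := LpZ `|c| p0 gp.
rewrite /vLp /vnrm (_ : (fun x => enorm (c *: g x)) = (fun x => `|c| * enorm (g x))); last first.
  by apply/funext => x; rewrite enormZ.
split; last by rewrite E normr_id.
split=> // i; rewrite (_ : (fun _ => _) = (fun x => c * g x 0 i)).
  exact: measurable_funM.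
by apply/funext => x; rewrite !mxE.
Qed.

Lemma vnrm_powR p g : 0 < p -> vLp p g ->
  (\int[leb]_x (enorm (g x) `^ p)%:E)%E = (vnrm p g `^ p)%:E.
Proof.
by move=> p0 [mg gp]; apply: (nrm_powR_pos p0) gp => x; exact: enorm_ge0.
Qed.

Lemma measurable_enorm_powR p g : vmeas g -> measurable_fun setT (fun x => (enorm (g x) `^ p)%:E).
Proof.
move=> mg; apply/measurable_EFinP.
apply: (@measurableT_comp _ _ _ _ _ _ (fun y : R => y `^ p)) => //.
exact: measurable_enorm.
Qed.

Lemma vnrm_ineq p (g1 g2 g3 g4 : V -> V) (c3 c4 : R) : 0 < p ->
  vLp p g1 -> vLp p g2 -> vLp p g3 -> vLp p g4 -> 0 <= c3 -> 0 <= c4 ->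
  (forall x, enorm (g1 x) `^ p + enorm (g2 x) `^ p <=
     c3 * enorm (g3 x) `^ p + c4 * enorm (g4 x) `^ p) ->
  vnrm p g1 `^ p + vnrm p g2 `^ p <= c3 * vnrm p g3 `^ p + c4 * vnrm p g4 `^ p.
Proof.
move=> p0 [_ h1] [_ h2] [_ h3] [_ h4] c30 c40 H; apply: (nrm_ineq p0 h1 h2 h3 h4 c30 c40).
by move=> x; rewrite !(ger0_norm (enorm_ge0 _)); exact: H.
Qed.

Lemma enorm_powR p (a : V) : enorm a `^ p = (enorm a ^+ 2) `^ (p / 2).
Proof. by rewrite -powR_mulrn ?enorm_ge0// -powRrM mulrC divfK. Qed.

(** Superadditivity of [t^(p/2)], the parallelogram identity and the convexity of [t^(p/2)], in this
    order, give the pointwise inequality. *)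
Lemma clarkson p g h : 2 <= p -> vLp p g -> vLp p h ->
  vnrm p (fun x => 2^-1 *: (g x + h x)) `^ p + vnrm p (fun x => 2^-1 *: (g x - h x)) `^ p <=
  2^-1 * vnrm p g `^ p + 2^-1 * vnrm p h `^ p.
Proof.
move=> p2 gp hp; have p0 : 0 < p by lra.
have p1 : 1 <= p by lra.
have [sp _] := vLpZ 2^-1 p0 (vLpD p1 gp hp).1.
have [dp _] := vLpZ 2^-1 p0 (vLpB p1 gp hp).1.
apply: vnrm_ineq => // x.
rewrite !enorm_powR; set a := g x; set b := h x.
have r1 : 1 <= p / 2 by lra.
have A := powR_superadd (sqr_ge0 (enorm (2^-1 *: (a + b)))) (sqr_ge0 (enorm (2^-1 *: (a - b)))) r1.
apply: le_trans A _.
have -> : enorm (2^-1 *: (a + b)) ^+ 2 + enorm (2^-1 *: (a - b)) ^+ 2 =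
   (enorm a ^+ 2 + enorm b ^+ 2) / 2.
  rewrite !enormZ !exprMn; have := sqr_enormD a b 1; have := sqr_enormD a b (-1).
  rewrite scale1r scaleN1r => -> ->; rewrite ger0_norm//; by field.
apply: le_trans (powR_midpoint (sqr_ge0 _) (sqr_ge0 _) r1) _.
by rewrite mulrDl ![_ / 2]mulrC.
Qed.

(** The pointwise case is [powR_second_diff] with [S] and [B] the squared norms and [m] the inner
    product, the condition [m^2 <= S B] being Cauchy-Schwarz. *)
Lemma vnrm_second_diff p : 2 <= p -> exists2 C : R, 0 <= C &
  forall g h e, vLp p g -> vLp p h -> `|e| <= 1 ->
  vnrm p (fun x => g x + e *: h x) `^ p + vnrm p (fun x => g x + (- e) *: h x) `^ p <=
  (2 + C * e ^+ 2) * vnrm p g `^ p + C * e ^+ 2 * vnrm p h `^ p.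
Proof.
move=> p2; have p0 : 0 < p by lra.
have p1 : 1 <= p by lra.
have r1 : 1 <= p / 2 by lra.
have [C C0 hC] := powR_second_diff r1; exists C => // g h e gp hp e1.
have [sp _] := vLpD_scale e p1 gp hp.
have [dp _] := vLpD_scale (- e) p1 gp hp.
apply: vnrm_ineq => //; first by rewrite addr_ge0// mulr_ge0// sqr_ge0.
  by rewrite mulr_ge0// sqr_ge0.
move=> x; rewrite !enorm_powR; set a := g x; set b := h x.
rewrite !sqr_enormD.
have mSB : dotr a b ^+ 2 <= enorm a ^+ 2 * enorm b ^+ 2.
  rewrite -exprMn -[leLHS]real_normK ?num_real//.
  by rewrite lerXn2r ?nnegrE ?mulr_ge0 ?enorm_ge0 ?dotr_le.
have := hC (enorm a ^+ 2) (enorm b ^+ 2) (dotr a b) e (sqr_ge0 _) (sqr_ge0 _) mSB e1.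
have -> : enorm a ^+ 2 + e ^+ 2 * enorm b ^+ 2 + 2 * e * dotr a b =
  enorm a ^+ 2 + 2 * e * dotr a b + e ^+ 2 * enorm b ^+ 2 by ring.
have -> : enorm a ^+ 2 + e ^+ 2 * enorm b ^+ 2 - 2 * e * dotr a b =
  enorm a ^+ 2 + 2 * (- e) * dotr a b + (- e) ^+ 2 * enorm b ^+ 2 by ring.
lra.
Qed.

End vector_Lp.

Lemma integrable_cst_lty d (T : measurableType d) (R : realType)
    (mu : {measure set T -> \bar R}) (A : set T) (c : R) :
  measurable A -> (mu A < +oo)%E -> mu.-integrable A (EFin \o cst c).
Proof.
move=> mA Afin; apply/integrableP; split; first exact/measurable_EFinP/measurable_cst.
rewrite (eq_integral (cst `|c|%:E))// integral_cst// lte_mul_pinfty//.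
Qed.

Section test_Lp.
Context {R : realType} {N : nat}.
Local Notation V := 'rV[R]_N.
Local Notation leb := (@lebesgue_rV R N).
Implicit Types (E C : set V) (phi : V -> R).

Lemma gradE phi x i : grad phi x 0 i = partial i phi x.
Proof. by rewrite mxE. Qed.

Lemma vmeas_grad phi : smooth phi -> vmeas (grad phi).
Proof.
move=> sp i; under eq_fun do rewrite gradE.
by apply: smooth_measurable; exact: smooth_partial.
Qed.

Lemma grad_bounded E phi : test_fun E phi ->
  exists2 M : R, 0 < M & forall x, enorm (grad phi x) <= M.
Proof.
move=> tp; have /choice[M hM] i : exists M : R, 0 < M /\ forall x, `|partial i phi x| <= M.
  by have [M M0 h] := test_fun_bounded (test_fun_partial i tp); exists M.
exists (1 + \sum_i M i); first by rewrite ltr_pwDl// sumr_ge0// => i _; apply/ltW; case: (hM i).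
move=> x; apply: le_trans (enorm_le_sum _) _; apply: ler_wpDl => //.
by apply: ler_sum => i _; rewrite gradE; case: (hM i).
Qed.

Lemma grad_off C phi x : closed C -> (forall x, ~ C x -> phi x = 0) -> ~ C x -> grad phi x = 0.
Proof. by move=> cC pC Cx; apply/rowP => i; rewrite gradE (partial_off i cC pC Cx) mxE. Qed.

Lemma bounded_csupp_Lp C (f : V -> R) (M q : R) : 0 < q -> measurable_fun setT f ->
  compact C -> (forall x, ~ C x -> f x = 0) -> (forall x, `|f x| <= M) -> Lp leb q f.
Proof.
move=> q0 mf cC fC fM; apply/(LpP _ _ q0); split; first exact: mf.
have mp : measurable_fun setT (fun x => `|f x| `^ q).
  exact/measurable_EFinP/measurable_abs_powR.
have fC' x : ~ C x -> `|f x| `^ q = 0 by move=> /fC ->; rewrite normr0 powR0// gt_eqF.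
have fM' x : `| `|f x| `^ q| <= M `^ q.
  by rewrite ger0_norm ?powR_ge0//; apply: powR_le => //; exact: ltW.
have /integrableP[_] := bounded_csupp_integrable mp cC fC' fM'.
apply: le_lt_trans; rewrite le_eqVlt; apply/orP; left; apply/eqP; apply: eq_integral => x _.
by rewrite [RHS]/= (ger0_norm (powR_ge0 _ _)).
Qed.

Lemma test_fun_Lp E phi q : 0 < q -> test_fun E phi -> Lp leb q phi.
Proof.
move=> q0 tp; have [sp [C [cC CE pC]]] := (test_funP _ _).1 tp.
have [M M0 hM] := test_fun_bounded tp.
exact: (bounded_csupp_Lp q0 (smooth_measurable sp) cC pC hM).
Qed.

Lemma test_fun_vLp E phi q : 0 < q -> test_fun E phi -> vLp q (grad phi).
Proof.
move=> q0 tp; have [sp [C [cC CE pC]]] := (test_funP _ _).1 tp.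
have [M M0 hM] := grad_bounded tp.
split; first exact: vmeas_grad.
apply: (bounded_csupp_Lp q0 (measurable_enorm (vmeas_grad sp)) cC) => [x Cx|x].
  by rewrite (grad_off (compact_closed_rV cC) pC Cx) enorm0.
by rewrite ger0_norm ?enorm_ge0.
Qed.

Lemma grad_shift (a : V) phi x : grad (fun x => phi (a + x)) x = grad phi (a + x).
Proof. by apply/rowP => i; rewrite !gradE partial_shift. Qed.

Lemma gradD phi psi : smooth phi -> smooth psi ->
  grad (phi \+ psi) = fun x => grad phi x + grad psi x.
Proof.
by move=> sp sq; apply/funext => x; apply/rowP => i; rewrite !mxE partialD.
Qed.

Lemma gradB phi psi : smooth phi -> smooth psi ->
  grad (phi \- psi) = fun x => grad phi x - grad psi x.
Proof.
by move=> sp sq; apply/funext => x; apply/rowP => i; rewrite !mxE partialB.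
Qed.

Lemma gradZ c phi : smooth phi -> grad (fun x => c * phi x) = fun x => c *: grad phi x.
Proof.
by move=> sp; apply/funext => x; apply/rowP => i; rewrite !mxE partialZ.
Qed.

Lemma is_derive_path phi (x z : V) k (s : R) : smooth phi ->
  is_derive s (1 : R) (fun s => phi (x + s ^+ k *: z))
    (dotr z (grad phi (x + s ^+ k *: z)) * (k%:R * s ^+ k.-1)).
Proof.
move=> sp.
have [dz zE] := smooth_directional (x + s ^+ k *: z) z sp.
have D1 := is_derive_line_at dz.
have D2 : is_derive s (1 : R) (fun t : R => t ^+ k) (k%:R * s ^+ k.-1).
  have := is_deriveX k (is_derive_id s (1 : R)); rewrite exprfctE => D.
  by apply: (is_derive_eq D); rewrite scaleRE mulr1.
have := is_derive1_comp (f := fun h => phi (x + h *: z)) (g := fun t : R => t ^+ k) D1 D2.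
rewrite zE => D; apply: (is_derive_eq D); congr (_ * _).
by apply: eq_bigr => i _; rewrite gradE.
Qed.

End test_Lp.

(** * Morrey and Poincare inequalities *)

Section morrey.
Context {R : realType} {N : nat}.
Local Notation V := 'rV[R]_N.
Local Notation leb := (@lebesgue_rV R N).
Variables (p : R).
Hypotheses (p1 : 1 < p) (pN : N%:R < p).

Let pp0 : 0 < p. Proof. exact: lt_trans ltr01 p1. Qed.

(** Segments issuing from [x] are run as [x + s^k (y - x)]. The speed [k s^(k-1)] beats the factor
    [(s^k)^(-N/p)] coming from the change of variables as soon as [k (p - N) >= p]. The resulting
    bound is uniform in [s], so one application of the mean value theorem replaces an integral over
    [s]. *)
Let k := Num.bound (p / (p - N%:R)).

Let k_gt : p / (p - N%:R) < k%:R.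
Proof. by apply: archi_boundP; apply: divr_ge0; [exact: ltW|rewrite subr_ge0 ltW]. Qed.

Let k0 : (0 < k)%N.
Proof.
rewrite -(ltr0n R); apply: le_lt_trans k_gt.
by apply: divr_ge0; [exact: ltW|rewrite subr_ge0 ltW].
Qed.

Let p' : R := p / (p - 1).
Let p'0 : 0 < p'. Proof. by rewrite divr_gt0 ?subr_gt0. Qed.
Let pp' : p'^-1 + p^-1 = 1.
Proof. by rewrite /p' invf_div; field; rewrite gt_eqF. Qed.

Variables (Q : set V) (vol D : R).
Hypotheses (mQ : measurable Q) (vol0 : 0 < vol) (Qvol : leb Q = vol%:E) (D0 : 0 <= D).
Hypothesis Qconv : forall x y (s : R), Q x -> Q y -> 0 <= s <= 1 -> Q (x + s *: (y - x)).
Hypothesis Qdiam : forall x y, Q x -> Q y -> enorm (y - x) <= D.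

Let Qfin : (leb Q < +oo)%E. Proof. by rewrite Qvol ltry. Qed.

Let nrm_indic : nrm leb p' \1_Q = vol `^ (1 - p^-1) /\ Lp leb p' \1_Q.
Proof.
have E : (\int[leb]_x (`|\1_Q x| `^ p')%:E)%E = vol%:E.
  rewrite -Qvol; have := integral_indic leb measurableT mQ; rewrite setIT => <-.
  apply: eq_integral => x _; rewrite indicE; case: (_ \in _); rewrite ?normr1 ?powR1//.
  by rewrite normr0 powR0// gt_eqF.
have h : Lp leb p' \1_Q.
  by apply/(LpP _ _ p'0); rewrite E ltry; split=> //; exact: measurable_indic.
split=> //; have := nrm_powR p'0 h; rewrite E => -[e].
by rewrite e -powRrM -pp' addrK mulfV ?gt_eqF// powRr1// nrm_ge0.
Qed.

(** The homothety of ratio [s] centred at [x] maps the convex set [Q] into itself and changes the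
    [L^p] norm by at most the factor [s^(-N/p)]; the factor in [vol] is the dual norm of the
    indicator of [Q] in Hoelder's inequality. *)
Lemma morrey_affine_bound (h : V -> R) (x : V) (s : R) : Q x -> 0 < s <= 1 ->
  (forall y, 0 <= h y) -> Lp leb p h ->
  (\int[leb]_y (\1_Q y * h (x + s *: (y - x)))%:E <=
     (vol `^ (1 - p^-1) * (s `^ (- (N%:R / p)) * nrm leb p (fun y => \1_Q y * h y)))%:E)%E.
Proof.
move=> Qx /andP[s0 s1] h0 hp; have [mh _] := hp.
pose H y := \1_Q y * h y; pose T (y : V) := (x - s *: x) + s *: y.
have TE y : x + s *: (y - x) = T y by rewrite /T scalerBr addrCA addrC.
have mI : measurable_fun setT (\1_Q : V -> R) by exact: measurable_indic.
have mH : measurable_fun setT H by exact: measurable_funM.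
have H0 y : 0 <= H y by rewrite /H mulr_ge0.
have Hp : Lp leb p H.
  apply: (Lp_le pp0 mH _ hp).1 => y; rewrite /H normrM ler_piMl//.
  by rewrite indicE; case: (_ \in _); rewrite ?normr1 ?normr0.
have mT : measurable_fun setT T by exact: measurable_affine.
have mHT : measurable_fun setT (H \o T) by exact: measurableT_comp.
have HTp : (\int[leb]_y (`|(H \o T) y| `^ p)%:E)%E = ((s `^ (- (N%:R / p)) * nrm leb p H) `^ p)%:E.
  have mf : measurable_fun setT (fun y => (`|H y| `^ p)%:E) by exact: measurable_abs_powR.
  have f0 y : (0 <= (`|H y| `^ p)%:E)%E by rewrite lee_fin powR_ge0.
  rewrite (ge0_integral_affine (x - s *: x) s0 mf f0) (nrm_powR pp0 Hp) -EFinM.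
  rewrite powRM ?powR_ge0 ?nrm_ge0// -powRrM mulNr divfK ?gt_eqF//.
  by rewrite powR_invn// ltW.
have c0 : 0 <= s `^ (- (N%:R / p)) * nrm leb p H by rewrite mulr_ge0 ?powR_ge0 ?nrm_ge0.
have hle := lexx (((s `^ (- (N%:R / p)) * nrm leb p H) `^ p)%:E).
rewrite -{1}HTp in hle.
have [HTL HTn] := nrm_le_powR pp0 c0 mHT hle.
have [nQ LQ] := nrm_indic.
have [_] := nrm_hoelder p'0 pp0 pp' LQ HTL.
move=> h1; apply: le_trans (_ : (nrm leb p' \1_Q * nrm leb p (H \o T))%:E <= _)%E; last first.
  by rewrite lee_fin nQ ler_wpM2l// powR_ge0.
apply: le_trans h1; rewrite le_eqVlt; apply/orP; left; apply/eqP; apply: eq_integral => y _.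
rewrite /= /H ger0_norm ?mulr_ge0//; congr EFin.
rewrite indicE; case: (boolP (y \in Q)) => [yQ|_]; last by rewrite !mul0r.
rewrite !mul1r TE indicE mem_set ?mul1r// -TE; apply: Qconv => //; first by rewrite inE in yQ.
by rewrite ltW.
Qed.

Let path_exp (c : R) : 0 < c < 1 -> k%:R * c ^+ k.-1 * (c ^+ k) `^ (- (N%:R / p)) <= k%:R.
Proof.
move=> /andP[c0 c1]; rewrite -mulrA ler_piMr//.
rewrite -(powR_mulrn k.-1 (ltW c0)) -(powR_mulrn k (ltW c0)) -powRrM -powRD; last first.
  by rewrite (gt_eqF c0) implybT.
apply: le_trans (_ : c `^ 0 <= _); last by rewrite powRr0.
apply: ger_powR; first by rewrite c0 ltW.
have kE : k.-1%:R = k%:R - 1 :> R by rewrite -[in RHS](prednK k0) -natr1 addrK.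
rewrite kE; have pN0 : 0 < p - N%:R by rewrite subr_gt0.
have : p <= k%:R * (p - N%:R) by rewrite -ler_pdivrMr// ltW.
have -> : k%:R - 1 + k%:R * - (N%:R / p) = (k%:R * (p - N%:R) - p) / p by field; rewrite gt_eqF.
by move=> h; apply: divr_ge0; [rewrite subr_ge0|exact: ltW].
Qed.

(** The integral over [Q] of [phi (x + s^k (y - x))] equals [phi x * vol] at [s = 0] and the
    integral of [phi] at [s = 1]. The mean value theorem reduces the difference to a derivative at
    one [c], where [morrey_affine_bound] applies with ratio [c^k]. *)
Lemma morrey_avg (phi : V -> R) (x : V) : test_fun setT phi -> Q x ->
  `|\int[leb]_(y in Q) phi y - phi x * vol| <=
    k%:R * D * vol `^ (1 - p^-1) * nrm leb p (fun y => \1_Q y * enorm (grad phi y)).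
Proof.
move=> tp Qx; have sp := test_fun_smooth tp.
pose f (s : R) (y : V) := phi (x + s ^+ k *: (y - x)).
pose df (s : R) (y : V) := dotr (y - x) (grad phi (x + s ^+ k *: (y - x))) * (k%:R * s ^+ k.-1).
have Df s y : is_derive s (1 : R) (f ^~ y) (df s y) by exact: is_derive_path.
have pE s y : partial1of2 f s y = df s y by rewrite partial1of2E; case: (Df s y).
have [M M0 hM] := test_fun_bounded tp.
have [G G0 hG] := grad_bounded tp.
have mf s : measurable_fun setT (f s).
  apply: (@measurableT_comp _ _ _ _ _ _ phi); first exact: smooth_measurable.
  rewrite (_ : (fun _ => _) = (fun y => (x - s ^+ k *: x) + s ^+ k *: y)); last first.
    by apply/funext => y; rewrite scalerBr addrCA addrC.
  exact: measurable_affine.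
have bint (g : V -> R) (B : R) : measurable_fun setT g -> (forall y, Q y -> `|g y| <= B) ->
    leb.-integrable Q (EFin \o g).
  move=> mg gB; apply: (@le_integrable _ _ _ leb Q mQ _ (EFin \o cst B)).
  - by apply/measurable_EFinP; exact: measurable_funTS.
  - by move=> y Qy /=; rewrite lee_fin (le_trans (gB y Qy))// ler_norm.
  - exact: integrable_cst_lty.
pose A (s : R) := \int[leb]_(y in Q) f s y.
have If s : leb.-integrable Q (EFin \o f s) by apply: (bint _ M) => // y _; exact: hM.
(* A crude bound for [s] in the open interval from -1 to 2, which surrounds both end points of the
   unit interval; it serves only to differentiate under the integral sign. *)
pose B : R := D * G * (k%:R * 2 ^+ k.-1).
have B0 : 0 <= B by rewrite /B !mulr_ge0// ltW.
have dfB s y : `]-1, 2[%classic s -> Q y -> `|partial1of2 f s y| <= B.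
  rewrite /= in_itv /= => s12 Qy; rewrite pE /df normrM.
  apply: ler_pM => //.
    apply: le_trans (dotr_le _ _) _; apply: ler_pM; rewrite ?enorm_ge0//; exact: Qdiam.
  rewrite normrM ger0_norm// ler_wpM2l// normrX lerXn2r ?nnegrE// ler_norml; lra.
have IB : leb.-integrable Q (EFin \o cst B).
  by apply: (bint _ B) => // y _ /=; rewrite ger0_norm.
have Dint (s : R) : `]-1, 2[%classic s -> is_derive s (1 : R) A (\int[leb]_(y in Q) df s y).
  move=> s12.
  have der x0 y : `]-1, 2[%classic x0 -> Q y -> derivable (f ^~ y) x0 1.
    by move=> _ _; case: (Df x0 y).
  have := @cvg_differentiation_under_integral R _ V leb f Q mQ s (-1) 2 s12 (fun x _ => If x) der
     (cst B) (fun _ => B0) IB dfB.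
  rewrite (_ : \int[leb]_(y in Q) partial1of2 f s y = \int[leb]_(y in Q) df s y); last first.
    by apply: eq_Rintegral => y _; rewrite pE.
  move=> H; have E : (fun h : R => h^-1 *: (A (h *: 1 + s) - A s)) =
     (fun h => h^-1 *: (A (h + s) - A s)).
    by apply/funext => h; rewrite [h%:A]mulr1.
  by apply: DeriveDef; [apply/cvg_ex; eexists; rewrite /= E; exact: H|
    rewrite /derive /= E; apply/cvg_lim => //; exact: norm_hausdorff].
have cA : {within `[0, 1], continuous A}.
  apply: derivable_within_continuous => s; rewrite in_itv/= => s01.
  by case: (Dint s) => //; rewrite /= in_itv/=; lra.
pose dA (s : R) := \int[leb]_(y in Q) df s y.
have hA s : s \in `](0 : R), 1[ -> is_derive s (1 : R) A (dA s).
  by rewrite in_itv/= => s01; apply: Dint; rewrite /= in_itv/=; lra.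
have [c c01 E] := @MVT R A dA 0 1 ltr01 hA cA.
have A1 : A 1 = \int[leb]_(y in Q) phi y.
  by apply: eq_Rintegral => y _; rewrite /f expr1n scale1r addrC subrK.
have A0 : A 0 = phi x * vol.
  rewrite /A (_ : f 0 = cst (phi x)); last first.
    by apply/funext => y; rewrite /f expr0n gtn_eqF// scale0r addr0.
  by rewrite Rintegral_cst//; congr (_ * _); exact: (congr1 fine Qvol).
rewrite -A1 -A0 E subr0 mulr1.
have {c01} c01 : 0 < c < 1 by move: c01; rewrite in_itv.
have mdf : measurable_fun setT (df c).
  apply: measurable_funM => //; rewrite /dotr; apply: measurable_sum => i.
  apply: measurable_funM.
    under eq_fun do rewrite mxE; apply: measurable_funD; last exact: measurable_cst.
    exact: measurable_coord.
  apply: (@measurableT_comp _ _ _ _ _ _ (fun y => grad phi y 0 i)); first exact: vmeas_grad.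
  rewrite (_ : (fun _ => _) = (fun y => (x - c ^+ k *: x) + c ^+ k *: y)); last first.
    by apply/funext => y; rewrite scalerBr addrCA addrC.
  exact: measurable_affine.
have Idf : leb.-integrable Q (EFin \o df c).
  apply: (bint _ B) => // y Qy; have := dfB c y; rewrite pE; apply=> //.
  by rewrite /= in_itv/=; lra.
have pc := path_exp c01; have [c0 c1] := andP c01.
have ck : 0 < c ^+ k <= 1 by rewrite exprn_gt0// exprn_ile1// ltW.
pose h y := enorm (grad phi y).
have hL : Lp leb p h by case: (test_fun_vLp pp0 tp).
have mab := morrey_affine_bound Qx ck (fun y => enorm_ge0 _) hL.
have I0 : (0 <= \int[leb]_y (\1_Q y * h (x + c ^+ k *: (y - x)))%:E)%E.
  by apply: integral_ge0 => y _; rewrite lee_fin mulr_ge0 ?enorm_ge0.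
set n := nrm leb p _ in mab *; have n0 : 0 <= n by exact: nrm_ge0.
have kc0 : 0 <= D * (k%:R * c ^+ k.-1) by rewrite !mulr_ge0// exprn_ge0// ltW.
apply: le_trans (_ : D * (k%:R * c ^+ k.-1) * (vol `^ (1 - p^-1) *
   ((c ^+ k) `^ (- (N%:R / p)) * n)) <= _); last first.
  have v0 := powR_ge0 vol (1 - p^-1).
  rewrite (_ : _ * _ = D * (vol `^ (1 - p^-1) * n) * (k%:R * c ^+ k.-1 * (c ^+ k) `^ (- (N%:R / p)))); last ring.
  rewrite (_ : k%:R * D * _ * _ = D * (vol `^ (1 - p^-1) * n) * k%:R); last ring.
  by rewrite ler_wpM2l// !mulr_ge0.
rewrite -lee_fin [X in (_ <= X)%E]EFinM.
apply: (@le_trans _ _ ((D * (k%:R * c ^+ k.-1))%:E *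
   \int[leb]_y (\1_Q y * h (x + c ^+ k *: (y - x)))%:E)%E); last first.
  by rewrite lee_wpmul2l// lee_fin.
have mg : measurable_fun setT (fun y => \1_Q y * h (x + c ^+ k *: (y - x))).
  apply: measurable_funM; first exact: measurable_indic.
  apply: (@measurableT_comp _ _ _ _ _ _ h); first by case: hL.
  rewrite (_ : (fun _ => _) = (fun y => (x - c ^+ k *: x) + c ^+ k *: y)); last first.
    by apply/funext => y; rewrite scalerBr addrCA addrC.
  exact: measurable_affine.
rewrite -(ge0_integralZl_EFin leb measurableT _ _ kc0); last 2 first.
- by move=> y _; rewrite lee_fin mulr_ge0 ?enorm_ge0.
- exact/measurable_EFinP.
rewrite (EFin_normr_Rintegral mQ Idf).
apply: le_trans (le_abse_integral leb mQ (measurable_int _ Idf)) _.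
rewrite integral_mkcond; apply: ge0_le_integral => //.
- by move=> y _; apply: erestrict_ge0 => z _; exact: abse_ge0.
- apply/(measurable_restrictT _ mQ); apply: measurableT_comp => //.
  exact: (measurable_int _ Idf).
- by apply: emeasurable_funM => //; exact/measurable_EFinP.
move=> y _; rewrite patchE; case: ifPn => [|_]; last first.
  by rewrite -EFinM lee_fin mulr_ge0// mulr_ge0 ?enorm_ge0.
rewrite inE => Qy; rewrite -EFinM /= lee_fin indicE mem_set// mul1r /df normrM.
rewrite [leLHS]mulrC [X in _ <= X * _]mulrC -mulrA ger0_norm; last by rewrite mulr_ge0// exprn_ge0// ltW.
rewrite ler_wpM2l//; first by rewrite mulr_ge0// exprn_ge0// ltW.
apply: le_trans (dotr_le _ _) _; rewrite ler_wpM2r ?enorm_ge0//; exact: Qdiam.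
Qed.

Lemma morrey_osc (phi : V -> R) (x y : V) : test_fun setT phi -> Q x -> Q y ->
  `|phi x - phi y| <=
    2 * k%:R * D * vol `^ (- p^-1) * nrm leb p (fun y => \1_Q y * enorm (grad phi y)).
Proof.
move=> tp Qx Qy; have hx := morrey_avg tp Qx; have hy := morrey_avg tp Qy.
set I := \int[leb]_(y in Q) phi y in hx hy; set n := nrm leb p _ in hx hy *.
have vE : vol `^ (1 - p^-1) = vol * vol `^ (- p^-1).
  by rewrite powRD ?powRr1 ?ltW// (gt_eqF vol0) implybT.
rewrite vE in hx hy; rewrite -(ler_pM2r vol0) -{1}(gtr0_norm vol0) -normrM mulrBl.
have -> : phi x * vol - phi y * vol = (I - phi y * vol) - (I - phi x * vol) by ring.
apply: le_trans (ler_normB _ _) _.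
apply: le_trans (lerD hy hx) _; rewrite le_eqVlt; apply/orP; left; apply/eqP; ring.
Qed.

End morrey.

Section box_morrey.
Context {R : realType} {N : nat}.
Local Notation V := 'rV[R]_N.
Local Notation leb := (@lebesgue_rV R N).
Variables (p : R).
Hypotheses (p1 : 1 < p) (pN : N%:R < p).
Let pp0 : 0 < p. Proof. exact: lt_trans ltr01 p1. Qed.

(** The constant of [morrey_osc] for a box of sides [l], its diameter being bounded by the sum of
    the sides. *)
Definition box_const (l : V) : R :=
  2 * (Num.bound (p / (p - N%:R)))%:R * (\sum_i l 0 i) * (\prod_i l 0 i) `^ (- p^-1).

Lemma cbox_convex (c l x y : V) (s : R) : cbox c l x -> cbox c l y -> 0 <= s <= 1 ->
  cbox c l (x + s *: (y - x)).
Proof.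
move=> cx cy /andP[s0 s1] i; rewrite !mxE.
move: (cx i) (cy i); set a := c 0 i; set b := x 0 i; set d := y 0 i; set e := l 0 i.
move=> /andP[ab be] /andP[ad de].
have -> : b + s * (d - b) = b * (1 - s) + d * s by ring.
have A : 0 <= (1 - s) * (b - a) by rewrite mulr_ge0// subr_ge0.
have B : 0 <= s * (d - a) by rewrite mulr_ge0// subr_ge0.
have C : 0 < (1 - s) * (a + e - b) + s * (a + e - d).
  have [s00|s00] := leP s 0.
    have -> : s = 0 by apply/eqP; rewrite eq_le s0 s00.
    by rewrite subr0 mul1r mul0r addr0 subr_gt0.
  by rewrite ltr_wpDl// ?mulr_ge0 ?mulr_gt0 ?subr_ge0 ?subr_gt0// ltW.
lra.
Qed.

Lemma cbox_diam (c l x y : V) : cbox c l x -> cbox c l y -> enorm (y - x) <= \sum_i l 0 i.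
Proof.
move=> cx cy; apply: le_trans (enorm_le_sum _) _; apply: ler_sum => i _.
by rewrite !mxE ler_norml; move: (cx i) (cy i); lra.
Qed.

Lemma box_osc (c l : V) (phi : V -> R) (x y : V) : (forall i, 0 < l 0 i) ->
  test_fun setT phi -> cbox c l x -> cbox c l y ->
  `|phi x - phi y| <= box_const l * nrm leb p (fun y => \1_(cbox c l) y * enorm (grad phi y)).
Proof.
move=> l0 tp cx cy.
have v0 : 0 < \prod_i l 0 i by apply: prodr_gt0.
have D0 : 0 <= \sum_i l 0 i by apply: sumr_ge0 => i _; exact: ltW.
apply: (morrey_osc p1 pN (measurable_cbox c l) v0 _ D0) => //.
- by apply: lebesgue_cbox => i; exact: ltW.
- by move=> *; exact: cbox_convex.
- by move=> *; exact: cbox_diam.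
Qed.

Lemma nrm_indic_le (A : set V) (phi : V -> R) E : measurable A -> test_fun E phi ->
  nrm leb p (fun y => \1_A y * enorm (grad phi y)) <= vnrm p (grad phi).
Proof.
move=> mA tp; have [_ gL] := test_fun_vLp pp0 tp; have [mg _] := gL.
apply: (Lp_le pp0 _ _ gL).2 => [|x].
  by apply: measurable_funM; [exact: measurable_indic|exact: mg].
rewrite normrM ler_piMl//; rewrite indicE; case: (_ \in _); rewrite ?normr1 ?normr0//.
Qed.

Lemma box_const_ge0 (l : V) : (forall i, 0 < l 0 i) -> 0 <= box_const l.
Proof.
move=> l0; apply: mulr_ge0; last exact: powR_ge0.
by apply: mulr_ge0; [apply: mulr_ge0|apply: sumr_ge0 => i _; exact: ltW].
Qed.

(** For a cube of side [r] the constant is a multiple of [r^(1 - N/p)], which tends to 0 with [r];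
    this is the source of equicontinuity. *)
Lemma cube_const_small (e : R) : 0 < e ->
  exists2 r : R, 0 < r & box_const (\row__ r) <= e.
Proof.
move=> e0; pose K : R := 2 * (Num.bound (p / (p - N%:R)))%:R * N%:R + 1.
have K0 : 0 < K by rewrite /K ltr_wpDl// !mulr_ge0.
pose a : R := 1 - N%:R / p.
have a0 : 0 < a by rewrite /a subr_gt0 ltr_pdivrMr ?mul1r.
exists ((e / K) `^ a^-1); first by rewrite powR_gt0// divr_gt0.
set r := _ `^ _; have r0 : 0 < r by rewrite powR_gt0// divr_gt0.
have rE : r `^ a = e / K by rewrite /r -powRrM mulVf ?gt_eqF// powRr1// divr_ge0 ?ltW.
clearbody r.
rewrite /box_const.
have -> : \sum_i (\row__ r : V) 0 i = \sum_(i < N) r by apply: eq_bigr => i _; rewrite mxE.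
have -> : \prod_i (\row__ r : V) 0 i = \prod_(i < N) r by apply: eq_bigr => i _; rewrite mxE.
rewrite sumr_const prodr_const card_ord -[r *+ N]mulr_natl.
have -> : (r ^+ N) `^ (- p^-1) = r `^ (- (N%:R / p)) by rewrite -(powR_mulrn N (ltW r0)) -powRrM mulrN.
have rX : r * r `^ (- (N%:R / p)) = r `^ a.
  by rewrite -{1}(powRr1 (ltW r0)) -powRD// (gt_eqF r0) implybT.
rewrite (_ : _ * _ * (_ * r) * _ = 2 * (Num.bound (p / (p - N%:R)))%:R * N%:R * (r * r `^ (- (N%:R / p)))); last ring.
rewrite rX rE.
rewrite mulrA ler_pdivrMr// [e * K]mulrC ler_pM2r//.
by rewrite /K lerDl.
Qed.

Lemma cube_osc (phi : V -> R) (x y : V) (r : R) E : 0 < r -> test_fun E phi -> `|x - y| < r ->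
  `|phi x - phi y| <= box_const (\row__ r) * vnrm p (grad phi).
Proof.
move=> r0 tp xy.
have tT : test_fun setT phi by exact: test_funS tp.
pose c : V := \row_i Num.min (x 0 i) (y 0 i).
have rr i : 0 < (\row__ r : V) 0 i by rewrite mxE.
have h i : `|x 0 i - y 0 i| < r.
  by apply: le_lt_trans xy; have := ler_coord_norm (x - y) i; rewrite !mxE.
have cx : cbox c (\row__ r) x.
  by move=> i; move: (h i); rewrite !mxE ltr_norml; case: (leP (x 0 i) (y 0 i)); lra.
have cy : cbox c (\row__ r) y.
  by move=> i; move: (h i); rewrite !mxE ltr_norml; case: (leP (x 0 i) (y 0 i)); lra.
apply: le_trans (box_osc rr tT cx cy) _; apply: ler_wpM2l; first exact: box_const_ge0.
exact: nrm_indic_le (measurable_cbox _ _) tp.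
Qed.

Variables (t x0 : V).
Hypothesis t0 : forall i, 0 < t 0 i.

(** Lower corners of the tiles, at the lattice translates of [x0]. When [x0] is taken in [K], every
    corner lies in a hole. *)
Definition tile_corner (j : 'rV[int]_N) : V := dilation t (map_mx intr j + x0).

Lemma tile_cover (x : V) : exists j, cbox (tile_corner j) t x.
Proof.
exists (\row_i Num.floor (x 0 i / t 0 i - x0 0 i)) => i; rewrite !mxE.
set z := x 0 i / t 0 i - x0 0 i.
have xE : x 0 i = t 0 i * (z + x0 0 i) by rewrite /z; field; rewrite gt_eqF.
rewrite xE; set f := (Num.floor z)%:~R.
rewrite (_ : t 0 i * (f + x0 0 i) + t 0 i = t 0 i * (f + x0 0 i + 1)); last ring.
rewrite ler_pM2l// ltr_pM2l// /f.
have := floor_le z; have := floorD1_gt z; rewrite intrD; lra.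
Qed.

Lemma tile_uniq (x : V) j j' : cbox (tile_corner j) t x -> cbox (tile_corner j') t x -> j = j'.
Proof.
have H (k k' : 'rV[int]_N) i : cbox (tile_corner k) t x -> cbox (tile_corner k') t x -> k 0 i <= k' 0 i.
  move=> /(_ i) + /(_ i); rewrite !mxE => /andP[h1 _] /andP[_ h2].
  rewrite -ltzD1 -(ltr_int R) intrD.
  have : t 0 i * ((k 0 i)%:~R + x0 0 i) < t 0 i * ((k' 0 i)%:~R + x0 0 i) + t 0 i.
    exact: le_lt_trans h1 h2.
  rewrite (_ : _ + t 0 i = t 0 i * ((k' 0 i)%:~R + x0 0 i + 1)); last ring.
  by rewrite ltr_pM2l//; lra.
by move=> h h'; apply/rowP => i; apply/eqP; rewrite eq_le !H.
Qed.

Section vanishing.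
Variables (E : set V) (phi : V -> R).
Hypotheses (tp : test_fun E phi) (phi0 : forall j, phi (tile_corner j) = 0).

Let Bt := box_const t.
Let Bt0 : 0 <= Bt. Proof. exact: box_const_ge0. Qed.

Lemma tile_sup j x : cbox (tile_corner j) t x ->
  `|phi x| <= Bt * nrm leb p (fun y => \1_(cbox (tile_corner j) t) y * enorm (grad phi y)).
Proof.
move=> jx; have tT : test_fun setT phi by exact: test_funS tp.
have jc : cbox (tile_corner j) t (tile_corner j) by move=> i; rewrite lexx ltrDl t0.
by have := box_osc t0 tT jx jc; rewrite phi0 subr0.
Qed.

Lemma poincare_sup x : `|phi x| <= Bt * vnrm p (grad phi).
Proof.
have [j jx] := tile_cover x; apply: le_trans (tile_sup jx) _.
apply: ler_wpM2l; first exact: Bt0.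
exact: nrm_indic_le (measurable_cbox _ _) tp.
Qed.

Lemma tile_Lp j : (\int[leb]_(x in cbox (tile_corner j) t) (`|phi x| `^ p)%:E <=
  ((\prod_i t 0 i) * Bt `^ p)%:E * \int[leb]_(x in cbox (tile_corner j) t) (enorm (grad phi x) `^ p)%:E)%E.
Proof.
set P := cbox _ _; have mP : measurable P by exact: measurable_cbox.
pose n := nrm leb p (fun y => \1_P y * enorm (grad phi y)).
have gL := (test_fun_vLp pp0 tp).2.
have mge := gL.1.
have I1 : (\int[leb]_(x in P) (enorm (grad phi x) `^ p)%:E = (n `^ p)%:E)%E.
  have fL : Lp leb p (fun y => \1_P y * enorm (grad phi y)).
    apply: (Lp_le pp0 _ _ gL).1 => [|x].
      by apply: measurable_funM; [exact: measurable_indic|exact: mge].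
    by rewrite normrM ler_piMl//; rewrite indicE; case: (_ \in _); rewrite ?normr1 ?normr0.
  rewrite /n -(nrm_powR pp0 fL) [LHS]integral_mkcond; apply: eq_integral => x _.
  rewrite patchE indicE; case: ifPn => _; last by rewrite mul0r normr0 powR0// gt_eqF.
  by rewrite mul1r (ger0_norm (enorm_ge0 _)).
rewrite I1 -EFinM -mulrA -powRM ?nrm_ge0//.
have mphi : measurable_fun setT (fun x => (`|phi x| `^ p)%:E).
  by apply: measurable_abs_powR; apply: smooth_measurable; exact: test_fun_smooth tp.
apply: (@le_trans _ _ (\int[leb]_(x in P) (cst ((Bt * n) `^ p)%:E x))%E).
  apply: ge0_le_integral => //.
  - exact: measurable_funTS.
  - by move=> x Px; rewrite lee_fin; apply: powR_le; [exact: ltW|exact: normr_ge0|exact: (tile_sup Px)].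
rewrite integral_cst// [X in (_ * X)%E](_ : _ = (\prod_i t 0 i)%:E); last first.
  by apply: lebesgue_cbox => i; exact: ltW.
by rewrite -EFinM mulrC.
Qed.

(** On each tile the oscillation bound from its corner, multiplied by the volume, compares the
    integrals of [|phi|^p] and [|grad phi|^p] with a constant independent of the tile; summing over
    the tiling preserves that constant. *)
Lemma poincare_Lp : Lp leb p phi /\
  nrm leb p phi <= (\prod_i t 0 i) `^ p^-1 * Bt * vnrm p (grad phi).
Proof.
have v0 : 0 <= \prod_i t 0 i by apply: prodr_ge0 => i _; exact: ltW.
have sp := test_fun_smooth tp.
have gL := test_fun_vLp pp0 tp.
have mphi : measurable_fun setT (fun x => (`|phi x| `^ p)%:E).
  by apply: measurable_abs_powR; exact: smooth_measurable.
have mgr : measurable_fun setT (fun x => (enorm (grad phi x) `^ p)%:E).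
  by apply: measurable_enorm_powR; exact: vmeas_grad.
have c0 : 0 <= (\prod_i t 0 i) `^ p^-1 * Bt by apply: mulr_ge0; [exact: powR_ge0|exact: Bt0].
apply: (nrm_le_powR pp0); [by apply: mulr_ge0 => //; exact: vnrm_ge0|exact: smooth_measurable|].
(* The tiles are enumerated through the codes of integer vectors, numbers that code no vector giving
   the empty set. *)
pose F (n : nat) : set V := if @pickle_inv 'rV[int]_N n is Some j then cbox (tile_corner j) t else set0.
have mF n : measurable (F n).
  by rewrite /F; case: pickle_inv => [j|]; [exact: measurable_cbox|exact: measurable0].
have FT : \bigcup_n F n = setT.
  apply/seteqP; split=> // x _; have [j jx] := tile_cover x.
  by exists (pickle j) => //; rewrite /F pickleK_inv.
have triv : trivIset setT F.
  apply/trivIsetP => m n _ _; apply: contraTeq => /set0P[x []].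
  have := @pickle_invK 'rV[int]_N n; have := @pickle_invK 'rV[int]_N m.
  rewrite /F; case: (pickle_inv m) => [j|//] /= jm; case: (pickle_inv n) => [j'|//] /= jn jx j'x.
  by rewrite negbK -jm -jn (tile_uniq jx j'x).
have c1 : 0 <= (\prod_i t 0 i) * Bt `^ p by apply: mulr_ge0 => //; exact: powR_ge0.
have -> : (((\prod_i t 0 i) `^ p^-1 * Bt * vnrm p (grad phi)) `^ p)%:E =
   (((\prod_i t 0 i) * Bt `^ p)%:E * \int[leb]_x (enorm (grad phi x) `^ p)%:E)%E.
  rewrite (vnrm_powR pp0 gL) -EFinM powRM ?vnrm_ge0// powRM ?powR_ge0//.
  by rewrite -powRrM mulVf ?gt_eqF// powRr1.
have sumE (f : V -> \bar R) : measurable_fun setT f -> (forall x, 0 <= f x)%E ->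
    (\int[leb]_x f x = \sum_(i <oo) \int[leb]_(x in F i) f x)%E.
  by move=> mf f0; rewrite -[X in integral _ X _]FT ge0_integral_bigcup// FT.
rewrite (sumE _ mphi) => [|x]; last by rewrite lee_fin powR_ge0.
rewrite (sumE _ mgr) => [|x]; last by rewrite lee_fin powR_ge0.
rewrite -nneseriesZl//; last by move=> n _; apply: integral_ge0 => x _; rewrite lee_fin powR_ge0.
apply: lee_nneseries => [n _ _|n _].
  by apply: integral_ge0 => x _; rewrite lee_fin powR_ge0.
rewrite /F; case: pickle_inv => [j|]; first exact: tile_Lp.
by rewrite !integral_set0 mule0.
Qed.

End vanishing.

End box_morrey.

(** * Sequences and completeness of [L^p] *)

Lemma seq_cvgP (R : realType) (u : nat -> R) (l : R) : u @ \oo --> l <->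
  forall e : R, 0 < e -> exists n0, forall n, (n0 <= n)%N -> `|u n - l| < e.
Proof.
split=> [/cvgrPdist_lt H e /H[n0 _ h]|H].
  by exists n0 => n /h; rewrite distrC.
apply/cvgrPdist_lt => e /H[n0 h]; exists n0 => // n /h.
by rewrite distrC.
Qed.

Lemma seq_cvg_ge (R : realType) (u : nat -> R) (l c : R) n0 : u @ \oo --> l ->
  (forall n, (n0 <= n)%N -> c <= u n) -> c <= l.
Proof.
move=> /seq_cvgP ul uc; apply/ler_addgt0Pr => e /ul[n1 h].
have := h _ (leq_maxr n0 n1); have := uc _ (leq_maxl n0 n1).
by rewrite ltr_norml; lra.
Qed.

Lemma seq_cvg_le (R : realType) (u : nat -> R) (l c : R) n0 : u @ \oo --> l ->
  (forall n, (n0 <= n)%N -> u n <= c) -> l <= c.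
Proof.
move=> /seq_cvgP ul uc; apply/ler_addgt0Pr => e /ul[n1 h].
have := h _ (leq_maxr n0 n1); have := uc _ (leq_maxl n0 n1).
by rewrite ltr_norml; lra.
Qed.

Lemma cvg_powR (R : realType) (u : nat -> R) (l q : R) : 0 < q -> (forall n, 0 <= u n) ->
  u @ \oo --> l -> u n `^ q @[n --> \oo] --> l `^ q.
Proof.
move=> q0 u0 ul; have l0 : 0 <= l by exact: (seq_cvg_ge (n0 := 0%N) ul (fun n _ => u0 n)).
have [lE|lN0] := eqVneq l 0.
  rewrite lE powR0 ?gt_eqF//; apply/seq_cvgP => e e0; rewrite lE in ul.
  have /seq_cvgP /(_ (e `^ q^-1) (powR_gt0 _ e0)) [n0 h] := ul; exists n0 => n /h.
  rewrite !subr0 !ger0_norm ?powR_ge0// => /(gt0_ltr_powR q0).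
  by rewrite !nnegrE u0 powR_ge0 -powRrM mulVf ?gt_eqF// powRr1 ?ltW//; exact.
have lp : 0 < l by rewrite lt_neqAle eq_sym lN0.
apply: (@cvg_comp _ _ _ u (fun y : R => y `^ q) _ (nbhs l)) => //.
have c : {for l, continuous (fun y : R => y `^ q)}.
  apply: differentiable_continuous; apply/derivable1_diffP.
  by case: (is_derive1_powR q lp).
exact: c.
Qed.

Section Lp_complete.
Context d (T : measurableType d) (R : realType).
Variable mu : {measure set T -> \bar R}.
Implicit Types (f g : T -> R) (q : R).

Lemma nrm_fatou q (f : nat -> T -> R) g (c : R) (J : nat) : 0 < q -> 0 <= c ->
  (forall n, Lp mu q (f n)) -> measurable_fun setT g ->
  {ae mu, forall x, f n x @[n --> \oo] --> g x} ->
  (forall n, (J <= n)%N -> nrm mu q (f n) <= c) ->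
  Lp mu q g /\ nrm mu q g <= c.
Proof.
move=> q0 c0 fq mg fg fc; apply: nrm_le_powR => //.
pose F n x := (`|f (n + J)%N x| `^ q)%:E.
have mF n : measurable_fun setT (F n) by apply: measurable_abs_powR; case: (fq (n + J)%N).
have F0 n x : (0 <= F n x)%E by rewrite lee_fin powR_ge0.
apply: (@le_trans _ _ (\int[mu]_x limn_einf (F ^~ x))%E).
  apply: ae_ge0_le_integral => //.
  - exact: measurable_abs_powR.
  - move=> x _; rewrite limn_einf_lim; apply: lime_ge; first exact: is_cvg_einfs.
    by apply: nearW => n; apply: le_ereal_inf_tmp => _ [k _ <-].
  - rewrite (_ : (fun _ => _) = (fun x => (- limn_esup (fun n => - F n x))%E)).
      apply: measurableT_comp => //; apply: measurable_fun_limn_esup => n.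
      exact: measurableT_comp.
    by apply/funext => x; rewrite (limn_esupN (F ^~ x)) oppeK.
  apply: filterS fg => x fgx _.
  suff : F ^~ x @ \oo --> (`|g x| `^ q)%:E by move=> /cvg_limn_einf_sup[-> _].
  apply: cvg_EFin; first exact: nearW.
  have := fgx; rewrite -(cvg_shiftn J) => h.
  by apply: cvg_powR => //; exact: cvg_norm h.
apply: le_trans (fatou mu measurableT mF (fun n x _ => F0 n x)) _.
rewrite limn_einf_lim; apply: lime_le; first exact: is_cvg_einfs.
apply: nearW => n; apply: (@le_trans _ _ (\int[mu]_x F n x)%E).
  by apply: ereal_inf_lbound; exists n => //=.
rewrite (nrm_powR q0 (fq _)) lee_fin; apply: powR_le; [exact: ltW|exact: nrm_ge0|].
by apply: fc; rewrite leq_addl.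
Qed.

(** Riesz-Fischer: along a subsequence with increments of norm at most [2^-k] the sum of absolute
    increments has finite norm, by Fatou, hence is finite almost everywhere; the subsequence then
    converges there, and Fatou again gives convergence in norm. *)
Lemma Lp_complete q (f : nat -> T -> R) : 1 <= q -> (forall n, Lp mu q (f n)) ->
  (forall e : R, 0 < e -> exists n0, forall m n, (n0 <= m)%N -> (n0 <= n)%N ->
     nrm mu q (f m \- f n) < e) ->
  exists2 g, Lp mu q g & forall e : R, 0 < e -> exists n0, forall n, (n0 <= n)%N ->
     nrm mu q (f n \- g) <= e.
Proof.
move=> q1 fq fC; have q0 : 0 < q by exact: lt_le_trans q1.
have /choice[M hM] : forall k, exists n0, forall m n, (n0 <= m)%N -> (n0 <= n)%N ->
     nrm mu q (f m \- f n) < 2^-1 ^+ k by move=> k; apply: fC; rewrite exprn_gt0.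
pose s k := (\sum_(j < k.+1) M j)%N.
have sM k : (M k <= s k)%N by rewrite /s big_ord_recr /= leq_addl.
have s_homo : {homo s : m n / (m <= n)%N}.
  by apply: homo_leq => [//|? ? ?|n]; [exact: leq_trans|rewrite {2}/s big_ord_recr leq_addr].
pose h k := f (s k).
have hq k : Lp mu q (h k) by exact: fq.
have hd k : nrm mu q (h k.+1 \- h k) <= 2^-1 ^+ k.
  by apply/ltW/hM; rewrite // (leq_trans (sM k))// s_homo.
pose S K x : R := \sum_(k < K) `|h k.+1 x - h k x|.
(* The bound is the value of the geometric sum of [2^-k] over [k < K]. *)
have SL K : Lp mu q (S K) /\ nrm mu q (S K) <= 2 - 2 * 2^-1 ^+ K.
  elim: K => [|K [IH1 IH2]].
    have -> : S 0%N = (fun x => 0 * h 0%N x) by apply/funext => x; rewrite /S big_ord0 mul0r.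
    by have [? ->] := LpZ 0 q0 (hq 0%N); rewrite normr0 mul0r expr0 mulr1 subrr.
  have dL := (LpB q1 (hq K.+1) (hq K)).1.
  have [aL an] : Lp mu q (fun x => `|h K.+1 x - h K x|) /\
      nrm mu q (fun x => `|h K.+1 x - h K x|) <= nrm mu q (h K.+1 \- h K).
    apply: (Lp_le q0 _ _ dL); last by move=> x; rewrite normr_id.
    by apply: measurableT_comp => //; case: dL.
  have [sL sn] := LpD q1 IH1 aL.
  have -> : S K.+1 = S K \+ (fun x => `|h K.+1 x - h K x|).
    by apply/funext => x; rewrite /S big_ord_recr.
  split=> //; apply: le_trans sn _; have := le_trans an (hd K); rewrite exprS; lra.
have S0 K x : 0 <= S K x by apply: sumr_ge0.
have S_homo x : {homo S ^~ x : m n / (m <= n)%N >-> m <= n}.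
  by apply: homo_leq => [//|? ? ?|n]; [exact: le_trans|rewrite /S big_ord_recr lerDl].
pose F K x := (`|S K x| `^ q)%:E.
have mF n : measurable_fun setT (F n) by apply: measurable_abs_powR; case: (SL n) => -[].
have F0 n x : (0 <= F n x)%E by rewrite lee_fin powR_ge0.
have F_homo x m n : (m <= n)%N -> (F m x <= F n x)%E.
  move=> mn; rewrite lee_fin; apply: powR_le; [exact: ltW|exact: normr_ge0|].
  by rewrite !ger0_norm//; exact: S_homo.
have mlF : measurable_fun setT (fun x => limn_einf (F ^~ x)).
  rewrite (_ : (fun _ => _) = (fun x => (- limn_esup (fun n => - F n x))%E)).
    apply: measurableT_comp => //; apply: measurable_fun_limn_esup => n.
    exact: measurableT_comp.
  by apply/funext => x; rewrite (limn_esupN (F ^~ x)) oppeK.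
have lF0 x : (0 <= limn_einf (F ^~ x))%E.
  rewrite limn_einf_lim; apply: lime_ge; first exact: is_cvg_einfs.
  by apply: nearW => n; apply: le_ereal_inf_tmp => _ [k _ <-].
have intF : mu.-integrable setT (fun x => limn_einf (F ^~ x)).
  apply/integrableP; split=> //; apply: (@le_lt_trans _ _ (2 `^ q)%:E); last exact: ltry.
  rewrite (eq_integral (fun x => limn_einf (F ^~ x))); last by move=> x _; rewrite gee0_abs.
  apply: le_trans (fatou mu measurableT mF (fun n x _ => F0 n x)) _.
  rewrite limn_einf_lim; apply: lime_le; first exact: is_cvg_einfs.
  apply: nearW => n; apply: (@le_trans _ _ (\int[mu]_x F n x)%E).
    by apply: ereal_inf_lbound; exists n => //=.
  rewrite (nrm_powR q0 (SL n).1) lee_fin; apply: powR_le; [exact: ltW|exact: nrm_ge0|].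
  by apply: le_trans (SL n).2 _; rewrite gerBl mulr_ge0// exprn_ge0.
have h_cvg : {ae mu, forall x, cvgn (h ^~ x)}.
  have := integrable_ae measurableT intF; apply: filterS => x /(_ I).
  rewrite is_cvg_limn_einfE; last first.
    by apply: ereal_nondecreasing_is_cvgn => m n; exact: F_homo.
  set l := limn _ => lfin.
  have Sb K : S K x <= (fine l) `^ q^-1.
    have : (F K x <= l)%E.
      have := ereal_nondecreasing_cvgn (F_homo x) => /cvg_lim; rewrite -/l => -> //.
      by apply: ereal_sup_ubound; exists K.
    rewrite -[l]fineK// lee_fin => H.
    have := powR_le (ltW (ltac:(by rewrite invr_gt0) : 0 < q^-1)) (powR_ge0 _ _) H.
    by rewrite -powRrM divff ?gt_eqF// powRr1// ger0_norm.
  have : cvgn (series (telescope (h ^~ x))).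
    apply: normed_cvg; apply: nondecreasing_is_cvgn.
      by apply: nondecreasing_series => k _ _; exact: normr_ge0.
    exists (fine l `^ q^-1) => _ [K _ <-]; rewrite /= seriesEnat /= big_mkord.
    exact: Sb.
  rewrite telescopeK => H.
  have -> : h ^~ x = (fun n => (h n x - h 0%N x) + h 0%N x).
    by apply/funext => n; rewrite subrK.
  by apply: is_cvgD => //; exact: is_cvg_cst.
(* An upper limit is measurable on the whole space and equals the limit wherever the latter
   exists. *)
pose g x := fine (limn_esup (fun k => (h k x)%:E)).
have mg : measurable_fun setT g.
  apply: (@measurableT_comp _ _ _ _ _ _ fine); first exact: fine_measurable.
  by apply: measurable_fun_limn_esup => n; apply/measurable_EFinP; case: (hq n).
have h_g : {ae mu, forall x, h n x @[n --> \oo] --> g x}.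
  apply: filterS h_cvg => x /cvg_ex[l hl].
  suff -> : g x = l by [].
  suff : (fun k => (h k x)%:E) @ \oo --> l%:E by rewrite /g => /cvg_limn_einf_sup[_ ->].
  by apply: cvg_EFin => //; exact: nearW.
have key n k : (M k <= n)%N -> Lp mu q (f n \- g) /\ nrm mu q (f n \- g) <= 2^-1 ^+ k.
  move=> kn; apply: (@nrm_fatou q (fun j => f n \- h j) (f n \- g) _ k q0).
  - by rewrite exprn_ge0.
  - by move=> j; exact: (LpB q1 (fq n) (hq j)).1.
  - by apply: measurable_funB => //; case: (fq n).
  - by apply: filterS h_g => x hx; apply: cvgB => //; exact: cvg_cst.
  - by move=> j kj; apply/ltW/hM => //; rewrite (leq_trans (sM k))// s_homo.
exists g.
  have [L _] := key (M 0%N) 0%N (leqnn _).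
  have := (LpB q1 (fq (M 0%N)) L).1; congr (Lp mu q _).
  by apply/funext => x /=; rewrite opprB addrC subrK.
move=> e e0; have /seq_cvgP /(_ e e0)[k hk] : (2^-1 : R) ^+ n @[n --> \oo] --> (0 : R).
  by apply: cvg_expr; rewrite ger0_norm//; lra.
exists (M k) => n /key[_]; move/le_trans; apply.
by have := hk k (leqnn k); rewrite subr0 ger0_norm ?exprn_ge0// => /ltW.
Qed.

End Lp_complete.

Section vector_Lp_more.
Context {R : realType} {N : nat}.
Local Notation V := 'rV[R]_N.
Local Notation leb := (@lebesgue_rV R N).
Implicit Types (g h : V -> V).

Lemma nrm0 (q : R) : 0 < q -> Lp leb q (cst 0) /\ nrm leb q (cst 0) = 0.
Proof.
move=> q0; rewrite /Lp /nrm; have -> : EFin \o cst 0 = cst 0%E :> (V -> \bar R) by [].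
have qn0 : q%:E != 0%E by rewrite eqe gt_eqF.
rewrite (@Lnorm0 _ _ _ leb q%:E qn0).
by split=> //; split=> //; exact: measurable_cst.
Qed.

Lemma vLp_coords (q : R) h : 1 <= q -> (forall i, Lp leb q (fun x => h x 0 i)) ->
  vLp q h /\ vnrm q h <= \sum_i nrm leb q (fun x => h x 0 i).
Proof.
move=> q1 hL; have q0 : 0 < q by exact: lt_le_trans q1.
have aL i : Lp leb q (fun x => `|h x 0 i|) /\ nrm leb q (fun x => `|h x 0 i|) <= nrm leb q (fun x => h x 0 i).
  apply: (Lp_le q0 _ _ (hL i)); last by move=> x; rewrite normr_id.
  by apply: measurableT_comp => //; case: (hL i).
have [sL sn] : Lp leb q (fun x => \sum_i `|h x 0 i|) /\
    nrm leb q (fun x => \sum_i `|h x 0 i|) <= \sum_i nrm leb q (fun x => h x 0 i).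
  elim: (index_enum 'I_N) => [|i s [IH1 IH2]].
    have -> : (fun x => \sum_(i <- [::]) `|h x 0 i|) = cst 0 by apply/funext => x; rewrite big_nil.
    by have [? ->] := nrm0 q0; rewrite big_nil.
  have -> : (fun x => \sum_(i <- i :: s) `|h x 0 i|) = (fun x => `|h x 0 i|) \+ (fun x => \sum_(i <- s) `|h x 0 i|).
    by apply/funext => x; rewrite big_cons.
  have [L n] := LpD q1 (aL i).1 IH1; split; first exact: L.
  by rewrite big_cons; apply: le_trans n _; apply: lerD; [exact: (aL i).2|exact: IH2].
have vm : vmeas h by move=> i; case: (hL i).
have [L n] := Lp_le q0 (measurable_enorm vm) (fun x =>
  ltac:(rewrite ger0_norm ?enorm_ge0// ger0_norm ?sumr_ge0//; exact: enorm_le_sum) :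
    `|enorm (h x)| <= `|\sum_i `|h x 0 i| |) sL.
by split; [split|exact: le_trans n sn].
Qed.

Lemma Lp_coord (q : R) h i : 0 < q -> vLp q h ->
  Lp leb q (fun x => h x 0 i) /\ nrm leb q (fun x => h x 0 i) <= vnrm q h.
Proof.
move=> q0 [mh hL]; apply: (Lp_le q0 (mh i) _ hL) => x.
by rewrite (ger0_norm (enorm_ge0 _)); exact: coord_le_enorm.
Qed.

Lemma vnrm_le_pointwise (q : R) g h : 0 < q -> vmeas g -> vLp q h ->
  (forall x, enorm (g x) <= enorm (h x)) -> vLp q g /\ vnrm q g <= vnrm q h.
Proof.
move=> q0 mg [_ hL] gh.
have [] := Lp_le q0 (measurable_enorm mg) _ hL; last by move=> L n; split.
by move=> x; rewrite !(ger0_norm (enorm_ge0 _)); exact: gh.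
Qed.

Lemma vnrm_triangle (q : R) f g h : 1 <= q -> vLp q f -> vLp q g -> vLp q h ->
  vnrm q (fun x => f x - h x) <= vnrm q (fun x => f x - g x) + vnrm q (fun x => g x - h x).
Proof.
move=> q1 fL gL hL; have [_] := vLpD q1 (vLpB q1 fL gL).1 (vLpB q1 gL hL).1.
by under eq_fun do rewrite addrA subrK.
Qed.

Lemma vnrm_lerB (q : R) f g : 1 <= q -> vLp q f -> vLp q g ->
  `|vnrm q f - vnrm q g| <= vnrm q (fun x => f x - g x).
Proof.
move=> q1 fL gL; have [_ A] := vLpD q1 (vLpB q1 fL gL).1 gL.
have [_ B] := vLpD q1 (vLpB q1 gL fL).1 fL.
move: A B; under eq_fun do rewrite subrK; under [X in _ -> vnrm _ X <= _ -> _]eq_fun do rewrite subrK.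
by rewrite [vnrm q (fun x => g x - f x)]vnrmBC ler_norml; lra.
Qed.

Local Opaque lebesgue_rV.

Lemma nrm_shift q (f : V -> R) a : measurable_fun setT f ->
  nrm leb q (fun x => f (a + x)) = nrm leb q f.
Proof.
move=> mf; rewrite /nrm !LnormE_int; congr (fine (_ `^ _)%E).
exact: (ge0_integral_shift a (f := fun x => (`|f x| `^ q)%:E) (measurable_abs_powR q mf)
  (fun x => powR_ge0 _ _ : (0 <= (`|f x| `^ q)%:E)%E)).
Qed.

End vector_Lp_more.

Lemma cauchy_seq_cvg (R : realType) (u : nat -> R) :
  (forall e : R, 0 < e -> exists n0, forall m n, (n0 <= m)%N -> (n0 <= n)%N -> `|u m - u n| < e) ->
  cvgn u.
Proof.
move=> h; apply: cauchy_cvg; apply: cauchy_exP => e e0; have [n0 hn0] := h e e0.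
by exists (u n0), n0 => // n /= hn; exact: hn0.
Qed.

Local Opaque nrm vnrm.

(** * Limits of test functions in energy *)

Section W0.
Context {R : realType} {N : nat}.
Local Notation V := 'rV[R]_N.
Local Notation leb := (@lebesgue_rV R N).

(* The three functional inequalities of [W_0^{1,p}(Om)], [p > N]:
   sup bound, Poincare inequality, uniform equicontinuity. *)
Definition admissible (Om : set V) (p C : R) : Prop :=
  [/\ open Om, 2 <= p, 0 < C,
     (forall phi, test_fun Om phi ->
        (forall x, `|phi x| <= C * vnrm p (grad phi)) /\
        nrm leb p phi <= C * vnrm p (grad phi)) &
     forall e : R, 0 < e -> exists2 r : R, 0 < r & forall phi (x y : V), test_fun Om phi ->
        `|x - y| < r -> `|phi x - phi y| <= e * vnrm p (grad phi)].

(* [u] is the continuous representative of an element of [W_0^{1,p}(Om)],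
   extended by 0, and [g] is its gradient. *)
Definition W0 (Om : set V) (p : R) (u : V -> R) (g : V -> V) : Prop :=
  [/\ vLp p g, (forall x, ~ Om x -> g x = 0) &
     exists phi : nat -> V -> R, [/\ forall n, test_fun Om (phi n),
       forall e : R, 0 < e -> exists n0, forall n, (n0 <= n)%N ->
          vnrm p (fun x => grad (phi n) x - g x) <= e &
       forall x, phi n x @[n --> \oo] --> u x]].

Variables (Om : set V) (p C : R).
Hypothesis adm : admissible Om p C.

Let oOm : open Om. Proof. by case: adm. Qed.
Let p2 : 2 <= p. Proof. by case: adm. Qed.
Let p1 : 1 <= p. Proof. exact: le_trans (ler1n _ 2) p2. Qed.
Let pp0 : 0 < p. Proof. exact: lt_le_trans p1. Qed.
Let C0 : 0 < C. Proof. by case: adm. Qed.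
Let Csup phi x : test_fun Om phi -> `|phi x| <= C * vnrm p (grad phi).
Proof. by move=> tp; case: adm => _ _ _ /(_ phi tp)[h _] _; exact: h. Qed.
Let CLp phi : test_fun Om phi -> nrm leb p phi <= C * vnrm p (grad phi).
Proof. by move=> tp; case: adm => _ _ _ /(_ phi tp)[_ h] _; exact: h. Qed.

Let gB phi psi : test_fun Om phi -> test_fun Om psi ->
  vnrm p (grad (phi \- psi)) = vnrm p (fun x => grad phi x - grad psi x).
Proof. by move=> tp tq; rewrite gradB//; [exact: test_fun_smooth tp|exact: test_fun_smooth tq]. Qed.

Let gL phi : test_fun Om phi -> vLp p (grad phi).
Proof. exact: test_fun_vLp. Qed.

(** The functional inequalities hold for the differences [phi m - phi n]. Letting [n] go to
    infinity, pointwise for the sup bound and by Fatou for the [L^p] bound, turns closeness of the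
    gradients into all the other estimates. *)
Lemma W0_approx u g (e : R) : W0 Om p u g -> 0 < e -> exists phi, [/\ test_fun Om phi,
  vnrm p (fun x => grad phi x - g x) <= e, (forall x, `|phi x - u x| <= C * e),
  Lp leb p (phi \- u) & nrm leb p (phi \- u) <= C * e].
Proof.
move=> [gp _ [phi [tphi phig phiu]]] e0; have e2 : 0 < e / 2 by rewrite divr_gt0.
have [n0 hn0] := phig _ e2.
have gnm m n : (n0 <= m)%N -> (n0 <= n)%N -> vnrm p (grad (phi m \- phi n)) <= e.
  move=> hm hn; rewrite gB//; apply: le_trans (vnrm_triangle p1 (gL (tphi m)) gp (gL (tphi n))) _.
  rewrite [X in _ + X]vnrmBC; have := hn0 _ hm; have := hn0 _ hn.
  move: (vnrm p _) (vnrm p _) => a b; lra.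
have tB m n : test_fun Om (phi m \- phi n) by exact: test_funB.
have mu' : measurable_fun setT (phi n0 \- u).
  have cu : continuous u.
    move=> x; apply/continuous_at_normP => d d0; have d3 : 0 < d / 3 by rewrite divr_gt0.
    have eC : 0 < d / 3 / C by rewrite divr_gt0.
    have [n1 hn1] := phig _ (divr_gt0 eC (ltr0n _ 2)).
    have ub y n : (n1 <= n)%N -> `|phi n y - u y| <= d / 3.
      move=> hn; apply: (@seq_cvg_le _ (fun k => `|phi n y - phi k y|) _ _ n1).
        by apply: cvg_norm; apply: cvgB; [exact: cvg_cst|exact: phiu].
      move=> k hk; apply: le_trans (Csup y (tB n k)) _; rewrite gB//.
      have := vnrm_triangle p1 (gL (tphi n)) gp (gL (tphi k)).
      have := hn1 _ hn; have := hn1 _ hk; rewrite [vnrm p (fun x => g x - _)]vnrmBC.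
      move: (vnrm p _) (vnrm p _) (vnrm p _) => a b c h1 h2 h3.
      by rewrite mulrC -ler_pdivlMr//; lra.
    have /continuous_at_normP /(_ _ d3)[r r0 hr] := @smooth_cont _ _ _ (test_fun_smooth (tphi n1)) x.
    exists r => // y /hr; have := ub x n1 (leqnn _); have := ub y n1 (leqnn _).
    rewrite !ler_norml !ltr_norml; lra.
  apply: measurable_funB; last exact: continuous_measurable_rV.
  by apply: smooth_measurable; exact: test_fun_smooth (tphi n0).
have c0 : 0 <= C * e by apply: mulr_ge0; exact: ltW.
have [L n] : Lp leb p (phi n0 \- u) /\ nrm leb p (phi n0 \- u) <= C * e.
  apply: (@nrm_fatou _ _ _ _ p (fun n => phi n0 \- phi n) _ (C * e) n0 pp0 c0 _ mu').
  - by move=> n; exact: test_fun_Lp (tB n0 n).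
  - by apply: aeW => x; apply: cvgB; [exact: cvg_cst|exact: phiu].
  - move=> n hn; apply: le_trans (CLp (tB n0 n)) _.
    by apply: ler_wpM2l; [exact: ltW|exact: gnm].
exists (phi n0); split=> //; first by apply: le_trans (hn0 _ (leqnn _)) _; lra.
  move=> x; apply: (@seq_cvg_le _ (fun n => `|phi n0 x - phi n x|) _ _ n0).
    by apply: cvg_norm; apply: cvgB; [exact: cvg_cst|exact: phiu].
  move=> k hk; apply: le_trans (Csup x (tB n0 k)) _.
  by apply: ler_wpM2l; [exact: ltW|exact: gnm].
Qed.

Lemma W0_continuous u g : W0 Om p u g -> continuous u.
Proof.
move=> ug x; apply/continuous_at_normP => d d0; have d3 : 0 < d / 3 by rewrite divr_gt0.
have eC : 0 < d / 3 / C by rewrite divr_gt0.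
have [phi [tp _ ub _ _]] := W0_approx ug eC.
have Cd : C * (d / 3 / C) = d / 3 by field; rewrite gt_eqF.
rewrite Cd in ub.
have /continuous_at_normP /(_ _ d3)[r r0 hr] := @smooth_cont _ _ _ (test_fun_smooth tp) x.
exists r => // y /hr; have := ub x; have := ub y.
rewrite !ler_norml !ltr_norml; lra.
Qed.

Lemma W0_test phi : test_fun Om phi -> W0 Om p phi (grad phi).
Proof.
move=> tp; split; first exact: gL.
  have [_ [D [cD DO pD]]] := (test_funP _ _).1 tp.
  by move=> x Ox; apply: (grad_off (compact_closed_rV cD) pD) => /DO.
exists (fun=> phi); split=> // [e e0|x]; last exact: cvg_cst.
exists 0%N => n _; have := (vLpZ 0 pp0 (gL tp)).2.
rewrite normr0 mul0r; have -> : (fun x => 0 *: grad phi x) = (fun x => grad phi x - grad phi x).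
  by apply/funext => x; rewrite scale0r subrr.
by move=> ->; exact: ltW.
Qed.

Lemma W0_off u g x : W0 Om p u g -> ~ Om x -> u x = 0.
Proof.
move=> [_ _ [phi [tphi _ phiu]]] Ox.
have := phiu x; rewrite (_ : phi ^~ x = cst 0); last first.
  by apply/funext => n; exact: (test_fun_off (tphi n)).
by move=> /cvg_lim <- //; rewrite lim_cst.
Qed.

Lemma W0_vLp u g : W0 Om p u g -> vLp p g.
Proof. by case. Qed.

Lemma W0_sup u g x : W0 Om p u g -> `|u x| <= C * vnrm p g.
Proof.
move=> ug; apply/ler_addgt0Pr => e e0.
have e2 : 0 < e / (2 * C) by rewrite divr_gt0// mulr_gt0.
have [phi [tp pg pu _ _]] := W0_approx ug e2.
have h1 := Csup x tp.
have h2 := vnrm_lerB p1 (gL tp) (W0_vLp ug).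
have h3 := pu x.
have E : C * (e / (2 * C)) = e / 2 by field; rewrite gt_eqF.
rewrite E in h3.
move: (vnrm p (fun x => _)) pg h2 => d dle; set a := vnrm p (grad phi) in h1 *; set b := vnrm p g => h2.
have : C * a <= C * (b + e / (2 * C)) by apply: ler_wpM2l; [exact: ltW|move: h2; rewrite ler_norml; lra].
rewrite mulrDr E; move: h1 h3; rewrite distrC !ler_norml; lra.
Qed.

Lemma W0_Lp u g : W0 Om p u g -> Lp leb p u /\ nrm leb p u <= C * vnrm p g.
Proof.
move=> ug.
have main (e : R) : 0 < e -> Lp leb p u /\ nrm leb p u <= C * vnrm p g + e.
  move=> e0; have e2 : 0 < e / (2 * C) by rewrite divr_gt0// mulr_gt0.
  have [phi [tp pg _ pL pn]] := W0_approx ug e2.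
  have [L n] := LpB p1 (test_fun_Lp pp0 tp) pL.
  have uE : phi \- (phi \- u) = u by apply/funext => x /=; rewrite opprB addrC subrK.
  rewrite uE in L n; split=> //; apply: le_trans n _.
  have E : C * (e / (2 * C)) = e / 2 by field; rewrite gt_eqF.
  rewrite E in pn; have h1 := CLp tp.
  have h2 := vnrm_lerB p1 (gL tp) (W0_vLp ug).
  move: (vnrm p (fun x => _)) pg h2 => d dle.
  set a := vnrm p (grad phi) in h1 *; set b := vnrm p g => h2.
  have : C * a <= C * (b + e / (2 * C)) by apply: ler_wpM2l; [exact: ltW|move: h2; rewrite ler_norml; lra].
  rewrite mulrDr E; lra.
split; first by case: (main 1 ltr01).
by apply/ler_addgt0Pr => e /main[].
Qed.

Lemma W0_equicont (e : R) : 0 < e -> exists2 r : R, 0 < r & forall u g x y, W0 Om p u g ->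
  `|x - y| < r -> `|u x - u y| <= e * vnrm p g.
Proof.
move=> e0; case: adm => _ _ _ _ /(_ e e0)[r r0 hr]; exists r => // u g x y [gp _ [phi [tphi phig phiu]]] xy.
apply/ler_addgt0Pr => d d0; have de : 0 < d / e by rewrite divr_gt0.
have [n0 hn0] := phig _ de.
apply: (@seq_cvg_le _ (fun n => `|phi n x - phi n y|) _ _ n0).
  by apply: cvg_norm; apply: cvgB; exact: phiu.
move=> n hn; apply: le_trans (hr _ _ _ (tphi n) xy) _.
have := vnrm_lerB p1 (gL (tphi n)) gp; have := hn0 _ hn.
move: (vnrm p (fun x => _)) => c cle; set a := vnrm p (grad _); set b := vnrm p g => h.
have -> : e * b + d = e * (b + d / e) by field; rewrite gt_eqF.
by apply: ler_wpM2l; [exact: ltW|move: h; rewrite ler_norml; lra].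
Qed.

Lemma W0_add u v g h c : W0 Om p u g -> W0 Om p v h ->
  W0 Om p (fun x => u x + c * v x) (fun x => g x + c *: h x).
Proof.
move=> [gp g0 [phi [tphi phig phiu]]] [hp h0 [psi [tpsi psih psiv]]].
have tcp n : test_fun Om (fun x => c * psi n x) by exact: test_funZ.
split.
- exact: (vLpD_scale c p1 gp hp).1.
- by move=> x Ox; rewrite g0// h0// scaler0 addr0.
exists (fun n => phi n \+ (fun x => c * psi n x)); split.
- by move=> n; exact: test_funD.
- move=> e e0; have e2 : 0 < e / 2 by rewrite divr_gt0.
  have c1 : 0 < 2 * (`|c| + 1) by rewrite mulr_gt0// ltr_wpDl.
  have ec : 0 < e / (2 * (`|c| + 1)) by rewrite divr_gt0.
  have [n1 hn1] := phig _ e2; have [n2 hn2] := psih _ ec.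
  exists (maxn n1 n2) => n; rewrite geq_max => /andP[/hn1 A /hn2 B].
  rewrite gradD; [|exact: test_fun_smooth (tphi n)|exact: test_fun_smooth (tcp n)].
  rewrite gradZ; last exact: test_fun_smooth (tpsi n).
  have := (vLpD_scale c p1 (vLpB p1 (gL (tphi n)) gp).1 (vLpB p1 (gL (tpsi n)) hp).1).2.
  have -> : (fun x => grad (phi n) x - g x + c *: (grad (psi n) x - h x)) =
     (fun x => grad (phi n) x + c *: grad (psi n) x - (g x + c *: h x)).
    by apply/funext => x; rewrite scalerBr opprD addrACA.
  move=> H; apply: le_trans H _.
  move: (vnrm p (fun x => _)) (vnrm p (fun x => _)) A B => a b A B.
  have : `|c| * a <= `|c| * (e / (2 * (`|c| + 1))) by apply: ler_wpM2l.
  have : `|c| * (e / (2 * (`|c| + 1))) <= e / 2.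
    rewrite invfM mulrA mulrA ler_pdivrMr; last by rewrite ltr_wpDl.
    rewrite -mulrA [leLHS]mulrC; apply: ler_wpM2l; first exact: ltW.
    by rewrite lerDl.
  lra.
- by move=> x; apply: cvgD; [exact: phiu|apply: cvgMr; exact: psiv].
Qed.

(** The gradients converge coordinatewise by completeness of [L^p], and the sup bound makes the
    functions Cauchy at every point; the limits form the required pair. *)
Lemma W0_test_complete (phi : nat -> V -> R) : (forall n, test_fun Om (phi n)) ->
  (forall e : R, 0 < e -> exists n0, forall m n, (n0 <= m)%N -> (n0 <= n)%N ->
     vnrm p (fun x => grad (phi m) x - grad (phi n) x) < e) ->
  exists u g, W0 Om p u g /\ forall e : R, 0 < e -> exists n0, forall n, (n0 <= n)%N ->
     vnrm p (fun x => grad (phi n) x - g x) <= e.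
Proof.
move=> tphi Cau.
have cL i n : Lp leb p (fun x => grad (phi n) x 0 i) by exact: (Lp_coord i pp0 (gL (tphi n))).1.
have /choice[f hf] : forall i, exists f, Lp leb p f /\ forall e : R, 0 < e -> exists n0, forall n,
    (n0 <= n)%N -> nrm leb p ((fun x => grad (phi n) x 0 i) \- f) <= e.
  move=> i; have [|f fL hf] := Lp_complete p1 (cL i); last by exists f.
  move=> e /Cau[n0 hn0]; exists n0 => m n hm hn; apply: le_lt_trans (hn0 _ _ hm hn).
  have := (Lp_coord i pp0 (vLpB p1 (gL (tphi m)) (gL (tphi n))).1).2.
  have -> : (fun x => (grad (phi m) x - grad (phi n) x) 0 i) =
      (fun x => grad (phi m) x 0 i) \- (fun x => grad (phi n) x 0 i).
    by apply/funext => x /=; rewrite !mxE.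
  exact.
pose h : V -> V := fun x => \row_i f i x.
have hE i : (fun x => h x 0 i) = f i by apply/funext => x; rewrite mxE.
have hL : vLp p h by apply: (vLp_coords p1 _).1 => i; rewrite hE; case: (hf i).
have phih (e : R) : 0 < e -> exists n0, forall n, (n0 <= n)%N -> vnrm p (fun x => grad (phi n) x - h x) <= e.
  move=> e0; have eN : 0 < e / N.+1%:R by rewrite divr_gt0.
  have /choice[M hM] i := (hf i).2 _ eN.
  exists (\sum_i M i)%N => n hn.
  have dL i : Lp leb p (fun x => (grad (phi n) x - h x) 0 i).
    by apply: (Lp_coord i pp0 _).1; exact: (vLpB p1 (gL (tphi n)) hL).1.
  apply: le_trans (vLp_coords p1 dL).2 _.
  apply: (@le_trans _ _ (\sum_(i < N) e / N.+1%:R)).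
    apply: ler_sum => i _; have := hM i n; rewrite (leq_trans _ hn); last first.
      by rewrite (bigD1 i)//= leq_addr.
    move=> /(_ isT).
    have -> : (fun x => (grad (phi n) x - h x) 0 i) = (fun x => grad (phi n) x 0 i) \- f i.
      by apply/funext => x /=; rewrite !mxE.
    exact.
  rewrite sumr_const card_ord -[leLHS]mulr_natr -mulrA ler_piMr//; first exact: ltW.
  by rewrite mulrC ler_pdivrMr// mul1r ler_nat.
have mO : measurable Om by exact: measurable_open_rV.
(* [W0] asks for a gradient vanishing off [Om]. The gradients of test functions vanish there, so
   truncating the limit can only decrease the distance to them. *)
pose g x : V := \1_Om x *: h x.
have gm : vmeas g.
  move=> i; under eq_fun do rewrite mxE; apply: measurable_funM; first exact: measurable_indic.
  by case: hL.
have phig0 n x : enorm (grad (phi n) x - g x) <= enorm (grad (phi n) x - h x).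
  rewrite /g indicE; case: (boolP (x \in Om)) => [_|/negP Ox]; first by rewrite scale1r.
  have [_ g0 _] := W0_test (tphi n); rewrite g0; last by move=> Ox'; apply: Ox; rewrite inE.
  by rewrite scale0r subrr enorm0 enorm_ge0.
have gp : vLp p g.
  apply: (vnrm_le_pointwise pp0 gm hL _).1 => x; rewrite enormZ ler_piMl ?enorm_ge0//.
  by rewrite indicE; case: (_ \in _); rewrite ?normr1 ?normr0.
have phig (e : R) : 0 < e -> exists n0, forall n, (n0 <= n)%N -> vnrm p (fun x => grad (phi n) x - g x) <= e.
  move=> /phih[n0 hn0]; exists n0 => n /hn0; apply: le_trans.
  apply: (vnrm_le_pointwise pp0 _ (vLpB p1 (gL (tphi n)) hL).1 (phig0 n)).2.
  by case: (vLpB p1 (gL (tphi n)) gp).1.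
have pc x : cvgn (phi ^~ x).
  apply: cauchy_seq_cvg => e e0; have eC : 0 < e / C by rewrite divr_gt0.
  have [n0 hn0] := Cau _ eC; exists n0 => m n hm hn.
  apply: le_lt_trans (Csup x (test_funB (tphi m) (tphi n))) _.
  by rewrite mulrC -ltr_pdivlMr// gB//; exact: hn0.
exists (fun x => limn (phi ^~ x)), g; split=> //; split=> //.
  by move=> x Ox; rewrite /g indicE memNset// scale0r.
by exists phi; split.
Qed.

Lemma W0_complete (u : nat -> V -> R) (g : nat -> V -> V) : (forall n, W0 Om p (u n) (g n)) ->
  (forall e : R, 0 < e -> exists n0, forall m n, (n0 <= m)%N -> (n0 <= n)%N ->
     vnrm p (fun x => g m x - g n x) < e) ->
  exists u' g', W0 Om p u' g' /\ forall e : R, 0 < e -> exists n0, forall n, (n0 <= n)%N ->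
     vnrm p (fun x => g n x - g' x) <= e.
Proof.
move=> ug Cau.
have h0 (n : nat) : 0 < n.+1%:R^-1 :> R by rewrite invr_gt0.
have /choice[phi hphi] : forall n, exists phi, test_fun Om phi /\ vnrm p (fun x => grad phi x - g n x) <= n.+1%:R^-1.
  by move=> n; have [phi [? ? _ _ _]] := W0_approx (ug n) (h0 n); exists phi.
have small (e : R) : 0 < e -> exists n0, forall n, (n0 <= n)%N -> vnrm p (fun x => grad (phi n) x - g n x) <= e.
  move=> e0; have /seq_cvgP /(_ e e0)[n0 hn0] := @cvg_harmonic R; exists n0 => n /hn0.
  rewrite subr0 ger0_norm; last exact/ltW/h0.
  by move=> /ltW; apply: le_trans; exact: (hphi n).2.
have [||u' [g' [ug' lim]]] := @W0_test_complete phi; first by move=> n; exact: (hphi n).1.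
  move=> e e0; have e3 : 0 < e / 4 by rewrite divr_gt0.
  have [n1 hn1] := small _ e3; have [n2 hn2] := Cau _ e3.
  exists (maxn n1 n2) => m n; rewrite !geq_max => /andP[m1 m2] /andP[k1 k2].
  have A := vnrm_triangle p1 (gL (hphi m).1) (W0_vLp (ug m)) (gL (hphi n).1).
  have B := vnrm_triangle p1 (W0_vLp (ug m)) (W0_vLp (ug n)) (gL (hphi n).1).
  apply: le_lt_trans A _; have := hn1 _ m1; have := hn1 _ k1; have := hn2 _ _ m2 k2.
  move: B; rewrite [vnrm p (fun x => g n x - _)]vnrmBC.
  move: (vnrm p _) (vnrm p _) (vnrm p _) (vnrm p _) => a b c d; lra.
exists u', g'; split=> // e e0; have e2 : 0 < e / 2 by rewrite divr_gt0.
have [n1 hn1] := small _ e2; have [n2 hn2] := lim _ e2.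
exists (maxn n1 n2) => n; rewrite geq_max => /andP[k1 k2].
apply: le_trans (vnrm_triangle p1 (W0_vLp (ug n)) (gL (hphi n).1) (W0_vLp ug')) _.
rewrite [X in X + _]vnrmBC; have := hn1 _ k1; have := hn2 _ k2.
move: (vnrm p _) (vnrm p _) => a b; lra.
Qed.

End W0.

(** * Weak gradients *)

Section fundamental_lemma.
Context {R : realType} {N : nat}.
Local Notation V := 'rV[R]_N.
Local Notation leb := (@lebesgue_rV R N).
Implicit Types (E C : set V) (f g phi : V -> R).

(** Only the coordinates selected by [P] are constrained. These sets are stable under intersection
    and generate the sigma-algebra, and their indicators are pointwise limits of products of smooth
    steps with values between 0 and 1. *)
Definition orthant (P : 'I_N -> bool) (a : 'I_N -> R) : set V :=
  [set x | forall i, P i -> a i < x 0 i].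

Definition orthants : set (set V) := [set A | exists P a, A = orthant P a].

Lemma g_sigma_orthants : (@measurable _ V) = <<s orthants >>.
Proof.
have RGE : @measurable _ (measurableTypeR R) = <<s @RGenOInfty.G R >>.
  exact: RGenOInfty.measurableE.
apply/seteqP; split; last first.
  apply: smallest_sub; first exact: sigma_algebra_measurable.
  move=> _ [P [a ->]].
  have -> : orthant P a = prod_set (fun i => if P i then `]a i, +oo[%classic else setT).
    apply/seteqP; split=> x /= h i; have := h i; case: (P i) => //=; rewrite in_itv/= andbT; first exact.
    by move=> + _.
  by apply: measurable_prod_set => i; case: (P i).
apply: smallest_sub; first exact: smallest_sigma_algebra.
move=> X; rewrite -bigcup_seq => -[i _ [B mB <-]]; rewrite setTI.
have {}mB : @measurable _ (measurableTypeR R) B by exact: mB.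
move: mB; rewrite RGE; move: B.
have [S0 SC SU] : sigma_algebra setT (<<s orthants >>) by exact: smallest_sigma_algebra.
suff : <<s @RGenOInfty.G R >> `<=` [set B | <<s orthants >> ((fun x : V => x 0 i) @^-1` B)] by [].
apply: smallest_sub.
  split=> /=.
  - by rewrite preimage_set0.
  - by move=> A /SC; rewrite !setTD preimage_setC.
  - by move=> F hF; rewrite preimage_bigcup; exact: SU.
move=> _ [x ->] /=; apply: sub_sigma_algebra; exists (pred1 i), (fun=> x).
apply/seteqP; split=> y /=; rewrite in_itv/= andbT; first by move=> xy j /eqP ->.
by move=> h; apply: h; exact: eqxx.
Qed.

Lemma setI_closed_orthants : setI_closed orthants.
Proof.
move=> _ _ [P [a ->]] [Q [b ->]].
exists (fun i => P i || Q i), (fun i => if P i then if Q i then Num.max (a i) (b i) else a i else b i).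
apply/seteqP; split=> x /=.
  move=> [h k] i; have := h i; have := k i.
  by case: (P i); case: (Q i) => //= A B _; rewrite ?gt_max ?A ?B.
move=> h; split=> i hi; move: (h i); rewrite hi ?orbT => /(_ isT).
  by case: (Q i) => //; rewrite gt_max => /andP[].
by case: (P i) => //; rewrite gt_max => /andP[].
Qed.

Let ostep (P : 'I_N -> bool) (a : 'I_N -> R) (k : nat) : V -> R :=
  fun x => \prod_i (if P i then step (k%:R * x 0 i + - (k%:R * a i)) else 1).

Let smooth_ostep P a k : smooth (ostep P a k).
Proof.
rewrite /ostep; apply: (@smooth_prod _ _ _ _ (fun i x => if P i then step (k%:R * x 0 i + - (k%:R * a i)) else 1)) => i.
by case: (P i); [exact: smooth_step|exact: smooth_cst].
Qed.

Let ostep_01 P a k x : 0 <= ostep P a k x <= 1.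
Proof.
apply/andP; split; first by apply: prodr_ge0 => i _; case: ifP => // _; exact: step_ge0.
by apply: prodr_ile1 => i _; case: ifP; rewrite ?ler01 ?lexx// step_ge0 step_le1.
Qed.

Let ostep_cvg P a x : ostep P a k x @[k --> \oo] --> (\1_(orthant P a) x : R).
Proof.
rewrite indicE; case: (asboolP (x \in orthant P a)) => [|hx].
  rewrite inE => hx; have /choice[m hm] : forall i, exists m : nat, P i -> 1 <= m%:R * (x 0 i - a i).
    move=> i; case: (boolP (P i)) => [/hx|]; last by exists 0%N.
    rewrite -subr_gt0 => d0; exists (Num.bound (x 0 i - a i)^-1) => _.
    by rewrite -ler_pdivrMr// div1r; apply/ltW/archi_boundP; rewrite invr_ge0 ltW.
  apply/seq_cvgP => e e0; exists (\sum_i m i)%N => k hk.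
  rewrite (_ : ostep _ _ _ _ = 1) ?mem_set//; first by rewrite subrr normr0.
  apply: big1 => i _; case: (boolP (P i)) => // Pi; rewrite -mulrBr step_ge1//.
  apply: le_trans (hm i Pi) _; apply: ler_wpM2r; first by rewrite subr_ge0 ltW// hx.
  by rewrite ler_nat (leq_trans _ hk)// (bigD1 i)//= leq_addr.
rewrite (negbTE (introN idP hx)); have [i /not_implyP[Pi /negP]] : exists i, ~ (P i -> a i < x 0 i).
  by apply/existsNP => h; apply: hx; rewrite inE.
rewrite -leNgt => xa; apply/seq_cvgP => e e0; exists 0%N => k _.
rewrite /ostep (bigD1 i)//= Pi step_le0 ?mul0r ?subr0 ?normr0//.
by rewrite -mulrBr mulr_ge0_le0// subr_le0.
Qed.

(** The sets over which [f] has integral zero form a Dynkin system. It contains the orthants, by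
    dominated convergence along the smooth steps, hence all measurable sets. *)
Lemma ae_eq0_smooth f : leb.-integrable setT (EFin \o f) ->
  (forall phi, smooth phi -> (forall x, `|phi x| <= 1) -> (\int[leb]_x (f x * phi x)%:E = 0)%E) ->
  {ae leb, forall x, f x = 0}.
Proof.
move=> intf h; have mf : measurable_fun setT f by apply/measurable_EFinP; exact: measurable_int intf.
have hT : (\int[leb]_x (f x)%:E = 0)%E.
  have := h (cst 1) (smooth_cst 1); under eq_integral do rewrite mulr1.
  by apply => x; rewrite normr1.
have key (S : set V) : measurable S -> (\int[leb]_(x in S) (f x)%:E = 0)%E.
  rewrite g_sigma_orthants; move: S.
  apply: (dynkin_induction g_sigma_orthants setI_closed_orthants).
  - exact: hT.
  - move=> _ [P [a ->]] /=.
    have mP : measurable (orthant P a).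
      by rewrite g_sigma_orthants; apply: sub_sigma_algebra; exists P, a.
    have [|||||A B C] := @dominated_convergence _ _ _ leb setT measurableT
      (fun k x => (f x * ostep P a k x)%:E) (fun x => (f x * \1_(orthant P a) x)%:E) (fun x => `|(f x)%:E|%E).
    + move=> k; apply/measurable_EFinP/measurable_funM => //; exact: smooth_measurable.
    + by apply/measurable_EFinP/measurable_funM => //; exact: measurable_indic.
    + apply: aeW => x _; apply/cvg_EFin; first by apply: nearW.
      by apply: cvgMr; exact: ostep_cvg.
    + exact: integrable_abse.
    + apply: aeW => x k _ /=; rewrite lee_fin normrM ler_piMr//.
      by rewrite ger0_norm; case/andP: (ostep_01 P a k x).
    move: C; rewrite (_ : [sequence _]_n = cst 0%E); last first.
      apply/funext => k /=; apply: h; first exact: smooth_ostep.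
      by move=> x; rewrite ger0_norm; case/andP: (ostep_01 P a k x).
    move=> /cvg_lim; rewrite lim_cst// => -> //.
    rewrite [LHS]integral_mkcond; apply: eq_integral => x _ /=.
    by rewrite patchE indicE; case: ifP; rewrite ?mulr1 ?mulr0.
  - move=> S mS h0; have := @integral_setU _ _ _ leb S (~` S) (EFin \o f) mS (measurableC mS).
    rewrite setUv => /(_ _ _)/esym; rewrite {1}[X in (X + _)%E]h0 add0e => ->.
    - exact: hT.
    - exact/measurable_EFinP.
    - by rewrite /disj_set setICr.
  - move=> F mF tF hF; rewrite integral_bigcup//; last first.
      by apply: integrableS intf => //; exact: bigcup_measurable.
    by rewrite eseries0.
have ae : ae_eq leb setT (EFin \o f) (cst 0%E).
  by apply: integral_ae_eq => // E _ mE; rewrite key// integral_cst// mul0e.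
by apply: filterS ae => x /(_ Logic.I) /= [].
Qed.

Lemma compact_ball_rV (c : V) (r : R) : compact [set x : V | `|x - c| <= r].
Proof.
apply: bounded_closed_compact; last first.
  rewrite (_ : [set x | _] = (fun x : V => `|x - c|) @^-1` [set y | y <= r])//.
  apply: closed_comp; last exact: closed_le.
  move=> x _; apply/continuous_at_normP => e e0; exists e => // y xy.
  apply: le_lt_trans (ler_dist_dist _ _) _.
  by rewrite opprB addrA subrK.
exists (r + `|c|); split; first exact: num_real.
move=> M hM x /= hx; apply: le_trans (ltW hM); rewrite -lerBlDr.
by apply: le_trans hx; exact: lerB_dist.
Qed.

Lemma cube_bump (c : V) (r : R) : 0 < r -> exists eta : V -> R,
  [/\ smooth eta, forall x, 0 <= eta x, forall x, `|x - c| < r -> 0 < eta x &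
      forall x, ~ (`|x - c| <= r) -> eta x = 0].
Proof.
move=> r0; pose F (i : 'I_N) (x : V) := expflat 0 (1 * x 0 i + (r - c 0 i)) * expflat 0 ((- 1) * x 0 i + (c 0 i + r)).
exists (fun x => \prod_i F i x); split.
- apply: smooth_prod => i; rewrite /F.
  by have := smoothM (smooth_expflat 0 1 (r - c 0 i) i) (smooth_expflat 0 (- 1) (c 0 i + r) i).
- by move=> x; apply: prodr_ge0 => i _; apply: mulr_ge0; exact: expflat_ge0.
- move=> x xc; apply: prodr_gt0 => i _; have := le_lt_trans (ler_coord_norm (x - c) i) xc.
  by rewrite !mxE ltr_norml => /andP[h1 h2]; apply: mulr_gt0; apply: expflat_gt0; lra.
- move=> x xc; have [i hi] : exists i, r < `|x 0 i - c 0 i|.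
    apply: contrapT => /forallNP h; apply: xc; apply: ler_norm_coord; first exact: ltW.
    by move=> i; rewrite !mxE leNgt; apply/negP; exact: h.
  rewrite (bigD1 i)//= /F; move: hi; rewrite ltr_normr => /orP[] hi.
    by rewrite [X in _ * X * _]expflat_le0 ?mulr0 ?mul0r//; lra.
  by rewrite expflat_le0 ?mul0r//; lra.
Qed.

Lemma cube_bump_test (c : V) (r : R) : 0 < r -> exists eta : V -> R,
  [/\ test_fun [set x : V | `|x - c| <= r] eta, forall x, 0 <= eta x &
      forall x, `|x - c| < r -> 0 < eta x].
Proof.
move=> r0; have [eta [se e0 epos eoff]] := cube_bump c r0; exists eta; split=> //.
by apply/test_funP; split=> //; exists [set x : V | `|x - c| <= r]; split=> //; exact: compact_ball_rV.
Qed.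

(** A bump [eta] supported in [E] makes [f * eta] integrable, and multiplying [eta] by any smooth
    function gives a test function; thus [ae_eq0_smooth] yields [f = 0] almost everywhere where
    [eta > 0]. Countably many such bumps cover [E]. *)
Lemma ae_eq0_weak E f : open E -> L1loc E f ->
  (forall phi, test_fun E phi -> (\int[leb]_(x in E) (f x * phi x)%:E = 0)%E) ->
  {ae leb, forall x, E x -> f x = 0}.
Proof.
move=> oE [mf lf] h; have mE := measurable_open_rV oE.
have local (c : V) (r : R) : 0 < r -> (forall x, `|x - c| <= r -> E x) ->
    {ae leb, forall x, `|x - c| < r -> f x = 0}.
  move=> r0 cE; pose C := [set x : V | `|x - c| <= r].
  have cC : compact C by exact: compact_ball_rV.
  have mC : measurable C by apply: measurable_closed_rV; exact: compact_closed_rV.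
  have [eta [teta eta0 etapos]] := cube_bump_test c r0.
  have [M M0 hM] := test_fun_bounded teta.
  have mfC : measurable_fun setT (f \_ C).
    by apply/(measurable_restrictT f mC); apply: measurable_funS mE _ mf => x; exact: cE.
  have FE x : (f \_ C) x * eta x = f x * eta x.
    rewrite patchE; case: ifPn => // /negP xC; rewrite (test_fun_off teta) ?mulr0//.
    by move=> xC'; apply: xC; rewrite inE.
  have intF : leb.-integrable setT (EFin \o (fun x => (f \_ C) x * eta x)).
    apply/integrableP; split; first by apply/measurable_EFinP/measurable_funM => //; exact: smooth_measurable (test_fun_smooth teta).
    apply: (@le_lt_trans _ _ (M%:E * \int[leb]_(x in C) `|f x|%:E)%E); last first.
      by apply: lte_mul_pinfty; [rewrite lee_fin ltW| |apply: lf => // x; exact: cE].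
    have mfa : measurable_fun C (fun x => `|f x|%:E).
      apply/measurable_EFinP; apply: measurableT_comp => //.
      by apply: measurable_funS mE _ mf => x; exact: cE.
    rewrite -ge0_integralZl//; last by rewrite lee_fin ltW.
    rewrite [leRHS]integral_mkcond; apply: ge0_le_integral => //.
    - apply/measurable_EFinP; apply: measurableT_comp => //.
      by apply/measurable_funM => //; exact: smooth_measurable (test_fun_smooth teta).
    - apply/(measurable_restrictT _ mC); apply: measurable_funeM => //.
    - move=> x _; rewrite [X in (_ <= X)%E]patchE /= patchE.
      case: ifP => _; last by rewrite mul0r normr0.
      by rewrite lee_fin normrM mulrC; apply: ler_wpM2r.
  have ae : {ae leb, forall x, (f \_ C) x * eta x = 0}.
    apply: (ae_eq0_smooth intF) => phi sphi _; under eq_integral do rewrite FE -mulrA.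
    have tp : test_fun E (phi \* eta).
      by apply: test_funMl; [exact: sphi|apply: test_funS teta => x; exact: cE].
    have H := h _ tp; rewrite integral_mkcond in H.
    rewrite -[RHS]H; apply: eq_integral => x _; rewrite patchE; case: ifPn => [_|/negP xE].
      by rewrite [eta x * _]mulrC.
    rewrite (test_fun_off teta) ?mul0r ?mulr0// => xC; apply: xE; rewrite inE; exact: cE.
  apply: filterS ae => x + xr; rewrite FE => /eqP; rewrite mulf_eq0 => /orP[/eqP //|].
  by rewrite gt_eqF// etapos.
(* A countable family of cubes: centres on the grid of mesh [1/(n+1)], radii twice the mesh. A point
   lies in the cube around its rounded-down grid point, and for a fine mesh that cube stays in any
   given neighbourhood. *)
pose cen (i : 'rV[int]_N * nat) : V := i.2.+1%:R^-1 *: map_mx intr i.1.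
pose rad (i : 'rV[int]_N * nat) : R := 2 / i.2.+1%:R.
pose P n x := if unpickle n is Some i then
  (forall y, `|y - cen i| <= rad i -> E y) -> `|x - cen i| < rad i -> f x = 0 else True.
have : {ae leb, forall x, forall n, P n x}.
  apply/ae_foralln => n; rewrite /P; case: unpickle => [i|]; last exact: aeW.
  have [cE|cE] := pselect (forall y, `|y - cen i| <= rad i -> E y); last exact: aeW.
  have r0 : 0 < rad i by rewrite /rad divr_gt0.
  by apply: filterS (local (cen i) (rad i) r0 cE) => x hx _.
apply: filterS => x hx Ex; have /nbhs_cubeP[r r0 hr] : nbhs x E by exact: open_nbhs_nbhs.
pose k := Num.bound (4 / r).
have k4 : 4 / k.+1%:R < r.
  rewrite ltr_pdivrMr// mulrC -ltr_pdivrMr//; apply: lt_trans (archi_boundP _) _; first by rewrite divr_ge0// ltW.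
  by rewrite ltr_nat.
pose j : 'rV[int]_N := \row_i Num.floor (x 0 i * k.+1%:R).
have xc : `|x - cen (j, k)| < rad (j, k).
  apply: ltr_norm_coord; first by rewrite divr_gt0.
  move=> i; rewrite !mxE /= /rad /= -subr_gt0.
  have -> : x 0 i - k.+1%:R^-1 * (Num.floor (x 0 i * k.+1%:R))%:~R =
    k.+1%:R^-1 * (x 0 i * k.+1%:R - (Num.floor (x 0 i * k.+1%:R))%:~R) by field.
  rewrite normrM ger0_norm ?invr_ge0// [X in _ - X]mulrC -mulrBl mulr_gt0 ?invr_gt0// subr_gt0.
  have := floor_itv (x 0 i * k.+1%:R); rewrite intrD => /andP[h1 h2].
  by rewrite ger0_norm; lra.
have := hx (pickle (j, k)); rewrite /P pickleK; apply => // y yc; apply: hr.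
have -> : x - y = (x - cen (j, k)) - (y - cen (j, k)) by rewrite opprB addrA subrK.
apply: le_lt_trans (ler_normB _ _) _; apply: lt_trans k4.
have -> : 4 / k.+1%:R = rad (j, k) + rad (j, k) by rewrite /rad /=; field.
by apply: ltr_leD.
Qed.

End fundamental_lemma.

Section weak_gradients.
Context {R : realType} {N : nat}.
Local Notation V := 'rV[R]_N.
Local Notation leb := (@lebesgue_rV R N).
Implicit Types (E C : set V) (f u phi : V -> R) (g h : V -> V).

Lemma L1loc_test_integrable E f phi : open E -> L1loc E f -> test_fun E phi ->
  leb.-integrable E (fun x => (f x * phi x)%:E).
Proof.
move=> oE [mf lf] tphi; have mE := measurable_open_rV oE.
have [sphi [C [cC CE phiC]]] := (test_funP _ _).1 tphi.
have mC : measurable C by apply: measurable_closed_rV; exact: compact_closed_rV.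
have [M M0 hM] := test_fun_bounded tphi.
have mphi := measurable_funS measurableT (@subsetT _ E) (smooth_measurable sphi).
apply/integrableP; split; first by apply/measurable_EFinP/measurable_funM.
have mfa : measurable_fun C (fun x => `|f x|%:E).
  by apply/measurable_EFinP; apply: measurableT_comp => //; exact: measurable_funS mE CE mf.
apply: (@le_lt_trans _ _ (M%:E * \int[leb]_(x in C) `|f x|%:E)%E); last first.
  by apply: lte_mul_pinfty; [rewrite lee_fin ltW| |exact: lf].
rewrite -ge0_integralZl//; last by rewrite lee_fin ltW.
rewrite [leLHS]integral_mkcond [leRHS]integral_mkcond; apply: ge0_le_integral => //.
- by move=> x _; rewrite patchE; case: ifP.
- apply/(measurable_restrictT _ mE)/measurable_EFinP; apply: measurableT_comp => //.
  by apply: measurable_funM.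
- by apply/(measurable_restrictT _ mC); exact: measurable_funeM.
- move=> x _; rewrite !patchE; case: (boolP (x \in C)) => [xC|/negP xC].
    rewrite mem_set; last by apply: CE; rewrite inE in xC.
    by rewrite lee_fin normrM mulrC; apply: ler_wpM2r.
  case: ifP => // _; rewrite phiC; first by rewrite mulr0 abse0.
  by move=> xC'; apply: xC; rewrite inE.
Qed.

Lemma L1locB E f f' : open E -> L1loc E f -> L1loc E f' -> L1loc E (f \- f').
Proof.
move=> oE [mf lf] [mf' lf']; split; first exact: measurable_funB.
move=> C cC CE; have mC : measurable C by apply: measurable_closed_rV; exact: compact_closed_rV.
have mE := measurable_open_rV oE.
have mCf := measurable_funS mE CE mf; have mCf' := measurable_funS mE CE mf'.
have a (k : V -> R) : measurable_fun C k -> measurable_fun C (fun x => `|k x|%:E).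
  by move=> mk; apply/measurable_EFinP; apply: measurableT_comp.
apply: (@le_lt_trans _ _ (\int[leb]_(x in C) (`|f x|%:E + `|f' x|%:E)%E)%E).
  apply: ge0_le_integral => //.
  - by apply: a; exact: measurable_funB.
  - by apply: emeasurable_funD; exact: a.
  - by move=> x _; rewrite -EFinD lee_fin; exact: ler_normB.
rewrite ge0_integralD//; [|exact: a|exact: a].
by apply: lte_add_pinfty; [exact: lf|exact: lf'].
Qed.

Lemma weak_gradient_uniq E u g h : open E -> weak_gradient E u g -> weak_gradient E u h ->
  {ae leb, forall x, E x -> g x = h x}.
Proof.
move=> oE [Lu Lg gu] [_ Lh hu].
have coord (i : 'I_N) : {ae leb, forall x, E x -> g x 0 i - h x 0 i = 0}.
  apply: (ae_eq0_weak oE (L1locB oE (Lg i) (Lh i))) => phi tphi.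
  have ig := L1loc_test_integrable oE (Lg i) tphi.
  have ih := L1loc_test_integrable oE (Lh i) tphi.
  have /oppe_inj A : (- (\int[leb]_(x in E) (g x 0%R i * phi x)%:E) = - (\int[leb]_(x in E) (h x 0%R i * phi x)%:E))%E.
    by rewrite -gu// -hu.
  under eq_integral do rewrite mulrBl EFinB.
  rewrite integralB//; last exact: measurable_open_rV.
  rewrite A subee//; apply: integrable_fin_num ih; exact: measurable_open_rV.
have : {ae leb, forall x, forall i : 'I_N, E x -> g x 0 i - h x 0 i = 0} by exact: filter_forall.
apply: filterS => x hx Ex; apply/rowP => i; apply/eqP; rewrite -subr_eq0; apply/eqP; exact: hx.
Qed.

Lemma weak_gradient_congr E u v g : measurable E -> (forall x, E x -> u x = v x) ->
  weak_gradient E u g -> weak_gradient E v g.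
Proof.
move=> mE uv [[mu lu] Lg ug]; split=> //.
  split; first by apply: eq_measurable_fun mu => x; rewrite inE; exact: uv.
  move=> C cC CE; rewrite (_ : (\int[leb]_(x in C) _)%E = (\int[leb]_(x in C) `|u x|%:E)%E); first exact: lu.
  by apply: eq_integral => x; rewrite inE => /CE /uv ->.
move=> phi i tphi; rewrite -ug//; apply: eq_integral => x; rewrite inE => Ex.
by rewrite uv.
Qed.

Lemma weak_gradientB E u v g h : open E -> weak_gradient E u g -> weak_gradient E v h ->
  weak_gradient E (u \- v) (fun x => g x - h x).
Proof.
move=> oE [Lu Lg ug] [Lv Lh vh]; have mE := measurable_open_rV oE; split.
- exact: L1locB.
- move=> i; have -> : (fun x => (g x - h x) 0 i) = (fun x => g x 0 i) \- (fun x => h x 0 i).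
    by apply/funext => x /=; rewrite !mxE.
  exact: L1locB.
move=> phi i tphi; have tp := test_fun_partial i tphi.
have iu := L1loc_test_integrable oE Lu tp; have iv := L1loc_test_integrable oE Lv tp.
have ig := L1loc_test_integrable oE (Lg i) tphi; have ih := L1loc_test_integrable oE (Lh i) tphi.
under eq_integral do rewrite mulrBl EFinB.
rewrite integralB// ug// vh//.
under [in RHS]eq_integral do rewrite !mxE mulrBl EFinB.
rewrite integralB// fin_num_oppeB; last exact: (integrable_fin_num mE ih).
by rewrite oppeK.
Qed.

(** Makes the energy of the chosen [wgrad] computable from any weak gradient at hand. *)
Lemma energy_weak_gradient p E u g h : open E -> weak_gradient E u g -> weak_gradient E u h ->
  energy p E g = energy p E h.
Proof.
move=> oE ug uh; have mE := measurable_open_rV oE.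
have m (k : V -> V) : weak_gradient E u k -> measurable_fun E (fun x => (enorm (k x) `^ p)%:E).
  move=> [_ Lk _]; pose k' x := \row_i ((fun y => k y 0 i) \_ E) x : V.
  apply: (eq_measurable_fun (fun x => (enorm (k' x) `^ p)%:E)).
    move=> x xE; congr (enorm _ `^ _)%:E; apply/rowP => i; by rewrite mxE patchE xE.
  apply: measurable_funTS; apply: measurable_enorm_powR => i.
  under eq_fun do rewrite mxE.
  by apply/(measurable_restrictT _ mE); case: (Lk i).
apply: ae_eq_integral => //; [exact: m ug|exact: m uh|].
by apply: filterS (weak_gradient_uniq oE ug uh) => x hx Ex; rewrite hx.
Qed.

Lemma wgradP E u g : weak_gradient E u g -> weak_gradient E u (wgrad E u).
Proof. by move=> ug; apply: (@getPex _ [set g | weak_gradient E u g]); exists g. Qed.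

End weak_gradients.

Section pairing.
Context d (T : measurableType d) (R : realType).
Variable mu : {measure set T -> \bar R}.
Variables (p q : R).
Hypotheses (p0 : 0 < p) (q0 : 0 < q) (pq : p^-1 + q^-1 = 1) (p1 : 1 <= p).

Definition pairing (f h : T -> R) : R := fine (\int[mu]_x (f x * h x)%:E).

Lemma pairingE f h : Lp mu p f -> Lp mu q h ->
  (\int[mu]_x (f x * h x)%:E)%E = (pairing f h)%:E.
Proof.
move=> fL hL; have [i _] := nrm_hoelder p0 q0 pq fL hL.
by rewrite fineK//; exact: integrable_fin_num i.
Qed.

Lemma pairing_le f h : Lp mu p f -> Lp mu q h -> `|pairing f h| <= nrm mu p f * nrm mu q h.
Proof.
move=> fL hL; have [i le] := nrm_hoelder p0 q0 pq fL hL.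
rewrite -lee_fin; apply: le_trans le.
have -> : (`|pairing f h|)%:E = `|(pairing f h)%:E|%E by [].
rewrite -pairingE//.
by apply: le_abse_integral => //; exact: measurable_int i.
Qed.

Lemma pairingB f f' h : Lp mu p f -> Lp mu p f' -> Lp mu q h ->
  pairing (f \- f') h = pairing f h - pairing f' h.
Proof.
move=> fL fL' hL; apply: EFin_inj; rewrite EFinB -!pairingE//; last exact: (LpB p1 fL fL').1.
have [i _] := nrm_hoelder p0 q0 pq fL hL; have [i' _] := nrm_hoelder p0 q0 pq fL' hL.
by rewrite -integralB//; apply: eq_integral => x _; rewrite -EFinB mulrBl.
Qed.
End pairing.

(** * Agreement of [W0] with the Sobolev space of the statement *)

Section bridge.
Context {R : realType} {N : nat}.
Local Notation V := 'rV[R]_N.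
Local Notation leb := (@lebesgue_rV R N).
Variables (Om : set V) (p C : R).
Hypothesis adm : admissible Om p C.
Implicit Types (u v : V -> R) (g h : V -> V).

Let oOm : open Om. Proof. by case: adm. Qed.
Let mOm : measurable Om. Proof. exact: measurable_open_rV. Qed.
Let p2 : 2 <= p. Proof. by case: adm. Qed.
Let p1 : 1 <= p. Proof. exact: le_trans (ler1n _ 2) p2. Qed.
Let p1' : 1 < p. Proof. by apply: lt_le_trans p2; rewrite ltr1n. Qed.
Let pp0 : 0 < p. Proof. exact: lt_le_trans p1. Qed.
Let C0 : 0 < C. Proof. by case: adm. Qed.
Let p' : R := p / (p - 1).
Let p'0 : 0 < p'. Proof. by rewrite divr_gt0// subr_gt0. Qed.
Let pp' : p^-1 + p'^-1 = 1.
Proof. by rewrite /p'; field; rewrite !gt_eqF// subr_gt0. Qed.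

Lemma Lp_L1loc f : Lp leb p f -> L1loc Om f.
Proof.
move=> fL; split; first by case: fL => mf _; exact: measurable_funTS.
move=> D cD DO; have mD : measurable D by apply: measurable_closed_rV; exact: compact_closed_rV.
have iL : Lp leb p' (\1_D : V -> R).
  apply: (@bounded_csupp_Lp _ _ D _ 1 p' p'0) => //.
  - by move=> x Dx; rewrite indicE memNset.
  - by move=> x; rewrite indicE; case: (_ \in _); rewrite ?normr1 ?normr0.
have [_ h] := nrm_hoelder pp0 p'0 pp' fL iL.
rewrite integral_mkcond; apply: le_lt_trans (le_lt_trans h (ltry _)).
rewrite le_eqVlt; apply/orP; left; apply/eqP; apply: eq_integral => x _.
by rewrite patchE indicE; case: ifP; rewrite ?mulr1 ?mulr0 ?normr0.
Qed.

(** Integration by parts is exact for a test function [phi] near [u]. The defect for [u] is then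
    bounded, by Hoelder with the exponent conjugate to [p], by [t * K], where [t] is the distance of
    the gradients and [K] depends on [psi] alone. *)
Lemma W0_weak_gradient u g : W0 Om p u g -> weak_gradient Om u g.
Proof.
move=> ug; have [uL _] := W0_Lp adm ug; have gp := W0_vLp ug.
have giL i := (Lp_coord i pp0 gp).1.
split; [exact: Lp_L1loc|by move=> i; exact: Lp_L1loc|] => psi i tpsi.
have tdpsi := test_fun_partial i tpsi.
have psiL := test_fun_Lp p'0 tpsi; have dpsiL := test_fun_Lp p'0 tdpsi.
have mpsi := smooth_measurable (test_fun_smooth tpsi); have mdpsi := smooth_measurable (test_fun_smooth tdpsi).
have O1 : (\int[leb]_(x in Om) (u x * partial i psi x)%:E = \int[leb]_x (u x * partial i psi x)%:E)%E.
  apply: integral_off; first exact: mOm.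
    by apply/measurable_EFinP/measurable_funM; [case: uL|exact: mdpsi].
  by move=> x Ox; rewrite (W0_off ug Ox) mul0r.
have O2 : (\int[leb]_(x in Om) (g x 0 i * psi x)%:E = \int[leb]_x (g x 0 i * psi x)%:E)%E.
  apply: integral_off; first exact: mOm.
    by apply/measurable_EFinP/measurable_funM; [case: (giL i)|exact: mpsi].
  by move=> x Ox; rewrite (test_fun_off tpsi Ox) mulr0.
rewrite O1 O2.
rewrite (pairingE pp0 p'0 pp' uL dpsiL) (pairingE pp0 p'0 pp' (giL i) psiL) -EFinN; congr EFin.
apply/eqP; rewrite -addr_eq0 -normr_le0; apply/ler_addgt0Pr => e e0; rewrite add0r.
set A := pairing _ _ _ + _; pose K := C * nrm leb p' (partial i psi) + nrm leb p' psi.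
have K0 : 0 <= K by apply: addr_ge0; [apply: mulr_ge0; [exact: ltW|exact: nrm_ge0]|exact: nrm_ge0].
have [t t0 tK] : exists2 t, 0 < t & t * K <= e.
  exists (e / (K + 1)); first by rewrite divr_gt0// ltr_wpDl.
  rewrite mulrAC ler_pdivrMr; last by rewrite ltr_wpDl.
  by apply: ler_wpM2l; [exact: ltW|rewrite lerDl].
have [phi [tphi pg _ pL pn]] := W0_approx adm ug t0.
have phiL := test_fun_Lp pp0 tphi; have dphiL := test_fun_Lp pp0 (test_fun_partial i tphi).
have ibp : pairing leb phi (partial i psi) + pairing leb (partial i phi) psi = 0.
  have tM := test_funMl (test_fun_smooth tphi) tpsi.
  have := integral_partial0 i tM; rewrite partialM; [|exact: test_fun_smooth tphi|exact: test_fun_smooth tpsi].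
  have [i1 _] := nrm_hoelder pp0 p'0 pp' phiL dpsiL; have [i2 _] := nrm_hoelder pp0 p'0 pp' dphiL psiL.
  have -> : (\int[leb]_x ((phi \* partial i psi \+ psi \* partial i phi) x)%:E =
     \int[leb]_x ((phi x * partial i psi x)%:E + (partial i phi x * psi x)%:E))%E.
    by apply: eq_integral => x _; rewrite -EFinD [partial i phi x * _]mulrC.
  rewrite integralD// (pairingE pp0 p'0 pp' phiL dpsiL) (pairingE pp0 p'0 pp' dphiL psiL) -EFinD.
  by case.
have -> : A = pairing leb (fun x => grad phi x 0 i - g x 0 i) psi * -1 - pairing leb (phi \- u) (partial i psi).
  rewrite (pairingB pp0 p'0 pp' p1 phiL uL dpsiL).
  have -> : (fun x => grad phi x 0 i - g x 0 i) = partial i phi \- (fun x => g x 0 i).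
    by apply/funext => x /=; rewrite gradE.
  rewrite (pairingB pp0 p'0 pp' p1 dphiL (giL i) psiL) /A.
  move: ibp; move: (pairing _ _ _) (pairing _ _ _) (pairing _ _ _) (pairing _ _ _) => a b c d; lra.
have d1 := pairing_le pp0 p'0 pp' pL dpsiL.
have gL := vLpB p1 (test_fun_vLp pp0 tphi) gp.
have [cL cn] := Lp_coord i pp0 gL.1.
have cE : (fun x => (grad phi x - g x) 0 i) = (fun x => grad phi x 0 i - g x 0 i).
  by apply/funext => x; rewrite [LHS]mxE; congr (_ + _); rewrite mxE.
rewrite cE in cL cn.
have d2 := pairing_le pp0 p'0 pp' cL psiL.
have b1 : nrm leb p (phi \- u) * nrm leb p' (partial i psi) <= C * t * nrm leb p' (partial i psi).
  by apply: ler_wpM2r; [exact: nrm_ge0|exact: pn].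
have b2 : nrm leb p (fun x => grad phi x 0 i - g x 0 i) * nrm leb p' psi <= t * nrm leb p' psi.
  by apply: ler_wpM2r; [exact: nrm_ge0|exact: le_trans cn pg].
move: d1 d2 b1 b2 tK; rewrite /K.
move: (pairing _ _ _) (pairing _ _ _) (nrm _ _ _) (nrm _ _ _) (nrm _ _ _) (nrm _ _ _) => a b c d k l.
rewrite !ler_norml => d1 d2 b1 b2 tK; lra.
Qed.

Lemma in_Lq_W0 (q : R) u : 0 < q -> Lp leb q u -> (forall x, ~ Om x -> u x = 0) -> forall v,
  (forall x, Om x -> v x = u x) -> Lq_norm Om q%:E v = (nrm leb q u)%:E /\ in_Lq Om q%:E v.
Proof.
move=> q0 uL u0 v vu.
have E : (EFin \o v) \_ Om = EFin \o u.
  apply/funext => x; rewrite patchE; case: ifPn => [|/negP xO]; first by rewrite inE => /vu /= ->.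
  by rewrite /= u0// => Ox; apply: xO; rewrite inE.
have N1 : Lq_norm Om q%:E v = (nrm leb q u)%:E by rewrite /Lq_norm E nrmE.
split=> //; split; last by rewrite N1 ltry.
case: uL => mu' _; apply: eq_measurable_fun (measurable_funTS mu').
by move=> x; rewrite inE => /vu.
Qed.

Lemma sobolev_normE v u g : weak_gradient Om v g -> Lp leb p u -> (forall x, Om x -> v x = u x) ->
  (forall x, ~ Om x -> u x = 0) -> vLp p g -> (forall x, ~ Om x -> g x = 0) ->
  energy p Om (wgrad Om v) = (vnrm p g `^ p)%:E /\
  sobolev_norm p Om v = ((nrm leb p u `^ p + vnrm p g `^ p) `^ p^-1)%:E.
Proof.
move=> vg uL vu u0 gp g0; have wg := wgradP vg.
have E : energy p Om (wgrad Om v) = (vnrm p g `^ p)%:E.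
  rewrite (energy_weak_gradient p oOm wg vg) /energy -(vnrm_powR pp0 gp).
  apply: integral_off; [exact: mOm|by apply: measurable_enorm_powR; case: gp|].
  by move=> x Ox; rewrite g0// enorm0 powR0// gt_eqF.
split=> //; rewrite /sobolev_norm E.
have -> : (\int[leb]_(x in Om) (`|v x| `^ p)%:E)%E = (\int[leb]_(x in Om) (`|u x| `^ p)%:E)%E.
  by apply: eq_integral => x; rewrite inE => /vu ->.
have -> : (\int[leb]_(x in Om) (`|u x| `^ p)%:E)%E = (\int[leb]_x (`|u x| `^ p)%:E)%E.
  apply: integral_off; [exact: mOm|by apply: measurable_abs_powR; case: uL|].
  by move=> x /u0 ->; rewrite normr0 powR0// gt_eqF.
by rewrite (nrm_powR pp0 uL) -EFinD poweR_EFin.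
Qed.

Lemma W0_energy u g v : W0 Om p u g -> (forall x, Om x -> v x = u x) ->
  [/\ weak_gradient Om v (wgrad Om v), weak_gradient Om v g,
      energy p Om (wgrad Om v) = (vnrm p g `^ p)%:E &
      sobolev_norm p Om v = ((nrm leb p u `^ p + vnrm p g `^ p) `^ p^-1)%:E].
Proof.
move=> ug vu; have vg : weak_gradient Om v g.
  by apply: weak_gradient_congr (W0_weak_gradient ug) => // x /vu.
have wg := wgradP vg; have [gp g0 _] := ug; have [uL _] := W0_Lp adm ug.
have [] := sobolev_normE vg uL vu (fun x => @W0_off _ _ _ _ _ _ x ug) gp g0; split=> //.
Qed.

Lemma W0_csobolev0 u g v : W0 Om p u g -> (forall x, Om x -> v x = u x) -> csobolev0 p Om v.
Proof.
move=> ug vu; have [uL _] := W0_Lp adm ug; have gp := W0_vLp ug.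
have [wv vg _ _] := W0_energy ug vu.
split; first split.
- split; first exact: (in_Lq_W0 pp0 uL (fun x => @W0_off _ _ _ _ _ _ x ug) vu).2.
  exists g => // i; apply: (in_Lq_W0 pp0 (Lp_coord i pp0 gp).1 _ _).2 => // x Ox.
  by case: ug => _ g0 _; rewrite g0// mxE.
(* By the Poincare inequality the full Sobolev norm is at most [K] times the norm of the gradient;
   half of [e] is used so that the final inequality is strict. *)
- move=> e e0; pose K := (C `^ p + 1) `^ p^-1.
  have K0 : 0 < K by rewrite powR_gt0// ltr_wpDl// powR_ge0.
  have eK : 0 < e / (2 * K) by rewrite divr_gt0// mulr_gt0.
  have [phi [tphi pg _ pL pn]] := W0_approx adm ug eK; exists phi => //.
  have w := W0_add adm (-1) ug (W0_test adm tphi).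
  have vw x : Om x -> (v \- phi) x = u x + -1 * phi x by move=> /vu /= ->; rewrite mulN1r.
  have [_ _ _ ->] := W0_energy w vw.
  rewrite lte_fin.
  have -> : (fun x => u x + -1 * phi x) = (fun x => - 1 * (phi \- u) x).
    by apply/funext => x /=; rewrite !mulN1r opprB.
  rewrite (LpZ (-1) pp0 pL).2 normrN1 mul1r.
  have -> : (fun x => g x + -1 *: grad phi x) = (fun x => g x - grad phi x).
    by apply/funext => x; rewrite scaleN1r.
  rewrite vnrmBC; apply: (@le_lt_trans _ _ (e / (2 * K) * K)); last first.
    by rewrite invfM mulrA mulfVK ?gt_eqF// ltr_pdivrMr// ltr_pMr// ltr1n.
  have h1 := powR_le (ltW pp0) (nrm_ge0 _ _ _) pn.
  have h2 := powR_le (ltW pp0) (vnrm_ge0 _ _) pg.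
  have b0 : 0 <= nrm leb p (phi \- u) `^ p + vnrm p (fun x => grad phi x - g x) `^ p.
    by apply: addr_ge0; exact: powR_ge0.
  apply: le_trans (powR_le _ b0 (lerD h1 h2)) _; first by rewrite invr_ge0 ltW.
  rewrite powRM; [|exact: ltW|exact: ltW].
  have c0 : 0 <= C `^ p + 1 by rewrite addr_ge0// powR_ge0.
  rewrite -[X in (_ + X) `^ _]mul1r -mulrDl (powRM _ c0 (powR_ge0 _ _)).
  by rewrite -powRrM divff ?gt_eqF// powRr1; [rewrite mulrC|exact: ltW].
- move=> x Ox; have cu := W0_continuous adm ug (x := x).
  apply/continuous_at_normP => e e0; have /continuous_at_normP /(_ e e0)[r r0 hr] := cu.
  have /nbhs_cubeP[r' r'0 hr'] : nbhs x Om by exact: open_nbhs_nbhs.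
  exists (Num.min r r'); first by rewrite lt_min r0.
  by move=> y; rewrite lt_min => /andP[/hr h /hr' Oy]; rewrite !vu.
Qed.

Lemma ae_eq0_continuous E (f : V -> R) : open E -> (forall x, E x -> {for x, continuous f}) ->
  {ae leb, forall x, E x -> f x = 0} -> forall x, E x -> f x = 0.
Proof.
move=> oE cf [A [mA A0 nA]] x Ex; apply: contrapT => fx; have f0 : 0 < `|f x| by rewrite normr_gt0; exact/eqP.
have /continuous_at_normP /(_ _ f0)[r r0 hr] := cf x Ex.
have /nbhs_cubeP[r' r'0 hr'] : nbhs x E by exact: open_nbhs_nbhs.
have m0 : 0 < Num.min r r' by rewrite lt_min r0.
have := lebesgue_ball_gt0 x m0; apply/negP; rewrite -leNgt -A0.
have mB : measurable [set y : V | `|x - y| < Num.min r r'].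
  apply: measurable_open_rV; rewrite openE => z /= xz; apply/nbhs_cubeP.
  exists (Num.min r r' - `|x - z|); first by rewrite subr_gt0.
  move=> y zy /=; rewrite (_ : x - y = (x - z) + (z - y)); last by rewrite addrA subrK.
  by apply: le_lt_trans (ler_normD _ _) _; rewrite addrC -ltrBrDr.
apply: le_measure; rewrite ?inE// => y /=; rewrite lt_min => /andP[xy1 xy2]; apply: nA => /(_ (hr' y xy2)) fy.
by have := hr y xy1; rewrite fy subr0 ltxx.
Qed.

(** The approximating test functions are Cauchy in energy, so by completeness they converge
    everywhere to a continuous function. It has zero [L^p] distance to [v] extended by 0, and two
    continuous functions equal almost everywhere on an open set are equal there. *)
Lemma csobolev0_W0 v : csobolev0 p Om v ->
  exists g, W0 Om p (fun x => \1_Om x * v x) g /\ weak_gradient Om v g.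
Proof.
move=> [[[[mv vL] [h vh hL]] appr] cv]; pose v' := (fun x => \1_Om x * v x) : V -> R.
have v'E : v' = v \_ Om.
  by apply/funext => x; rewrite /v' indicE patchE; case: ifP; rewrite ?mul1r ?mul0r.
have patchL (k : V -> R) : in_Lq Om p%:E k -> Lp leb p (k \_ Om).
  move=> [mk kL]; split; first by apply/(measurable_restrictT _ mOm).
  move: kL; rewrite /Lq_norm; congr ('N[_]__[_] < _)%E; apply/funext => x; rewrite /= !patchE.
  by case: ifP.
pose g : V -> V := fun x => \row_i ((fun x => h x 0 i) \_ Om) x.
have gi i : (fun x => g x 0 i) = (fun x => h x 0 i) \_ Om by apply/funext => x; rewrite mxE.
have gL : vLp p g by apply: (vLp_coords p1 _).1 => i; rewrite gi; exact: patchL.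
have gh x : Om x -> g x = h x by move=> Ox; apply/rowP => i; rewrite mxE patchE mem_set.
have g0 x : ~ Om x -> g x = 0 by move=> Ox; apply/rowP => i; rewrite !mxE patchE memNset.
have v'L : Lp leb p v' by rewrite v'E; exact: patchL.
have vg : weak_gradient Om v g.
  case: vh => Lv Lh vh; split=> //; first by move=> i; apply: Lp_L1loc; exact: (Lp_coord i pp0 gL).1.
  move=> phi i tphi; rewrite vh//; congr oppe; apply: eq_integral => x; rewrite inE => Ox.
  by rewrite gh.
have v'0 x : ~ Om x -> v' x = 0 by move=> Ox; rewrite /v' indicE memNset// mul0r.
have vv' x : Om x -> v x = v' x by move=> Ox; rewrite /v' indicE mem_set// mul1r.
have ap (e : R) : 0 < e -> exists phi, [/\ test_fun Om phi, nrm leb p (v' \- phi) <= e &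
    vnrm p (fun x => grad phi x - g x) <= e].
  move=> e0; have [phi tphi q] := appr e e0; exists phi.
  have tW := W0_test adm tphi.
  have [_ g0' _] := tW.
  have vL' := (LpB p1 v'L (test_fun_Lp pp0 tphi)).1; have gL' := (vLpB p1 gL (test_fun_vLp pp0 tphi)).1.
  have vvp x : Om x -> (v \- phi) x = (v' \- phi) x by move=> /vv' /= ->.
  have o1 x : ~ Om x -> (v' \- phi) x = 0 by move=> Ox /=; rewrite v'0// (test_fun_off tphi)// subrr.
  have o2 x : ~ Om x -> g x - grad phi x = 0 by move=> Ox /=; rewrite g0// g0'// subrr.
  have [_ SE] := sobolev_normE (weak_gradientB oOm vg (W0_weak_gradient tW)) vL' vvp o1 gL' o2.
  move: q; rewrite SE lte_fin vnrmBC; move: (nrm_ge0 leb p (v' \- phi)) (vnrm_ge0 p (fun x => grad phi x - g x)).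
  move: (nrm _ _ _) (vnrm _ _) => a b a0 b0 ab.
  have h0 (x y : R) : 0 <= x -> 0 <= y -> x <= (x `^ p + y `^ p) `^ p^-1.
    move=> x0 y0; rewrite -[leLHS](powRr1 x0) -[X in _ `^ X](@divff _ p) ?gt_eqF// powRrM.
    by apply: powR_le; rewrite ?invr_ge0 ?powR_ge0 ?(ltW pp0)// lerDl powR_ge0.
  split=> //; first exact: le_trans (h0 a b a0 b0) (ltW ab).
  by apply: le_trans (h0 b a b0 a0) _; rewrite addrC; exact: ltW.
have n0 (n : nat) : 0 < n.+1%:R^-1 :> R by rewrite invr_gt0.
have /choice[phi hphi] : forall n, exists phi, [/\ test_fun Om phi, nrm leb p (v' \- phi) <= n.+1%:R^-1 &
    vnrm p (fun x => grad phi x - g x) <= n.+1%:R^-1] by move=> n; exact: ap.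
have tphi n : test_fun Om (phi n) by case: (hphi n).
have small (e : R) : 0 < e -> exists n0, forall n, (n0 <= n)%N -> n.+1%:R^-1 <= e.
  move=> e0; have /seq_cvgP /(_ e e0)[m hm] := @cvg_harmonic R; exists m => n /hm.
  rewrite subr0 ger0_norm; last exact/ltW/n0.
  exact: ltW.
have phig (e : R) : 0 < e -> exists n0, forall n, (n0 <= n)%N -> vnrm p (fun x => grad (phi n) x - g x) <= e.
  by move=> /small[m hm]; exists m => n /hm; apply: le_trans; case: (hphi n).
have [||u' [g' [ug' lim]]] := W0_test_complete adm (phi := phi); first exact: tphi.
  move=> e e0; have e3 : 0 < e / 3 by rewrite divr_gt0.
  have [m hm] := phig _ e3; exists m => i j /hm h1 /hm h2.
  have := vnrm_triangle p1 (test_fun_vLp pp0 (tphi i)) gL (test_fun_vLp pp0 (tphi j)).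
  rewrite [X in _ + X]vnrmBC; move: h1 h2; move: (vnrm _ _) (vnrm _ _) (vnrm _ _) => a b c; lra.
have diff n := W0_add adm (-1) ug' (W0_test adm (tphi n)).
have dE n : (fun x => u' x + -1 * phi n x) = u' \- phi n by apply/funext => x; rewrite mulN1r.
have dgE n : (fun x => g' x + -1 *: grad (phi n) x) = (fun x => g' x - grad (phi n) x).
  by apply/funext => x; rewrite scaleN1r.
have [u'L _] := W0_Lp adm ug'.
have nv : nrm leb p (u' \- v') = 0.
  apply/le_anti; rewrite nrm_ge0 andbT; apply/ler_addgt0Pr => e e0; rewrite add0r.
  have e2 : 0 < e / 2 by rewrite divr_gt0.
  have eC : 0 < e / 2 / C by rewrite divr_gt0.
  have [m1 h1] := lim _ eC; have [m2 h2] := small _ e2; pose n := maxn m1 m2.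
  have pL := test_fun_Lp pp0 (tphi n).
  have [_] := LpD p1 (LpB p1 u'L pL).1 (LpB p1 pL v'L).1.
  have -> : (u' \- phi n) \+ (phi n \- v') = u' \- v' by apply/funext => x /=; rewrite addrA subrK.
  move/le_trans; apply; have [_ k1] := W0_Lp adm (diff n); rewrite dE dgE in k1.
  have k2 := h1 n (leq_maxl _ _); rewrite vnrmBC in k2.
  have k3 : nrm leb p (phi n \- v') <= e / 2.
    have [_ k _] := hphi n; apply: le_trans (h2 n (leq_maxr _ _)); apply: le_trans k.
    have -> : phi n \- v' = (fun x => -1 * (v' \- phi n) x) by apply/funext => x /=; rewrite mulN1r opprB.
    by have [_ ->] := LpZ (-1) pp0 (LpB p1 v'L pL).1; rewrite normrN1 mul1r.
  have k4 : C * vnrm p (fun x => g' x - grad (phi n) x) <= C * (e / 2 / C).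
    by apply: ler_wpM2l; [exact: ltW|exact: k2].
  have k5 : C * (e / 2 / C) = e / 2 by field; rewrite gt_eqF.
  move: k1 k3 k4; rewrite k5; move: (nrm _ _ _) (nrm _ _ _) (C * _) => a b c; lra.
have cv' x : Om x -> {for x, continuous v'}.
  move=> Ox; apply/continuous_at_normP => e e0; have /continuous_at_normP /(_ e e0)[r r0 hr] := cv x Ox.
  have /nbhs_cubeP[r' r'0 hr'] : nbhs x Om by exact: open_nbhs_nbhs.
  exists (Num.min r r'); first by rewrite lt_min r0.
  by move=> y; rewrite lt_min => /andP[/hr h' /hr' Oy]; rewrite -!vv'.
have u'v' x : u' x = v' x.
  have [Ox|Ox] := pselect (Om x); last by rewrite (W0_off ug' Ox) v'0.
  apply/eqP; rewrite -subr_eq0; apply/eqP.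
  have dL := (LpB p1 u'L v'L).1.
  apply: (@ae_eq0_continuous Om (u' \- v') oOm _ _ x Ox); first move=> y Oy.
    by apply: continuousB; [exact: (W0_continuous adm ug')|exact: cv'].
  have := nrm_powR pp0 dL; rewrite nv powR0 ?gt_eqF// => I0.
  have : ae_eq leb setT (fun x => (`|(u' \- v') x| `^ p)%:E) (cst 0%E).
    apply/ae_eq_integral_abs => //; first by apply: measurable_abs_powR; case: dL.
    apply: etrans I0; apply: eq_integral => y _; rewrite /= ger0_norm//; exact: powR_ge0.
  apply: filterS => y /(_ Logic.I) /= [] /eqP; rewrite powR_eq0 => /andP[]; rewrite normr_eq0 => /eqP + _ _.
  exact.
exists g; split=> //; split=> //; exists phi; split=> // x.
rewrite -[X in _ --> X]u'v'; apply/seq_cvgP => e e0.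
have eC : 0 < e / 2 / C by rewrite !divr_gt0.
have [m hm] := lim _ eC; exists m => n /hm h1.
have := W0_sup adm x (diff n); rewrite mulN1r dgE [vnrm _ _]vnrmBC distrC => h2; apply: le_lt_trans h2 _.
apply: (@le_lt_trans _ _ (C * (e / 2 / C))); first by apply: ler_wpM2l; [exact: ltW|exact: h1].
have -> : C * (e / 2 / C) = e / 2 by field; rewrite gt_eqF.
by rewrite ltr_pdivrMr// ltr_pMr// ltr1n.
Qed.

Lemma Linfty_le E (f : V -> R) (M : R) : 0 <= M -> (forall x, E x -> `|f x| <= M) ->
  (Lq_norm E +oo f <= M%:E)%E.
Proof.
move=> M0 fM; rewrite /Lq_norm unlock; case: ifP => // _; apply/ess_supP; apply: aeW => x /=.
by rewrite patchE; case: ifPn; rewrite ?inE ?abse0 ?lee_fin// => /fM.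
Qed.

(** A value above the essential bound would persist, by continuity, on a ball of positive measure
    inside [E]. *)
Lemma Linfty_ge E (f : V -> R) x : open E -> E x -> {for x, continuous f} ->
  (`|f x|%:E <= Lq_norm E +oo f)%E.
Proof.
move=> oE Ex cf; rewrite /Lq_norm unlock.
(* The norm at [+oo] is the essential supremum only when the whole space has positive measure. *)
rewrite (lebesgue_open_gt0 openT (x := x))//; rewrite leNgt; apply/negP => lt.
have [y [ly yf]] : exists y : R, (ess_sup leb (abse \o (EFin \o f) \_ E) <= y%:E)%E /\ y < `|f x|.
  move: lt; case: (ess_sup _ _) => [y|//|_]; first by exists y; rewrite lte_fin in lt *; split.
  by exists (`|f x| - 1); split; [exact: leNye|rewrite ltrBlDr ltrDl].
move: ly => /ess_supP [A [mA A0 nA]].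
have d0 : 0 < `|f x| - y by rewrite subr_gt0.
have /continuous_at_normP /(_ _ d0)[r r0 hr] := cf.
have /nbhs_cubeP[r' r'0 hr'] : nbhs x E by exact: open_nbhs_nbhs.
have m0 : 0 < Num.min r r' by rewrite lt_min r0.
have := lebesgue_ball_gt0 x m0; apply/negP; rewrite -leNgt -A0.
have mB : measurable [set y : V | `|x - y| < Num.min r r'].
  apply: measurable_open_rV; rewrite openE => z /= xz; apply/nbhs_cubeP.
  exists (Num.min r r' - `|x - z|); first by rewrite subr_gt0.
  move=> w zw /=; rewrite (_ : x - w = (x - z) + (z - w)); last by rewrite addrA subrK.
  by apply: le_lt_trans (ler_normD _ _) _; rewrite addrC -ltrBrDr.
apply: le_measure; rewrite ?inE// => z /=; rewrite lt_min => /andP[xz1 xz2]; apply: nA => /=.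
rewrite patchE mem_set; last exact: hr'.
move=> /=; rewrite lee_fin => fz; have := hr z xz1; apply/negP; rewrite -leNgt.
by have := lerB_dist (f x) (f z); lra.
Qed.

End bridge.

Lemma continuous_rVP (R : realType) N (f : 'rV[R]_N -> 'rV[R]_N) :
  (forall x (e : R), 0 < e -> exists2 r : R, 0 < r & forall y, `|x - y| < r -> `|f x - f y| < e) ->
  continuous f.
Proof.
move=> h x A /nbhs_cubeP[e e0 hA]; have [r r0 hr] := h x e e0.
by apply/nbhs_cubeP; exists r => // y /hr /hA.
Qed.

(** * Periodically perforated sets *)

Section perforated_geometry.
Context {R : realType} {N : nat}.
Local Notation V := 'rV[R]_N.
Implicit Types (x y : V) (j : 'rV[int]_N).
Variables (t : V) (K : set V).
Hypotheses (t0 : forall i, 0 < t 0 i) (cK : compact K) (Kcube : K `<=` closure (cube 2^-1)).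
Let Om := perforated t K.

Lemma closure_cube x (r : R) i : closure (cube r) x -> `|x 0 i| <= r.
Proof.
move=> cx; have cl : closed [set y : V | `|y 0 i| <= r].
  rewrite (_ : [set y : V | _] = (fun y : V => `|y 0 i|) @^-1` [set s | s <= r])//.
  apply: closed_comp; last exact: closed_le.
  move=> y _; apply/continuous_at_normP => e e0; exists e => // z yz.
  apply: le_lt_trans (ler_dist_dist _ _) _; apply: le_lt_trans yz.
  by have := ler_coord_norm (y - z) i; rewrite !mxE.
rewrite closureE in cx; apply: (cx [set y : V | `|y 0 i| <= r]); split=> // y /(_ i).
by move=> /andP[/ltW h1 /ltW h2] /=; rewrite ler_norml h1.
Qed.

Lemma dilationD x y : dilation t (x + y) = dilation t x + dilation t y.
Proof. by apply/rowP => i; rewrite !mxE mulrDr. Qed.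

Lemma dilation_inj x y : dilation t x = dilation t y -> x = y.
Proof.
move=> /rowP xy; apply/rowP => i; have := xy i; rewrite !mxE; apply: mulfI.
by rewrite gt_eqF.
Qed.

Definition undil (x : V) : V := \row_i (x 0 i / t 0 i).

Lemma undilK x : dilation t (undil x) = x.
Proof. by apply/rowP => i; rewrite !mxE mulrC divfK// gt_eqF. Qed.

Definition lattice j : V := dilation t (map_mx intr j).

Lemma perforatedP x : Om x <-> forall j k, K k -> x <> lattice j + dilation t k.
Proof.
split=> [Ox j k Kk xE|h [j _ [_ [k Kk <-] xE]]].
  apply: Ox; exists j => //; exists (map_mx intr j + k); first by exists k.
  by rewrite xE dilationD.
by apply: (h j k Kk); rewrite -xE dilationD.
Qed.

Lemma lattice_shift j x : Om (lattice j + x) <-> Om x.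
Proof.
have sh a y : Om y -> Om (lattice a + y).
  move=> /perforatedP h; apply/perforatedP => b k Kk E; apply: (h (b - a) k Kk).
  have -> : lattice (b - a) = lattice b - lattice a.
    by rewrite /lattice; apply/rowP => i; rewrite !mxE intrB mulrBr.
  by rewrite addrAC -E addrAC subrr add0r.
split; last exact: sh.
move=> /(sh (- j)); rewrite addrA (_ : lattice (- j) = - lattice j) ?addNr ?add0r//.
by apply/rowP => i; rewrite !mxE intrN mulrN.
Qed.

Lemma K_half k i : K k -> `|k 0 i| <= 2^-1.
Proof. by move=> /Kcube; exact: closure_cube. Qed.

Lemma continuous_dilation a : continuous (fun x : V => a + dilation t x).
Proof.
apply: continuous_rVP => x e e0; pose M := 1 + \sum_i t 0 i.
have M0 : 0 < M by rewrite ltr_pwDl// sumr_ge0// => i _; exact/ltW.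
exists (e / M); first by rewrite divr_gt0.
move=> y xy; rewrite opprD addrACA subrr add0r.
apply: ltr_norm_coord => // i; rewrite !mxE -mulrBr normrM.
rewrite gtr0_norm//; apply: (@le_lt_trans _ _ (M * `|x - y|)); last first.
  by rewrite mulrC -ltr_pdivlMr.
apply: ler_pM => //; first exact/ltW.
  rewrite /M (bigD1 i)//= addrCA lerDl addr_ge0// sumr_ge0// => ? _; exact/ltW.
by have := ler_coord_norm (x - y) i; rewrite !mxE.
Qed.

(** The union of the holes is infinite but locally finite: points at distance less than 1 from [x]
    meet only holes whose index has coordinates bounded by [m], and each hole is compact. *)
Lemma open_perforated : open Om.
Proof.
(* If [y] is in the hole of index [j], then [j] is [y/t - k] coordinatewise, with [|y| <= |x| + 1]
   and [|k| <= 1/2]. The ordinals below [2 m + 1] code, after a shift by [m], the integers between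
   [-m] and [m]. *)
rewrite openE => x Ox; pose m := Num.bound (\sum_i ((`|x| + 1) / t 0 i) + 1).
pose J (f : {ffun 'I_N -> 'I_(m + m).+1}) : 'rV[int]_N := \row_i ((f i)%:Z - m%:Z).
have cl f : \forall y \near nbhs x, ~ ((fun k => lattice (J f) + dilation t k) @` K) y.
  have cI : compact ((fun k => lattice (J f) + dilation t k) @` K).
    apply: continuous_compact => //; apply: continuous_subspaceT => y.
    exact: continuous_dilation.
  have : open (~` ((fun k => lattice (J f) + dilation t k) @` K)).
    by apply: closed_openC; exact: compact_closed_rV.
  rewrite openE => /(_ x); apply => -[k Kk xE]; apply: ((perforatedP x).1 Ox (J f) k Kk).
  by rewrite xE.
have n1 : \forall y \near nbhs x, `|x - y| < 1 by apply/nbhs_cubeP; exists 1.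
have cl' := @filter_forall _ _ (fun f y => ~ ((fun k => lattice (J f) + dilation t k) @` K) y) (nbhs x) (nbhs_filter x) cl.
have c2 := @filterI _ (nbhs x) (nbhs_filter x) _ _ n1 cl'.
suff : nbhs x Om by [].
apply: (@filterS _ (nbhs x) (nbhs_filter x) _ _ _ c2) => y [xy hy]; apply/perforatedP => j k Kk yE.
have jm i : `|(j 0 i)%:~R| <= m%:R :> R.
  have yi : y 0 i = t 0 i * (j 0 i)%:~R + t 0 i * k 0 i by rewrite yE !mxE.
  have -> : (j 0 i)%:~R = y 0 i / t 0 i - k 0 i :> R.
    by rewrite yi; field; rewrite gt_eqF.
  apply: le_trans (ler_normB _ _) _; rewrite normrM (gtr0_norm (_ : 0 < (t 0 i)^-1)) ?invr_gt0//.
  apply: (@le_trans _ _ ((`|x| + 1) / t 0 i + 1)).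
    apply: lerD; last by apply: le_trans (K_half i Kk) _; rewrite invf_le1// ler1n.
    rewrite ler_pM2r ?invr_gt0//; apply: le_trans (ler_coord_norm _ _) _.
    rewrite (_ : y = x - (x - y)); last by rewrite opprB addrC subrK.
    by apply: le_trans (ler_normB _ _) _; rewrite lerD2l ltW.
  apply: le_trans (ltW (archi_boundP _)).
    rewrite lerD2r (bigD1 i)//= lerDl sumr_ge0// => l _; rewrite divr_ge0 ?addr_ge0//; exact/ltW.
  by rewrite addr_ge0// sumr_ge0// => l _; rewrite divr_ge0 ?addr_ge0//; exact/ltW.
pose a i := absz (j 0 i + m%:Z).
have jm' i : (0 <= j 0 i + m%:Z) && (a i < (m + m).+1)%N.
  have := jm i; rewrite -intr_norm -[m%:R]/((m%:Z)%:~R) ler_int ler_norml => /andP[h1 h2].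
  rewrite -lerBlDr sub0r h1 /= ltnS -lez_nat /a gez0_abs; last by rewrite -lerBlDr sub0r.
  by rewrite PoszD lerD2r.
pose f : {ffun 'I_N -> 'I_(m + m).+1} := [ffun i => inord (a i)].
apply: (hy f); exists k => //; rewrite yE (_ : J f = j)//.
apply/rowP => i; rewrite !mxE ffunE inordK; last by case/andP: (jm' i).
by rewrite /a gez0_abs ?addrK//; case/andP: (jm' i).
Qed.

Definition cell : set V := [set x | forall i, `|x 0 i| <= t 0 i / 2].

Lemma compact_cell : compact cell.
Proof.
have -> : cell = [set x : V | forall i, (fun i => `[- (t 0 i / 2), t 0 i / 2]%classic) i (x ord0 i)].
  by apply/seteqP; split=> x /= h i; have := h i; rewrite /= in_itv /= ler_norml.
by apply: (@rV_compact _ N (fun i => `[- (t 0 i / 2), t 0 i / 2]%classic)) => i; exact: segment_compact.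
Qed.

Lemma cell_cover x : exists j, cell (lattice j + x).
Proof.
exists (\row_i (- Num.floor (x 0 i / t 0 i + 2^-1))) => i; rewrite !mxE intrN.
have := floor_itv (x 0 i / t 0 i + 2^-1); rewrite intrD; set f := (_)%:~R => /andP[h1 h2].
have -> : t 0 i * - f + x 0 i = t 0 i * (x 0 i / t 0 i - f) by field; rewrite gt_eqF.
rewrite normrM gtr0_norm// ler_pM2l// ler_norml; lra.
Qed.

(** A point of the open cell can lie only in the hole of index 0: the index is a difference of a
    coordinate below 1/2 and one at most 1/2 in absolute value, hence an integer smaller than 1 in
    absolute value. *)
Lemma open_cellE : dilation t @` (cube 2^-1 `\` K) =
  [set x : V | forall i, `|x 0 i| < t 0 i / 2] `&` Om.
Proof.
apply/seteqP; split=> [_ [y [yc yK] <-]|x [xc Ox]].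
  split=> [i|].
    by rewrite mxE normrM gtr0_norm// ltr_pM2l// ltr_norml; exact: yc.
  apply/perforatedP => j k Kk E.
  have yi i : y 0 i - k 0 i = (j 0 i)%:~R.
    have /dilation_inj -> : dilation t y = dilation t (map_mx intr j + k) by rewrite dilationD.
    by rewrite !mxE addrK.
  have j0 i : j 0 i = 0.
    have := K_half i Kk; have := yc i; rewrite ler_norml => /andP[a1 a2] /andP[b1 b2].
    have h1 : (j 0 i)%:~R < 1 :> R by rewrite -yi; lra.
    have h2 : -1 < (j 0 i)%:~R :> R by rewrite -yi; lra.
    rewrite -[1]/(1%:~R) ltr_int in h1; rewrite -[-1]/((-1)%:~R) ltr_int in h2.
    by apply/le_anti; rewrite -ltzD1 h1 /=; move: h2; rewrite -lezD1 addNr.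
  apply: yK; suff -> : y = k by [].
  by apply/rowP => i; apply/eqP; rewrite -subr_eq0 yi j0.
exists (undil x); last exact: undilK.
split=> [i|Kx].
  have := xc i; rewrite mxE -ltr_norml normrM (gtr0_norm (_ : 0 < (t 0 i)^-1)) ?invr_gt0//.
  by rewrite ltr_pdivrMr// mulrC.
apply: ((perforatedP x).1 Ox 0 _ Kx); rewrite undilK /lattice map_mx0.
by apply/rowP => i; rewrite !mxE mulr0 add0r.
Qed.

Lemma open_open_cell : open (dilation t @` (cube 2^-1 `\` K)).
Proof.
rewrite open_cellE; apply: openI; last exact: open_perforated.
rewrite openE => x xc; have cl i : \forall y \near nbhs (x : V), `|(y : V) 0 i| < t 0 i / 2.
  have d0 : 0 < t 0 i / 2 - `|x 0 i| by rewrite subr_gt0.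
  apply/nbhs_cubeP; exists (t 0 i / 2 - `|x 0 i|) => // y xy.
  have := le_lt_trans (ler_coord_norm (x - y) i) xy; rewrite !mxE distrC => h.
  by have := ler_dist_dist (y 0 i) (x 0 i); rewrite ler_norml; lra.
exact: filter_forall cl.
Qed.

(** Maximum points are sought in the closed cell, which is compact, while the normalization of the
    minimizers concerns the open one. Shrinking a boundary point slightly towards the centre joins
    the two. *)
Lemma cell_approx x (r : R) : 0 < r -> cell x -> Om x ->
  exists2 y, (dilation t @` (cube 2^-1 `\` K)) y & `|x - y| < r.
Proof.
move=> r0 xc Ox; have /nbhs_cubeP[r' r'0 hr'] : nbhs x Om.
  by have := open_perforated; rewrite openE => /(_ _ Ox).
pose m := Num.min (Num.min r r' / (`|x| + 1)) 1.
have x1 : 0 < `|x| + 1 by rewrite ltr_wpDl.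
have m0 : 0 < m by rewrite lt_min divr_gt0 ?lt_min ?r0//=.
have m1 : m <= 1 by rewrite ge_min lexx orbT.
pose s := 2^-1 * m; have s0 : 0 < s by rewrite mulr_gt0.
have s1 : s < 1 by rewrite /s; lra.
exists ((1 - s) *: x); last first.
  rewrite scalerBl scale1r opprB addrC subrK normrZ gtr0_norm//.
  have h : m * (`|x| + 1) <= Num.min r r'.
    by rewrite -ler_pdivlMr// /m ge_min lexx.
  have : Num.min r r' <= r by rewrite ge_min lexx.
  have : 0 <= m * `|x| by rewrite mulr_ge0// ltW.
  rewrite mulrDr mulr1 in h; rewrite /s -mulrA; lra.
rewrite open_cellE; split.
  move=> i; rewrite mxE normrM gtr0_norm; last by rewrite subr_gt0.
  apply: (@le_lt_trans _ _ ((1 - s) * (t 0 i / 2))).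
    by apply: ler_wpM2l; [rewrite subr_ge0 ltW|exact: xc].
  by rewrite gtr_pMl ?divr_gt0// ltrBlDr ltrDl.
apply: hr'; rewrite scalerBl scale1r opprB addrC subrK normrZ gtr0_norm//.
have h : m * (`|x| + 1) <= Num.min r r'.
  by rewrite -ler_pdivlMr// /m ge_min lexx.
have : Num.min r r' <= r' by rewrite ge_min lexx orbT.
have : 0 <= m * `|x| by rewrite mulr_ge0// ltW.
rewrite mulrDr mulr1 in h; rewrite /s -mulrA; lra.
Qed.

Lemma perforated_nonempty : K `<` closure (cube 2^-1) -> exists x, Om x.
Proof.
move=> [_ /existsNP[y /not_implyP[yc yK]]].
have : open (~` K) by apply: closed_openC; exact: compact_closed_rV.
rewrite openE => /(_ y yK) /nbhs_cubeP[r r0 hr].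
have [z [zc]] := yc [set z | `|y - z| < r] ltac:(by apply/nbhs_cubeP; exists r).
move=> zy; exists (dilation t z).
have : (dilation t @` (cube 2^-1 `\` K)) (dilation t z) by exists z => //; split=> //; exact: hr.
by rewrite open_cellE => -[].
Qed.

Lemma corner_notin x0 j : K x0 -> ~ Om (tile_corner t x0 j).
Proof. by move=> Kx0 /perforatedP /(_ j x0 Kx0); apply; rewrite /tile_corner dilationD. Qed.

End perforated_geometry.

(** Serves contrapositively: positive capacity provides a point of [K], the base point of the
    tiling. *)
Lemma cap_set0 (R : realType) N (p : R) (E : set 'rV[R]_N) : 0 < p -> cap p set0 E = 0%E.
Proof.
move=> p0; have I0 : energy p E (grad (cst 0 : 'rV[R]_N -> R)) = 0%E.
  rewrite /energy; apply: integral0_eq => x _.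
  rewrite (_ : grad _ x = 0) ?enorm0 ?powR0 ?gt_eqF//.
  by apply/rowP => i; rewrite !mxE partial_cst.
apply/eqP; rewrite eq_le; apply/andP; split.
  by apply: ereal_inf_lbound; exists (cst 0) => //; split=> //; exact: test_fun0.
apply: le_ereal_inf_tmp => _ [phi _ <-]; apply: integral_ge0 => x _.
by rewrite lee_fin powR_ge0.
Qed.

Lemma perforated_admissible (R : realType) N (p : R) (t : 'rV[R]_N) (K : set 'rV[R]_N) :
  (2 <= N)%N -> N%:R < p -> (forall i, 0 < t 0 i) -> compact K -> K `<=` closure (cube 2^-1) ->
  (exists x0, K x0) -> exists C, admissible (perforated t K) p C.
Proof.
move=> N2 pN t0 cK Kc [x0 Kx0].
have p2 : 2 < p by apply: le_lt_trans pN; rewrite ler_nat.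
have p1 : 1 < p by apply: lt_trans p2; rewrite ltr1n.
pose B := box_const p t; have B0 : 0 <= B by exact: box_const_ge0.
pose D := (\prod_i t 0 i) `^ p^-1.
have D0 : 0 <= D by exact: powR_ge0.
(* Dominates both the sup constant [B] and the Poincare constant [D * B]; the summand 1 makes it
   positive. *)
exists (B + D * B + 1); split.
- exact: open_perforated.
- exact: ltW.
- by rewrite ltr_wpDl// addr_ge0// mulr_ge0.
- move=> phi tphi; have v0 j : phi (tile_corner t x0 j) = 0.
    by apply: (test_fun_off tphi); exact: corner_notin.
  have le1 (a : R) : 0 <= a -> B * a <= (B + D * B + 1) * a /\ D * B * a <= (B + D * B + 1) * a.
    move=> a0; split; apply: ler_wpM2r => //; first by rewrite -addrA lerDl addr_ge0// mulr_ge0.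
    by rewrite [B + _]addrC -addrA lerDl addr_ge0.
  have [l1 l2] := le1 _ (vnrm_ge0 p (grad phi)); split.
    by move=> x; apply: le_trans (poincare_sup p1 pN t0 tphi v0 x) l1.
  by apply: le_trans (poincare_Lp p1 pN t0 tphi v0).2 l2.
- move=> e e0; have [r r0 hr] := cube_const_small p1 pN e0; exists r => // phi x y tphi xy.
  apply: le_trans (cube_osc p1 pN r0 tphi xy) _; apply: ler_wpM2r; first exact: vnrm_ge0.
  exact: hr.
Qed.

(** * The constants lambda and their limit *)

Section real_facts.
Context {R : realType}.
Implicit Types (x y a : R).

Lemma powR_lip p B x y : 1 <= p -> 0 <= x <= B -> 0 <= y <= B ->
  `|x `^ p - y `^ p| <= p * B `^ (p - 1) * `|x - y|.
Proof.
move=> p1; wlog yx : x y / y <= x.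
  move=> h hx hy; case: (leP y x) => [yx|/ltW xy]; first exact: h.
  by rewrite distrC [X in _ * X]distrC; exact: h.
move=> /andP[x0 xB] /andP[y0 yB]; have p0 : 0 <= p by exact: le_trans p1.
rewrite ger0_norm; last by rewrite subr_ge0; exact: powR_le.
rewrite ger0_norm ?subr_ge0//; apply: le_trans (powR_tangent x0 y0 p1) _.
apply: ler_wpM2r; first by rewrite subr_ge0.
by apply: ler_wpM2l => //; apply: powR_le => //; rewrite subr_ge0.
Qed.

Lemma powR_bernoulli a r : 0 <= a -> 1 <= r -> 1 + r * (a - 1) <= a `^ r.
Proof.
move=> a0 r1; have := @powR_tangent R 1 a r ler01 a0 r1.
by rewrite !powR1 mulr1; lra.
Qed.

Lemma powR_unbounded a B : 1 < a -> exists Q, forall q, Q <= q -> B < a `^ q.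
Proof.
move=> a1; have d0 : 0 < a - 1 by rewrite subr_gt0.
exists (Num.max 1 (B / (a - 1))) => q; rewrite ge_max => /andP[q1 hq].
apply: lt_le_trans (powR_bernoulli (ltW (lt_trans ltr01 a1)) q1).
by move: hq; rewrite ler_pdivrMr// => hq; lra.
Qed.

(** The constants are infima of energies, that is of [p]-th powers; this extracts the infimum of the
    gradient norms themselves as a positive real number. *)
Lemma ereal_inf_powR (S : set R) (c p : R) : 0 < p -> 0 < c -> S !=set0 -> (forall s, S s -> c <= s) ->
  exists L : R, [/\ c <= L, ereal_inf [set (s `^ p)%:E | s in S] = (L `^ p)%:E,
    (forall s, S s -> L <= s) & forall e, 0 < e -> exists2 s, S s & s < L + e].
Proof.
move=> p0 c0 S0 Sc; have hS : has_inf S by split=> //; exists c.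
have cL : c <= inf S by exact: lb_le_inf.
have L0 : 0 <= inf S by exact: le_trans (ltW c0) cL.
have Ls s : S s -> inf S <= s by move=> Ss; apply: ge_inf => //; exists c.
exists (inf S); split=> //; last first.
  by move=> e e0; have [s Ss sl] := inf_adherent e0 hS; exists s.
apply/eqP; rewrite eq_le; apply/andP; split; last first.
  apply: le_ereal_inf_tmp => _ [s Ss <-]; rewrite lee_fin; apply: powR_le; [exact: ltW|exact: L0|exact: Ls].
rewrite leNgt; apply/negP => lt.
have [s0 Ss0] := S0.
have [M ME] : exists M : R, ereal_inf [set (s `^ p)%:E | s in S] = M%:E.
  have : (ereal_inf [set (s `^ p)%:E | s in S] <= (s0 `^ p)%:E)%E by apply: ereal_inf_lbound; exists s0.
  by move: lt; case: (ereal_inf _) => // M _ _; exists M.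
rewrite ME lte_fin in lt; have M0 : 0 <= M by exact: le_trans (powR_ge0 _ _) (ltW lt).
have lt' : inf S < M `^ p^-1.
  rewrite -[ltLHS](powRr1 L0) -[X in _ `^ X < _](@divff _ p) ?gt_eqF// powRrM.
  by apply: gt0_ltr_powR; rewrite ?invr_gt0 ?nnegrE ?powR_ge0.
have [s Ss] := inf_adherent (eps := M `^ p^-1 - inf S) ltac:(by rewrite subr_gt0) hS.
rewrite addrC subrK => sM; have s0' : 0 <= s by exact: le_trans L0 (Ls s Ss).
have : (M%:E <= (s `^ p)%:E)%E by rewrite -ME; apply: ereal_inf_lbound; exists s.
rewrite lee_fin leNgt => /negP; apply.
rewrite -[ltRHS](powRr1 M0) -[X in _ < _ `^ X](@mulVf _ p) ?gt_eqF// powRrM.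
by apply: gt0_ltr_powR; rewrite ?nnegrE ?powR_ge0.
Qed.

Lemma compact_subseq N (Y : set 'rV[R]_N) (z : nat -> 'rV[R]_N) : compact Y -> (forall n, Y (z n)) ->
  exists (s : nat -> nat) z', [/\ {homo s : m n / (m < n)%N}, Y z' &
    forall r : R, 0 < r -> exists n0, forall n, (n0 <= n)%N -> `|z (s n) - z'| < r].
Proof.
move=> cY Yz; have [|z' [Yz' cl]] := cY (z @ \oo) _; first by exists 0%N => // n _; exact: Yz.
have near k n : exists m, (n < m)%N /\ `|z m - z'| < k.+1%:R^-1.
  have nb : nbhs z' [set y | `|z' - y| < k.+1%:R^-1].
    by apply/nbhs_cubeP; exists k.+1%:R^-1 => //; rewrite invr_gt0.
  have fi : (z @ \oo) [set z m | m in [set m | (n < m)%N]].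
    by exists n.+1 => // m /= nm; exists m.
  by have [_ [[m nm <-] /= zm]] := cl _ _ fi nb; exists m; rewrite distrC.
have /choice[f hf] : forall kn : nat * nat, exists m, (kn.2 < m)%N /\ `|z m - z'| < kn.1.+1%:R^-1.
  by move=> [k n]; exact: near.
pose s := fix s k := if k is k'.+1 then f (k, s k') else f (0, 0)%N.
exists s, z'; split=> //.
  apply: homo_ltn; first by move=> a b c; exact: ltn_trans.
  by move=> i /=; exact: (hf (_, _)).1.
move=> r r0; have /seq_cvgP /(_ r r0)[n0 hn0] := @cvg_harmonic R.
exists n0 => n /hn0; rewrite subr0 ger0_norm; last by rewrite invr_ge0.
apply: lt_trans; case: n => [|n] /=; exact: (hf (_, _)).2.
Qed.

End real_facts.

Section lambda.
Context {R : realType} {N : nat}.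
Local Notation V := 'rV[R]_N.
Local Notation leb := (@lebesgue_rV R N).
Variables (Om : set V) (p C : R).
Hypothesis adm : admissible Om p C.
Hypothesis Om0 : exists x, Om x.
Implicit Types (u v : V -> R) (g h : V -> V).

Let oOm : open Om. Proof. by case: adm. Qed.
Let p2 : 2 <= p. Proof. by case: adm. Qed.
Let p1 : 1 <= p. Proof. exact: le_trans (ler1n _ 2) p2. Qed.
Let pp0 : 0 < p. Proof. exact: lt_le_trans p1. Qed.
Let C0 : 0 < C. Proof. by case: adm. Qed.

(** Uniform convexity: if the norms tend to [L] and midpoints are not appreciably shorter than [L],
    Clarkson's inequality leaves nothing for the half differences. *)
Lemma clarkson_cauchy (g : nat -> V -> V) (L : R) : (forall n, vLp p (g n)) ->
  vnrm p (g n) @[n --> \oo] --> L ->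
  (forall e : R, 0 < e -> exists n0, forall m n, (n0 <= m)%N -> (n0 <= n)%N ->
     L - e <= vnrm p (fun x => 2^-1 *: (g m x + g n x))) ->
  forall e : R, 0 < e -> exists n0, forall m n, (n0 <= m)%N -> (n0 <= n)%N ->
     vnrm p (fun x => g m x - g n x) < e.
Proof.
move=> gL /seq_cvgP lim mid e e0.
have L0 : 0 <= L by apply: (@seq_cvg_ge _ (fun n => vnrm p (g n)) L 0 0); [exact/seq_cvgP|move=> n _; exact: vnrm_ge0].
pose B := L + 1; pose M := p * B `^ (p - 1).
have M0 : 0 <= M by rewrite mulr_ge0 ?powR_ge0// ltW.
(* Each of the other three [p]-th powers is within [eta] of [L^p], so the half difference has its
   [p]-th power below [2 * eta], which is [(e/2)^p]. *)
pose eta := (e / 2) `^ p / 2.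
have eta0 : 0 < eta by rewrite divr_gt0 ?powR_gt0 ?divr_gt0.
pose d := Num.min 1 (eta / 2 / (M + 1)).
have M1 : 0 < M + 1 by rewrite ltr_wpDl.
have d0 : 0 < d by rewrite lt_min ltr01 /=; apply: divr_gt0 => //; apply: divr_gt0.
have d1 : d <= 1 by rewrite ge_min lexx.
have Md : M * d < eta.
  apply: (@le_lt_trans _ _ (eta / 2)); last by rewrite ltr_pdivrMr// ltr_pMr// ltr1n.
  apply: (@le_trans _ _ ((M + 1) * d)); first by apply: ler_wpM2r; [exact: ltW|rewrite lerDl].
  by rewrite mulrC -ler_pdivlMr ?ltr_wpDl// /d ge_min lexx orbT.
have near (c : R) : 0 <= c -> `|c - L| <= d -> `|c `^ p - L `^ p| < eta.
  move=> c0 cL; apply: le_lt_trans Md.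
  have LB : 0 <= L <= B by rewrite L0 /= /B lerDl.
  have cB : 0 <= c <= B by rewrite c0 /= /B; move: cL; rewrite ler_norml; lra.
  apply: le_trans (powR_lip p1 cB LB) _; exact: ler_wpM2l.
have [n1 h1] := lim d d0; have [n2 h2] := mid d d0.
exists (maxn n1 n2) => m n; rewrite !geq_max => /andP[/h1 m1 m2] /andP[/h1 k1 k2].
have m12 := h2 m n m2 k2.
have ck := clarkson p2 (gL m) (gL n).
have [DL Dn] := vLpD p1 (gL m) (gL n).
have := (vLpZ 2^-1 pp0 DL).2; rewrite ger0_norm; last by rewrite invr_ge0.
have := (vLpZ 2^-1 pp0 (vLpB p1 (gL m) (gL n)).1).2; rewrite ger0_norm; last by rewrite invr_ge0.
move=> E1 E2; move: ck m12; rewrite E1 E2.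
have a0 := vnrm_ge0 p (g m); have b0 := vnrm_ge0 p (g n).
have s0 := vnrm_ge0 p (fun x => g m x + g n x); have t0 := vnrm_ge0 p (fun x => g m x - g n x).
move: Dn m1 k1 a0 b0 s0 t0 {E1 E2}.
move: (vnrm p (g m)) (vnrm p (g n)) (vnrm p (fun x => g m x + g n x)) (vnrm p (fun x => g m x - g n x)).
move=> a b c f cab aL bL a0 b0 c0 f0 ck mid'.
have na := near a a0 (ltW aL); have nb := near b b0 (ltW bL).
have nc : `|(2^-1 * c) `^ p - L `^ p| < eta.
  apply: near; first by rewrite mulr_ge0.
  by move: aL bL mid' cab; rewrite !ltr_norml ler_norml; lra.
rewrite ltNge; apply/negP => ef.
have : (e / 2) `^ p <= (2^-1 * f) `^ p.
  by apply: powR_le; [exact: ltW|apply: divr_ge0 => //; exact: ltW|rewrite mulrC ler_pM2l// invr_gt0].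
have -> : (e / 2) `^ p = 2 * eta by rewrite /eta; field.
move: ck na nb nc; rewrite !ltr_norml.
move: (a `^ p) (b `^ p) ((_ * c) `^ p) ((_ * f) `^ p) (L `^ p) => a' b' c' f' L'; lra.
Qed.

Lemma nrm_eq0_continuous (q : R) f : 0 < q -> Lp leb q f -> continuous f -> nrm leb q f = 0 ->
  forall x, f x = 0.
Proof.
move=> q0 fL cf n0; have I0 := nrm_powR q0 fL; rewrite n0 powR0 ?gt_eqF// in I0.
move=> x; apply: (@ae_eq0_continuous _ _ setT f openT _ _ x) => // [y _|]; first exact: cf.
have : ae_eq leb setT (fun x => (`|f x| `^ q)%:E) (cst 0%E).
  apply/ae_eq_integral_abs => //; first by apply: measurable_abs_powR; case: fL.
  by apply: etrans I0; apply: eq_integral => y _; rewrite /= ger0_norm//; exact: powR_ge0.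
by apply: filterS => y /(_ Logic.I) /= [] /eqP; rewrite powR_eq0 => /andP[]; rewrite normr_eq0 => /eqP + _ _.
Qed.

Lemma energy_W0 u g : W0 Om p u g -> energy p Om g = (vnrm p g `^ p)%:E.
Proof.
move=> [gp g0 _]; rewrite /energy -(vnrm_powR pp0 gp); apply: integral_off.
- exact: measurable_open_rV.
- by apply: measurable_enorm_powR; case: gp.
- by move=> x Ox; rewrite g0// enorm0 powR0// gt_eqF.
Qed.

(** Interpolating between the sup bound and the Poincare inequality keeps the same constant [C] for
    every [q], which is what makes bounds uniform as [q] grows. *)
Lemma W0_Lq (q : R) u g : p <= q -> W0 Om p u g -> Lp leb q u /\ nrm leb q u <= C * vnrm p g.
Proof.
move=> pq ug; have [uL un] := W0_Lp adm ug.
have q0 : 0 < q by exact: lt_le_trans pq.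
pose M := C * vnrm p g; have M0 : 0 <= M by rewrite mulr_ge0 ?vnrm_ge0// ltW.
have [L h] := nrm_interp pp0 pq M0 (fun x => W0_sup adm x ug) uL; split=> //.
rewrite leNgt; apply/negP => lt.
have : nrm leb q u `^ q <= M `^ q.
  apply: le_trans h _; have -> : M `^ q = M `^ (q - p) * M `^ p.
    have H : (q - p + p == 0) ==> (M != 0) by rewrite subrK gt_eqF.
    by rewrite -(powRD H) subrK.
  by apply: ler_wpM2l; [exact: powR_ge0|apply: powR_le; [exact: ltW|exact: nrm_ge0|exact: un]].
by rewrite leNgt gt0_ltr_powR// nnegrE// nrm_ge0.
Qed.

Definition Lam (q : \bar R) : R := fine (lambda p q Om) `^ p^-1.

Let test_bump : exists phi x, [/\ test_fun Om phi, Om x & 0 < phi x].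
Proof.
have [x Ox] := Om0; have /nbhs_cubeP[r r0 hr] : nbhs x Om by exact: open_nbhs_nbhs.
have r2 : 0 < r / 2 by rewrite divr_gt0.
have [eta [te _ ep]] := cube_bump_test x r2; exists eta, x; split=> //.
  apply: test_funS te => y /= yx; apply: hr; rewrite distrC; apply: le_lt_trans yx _.
  by rewrite ltr_pdivrMr// ltr_pMr// ltr1n.
by apply: ep; rewrite subrr normr0.
Qed.

Let grad_scale (c : R) phi : test_fun Om phi ->
  test_fun Om (fun x => c * phi x) /\ vnrm p (grad (fun x => c * phi x)) = `|c| * vnrm p (grad phi).
Proof.
move=> tp; split; first exact: test_funZ.
by rewrite gradZ; [exact: (vLpZ c pp0 (test_fun_vLp pp0 tp)).2|exact: test_fun_smooth tp].
Qed.

Let LamE (q : \bar R) (S : set R) : (forall x : \bar R, (exists2 phi, (test_fun Om phi /\ Lq_norm Om q phi = 1%E) &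
   energy p Om (grad phi) = x) <-> exists2 s, S s & (s `^ p)%:E = x) ->
  S !=set0 -> (forall s, S s -> C^-1 <= s) ->
  [/\ 0 < Lam q, lambda p q Om = (Lam q `^ p)%:E, C^-1 <= Lam q, forall s, S s -> Lam q <= s &
     forall e, 0 < e -> exists2 s, S s & s < Lam q + e].
Proof.
move=> SE S0 Sc; have c0 : 0 < C^-1 by rewrite invr_gt0.
have [L [cL LE Ls Le]] := ereal_inf_powR pp0 c0 S0 Sc.
have lE : lambda p q Om = (L `^ p)%:E.
  by rewrite -LE; congr ereal_inf; apply/seteqP; split=> x /SE.
have L0 : 0 < L by exact: lt_le_trans cL.
have -> : Lam q = L by rewrite /Lam lE /= -powRrM divff ?gt_eqF// powRr1// ltW.
by split.
Qed.

(** The infimum runs over test functions; the Rayleigh inequality passes to all of [W0] by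
    approximation in energy, which by [W0_Lq] is also approximation in [L^q]. *)
Lemma LamP (q : R) : p <= q -> [/\ 0 < Lam q%:E, lambda p q%:E Om = (Lam q%:E `^ p)%:E,
  C^-1 <= Lam q%:E, (forall u g, W0 Om p u g -> Lam q%:E * nrm leb q u <= vnrm p g) &
  forall e, 0 < e -> exists phi, [/\ test_fun Om phi, nrm leb q phi = 1 & vnrm p (grad phi) < Lam q%:E + e]].
Proof.
move=> pq; have q0 : 0 < q by exact: lt_le_trans pq.
have q1 : 1 <= q by exact: le_trans pq.
have NE phi : test_fun Om phi -> Lq_norm Om q%:E phi = (nrm leb q phi)%:E.
  move=> tp; apply: (in_Lq_W0 q0 (test_fun_Lp q0 tp) _ _).1 => // x.
  exact: test_fun_off tp.
have EE phi : test_fun Om phi -> energy p Om (grad phi) = (vnrm p (grad phi) `^ p)%:E.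
  by move=> tp; apply: energy_W0; exact: (W0_test adm tp).
pose S : set R := [set vnrm p (grad phi) | phi in [set phi | test_fun Om phi /\ nrm leb q phi = 1]].
have [|||L0 LE LC Ls Le] := @LamE q%:E S.
- move=> x; split=> [[phi [tp np] <-]|[_ [phi [tp np] <-] <-]].
    exists (vnrm p (grad phi)); last by rewrite EE.
    by exists phi => //; split=> //; move: np; rewrite NE// => -[].
  by exists phi; rewrite ?EE// NE// np.
- have [phi [x [tp Ox px]]] := test_bump.
  have n0 : 0 < nrm leb q phi.
    rewrite lt_neqAle nrm_ge0 andbT; apply/eqP => /esym n0.
    have := nrm_eq0_continuous q0 (test_fun_Lp q0 tp) (smooth_cont (test_fun_smooth tp)) n0 x.
    by move=> E; rewrite E ltxx in px.
  exists (vnrm p (grad (fun x => (nrm leb q phi)^-1 * phi x))); exists (fun x => (nrm leb q phi)^-1 * phi x) => //.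
  split; first exact: test_funZ.
  by rewrite (LpZ _ q0 (test_fun_Lp q0 tp)).2 ger0_norm ?invr_ge0 ?nrm_ge0// mulVf// gt_eqF.
- move=> _ [phi [tp np] <-]; have [_] := W0_Lq pq (W0_test adm tp).
  by rewrite np -ler_pdivrMl// mulr1.
split=> //; last by move=> e e0; have [_ [phi [tp np] <-] lt] := Le e e0; exists phi.
have test phi : test_fun Om phi -> Lam q%:E * nrm leb q phi <= vnrm p (grad phi).
  move=> tp; have [n0|n0] := eqVneq (nrm leb q phi) 0; first by rewrite n0 mulr0 vnrm_ge0.
  have n1 : 0 < nrm leb q phi by rewrite lt_neqAle nrm_ge0 eq_sym n0.
  have [ts gs] := grad_scale (nrm leb q phi)^-1 tp.
  rewrite -ler_pdivlMr//; apply: Ls; exists (fun x => (nrm leb q phi)^-1 * phi x).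
    split=> //; rewrite (LpZ _ q0 (test_fun_Lp q0 tp)).2 ger0_norm ?invr_ge0 ?nrm_ge0// mulVf//.
  by rewrite gs ger0_norm ?invr_ge0 ?nrm_ge0// mulrC.
move=> u g ug; apply/ler_addgt0Pr => e e0.
(* An approximant within [e / K] costs [Lam C e / K] in the [L^q] norm and [e / K] in the energy
   norm, [e] in all. *)
pose K := Lam q%:E * C + 1; have K0 : 0 < K by rewrite ltr_wpDl// mulr_ge0 ?(ltW L0)// ltW.
have eK : 0 < e / K by rewrite divr_gt0.
have [phi [tp pg _ _ _]] := W0_approx adm ug eK.
have w := W0_add adm (-1) ug (W0_test adm tp).
have [_ wn] := W0_Lq pq w.
have uE : (fun x => u x + -1 * phi x) = u \- phi by apply/funext => x; rewrite mulN1r.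
have gE : (fun x => g x + -1 *: grad phi x) = (fun x => g x - grad phi x).
  by apply/funext => x; rewrite scaleN1r.
rewrite uE gE vnrmBC in wn.
have [uL _] := W0_Lq pq ug; have pL := test_fun_Lp q0 tp.
have [_ tri] := LpD q1 (LpB q1 uL pL).1 pL.
have uE' : (u \- phi) \+ phi = u by apply/funext => x /=; rewrite subrK.
rewrite uE' in tri; have tt := test _ tp.
have vv := vnrm_lerB p1 (test_fun_vLp pp0 tp) (W0_vLp ug).
have h1 : Lam q%:E * nrm leb q u <= Lam q%:E * (nrm leb q (u \- phi) + nrm leb q phi).
  by apply: ler_wpM2l => //; exact: ltW.
apply: le_trans h1 _; rewrite mulrDr.
have h2 : Lam q%:E * nrm leb q (u \- phi) <= Lam q%:E * C * (e / K).
  rewrite -mulrA; apply: ler_wpM2l; first exact: ltW.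
  by apply: le_trans wn _; apply: ler_wpM2l; [exact: ltW|exact: pg].
have h3 : Lam q%:E * C * (e / K) + e / K = e.
  by rewrite -[X in _ + X]mul1r -mulrDl mulrC divfK// gt_eqF.
move: vv tt h2 pg; move: (Lam q%:E * nrm _ _ _) (Lam q%:E * nrm _ _ _) (vnrm p g) (vnrm p (grad phi)) (vnrm _ _).
by move=> a b c d f; rewrite ler_norml; lra.
Qed.

Lemma test_fun_max phi : test_fun Om phi -> exists x, forall y, `|phi y| <= `|phi x|.
Proof.
move=> /test_funP[sp [D [cD DO pD]]].
have [x0|D0] := pselect (exists x, D x); last first.
  by exists 0 => y; rewrite pD ?normr0// => Dy; apply: D0; exists y.
have [|x Dx hx] := EVT_max_rV (f := fun x => `|phi x|) x0 cD.
  by apply: continuous_subspaceT => x; apply: (@continuous_comp _ _ _ phi (fun s : R => `|s|)); [exact: smooth_cont|exact: norm_continuous].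
exists x => y; have [Dy|/pD ->] := pselect (D y); last by rewrite normr0.
by apply: hx; rewrite inE.
Qed.

Lemma LamooP : [/\ 0 < Lam +oo, lambda p +oo Om = (Lam +oo `^ p)%:E,
  C^-1 <= Lam +oo, (forall u g x, W0 Om p u g -> Lam +oo * `|u x| <= vnrm p g) &
  forall e, 0 < e -> exists phi, [/\ test_fun Om phi, exists x, `|phi x| = 1 & vnrm p (grad phi) < Lam +oo + e]].
Proof.
have NE phi x : test_fun Om phi -> (forall y, `|phi y| <= `|phi x|) -> Lq_norm Om +oo phi = (`|phi x|)%:E.
  move=> tp px; apply/eqP; rewrite eq_le; apply/andP; split; first by apply: Linfty_le => // y _; exact: px.
  have [Ox|Ox] := pselect (Om x); last by rewrite (test_fun_off tp Ox) normr0 Lnorm_ge0.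
  by apply: Linfty_ge => //; exact: smooth_cont (test_fun_smooth tp) x.
have EE phi : test_fun Om phi -> energy p Om (grad phi) = (vnrm p (grad phi) `^ p)%:E.
  by move=> tp; apply: energy_W0; exact: (W0_test adm tp).
pose S : set R := [set vnrm p (grad phi) | phi in [set phi | test_fun Om phi /\
   exists2 x, `|phi x| = 1 & forall y, `|phi y| <= `|phi x|]].
have [|||L0 LE LC Ls Le] := @LamE +oo%E S.
- move=> x; split=> [[phi [tp np] <-]|[_ [phi [tp [y y1 yn]] <-] <-]].
    exists (vnrm p (grad phi)); last by rewrite EE.
    exists phi => //; split=> //; have [y hy] := test_fun_max tp; exists y => //.
    by move: np; rewrite (NE _ _ tp hy) => -[].
  by exists phi; rewrite ?EE// (NE _ _ tp yn) y1.
- have [phi [x [tp Ox px]]] := test_bump; have [y hy] := test_fun_max tp.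
  have y0 : 0 < `|phi y| by apply: lt_le_trans (hy x); rewrite normr_gt0 gt_eqF.
  exists (vnrm p (grad (fun x => `|phi y|^-1 * phi x))); exists (fun x => `|phi y|^-1 * phi x) => //.
  split; first exact: test_funZ.
  exists y => [|z]; rewrite !normrM; first by rewrite normfV normr_id mulVf// gt_eqF.
  by apply: ler_wpM2l.
- move=> _ [phi [tp [y y1 _]] <-]; have := W0_sup adm y (W0_test adm tp).
  by rewrite y1 -ler_pdivrMl// mulr1.
split=> //; last first.
  by move=> e e0; have [_ [phi [tp [y y1 _]] <-] lt] := Le e e0; exists phi; split=> //; exists y.
have test phi x : test_fun Om phi -> Lam +oo * `|phi x| <= vnrm p (grad phi).
  move=> tp; have [y hy] := test_fun_max tp.
  apply: (@le_trans _ _ (Lam +oo * `|phi y|)); first by apply: ler_wpM2l; [exact: ltW|exact: hy].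
  have [n0|n0] := eqVneq `|phi y| 0; first by rewrite n0 mulr0 vnrm_ge0.
  have n1 : 0 < `|phi y| by rewrite lt_neqAle normr_ge0 eq_sym n0.
  have [ts gs] := grad_scale `|phi y|^-1 tp.
  rewrite -ler_pdivlMr//; apply: Ls; exists (fun x => `|phi y|^-1 * phi x).
    split=> //; exists y => [|z]; rewrite !normrM; first by rewrite normfV normr_id mulVf.
    by apply: ler_wpM2l.
  by rewrite gs normfV normr_id mulrC.
move=> u g x ug; apply/ler_addgt0Pr => e e0.
pose K := Lam +oo * C + 1; have K0 : 0 < K by rewrite ltr_wpDl// mulr_ge0 ?(ltW L0)// ltW.
have eK : 0 < e / K by rewrite divr_gt0.
have [phi [tp pg pu _ _]] := W0_approx adm ug eK.
have tt := test _ x tp.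
have vv := vnrm_lerB p1 (test_fun_vLp pp0 tp) (W0_vLp ug).
have ux : `|u x| <= `|phi x| + C * (e / K).
  have := pu x; rewrite distrC; have := lerB_dist (u x) (phi x); lra.
have h1 : Lam +oo * `|u x| <= Lam +oo * (`|phi x| + C * (e / K)).
  by apply: ler_wpM2l => //; exact: ltW.
apply: le_trans h1 _; rewrite mulrDr mulrA.
have h3 : Lam +oo * C * (e / K) + e / K = e.
  by rewrite -[X in _ + X]mul1r -mulrDl mulrC divfK// gt_eqF.
move: vv tt pg; move: (Lam +oo * `|_|) (vnrm p g) (vnrm p (grad phi)) (vnrm _ _).
by move=> a c d f; rewrite ler_norml; lra.
Qed.

End lambda.

Lemma pairingZ d (T : measurableType d) (R : realType) (mu : {measure set T -> \bar R}) (p q c : R)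
    (f h : T -> R) : 0 < p -> 0 < q -> p^-1 + q^-1 = 1 -> Lp mu p f -> Lp mu q h ->
  pairing mu (fun x => c * f x) h = c * pairing mu f h.
Proof.
move=> p0 q0 pq fL hL; apply: EFin_inj; rewrite EFinM -(pairingE p0 q0 pq fL hL).
rewrite -(pairingE p0 q0 pq (LpZ c p0 fL).1 hL) -integralZl//; last exact: (nrm_hoelder p0 q0 pq fL hL).1.
by apply: eq_integral => x _; rewrite -EFinM mulrA.
Qed.

(** Linearizes a Rayleigh inequality after raising it to the power [r]. If [1 + x < 0] the left side
    is nonpositive because [r >= 1], so no smallness of [x] is required. *)
Lemma powR_bernoulli_le (R : realType) (L E x r : R) : 0 <= L -> 1 <= r -> 0 <= E -> L * (1 + x) <= E ->
  L `^ r * (1 + r * x) <= E `^ r.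
Proof.
move=> L0 r1 E0 LE; have r0 : 0 <= r by exact: le_trans r1.
have [x1|x1] := lerP 0 (1 + x).
  apply: (@le_trans _ _ ((L * (1 + x)) `^ r)); last by apply: powR_le => //; exact: mulr_ge0.
  rewrite powRM//; apply: ler_wpM2l; first exact: powR_ge0.
  by have := powR_bernoulli x1 r1; rewrite (_ : 1 + x - 1 = x)//; lra.
apply: le_trans (powR_ge0 _ _); apply: mulr_ge0_le0; first exact: powR_ge0.
have : r * x <= 1 * x by rewrite ler_nM2r//; lra.
lra.
Qed.

(** The arithmetic of the concentration estimate. [A0] is the perturbed energy along the sequence,
    [A1] and [A2] those of the limit at [e] and [-e], [A3] the error of replacing [Lam q] by its
    limit, and [w] the second-order term. *)
Lemma second_order_combine (R : realType) (A0 A1 A2 A3 x y s w a : R) :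
  A0 - A1 < a -> A3 + (s + x) <= A0 -> s - y <= A2 -> A1 + A2 <= 2 * s + w -> - a <= A3 ->
  x - y <= w + 2 * a.
Proof. lra. Qed.

Local Opaque Lam.

(** * The limit of the minimizers *)

Section asymptotics.
Context {R : realType} {N : nat}.
Local Notation V := 'rV[R]_N.
Local Notation leb := (@lebesgue_rV R N).
Variables (Om : set V) (p C : R).
Hypothesis adm : admissible Om p C.
Hypothesis Om0 : exists x, Om x.
Implicit Types (u v : V -> R) (g h : V -> V).
Local Notation Lam := (Lam Om p).

Let oOm : open Om. Proof. by case: adm. Qed.
Let p2 : 2 <= p. Proof. by case: adm. Qed.
Let p1 : 1 <= p. Proof. exact: le_trans (ler1n _ 2) p2. Qed.
Let pp0 : 0 < p. Proof. exact: lt_le_trans p1. Qed.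
Let C0 : 0 < C. Proof. by case: adm. Qed.
Let Loo0 : 0 < Lam +oo. Proof. by case: (LamooP adm Om0). Qed.

(** Near [x0] the function exceeds [1 - e/2] in absolute value on a ball of measure [m], and
    [m^(1/q)] tends to 1. *)
Lemma nrm_large_q f x0 (e : R) : continuous f -> `|f x0| = 1 -> 0 < e < 1 ->
  exists Q, forall q, Q <= q -> Lp leb q f -> 1 - e <= nrm leb q f.
Proof.
move=> cf fx /andP[e0 e1]; have e2 : 0 < e / 2 by rewrite divr_gt0.
have /continuous_at_normP /(_ _ e2)[r r0 hr] := cf x0.
pose B : set V := [set y : V | `|x0 - y| < r].
have mB : measurable B by apply: measurable_open_rV; exact: open_norm_ball.
have Bfin : (leb B < +oo)%E.
  apply: (@norm_bounded_lebesgue _ _ B (r + `|x0|)) => // y /= xy.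
  rewrite (_ : y = x0 - (x0 - y)); last by rewrite opprB addrC subrK.
  by apply: le_trans (ler_normB _ _) _; rewrite addrC lerD2r ltW.
have Bpos := lebesgue_ball_gt0 x0 r0.
pose m := fine (leb B); have mE : leb B = m%:E by rewrite fineK// ge0_fin_numE.
have m0 : 0 < m by rewrite -lte_fin -mE.
(* A ratio above 1, so [a^q m > 1] for large [q]; then [(1 - e/2)^q m] exceeds [(1 - e)^q]. *)
pose a := (1 - e / 2) / (1 - e).
have e1' : 0 < 1 - e by rewrite subr_gt0.
have a1 : 1 < a by rewrite ltr_pdivlMr// mul1r ltrD2l ltrN2 ltr_pdivrMr// ltr_pMr// ltr1n.
have [Q hQ] := powR_unbounded m^-1 a1.
exists (Num.max 1 Q) => q; rewrite ge_max => /andP[q1 /hQ aq] fL; have q0 : 0 < q by exact: lt_le_trans q1.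
rewrite leNgt; apply/negP => lt.
have h1 : nrm leb q f `^ q <= (1 - e) `^ q by apply: powR_le; [exact: ltW|exact: nrm_ge0|exact: ltW].
have h2 : (1 - e / 2) `^ q * m <= nrm leb q f `^ q.
  rewrite -lee_fin EFinM -(nrm_powR q0 fL) -mE -integral_cst//.
  rewrite integral_mkcond; apply: ge0_le_integral => //.
  - by move=> x _; rewrite patchE; case: ifP => // _; rewrite lee_fin powR_ge0.
  - by apply/(measurable_restrictT _ mB); exact: measurable_cst.
  - by apply: measurable_abs_powR; case: fL.
  - move=> x _; rewrite patchE; case: ifPn => [|_]; last by rewrite lee_fin powR_ge0.
    rewrite inE => xB; rewrite lee_fin; apply: powR_le; [exact: ltW|lra|].
    by have := hr x xB; have := lerB_dist (f x0) (f x); rewrite fx; lra.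
have E : 1 - e / 2 = a * (1 - e) by rewrite divfK// gt_eqF.
have aE : 0 <= a by exact: le_trans (ltW a1).
rewrite E powRM ?(ltW e1')// in h2.
have := le_trans h2 h1; rewrite -mulrA mulrC -mulrA -[leRHS]mulr1 ler_pM2l ?powR_gt0//.
rewrite leNgt => /negP; apply; rewrite mulrC -ltr_pdivrMr// div1r; exact: aq.
Qed.

Lemma Lam_limsup (e : R) : 0 < e -> exists Q, forall q, Q <= q -> Lam q%:E <= Lam +oo + e.
Proof.
move=> e0; have e2 : 0 < e / 2 by rewrite divr_gt0.
have [_ _ _ _ /(_ _ e2)[phi [tp [x px] pg]]] := LamooP adm Om0.
have Le : 0 < Lam +oo + e by rewrite addr_gt0.
(* Chosen so that [(Lam oo + e) (1 - d) = Lam oo + e/2]. *)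
pose d := e / 2 / (Lam +oo + e).
have d01 : 0 < d < 1.
  rewrite divr_gt0//= ltr_pdivrMr// mul1r; apply: (@lt_trans _ _ e); last by rewrite ltrDr.
  by rewrite ltr_pdivrMr// ltr_pMr// ltr1n.
have [Q hQ] := nrm_large_q (smooth_cont (test_fun_smooth tp)) px d01.
exists (Num.max p Q) => q; rewrite ge_max => /andP[pq /hQ nq].
have q0 : 0 < q by exact: lt_le_trans pq.
have {}nq := nq (test_fun_Lp q0 tp).
have [Lq _ _ /(_ _ _ (W0_test adm tp)) h _] := LamP adm Om0 pq.
have d1 : 0 < 1 - d by rewrite subr_gt0; case/andP: d01.
rewrite -(ler_pM2r d1); apply: (@le_trans _ _ (Lam +oo + e / 2)); last first.
  have E : (Lam +oo + e) * d = e / 2 by rewrite /d mulrC divfK// gt_eqF.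
  by rewrite mulrBr mulr1 E; lra.
apply: le_trans _ (ltW pg); apply: le_trans h.
by apply: ler_wpM2l; [exact: ltW|exact: nq].
Qed.

(** Interpolation gives [1 <= M^(q-p) B^p], where [B] bounds the [L^p] norm independently of [q]; if
    [M] were below [1 - e], the right side would tend to 0. *)
Lemma max_lower (e : R) : 0 < e < 1 -> exists Q, forall q u g M, Q <= q -> W0 Om p u g ->
  nrm leb q u = 1 -> vnrm p g = Lam q%:E -> (forall x, `|u x| <= M) -> 1 - e <= M.
Proof.
move=> /andP[e0 e1]; have [Q1 h1] := Lam_limsup ltr01.
have e1' : 0 < 1 - e by rewrite subr_gt0.
pose B := C * (Lam +oo + 1).
have a1 : 1 < (1 - e)^-1 by rewrite invf_gt1// ltrBlDr ltrDl.
have [Q2 h2] := powR_unbounded (B `^ p) a1.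
exists (Num.max p (Num.max Q1 (p + Q2))) => q u g M; rewrite !ge_max => /and3P[pq /h1 qL].
rewrite -lerBrDl => /h2 qB ug un gn uM; rewrite leNgt; apply/negP => lt.
have M0 : 0 <= M by exact: le_trans (normr_ge0 _) (uM 0).
have [uL uC] := W0_Lp adm ug.
have [_] := nrm_interp pp0 pq M0 uM uL; rewrite un powR1 leNgt => /negP; apply.
have nB : nrm leb p u <= B.
  by apply: le_trans uC _; apply: ler_wpM2l; [exact: ltW|rewrite gn].
have nBp : nrm leb p u `^ p <= B `^ p by apply: powR_le; [exact: ltW|exact: nrm_ge0|].
have Me : M `^ (q - p) <= (1 - e) `^ (q - p) by apply: powR_le => //; [rewrite subr_ge0|exact: ltW].
apply: (@le_lt_trans _ _ ((1 - e) `^ (q - p) * B `^ p)).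
  by apply: ler_pM => //; exact: powR_ge0.
have E : (1 - e) `^ (q - p) * (1 - e)^-1 `^ (q - p) = 1 :> R.
  by rewrite -powRM ?invr_ge0 ?(ltW e1')// divff ?powR1// gt_eqF.
by rewrite -[ltRHS]E ltr_pM2l ?powR_gt0.
Qed.

Lemma W0_mid u v g h : W0 Om p u g -> W0 Om p v h ->
  W0 Om p (fun x => 2^-1 * (u x + v x)) (fun x => 2^-1 *: (g x + h x)).
Proof.
move=> ug vh; have := W0_add adm 2^-1 (W0_add adm (- 2^-1) ug ug) vh.
have -> : (fun x => u x + - 2^-1 * u x + 2^-1 * v x) = (fun x => 2^-1 * (u x + v x)).
  by apply/funext => x; field.
have -> // : (fun x => g x + (- 2^-1) *: g x + 2^-1 *: h x) = (fun x => 2^-1 *: (g x + h x)).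
by apply/funext => x; apply/rowP => i; rewrite !mxE; field.
Qed.

Lemma W0_sub u v g h : W0 Om p u g -> W0 Om p v h -> W0 Om p (u \- v) (fun x => g x - h x).
Proof.
move=> ug vh; have := W0_add adm (-1) ug vh.
have -> : (fun x => u x + -1 * v x) = u \- v by apply/funext => x; rewrite mulN1r.
by have -> : (fun x => g x + -1 *: h x) = (fun x => g x - h x) by apply/funext => x; rewrite scaleN1r.
Qed.

Section sequence.
Variables (qn : nat -> R) (u : nat -> V -> R) (g : nat -> V -> V) (z : nat -> V) (Y : set V).
Hypotheses (pq : forall n, p < qn n) (qoo : qn n @[n --> \oo] --> +oo).
Hypotheses (ug : forall n, W0 Om p (u n) (g n)) (u0 : forall n x, 0 <= u n x).
Hypotheses (un : forall n, nrm leb (qn n) (u n) = 1) (gn : forall n, vnrm p (g n) = Lam (qn n)%:E).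
Hypotheses (uz : forall n x, u n x <= u n (z n)) (cY : compact Y) (Yz : forall n, Y (z n)).

Let qlarge Q : exists n0, forall n, (n0 <= n)%N -> Q <= qn n.
Proof. by move/cvgryPge: qoo => /(_ Q)[n0 _ hn0]; exists n0 => n; exact: hn0. Qed.

Let pq' n : p <= qn n. Proof. exact: ltW. Qed.

Let uabs n x : `|u n x| <= u n (z n). Proof. by rewrite ger0_norm. Qed.

Let Loo_max n : Lam +oo * u n (z n) <= Lam (qn n)%:E.
Proof.
have [_ _ _ h _] := LamooP adm Om0.
by have := h _ _ (z n) (ug n); rewrite gn ger0_norm.
Qed.

(** A squeeze: [Lam oo] times the maximum of [u n] is at most [Lam (qn n)], itself at most
    [Lam oo + e] eventually, while the maximum is eventually at least [1 - e]. *)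
Lemma Lam_max_limit : Lam (qn n)%:E @[n --> \oo] --> Lam +oo /\ u n (z n) @[n --> \oo] --> (1 : R).
Proof.
have low (e : R) : 0 < e -> exists n0, forall n, (n0 <= n)%N -> 1 - e <= u n (z n).
  move=> e0; pose e' := Num.min e 2^-1.
  have e'01 : 0 < e' < 1.
    apply/andP; split; first by rewrite lt_min e0 invr_gt0 ltr0n.
    by rewrite gt_min; apply/orP; right; rewrite invf_lt1 ?ltr1n.
  have [Q hQ] := max_lower e'01; have [n0 hn0] := qlarge Q.
  exists n0 => n /hn0 hn; apply: le_trans (hQ _ _ _ _ hn (ug n) (un n) (gn n) (uabs n)).
  by rewrite lerD2l lerN2 ge_min lexx.
have up (e : R) : 0 < e -> exists n0, forall n, (n0 <= n)%N -> Lam (qn n)%:E <= Lam +oo + e.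
  by move=> /Lam_limsup[Q hQ]; have [n0 hn0] := qlarge Q; exists n0 => n /hn0 /hQ.
split; apply/seq_cvgP => e e0.
  have e2 : 0 < e / 2 by rewrite divr_gt0.
  have eL : 0 < e / 2 / Lam +oo by rewrite divr_gt0.
  have [n1 h1] := low _ eL; have [n2 h2] := up _ e2; exists (maxn n1 n2) => n.
  rewrite geq_max => /andP[/h1 a /h2 b].
  have c : Lam +oo * (1 - e / 2 / Lam +oo) <= Lam (qn n)%:E.
    by apply: le_trans (Loo_max n); apply: ler_wpM2l; [exact: ltW|].
  rewrite mulrBr mulr1 mulrC divfK ?gt_eqF// in c.
  by rewrite ltr_norml; lra.
have e2 : 0 < e / 2 by rewrite divr_gt0.
have eL : 0 < e / 2 * Lam +oo by rewrite mulr_gt0.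
have [n1 h1] := low _ e2; have [n2 h2] := up _ eL; exists (maxn n1 n2) => n.
rewrite geq_max => /andP[/h1 a /h2 b].
have := le_trans (Loo_max n) b.
have -> : Lam +oo + e / 2 * Lam +oo = Lam +oo * (1 + e / 2) by rewrite mulrDr mulr1 [X in _ + X]mulrC.
rewrite ler_pM2l// => c.
by rewrite ltr_norml; lra.
Qed.

Lemma precompact : exists s : nat -> nat, {homo s : m n / (m < n)%N} /\ exists v h, W0 Om p v h /\
  forall e : R, 0 < e -> exists n0, forall n, (n0 <= n)%N -> vnrm p (fun x => g (s n) x - h x) <= e.
Proof.
have [s [z' [sm Yz' zs]]] := compact_subseq cY Yz.
have sn n : (n <= s n)%N by elim: n => // n IH; exact: leq_ltn_trans IH (sm _ _ (ltnSn n)).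
have [/seq_cvgP Ll /seq_cvgP Ml] := Lam_max_limit.
exists s; split=> //.
have [|v [h [vh lim]]] := W0_complete adm (u := u \o s) (g := g \o s) (fun n => ug (s n)); last first.
  by exists v, h; split.
apply: (@clarkson_cauchy _ _ _ _ _ adm _ (Lam +oo)) => [n||e e0]; first exact: W0_vLp (ug (s n)).
  apply/seq_cvgP => e /Ll[n0 hn0]; exists n0 => n hn; rewrite /= gn; apply: hn0.
  exact: leq_trans (sn n).
(* At [z (s m)] the first function is at least [1 - d]; the second is at least [1 - 2 d], one [d]
   being lost on its maximum and one on its oscillation. The midpoint therefore reaches [1 - 2 d],
   and [2 d Lam oo <= e]. *)
pose d := Num.min 1 (e / 2 / Lam +oo).
have d0 : 0 < d by rewrite lt_min ltr01 /= !divr_gt0.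
have dL : Lam +oo * (2 * d) <= e.
  rewrite mulrCA -ler_pdivlMl// mulrC -ler_pdivlMr//.
  by rewrite [X in X / _]mulrC /d ge_min lexx orbT.
have L1 : 0 < Lam +oo + 1 by rewrite addr_gt0.
have dL1 : 0 < d / (Lam +oo + 1) by rewrite divr_gt0.
have [r r0 hr] := W0_equicont adm dL1.
have [n1 h1] := Ml _ d0; have [n2 h2] := Ll _ ltr01; have [n3 h3] := zs (r / 2) ltac:(by rewrite divr_gt0).
exists (maxn n1 (maxn n2 n3)) => m n; rewrite !geq_max => /and3P[a1 a2 a3] /and3P[b1 b2 b3].
have [_ _ _ LL _] := LamooP adm Om0.
apply: le_trans (LL _ _ (z (s m)) (W0_mid (ug (s m)) (ug (s n)))).
apply: (@le_trans _ _ (Lam +oo * (1 - 2 * d))); first by rewrite mulrBr mulr1 lerD2l lerN2.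
apply: ler_wpM2l; first exact: ltW.
rewrite ger0_norm; last by rewrite mulr_ge0// addr_ge0.
have zz : `|z (s m) - z (s n)| < r.
  rewrite (_ : _ - _ = (z (s m) - z') - (z (s n) - z')); last by rewrite opprB addrA subrK.
  apply: le_lt_trans (ler_normB _ _) _; have -> : r = r / 2 + r / 2 by field.
  by apply: ltrD; exact: h3.
have eq1 := hr _ _ _ _ (ug (s n)) zz.
have eq2 : d / (Lam +oo + 1) * vnrm p (g (s n)) <= d.
  have := h2 (s n) (leq_trans b2 (sn n)); rewrite gn ltr_norml => /andP[_ hl].
  by rewrite mulrAC ler_pdivrMr; [rewrite ler_pM2l; [rewrite -lerBlDl; exact: ltW|exact: d0]|exact: L1].
have m1 := h1 (s m) (leq_trans a1 (sn m)); have m2 := h1 (s n) (leq_trans b1 (sn n)).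
move: (le_trans eq1 eq2) m1 m2; rewrite !ltr_norml ler_norml.
move: (u (s n) (z (s m))) (u (s n) (z (s n))) (u (s m) (z (s m))) => a b c; lra.
Qed.

Section limit.
Variables (v : V -> R) (h : V -> V).
Hypothesis vh : W0 Om p v h.
Hypothesis gh : forall e : R, 0 < e -> exists n0, forall n, (n0 <= n)%N -> vnrm p (fun x => g n x - h x) <= e.

Let uv n x : `|u n x - v x| <= C * vnrm p (fun x => g n x - h x).
Proof. exact: (W0_sup adm x (W0_sub (ug n) vh)). Qed.

Let uv_lim (e : R) : 0 < e -> exists n0, forall n x, (n0 <= n)%N -> `|u n x - v x| <= e.
Proof.
move=> e0; have eC : 0 < e / C by rewrite divr_gt0.
have [n0 hn0] := gh eC; exists n0 => n x /hn0 hn; apply: le_trans (uv n x) _.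
by rewrite mulrC -ler_pdivlMr.
Qed.

Lemma limit_vnrm : vnrm p h = Lam +oo.
Proof.
have [Ll _] := Lam_max_limit.
suff : vnrm p (g n) @[n --> \oo] --> vnrm p h.
  move=> H; have := cvg_unique _ H; apply => //.
  by move: Ll; under eq_fun do rewrite -gn.
apply/seq_cvgP => e e0; have e2 : 0 < e / 2 by rewrite divr_gt0.
have [n0 hn0] := gh e2; exists n0 => n /hn0 hn.
apply: le_lt_trans (vnrm_lerB p1 (W0_vLp (ug n)) (W0_vLp vh)) _.
by apply: le_lt_trans hn _; rewrite ltr_pdivrMr// ltr_pMr// ltr1n.
Qed.

Lemma limit_ge0 x : 0 <= v x.
Proof.
apply/ler_addgt0Pr => e e0; have [n0 hn0] := uv_lim e0.
by have := hn0 _ x (leqnn n0); have := u0 n0 x; rewrite ler_norml; lra.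
Qed.

Lemma limit_le1 x : v x <= 1.
Proof.
have [_ /seq_cvgP Ml] := Lam_max_limit; apply/ler_addgt0Pr => e e0.
have e2 : 0 < e / 2 by rewrite divr_gt0.
have [n0 hn0] := uv_lim e2; have [n1 hn1] := Ml _ e2.
have := hn0 _ x (leq_maxl n0 n1); have := hn1 _ (leq_maxr n0 n1); have := uz (maxn n0 n1) x.
by rewrite ler_norml ltr_norml; lra.
Qed.

Lemma limit_max : exists2 z', Y z' & v z' = 1.
Proof.
have [s [z' [sm Yz' zs]]] := compact_subseq cY Yz; exists z' => //.
have sn n : (n <= s n)%N by elim: n => // n IH; exact: leq_ltn_trans IH (sm _ _ (ltnSn n)).
have [_ /seq_cvgP Ml] := Lam_max_limit.
apply/eqP; rewrite -subr_eq0 -normr_le0; apply/ler_addgt0Pr => e e0; rewrite add0r.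
have e3 : 0 < e / 3 by rewrite divr_gt0.
have /continuous_at_normP /(_ _ e3)[r r0 hr] := W0_continuous adm vh (x := z').
have [n1 h1] := Ml _ e3; have [n2 h2] := uv_lim e3; have [n3 h3] := zs _ r0.
pose n := maxn n1 (maxn n2 n3).
have k1 := h1 (s n) (leq_trans (leq_maxl _ _) (sn n)).
have k2 := h2 (s n) (z (s n)) (leq_trans (leq_trans (leq_maxl _ _) (leq_maxr _ _)) (sn n)).
have := h3 n (leq_trans (leq_maxr _ _) (leq_maxr _ _)); rewrite distrC => /hr k3.
move: k1 k2 k3; rewrite !ltr_norml !ler_norml; lra.
Qed.

(** * Concentration at a maximum point of the limit *)

Section concentration.
Variable z0 : V.
Hypothesis vz0 : v z0 = 1.

Let W n : V -> R := fun x => u n x `^ (qn n - 1).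
Let q' n : R := qn n / (qn n - 1).
Let q0 n : 0 < qn n. Proof. exact: lt_trans (pq n). Qed.
Let q1 n : 0 < qn n - 1.
Proof. by rewrite subr_gt0; apply: le_lt_trans (pq n). Qed.
Let q'0 n : 0 < q' n. Proof. exact: divr_gt0. Qed.
Let qq' n : (qn n)^-1 + (q' n)^-1 = 1.
Proof. by rewrite /q'; field; rewrite !gt_eqF. Qed.

Let uL n : Lp leb (qn n) (u n). Proof. by have [] := W0_Lq adm (pq' n) (ug n). Qed.

Let WL n : Lp leb (q' n) (W n) /\ nrm leb (q' n) (W n) <= 1.
Proof.
have mu' : measurable_fun setT (u n) by case: (uL n).
apply: nrm_le_powR => //.
  by apply: (@measurableT_comp _ _ _ _ _ _ (fun s : R => s `^ (qn n - 1)) _ (u n)); [exact: measurable_powR|exact: mu'].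
have -> : (\int[leb]_x (`|W n x| `^ q' n)%:E = \int[leb]_x (`|u n x| `^ qn n)%:E)%E.
  apply: eq_integral => x _; rewrite /W ger0_norm ?powR_ge0// ger0_norm// -powRrM /q'.
  by rewrite mulrC divfK// gt_eqF.
by rewrite (nrm_powR (q0 n) (uL n)) un !powR1.
Qed.

Let I n phi := pairing leb phi (W n).

Let pairing_u n : I n (u n) = 1.
Proof.
apply: EFin_inj; rewrite -(pairingE (q0 n) (q'0 n) (qq' n) (uL n) (WL n).1).
have -> : (\int[leb]_x (u n x * W n x)%:E = \int[leb]_x (`|u n x| `^ qn n)%:E)%E.
  apply: eq_integral => x _; rewrite /W ger0_norm// [in RHS]powR_split//.
  by apply: ltW; rewrite -subr_gt0.
by rewrite (nrm_powR (q0 n) (uL n)) un powR1.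
Qed.

Let testL n phi : test_fun Om phi -> Lp leb (qn n) phi.
Proof. exact: test_fun_Lp. Qed.

(** [W n] has dual norm at most 1 and pairs to 1 with [u n]: it supports the [L^q] norm at [u n], so
    [1 + e I] is at most the norm of [u n + e phi]. This one-sided bound stands in for the
    Euler-Lagrange equation. *)
Let perturbed n phi (e : R) : test_fun Om phi ->
  Lam (qn n)%:E * (1 + e * I n phi) <= vnrm p (fun x => g n x + e *: grad phi x).
Proof.
move=> tp; have w := W0_add adm e (ug n) (W0_test adm tp).
have [Ln _ _ LL _] := LamP adm Om0 (pq' n).
apply: le_trans (LL _ _ w); apply: ler_wpM2l; first exact: ltW.
have q1' : 1 <= qn n by apply: ltW; rewrite -subr_gt0.
have eL := (LpZ (- e) (q0 n) (testL n tp)).1.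
have E : (fun x => u n x + e * phi x) = u n \- (fun x => (- e) * phi x).
  by apply/funext => x /=; rewrite mulNr opprK.
have := pairingB (q0 n) (q'0 n) (qq' n) q1' (uL n) eL (WL n).1.
rewrite (pairingZ _ (q0 n) (q'0 n) (qq' n) (testL n tp) (WL n).1) -/(I n _) -/(I n _) -/(I n _) pairing_u -E mulNr opprK => <-.
apply: le_trans (ler_norm _) _.
have L := (LpB q1' (uL n) eL).1; rewrite -E in L.
apply: le_trans (pairing_le (q0 n) (q'0 n) (qq' n) L (WL n).1) _.
by rewrite -[leRHS]mulr1; apply: ler_wpM2l; [exact: nrm_ge0|exact: (WL n).2].
Qed.

Let I_bound n phi : test_fun Om phi -> `|I n phi| <= C * vnrm p (grad phi).
Proof.
move=> tp; have [_ h1] := W0_Lq adm (pq' n) (W0_test adm tp).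
apply: le_trans (pairing_le (q0 n) (q'0 n) (qq' n) (testL n tp) (WL n).1) _.
apply: le_trans h1; rewrite -[leRHS]mulr1; apply: ler_wpM2l; [exact: nrm_ge0|exact: (WL n).2].
Qed.

(* Convexity and second-order smoothness of the energy: the sum of the two one-sided
   bounds at [e] and [-e] leaves only a term of order [e ^+ 2]. *)
Let upper phi (d : R) : test_fun Om phi -> 0 < d ->
  exists n0, forall n, (n0 <= n)%N -> I n phi - phi z0 <= d.
Proof.
move=> tp d0; have gp := test_fun_vLp pp0 tp; have hp := W0_vLp vh.
have [K K0 hK] := vnrm_second_diff p2 (N := N) (R := R).
have vhL := limit_vnrm.
pose S := Lam +oo `^ p; have S0 : 0 < S by exact: powR_gt0.
pose T := K * S + K * vnrm p (grad phi) `^ p; have T0 : 0 <= T.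
  by apply: addr_ge0; apply: mulr_ge0 => //; [exact: ltW|exact: powR_ge0].
(* Bounds [1 + p e I] uniformly in [n], since [e <= 1]; hence replacing [Lam (qn n)^p] by [Lam oo^p]
   eventually costs at most [e^2]. *)
pose Bd := 1 + p * (C * vnrm p (grad phi)).
have Bd0 : 0 < Bd.
  by rewrite ltr_pwDl// !mulr_ge0 ?vnrm_ge0// ltW.
(* The comparison ends in [e p S (I - phi z0) <= (T + 2) e^2], one [e^2] coming from the convergence
   of the energies and one from that of the constants; this [e] keeps the right side below
   [e d p S]. *)
pose e := Num.min 1 (d * (p * S) / (T + 2)).
have T2 : 0 < T + 2 by rewrite ltr_wpDl.
have pS : 0 < p * S by exact: mulr_gt0.
have e0 : 0 < e by rewrite lt_min ltr01 /=; apply: divr_gt0 => //; exact: mulr_gt0.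
have e1 : e <= 1 by rewrite ge_min lexx.
have ed : e * (T + 2) <= d * (p * S) by rewrite -ler_pdivlMr// /e ge_min lexx orbT.
have ee : 0 < e ^+ 2 by rewrite exprn_gt0.
pose E s := vnrm p (fun x => h x + s *: grad phi x).
have gnL n := W0_vLp (ug n).
have gE : vnrm p (fun x => g n x + e *: grad phi x) @[n --> \oo] --> E e.
  apply/seq_cvgP => a a0; have a2 : 0 < a / 2 by rewrite divr_gt0.
  have [n0 hn0] := gh a2; exists n0 => n /hn0 hn.
  have l1 := (vLpD_scale e p1 (gnL n) gp).1; have l2 := (vLpD_scale e p1 hp gp).1.
  apply: le_lt_trans (vnrm_lerB p1 l1 l2) _.
  have -> : (fun x => g n x + e *: grad phi x - (h x + e *: grad phi x)) = (fun x => g n x - h x).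
    by apply/funext => x; rewrite opprD addrACA subrr addr0.
  by apply: le_lt_trans hn _; rewrite ltr_pdivrMr// ltr_pMr// ltr1n.
have gEp := cvg_powR pp0 (fun n => vnrm_ge0 p _) gE.
have [Ll _] := Lam_max_limit.
have Llp := cvg_powR pp0 (fun n => ltW (let: And5 a _ _ _ _ := LamP adm Om0 (pq' n) in a)) Ll.
move/seq_cvgP: gEp => /(_ _ ee)[n1 h1].
have eB : 0 < e ^+ 2 / Bd by exact: divr_gt0.
move/seq_cvgP: Llp => /(_ _ eB)[n2 h2].
exists (maxn n1 n2) => n; rewrite geq_max => /andP[/h1 k1 /h2 k2].
have [Ln _ _ _ _] := LamP adm Om0 (pq' n).
have b1 := powR_bernoulli_le (ltW Ln) p1 (vnrm_ge0 _ _) (perturbed n e tp).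
have b2 : S * (1 + p * - (e * phi z0)) <= E (- e) `^ p.
  apply: powR_bernoulli_le => //; [exact: ltW|exact: vnrm_ge0|].
  have [_ _ _ LL _] := LamooP adm Om0.
  apply: le_trans (LL _ _ z0 (W0_add adm (- e) vh (W0_test adm tp))).
  by apply: ler_wpM2l; [exact: ltW|rewrite vz0 mulNr; exact: ler_norm].
have ae : `|e| <= 1 by rewrite ger0_norm// ltW.
have b3 := hK h (grad phi) e hp gp ae; rewrite vhL -/S -/(E e) -/(E (- e)) in b3.
have b4 : (2 + K * e ^+ 2) * S + K * e ^+ 2 * vnrm p (grad phi) `^ p = 2 * S + T * e ^+ 2.
  by rewrite /T; ring.
rewrite b4 in b3.
pose X := Lam (qn n)%:E `^ p; rewrite -/X in k2 b1.
have Ib := I_bound n tp.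
have b5 : `|(X - S) * (1 + p * (e * I n phi))| <= e ^+ 2.
  rewrite normrM; apply: (@le_trans _ _ (e ^+ 2 / Bd * Bd)); last by rewrite divfK// gt_eqF.
  apply: ler_pM => //; first exact: ltW.
  apply: le_trans (ler_normD _ _) _; rewrite normr1 lerD2l normrM gtr0_norm//.
  apply: ler_wpM2l; first exact: ltW.
  rewrite normrM gtr0_norm//; apply: le_trans Ib.
  by rewrite ler_piMl.
have b6 : X * (1 + p * (e * I n phi)) = (X - S) * (1 + p * (e * I n phi)) + S * (1 + p * (e * I n phi)) by ring.
rewrite b6 in b1.
have b7 : e * ((I n phi - phi z0) * (p * S)) <= e * (d * (p * S)).
  apply: (@le_trans _ _ (e * (e * (T + 2)))); last by apply: ler_wpM2l; [exact: ltW|exact: ed].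
  have -> : e * (e * (T + 2)) = T * e ^+ 2 + 2 * e ^+ 2 by ring.
  have -> : e * ((I n phi - phi z0) * (p * S)) = S * (p * (e * I n phi)) - S * (p * (e * phi z0)) by ring.
  rewrite [S * (1 + _)]mulrDr mulr1 in b1; rewrite [S * (1 + _)]mulrDr mulr1 mulrN mulrN in b2.
  apply: (second_order_combine _ b1 b2 b3); first by move: k1; rewrite ltr_norml => /andP[].
  by move: b5; rewrite ler_norml => /andP[].
by move: b7; rewrite ler_pM2l// ler_pM2r.
Qed.

Lemma concentration phi : test_fun Om phi ->
  (\int[leb]_(x in Om) (u n x `^ (qn n - 1) * phi x)%:E)%E @[n --> \oo] --> (phi z0)%:E.
Proof.
move=> tp.
have IE n : (\int[leb]_(x in Om) (u n x `^ (qn n - 1) * phi x)%:E)%E = (I n phi)%:E.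
  rewrite -(pairingE (q0 n) (q'0 n) (qq' n) (testL n tp) (WL n).1).
  rewrite (_ : (\int[leb]_x (phi x * W n x)%:E = \int[leb]_x (W n x * phi x)%:E)%E); last first.
    by apply: eq_integral => x _; rewrite mulrC.
  apply: integral_off; first exact: measurable_open_rV.
    apply/measurable_EFinP/measurable_funM; first by case: (WL n) => -[].
    exact: smooth_measurable (test_fun_smooth tp).
  by move=> x Ox; rewrite (test_fun_off tp Ox) mulr0.
under eq_fun do rewrite IE.
apply/cvg_EFin; first exact: nearW.
apply/seq_cvgP => e e0; have e2 : 0 < e / 2 by rewrite divr_gt0.
have tN := test_funZ (-1) tp.
have [n1 h1] := upper tp e2; have [n2 h2] := upper tN e2.
exists (maxn n1 n2) => n; rewrite geq_max => /andP[/h1 k1 /h2].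
rewrite /I (pairingZ _ (q0 n) (q'0 n) (qq' n) (testL n tp) (WL n).1) -/(I n phi) !mulN1r => k2.
rewrite [X in `|X - _|](_ : _ = I n phi)//.
move: k1 k2; move: (I n phi) (phi z0) => a b; rewrite ltr_norml; lra.
Qed.

End concentration.

(** Tested against a bump around [z1] inside [Om] that vanishes at [z2], one and the same sequence
    would have two limits. *)
Lemma max_unique z1 z2 : v z1 = 1 -> v z2 = 1 -> z1 = z2.
Proof.
move=> vz1 vz2; apply: contrapT => z12.
have d0 : 0 < `|z1 - z2| by rewrite normr_gt0 subr_eq0; exact/eqP.
have Oz : Om z1.
  by apply: contrapT => /(W0_off vh); rewrite vz1 => /eqP; rewrite oner_eq0.
have /nbhs_cubeP[r r0 hr] : nbhs z1 Om by exact: open_nbhs_nbhs.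
pose m := Num.min (r / 2) (`|z1 - z2| / 2).
have m0 : 0 < m by rewrite lt_min !divr_gt0.
have [eta [te _ ep]] := cube_bump_test z1 m0.
have tO : test_fun Om eta.
  apply: test_funS te => y /= yx; apply: hr; rewrite distrC; apply: le_lt_trans yx _.
  by rewrite gt_min ltr_pdivrMr// ltr_pMr// ltr1n.
have e1 : 0 < eta z1 by apply: ep; rewrite subrr normr0.
have e2 : eta z2 = 0.
  apply: (test_fun_off te) => /=; apply/negP; rewrite -ltNge distrC gt_min.
  by apply/orP; right; rewrite ltr_pdivrMr// ltr_pMr// ltr1n.
have L1 := @cvg_lim _ (@ereal_hausdorff R) _ _ _ _ _ (concentration vz1 tO).
have L2 := @cvg_lim _ (@ereal_hausdorff R) _ _ _ _ _ (concentration vz2 tO).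
have E : eta z1 = eta z2 by apply: EFin_inj; rewrite -L1 -L2.
by rewrite E e2 ltxx in e1.
Qed.

End limit.
End sequence.
End asymptotics.

(** * Existence of minimizers *)

Section real_tightness.
Context {R : realType}.

Lemma pigeonhole_increment (F : nat -> R) n : (0 < n)%N -> (forall j, 0 <= F j <= 1) ->
  exists2 j, (j < n)%N & F j.+1 - F j <= n%:R^-1.
Proof.
move=> n0 F01; apply: contrapT => h.
have big j : (j < n)%N -> n%:R^-1 < F j.+1 - F j.
  by move=> jn; rewrite ltNge; apply/negP => le; apply: h; exists j.
have n0' : 0 < n%:R :> R by rewrite ltr0n.
have : \sum_(0 <= j < n) n%:R^-1 < \sum_(0 <= j < n) (F j.+1 - F j).
  by apply: ltr_sum_nat => // j /andP[_ /big].
rewrite telescope_sumr// sumr_const_nat subn0 -[X in X < _]mulr_natl divff ?gt_eqF//.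
by have /andP[_] := F01 n; have /andP[] := F01 0%N; lra.
Qed.

(* Splitting mass strictly lowers the sum of the [p]-powers below the sum of the [q]-powers,
   [p < q]: almost no loss forces one of the two pieces to be small. *)
Lemma no_splitting (p q alpha eta : R) : 1 <= p -> p < q -> 0 < alpha -> 0 < eta ->
  exists2 d, 0 < d & forall a b, 0 <= a -> 0 <= b -> a `^ p + b `^ p <= 1 + d ->
    1 - d <= a `^ q + b `^ q -> alpha <= a -> b <= eta.
Proof.
move=> p1 pq al0 et0; have p0 : 0 < p by exact: lt_le_trans p1.
have qp : 0 < q - p by rewrite subr_gt0.
(* A third of the smallest threshold: a piece of [p]-mass at least [1 - k] together with another of
   [p]-mass at least [3 k] would exceed the available [1 + d]. *)
pose k := Num.min (alpha `^ p) (Num.min (eta `^ p) 1) / 3.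
have k0 : 0 < k.
  by apply: divr_gt0 => //; rewrite !lt_min; apply/and3P; split; rewrite ?powR_gt0.
have k1 : k < 1.
  by rewrite /k ltr_pdivrMr// mul1r; apply: (@le_lt_trans _ _ 1); [rewrite !ge_min lexx !orbT|rewrite ltr1n].
have k3 : 3 * k <= alpha `^ p by rewrite /k mulrC divfK// ge_min lexx.
have k4 : 3 * k <= eta `^ p by rewrite /k mulrC divfK// !ge_min lexx !orbT.
(* If both pieces have [p]-mass below [1 - k], passing from [p]-th to [q]-th powers loses at least
   the factor [1 - k']; with [3 d <= k'] too little [q]-mass remains. *)
pose k' := 1 - (1 - k) `^ ((q - p) / p).
have k1' : 0 < 1 - k by rewrite subr_gt0.
have k'0 : 0 < k'.
  have E1 : (1 : R) `^ ((q - p) / p) = 1 by rewrite powR1.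
  rewrite subr_gt0 -[ltRHS]E1; apply: gt0_ltr_powR; rewrite ?nnegrE ?(ltW k1')//.
    exact: divr_gt0.
  by rewrite ltrBlDr ltrDl.
pose d := Num.min k (k' / 3).
have d0 : 0 < d by rewrite lt_min k0 divr_gt0.
have dk : d <= k by rewrite ge_min lexx.
have dk' : 3 * d <= k' by rewrite mulrC -ler_pdivlMr// ge_min lexx orbT.
exists d => // a b a0 b0 hp hq aal.
have pow x : 0 <= x -> x `^ q = x `^ p * x `^ (q - p).
  move=> x0; have H : (p + (q - p) == 0) ==> (x != 0).
    have q0 : 0 < q by exact: lt_trans p0 pq.
    by apply/implyP; rewrite addrCA subrr addr0 => /eqP E; rewrite E ltxx in q0.
  by rewrite -(powRD H) addrCA subrr addr0.
(* Any common upper bound of the two pieces has [p]-th power at least [1 - k]; it is applied to the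
   larger piece. *)
have lower m : 0 <= m -> a <= m -> b <= m -> 1 - k <= m `^ p.
  move=> m0 am bm; rewrite leNgt; apply/negP => lt.
  have mq : m `^ (q - p) <= 1 - k'.
    rewrite /k' opprB addrCA subrr addr0.
    have -> : m `^ (q - p) = (m `^ p) `^ ((q - p) / p) by rewrite -powRrM mulrC divfK// gt_eqF.
    by apply: powR_le; [rewrite divr_ge0// ltW|exact: powR_ge0|exact: ltW].
  have aq : a `^ q <= a `^ p * (1 - k').
    rewrite pow//; apply: ler_wpM2l; first exact: powR_ge0.
    by apply: le_trans mq; apply: powR_le => //; exact: ltW.
  have bq : b `^ q <= b `^ p * (1 - k').
    rewrite pow//; apply: ler_wpM2l; first exact: powR_ge0.
    by apply: le_trans mq; apply: powR_le => //; exact: ltW.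
  have k'1 : 0 <= 1 - k' by exact: le_trans (powR_ge0 _ _) mq.
  have : 1 - d <= (1 + d) * (1 - k').
    apply: le_trans hq _; apply: le_trans (lerD aq bq) _.
    by rewrite -mulrDl; apply: ler_wpM2r.
  have dk'0 : 0 <= d * k' by rewrite mulr_ge0// ltW.
  rewrite mulrDl mul1r mulrBr mulr1; move: dk' dk'0 d0; lra.
rewrite leNgt; apply/negP => eb.
have ebp : eta `^ p <= b `^ p by apply: powR_le; exact: ltW.
have aap : alpha `^ p <= a `^ p by apply: powR_le; [exact: ltW|exact: ltW|exact: aal].
have [ab|/ltW ba] := lerP a b.
  have := lower b b0 ab (lexx _); move: hp dk k3 aap k0; lra.
have := lower a a0 (lexx _) ba; move: hp dk k4 ebp k0; lra.
Qed.

End real_tightness.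

Lemma powR_lip_shift (R : realType) (p L a t : R) : 1 <= p -> 0 <= L -> 0 <= t -> t <= 1 ->
  0 <= a -> a <= L + 1 -> (a + t) `^ p <= a `^ p + p * (L + 2) `^ (p - 1) * t.
Proof.
move=> p1 L0 t0 t1 a0 a1; have b1 : 0 <= a + t <= L + 2 by apply/andP; split; lra.
have b2 : 0 <= a <= L + 2 by apply/andP; split; lra.
have := powR_lip p1 b1 b2; rewrite addrAC subrr add0r (ger0_norm t0) ler_norml => /andP[_].
by rewrite lerBlDl.
Qed.

(** * Cutoffs and tightness of near-minimizers *)

Section cutoff.
Context {R : realType} {N : nat}.
Local Notation V := 'rV[R]_N.
Local Notation leb := (@lebesgue_rV R N).

Lemma partial_scale i (s : R) (f : V -> R) x : smooth f ->
  partial i (fun x => f (s *: x)) x = s * partial i f (s *: x).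
Proof.
move=> sf; have D := smooth_directional (s *: x) (s *: delta_mx 0 i) sf.
have {}D : is_derive x (delta_mx 0 i) (fun x => f (s *: x)) (\sum_k (s *: delta_mx 0 i : V) 0 k * partial k f (s *: x)).
  apply/is_derive_line; move/is_derive_line: D.
  rewrite (_ : (fun h => f (s *: x + h *: (s *: delta_mx 0 i))) = (fun h => f (s *: (x + h *: delta_mx 0 i))))//.
  by apply/funext => h; rewrite scalerDr !scalerA [h * s]mulrC.
rewrite /partial; have [_ ->] := D; rewrite (bigD1 i)//= big1 ?addr0.
  by rewrite !mxE !eqxx mulr1.
by move=> k ki; rewrite !mxE (negbTE ki) andbF mulr0 mul0r.
Qed.

Definition cutoff (r : R) : V -> R :=
  fun x => \prod_i (step (- r^-1 * x 0 i + 2) * step (r^-1 * x 0 i + 2)).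

Lemma smooth_cutoff r : smooth (cutoff r).
Proof.
apply: (smooth_prod _ (F := fun i x => step (- r^-1 * x 0 i + 2) * step (r^-1 * x 0 i + 2))) => i.
by apply: (smoothM (f := fun x : V => step (- r^-1 * x 0 i + 2)) (g := fun x : V => step (r^-1 * x 0 i + 2)));
  exact: smooth_step.
Qed.

Lemma cutoff_01 r x : 0 <= cutoff r x <= 1.
Proof.
apply/andP; split; first by apply: prodr_ge0 => i _; rewrite mulr_ge0 ?step_ge0.
by apply: prodr_ile1 => i _; rewrite mulr_ge0 ?step_ge0//= mulr_ile1 ?step_ge0 ?step_le1.
Qed.

Lemma cutoff_in r x : 0 < r -> `|x| <= r -> cutoff r x = 1.
Proof.
move=> r0 xr; apply: big1 => i _; have := le_trans (ler_coord_norm x i) xr.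
rewrite ler_norml => /andP[h1 h2].
have k1 : r^-1 * x 0 i <= 1 by rewrite mulrC ler_pdivrMr// mul1r.
have k2 : -1 <= r^-1 * x 0 i by rewrite mulrC ler_pdivlMr// mulN1r.
rewrite !step_ge1 ?mulr1//; rewrite ?mulNr; lra.
Qed.

Lemma cutoff_out r x : 0 < r -> 2 * r <= `|x| -> cutoff r x = 0.
Proof.
move=> r0 xr; have [i hi] : exists i, 2 * r <= `|x 0 i|.
  apply: contrapT => /forallNP h.
  have : `|x| < 2 * r.
    by apply: ltr_norm_coord; [rewrite mulr_gt0|move=> i; rewrite ltNge; apply/negP; exact: h].
  by rewrite ltNge xr.
rewrite /cutoff (bigD1 i)//=; move: hi; rewrite ler_normr => /orP[] hi.
  rewrite step_le0 ?mul0r//.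
  have : 2 <= r^-1 * x 0 i by rewrite mulrC ler_pdivlMr.
  by rewrite mulNr; lra.
rewrite [X in _ * X * _]step_le0 ?mulr0 ?mul0r//.
have : 2 <= r^-1 * - x 0 i by rewrite mulrC ler_pdivlMr.
by rewrite mulrN; lra.
Qed.

Lemma cutoff_scale r x : cutoff r x = cutoff 1 (r^-1 *: x).
Proof. by apply: eq_bigr => i _; rewrite !mxE invr1 !mulNr mul1r. Qed.

(** All cutoffs are rescalings of [cutoff 1], whose gradient is bounded. *)
Lemma cutoff_grad : exists2 M : R, 0 < M & forall r x, 0 < r -> enorm (grad (cutoff r) x) <= M / r.
Proof.
have t1 : test_fun [set: V] (cutoff 1).
  apply/test_funP; split; first exact: smooth_cutoff.
  exists [set x : V | `|x - 0| <= 2]; split; [exact: compact_ball_rV|by []|].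
  move=> x /= /negP; rewrite -ltNge subr0 => /ltW x2; apply: cutoff_out => //.
  by rewrite mulr1.
have [M M0 hM] := grad_bounded t1; exists M => // r x r0.
have -> : grad (cutoff r) x = r^-1 *: grad (cutoff 1) (r^-1 *: x).
  apply/rowP => i; rewrite gradE mxE gradE.
  have -> : cutoff r = (fun x => cutoff 1 (r^-1 *: x)) by apply/funext => y; exact: cutoff_scale.
  by rewrite partial_scale//; exact: smooth_cutoff.
rewrite enormZ gtr0_norm ?invr_gt0// mulrC ler_pM2r ?invr_gt0//; exact: hM.
Qed.

Lemma gradM (f h : V -> R) : smooth f -> smooth h ->
  grad (f \* h) = fun x => f x *: grad h x + h x *: grad f x.
Proof.
by move=> sf sh; apply/funext => x; apply/rowP => i; rewrite !mxE partialM.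
Qed.

(** The function [sqrt (phi^2 + e^2) - e]: smooth, with the zeros of [phi], and its gradient is that
    of [phi] times a factor of absolute value at most 1. *)
Lemma smooth_abs E (phi : V -> R) (e : R) : test_fun E phi -> 0 < e -> exists psi : V -> R, [/\ test_fun E psi,
  forall x, 0 <= psi x <= `|phi x|, forall x, `|phi x| <= psi x + e,
  (forall x, phi x = 0 -> psi x = 0) & forall x, enorm (grad psi x) <= enorm (grad phi x)].
Proof.
move=> /test_funP[sp [D [cD DE pD]]] e0.
pose F : V -> R := (phi \* phi) \+ cst (e ^+ 2).
have e2 : 0 < e ^+ 2 by rewrite exprn_gt0.
have F0 x : 0 < F x by rewrite /F /= ltr_wpDl// -expr2 sqr_ge0.
have sF : smooth F by apply: smoothD; [exact: smoothM|exact: smooth_cst].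
have [sS dS] := smooth_sqrt sF F0.
pose S : V -> R := fun x => Num.sqrt (F x).
have Se x : e <= S x.
  rewrite -[leLHS](ger0_norm (ltW e0)) -sqrtr_sqr /S; apply: ler_wsqrtr.
  by rewrite /F /= lerDr -expr2 sqr_ge0.
have Sp x : `|phi x| <= S x.
  by rewrite -sqrtr_sqr /S; apply: ler_wsqrtr; rewrite /F /= -expr2 lerDl ltW.
have Spe x : S x <= `|phi x| + e.
  rewrite /S -[leRHS]ger0_norm; last by rewrite addr_ge0// ltW.
  rewrite -sqrtr_sqr; apply: ler_wsqrtr; rewrite /F /= sqrrD real_normK ?num_real// -expr2 lerD2r lerDl.
  by rewrite mulrn_wge0// mulr_ge0// ltW.
have S0 x : 0 < S x by exact: lt_le_trans (Se x).
have smS : smooth (S \- cst e) by apply: smoothB; [exact: sS|exact: smooth_cst].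
exists (S \- cst e); split.
- apply/test_funP; split; first exact: smS.
  exists D; split=> // x /pD px /=; rewrite /S /F /= px mulr0 add0r sqrtr_sqr ger0_norm ?subrr//.
  exact: ltW.
- by move=> x /=; rewrite subr_ge0 Se lerBlDr Spe.
- by move=> x /=; rewrite subrK.
- by move=> x px /=; rewrite /S /F /= px mulr0 add0r sqrtr_sqr ger0_norm ?subrr// ltW.
move=> x; have -> : grad (S \- cst e) x = (phi x / S x) *: grad phi x.
  apply/rowP => i; rewrite [RHS]mxE !gradE partialB; [|exact: sS|exact: smooth_cst].
  rewrite /= partial_cst subr0 dS partialD; [|exact: smoothM|exact: smooth_cst].
  rewrite /= partial_cst addr0 partialM// /= -/(S x); field; by rewrite gt_eqF.
rewrite enormZ ler_piMl ?enorm_ge0// normrM normfV (gtr0_norm (S0 x)) ler_pdivrMr// mul1r.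
exact: Sp.
Qed.

End cutoff.

Lemma nrm_ineq3 d (T : measurableType d) (R : realType) (mu : {measure set T -> \bar R}) (q : R)
    (f1 f2 f3 f4 f5 : T -> R) : 0 < q ->
  Lp mu q f1 -> Lp mu q f2 -> Lp mu q f3 -> Lp mu q f4 -> Lp mu q f5 ->
  (forall x, `|f1 x| `^ q + `|f2 x| `^ q <= `|f3 x| `^ q + `|f4 x| `^ q + `|f5 x| `^ q) ->
  nrm mu q f1 `^ q + nrm mu q f2 `^ q <= nrm mu q f3 `^ q + nrm mu q f4 `^ q + nrm mu q f5 `^ q.
Proof.
move=> q0 h1 h2 h3 h4 h5 H.
have m f : Lp mu q f -> measurable_fun setT (fun x => (`|f x| `^ q)%:E).
  by move=> [mf _]; exact: measurable_abs_powR.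
have p0 (f : T -> R) : forall x, setT x -> (0 <= (`|f x| `^ q)%:E)%E.
  by move=> x _; rewrite lee_fin powR_ge0.
rewrite -lee_fin !EFinD -(nrm_powR q0 h1) -(nrm_powR q0 h2) -(nrm_powR q0 h3) -(nrm_powR q0 h4) -(nrm_powR q0 h5).
rewrite -(ge0_integralD mu measurableT (p0 f1) (m _ h1) (p0 f2) (m _ h2)).
rewrite -(ge0_integralD mu measurableT (p0 f3) (m _ h3) (p0 f4) (m _ h4)).
have m2 f f' : Lp mu q f -> Lp mu q f' -> measurable_fun setT (fun x => ((`|f x| `^ q)%:E + (`|f' x| `^ q)%:E)%E).
  by move=> h h'; apply: emeasurable_funD; exact: m.
have p02 (f f' : T -> R) : forall x, setT x -> (0 <= (`|f x| `^ q)%:E + (`|f' x| `^ q)%:E)%E.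
  by move=> x _; rewrite -EFinD lee_fin addr_ge0 ?powR_ge0.
rewrite -(ge0_integralD mu measurableT (p02 f3 f4) (m2 _ _ h3 h4) (p0 f5) (m _ h5)).
apply: ge0_le_integral => //.
- by move=> x _; exact: p02.
- exact: m2.
- by apply: emeasurable_funD; [exact: m2|exact: m].
- by move=> x _; rewrite -!EFinD lee_fin; exact: H.
Qed.

Lemma nrm_lower d (T : measurableType d) (R : realType) (mu : {measure set T -> \bar R}) (q s w : R)
    (f : T -> R) (A : set T) : 0 < q -> Lp mu q f -> measurable A -> mu A = w%:E -> 0 <= s ->
  (forall x, A x -> s <= `|f x|) -> s `^ q * w <= nrm mu q f `^ q.
Proof.
move=> q0 fL mA Aw s0 sf; rewrite -lee_fin EFinM -(nrm_powR q0 fL) -Aw -integral_cst//.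
rewrite integral_mkcond; apply: ge0_le_integral => //.
- by move=> x _; rewrite patchE; case: ifP => // _; rewrite lee_fin powR_ge0.
- by apply/(measurable_restrictT _ mA); exact: measurable_cst.
- by apply: measurable_abs_powR; case: fL.
- move=> x _; rewrite patchE; case: ifPn => [|_]; last by rewrite lee_fin powR_ge0.
  by rewrite inE => xA; rewrite lee_fin; apply: powR_le; [exact: ltW|exact: s0|exact: sf].
Qed.

Section tightness.
Context {R : realType} {N : nat}.
Local Notation V := 'rV[R]_N.
Local Notation leb := (@lebesgue_rV R N).
Variables (Om : set V) (p C : R).
Hypothesis adm : admissible Om p C.
Hypothesis Om0 : exists x, Om x.
Variable q : R.
Hypothesis pq : p < q.
Local Notation L := (Lam Om p q%:E).

Let p2 : 2 <= p. Proof. by case: adm. Qed.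
Let p1 : 1 <= p. Proof. exact: le_trans (ler1n _ 2) p2. Qed.
Let pp0 : 0 < p. Proof. exact: lt_le_trans p1. Qed.
Let q0 : 0 < q. Proof. exact: lt_trans pq. Qed.
Let C0 : 0 < C. Proof. by case: adm. Qed.
Let L0 : 0 < L. Proof. by case: (LamP adm Om0 (ltW pq)). Qed.
Let LL u g : W0 Om p u g -> L * nrm leb q u <= vnrm p g.
Proof. by case: (LamP adm Om0 (ltW pq)) => _ _ _ h _; exact: h. Qed.

Let indic_le (A : set V) (f : V -> R) : measurable A -> Lp leb q f ->
  Lp leb q (fun x => \1_A x * f x) /\ nrm leb q (fun x => \1_A x * f x) <= nrm leb q f.
Proof.
move=> mA fL; apply: Lp_le => //.
  by apply: measurable_funM; [exact: measurable_indic|case: fL].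
by move=> x; rewrite normrM ler_piMl// indicE; case: (_ \in _); rewrite ?normr1 ?normr0.
Qed.

Let measurable_le_norm r : measurable [set x : V | `|x| <= r].
Proof.
apply: measurable_closed_rV; apply: compact_closed_rV.
by have := @compact_ball_rV R N 0 r; under eq_fun do rewrite subr0.
Qed.

(** The gradients of the two pieces are [chi grad psi] and [(1 - chi) grad psi] up to the term
    [psi grad chi], of norm at most [t]. The [p]-th powers of the main terms add up pointwise to at
    most [|grad psi|^p]; each piece then satisfies the Rayleigh inequality. *)
Lemma split_energy (psi : V -> R) (M r t : R) : test_fun Om psi -> 0 < r ->
  (forall x : V, enorm (grad (cutoff r) x) <= M / r) -> M / r * nrm leb p psi <= t ->
  vnrm p (grad psi) <= L + 1 -> t <= 1 ->
  (L * nrm leb q (cutoff r \* psi)) `^ p + (L * nrm leb q (psi \- (cutoff r \* psi))) `^ p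
  <= vnrm p (grad psi) `^ p + 2 * (p * (L + 2) `^ (p - 1)) * t.
Proof.
move=> tpsi r0 hM ht hpsi t1; pose chi : V -> R := cutoff r.
have schi : smooth chi by exact: smooth_cutoff.
have spsi := test_fun_smooth tpsi.
have c01 x : 0 <= chi x <= 1 by exact: cutoff_01.
have t1f : test_fun Om (chi \* psi) by exact: test_funMl.
have t2f : test_fun Om (psi \- (chi \* psi)) by exact: test_funB.
have gpsi := test_fun_vLp pp0 tpsi.
pose g1 x : V := chi x *: grad psi x; pose g2 x : V := (1 - chi x) *: grad psi x.
pose k x : V := psi x *: grad chi x.
have mchi := smooth_measurable schi.
have c1 x : 0 <= 1 - chi x by rewrite subr_ge0; case/andP: (c01 x).
have [vm _] := gpsi.
have g1L : vLp p g1 /\ vnrm p g1 <= vnrm p (grad psi).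
  apply: vnrm_le_pointwise => //.
    by move=> i; under eq_fun do rewrite mxE; apply: measurable_funM => //; exact: vm.
  by move=> x; rewrite enormZ ler_piMl ?enorm_ge0// ger0_norm; case/andP: (c01 x).
have g2L : vLp p g2 /\ vnrm p g2 <= vnrm p (grad psi).
  apply: vnrm_le_pointwise => //.
    move=> i; under eq_fun do rewrite mxE; apply: measurable_funM; last exact: vm.
    by apply: measurable_funB => //; exact: measurable_cst.
  by move=> x; rewrite enormZ ler_piMl ?enorm_ge0// ger0_norm// lerBlDr lerDl; case/andP: (c01 x).
have kL : vLp p k /\ vnrm p k <= t.
  have pL := test_fun_Lp pp0 tpsi.
  have [ML Mn] := LpZ (M / r) pp0 pL.
  have km : vmeas k.
    move=> i; under eq_fun do rewrite mxE; apply: measurable_funM; first exact: smooth_measurable.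
    by have := vmeas_grad schi; apply.
  have [kk kn] := Lp_le pp0 (measurable_enorm km) (fun x => ltac:(
     rewrite (ger0_norm (enorm_ge0 _)) /k enormZ normrM mulrC; apply: ler_wpM2r => //;
     exact: le_trans (hM x) (ler_norm _)) : `|enorm (k x)| <= `|(fun x => M / r * psi x) x|) ML.
  split; first by split.
  have Mr : 0 <= M / r by exact: le_trans (enorm_ge0 _) (hM 0).
  by apply: le_trans kn _; rewrite Mn ger0_norm.
have E1 : grad (chi \* psi) = fun x => g1 x + k x by rewrite gradM.
have E2 : grad (psi \- (chi \* psi)) = fun x => g2 x - k x.
  rewrite gradB; [|exact: spsi|exact: test_fun_smooth t1f].
  rewrite E1; apply/funext => x; rewrite /g1 /g2 scalerBl scale1r opprD addrA.
  by [].
have h1 : L * nrm leb q (chi \* psi) <= vnrm p g1 + t.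
  apply: le_trans (LL (W0_test adm t1f)) _; rewrite E1.
  by apply: le_trans (vLpD p1 g1L.1 kL.1).2 _; rewrite lerD2l; case: kL.
have h2 : L * nrm leb q (psi \- (chi \* psi)) <= vnrm p g2 + t.
  apply: le_trans (LL (W0_test adm t2f)) _; rewrite E2.
  by apply: le_trans (vLpB p1 g2L.1 kL.1).2 _; rewrite lerD2l; case: kL.
have t0 : 0 <= t by apply: le_trans (vnrm_ge0 p k) _; case: kL.
have lip a := @powR_lip_shift _ p L a t p1 (ltW L0) t0 t1.
have s : vnrm p g1 `^ p + vnrm p g2 `^ p <= vnrm p (grad psi) `^ p.
  have := vnrm_ineq pp0 g1L.1 g2L.1 gpsi gpsi ler01 (lexx 0).
  rewrite mul1r mul0r addr0; apply => x; rewrite mul1r mul0r addr0 !enormZ.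
  rewrite (ger0_norm (c1 x)) ger0_norm; last by case/andP: (c01 x).
  apply: le_trans (powR_superadd _ _ p1) _.
  - by rewrite mulr_ge0 ?enorm_ge0//; case/andP: (c01 x).
  - by rewrite mulr_ge0 ?enorm_ge0.
  by rewrite -mulrDl addrC subrK mul1r.
have l1 := lip _ (vnrm_ge0 p g1) (le_trans g1L.2 hpsi).
have l2 := lip _ (vnrm_ge0 p g2) (le_trans g2L.2 hpsi).
have n1 : 0 <= L * nrm leb q (chi \* psi) by rewrite mulr_ge0 ?nrm_ge0// ltW.
have n2 : 0 <= L * nrm leb q (psi \- (chi \* psi)) by rewrite mulr_ge0 ?nrm_ge0// ltW.
apply: le_trans (lerD (powR_le (ltW pp0) n1 h1) (powR_le (ltW pp0) n2 h2)) _.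
apply: le_trans (lerD l1 l2) _.
rewrite addrACA; apply: lerD; first exact: s.
by rewrite -[2 * _ * _]mulrA [2 * _]mulr_natl mulr2n.
Qed.

(** Among [n] dyadic annuli one carries [q]-mass at most [1/n], and the cut is made there: hardly
    any [q]-mass is lost and the energies nearly add. As equicontinuity gives the inner piece a
    definite mass around [z], [no_splitting] forces the outer one to be small. *)
Lemma tight (m0 r1 eta : R) : 0 < m0 -> 0 < eta -> exists d r : R, [/\ 0 < d, 0 < r &
  forall psi z, test_fun Om psi -> nrm leb q psi = 1 -> vnrm p (grad psi) <= L + d -> `|z| <= r1 ->
    m0 <= `|psi z| -> nrm leb q (fun x => \1_[set x : V | r < `|x|] x * psi x) <= eta].
Proof.
move=> m00 eta0; have L1 : 0 < L + 1 by rewrite addr_gt0.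
have e1 : 0 < m0 / 2 / (L + 1) by rewrite !divr_gt0.
have m2 : 0 < m0 / 2 by rewrite divr_gt0.
have [_ _ _ _ /(_ _ e1)[rho rho0 hrho]] := adm.
pose w := \prod_(i < N) (\row__ rho : V) 0 i.
have w0 : 0 < w by apply: prodr_gt0 => i _; rewrite mxE.
(* On a cube of side [rho] at [z] the function stays above [m0 / 2]; [alpha] is the [L^q] norm this
   guarantees. *)
pose alpha := (m0 / 2) * w `^ q^-1.
have al0 : 0 < alpha by rewrite mulr_gt0// powR_gt0.
have [d0 d00 split_] := no_splitting p1 pq al0 eta0.
have [M M0 hM] := @cutoff_grad R N.
pose Kp := p * (L + 2) `^ (p - 1).
have Kp0 : 0 <= Kp by rewrite mulr_ge0 ?powR_ge0// ltW.
have Kp1 : 0 < 3 * (Kp + 1) by rewrite mulr_gt0// ltr_wpDl.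
have Lp0 : 0 < L `^ p by exact: powR_gt0.
(* Three errors of size at most [Kp d] occur: one from [vnrm p (grad psi) <= L + d] and two from the
   cutoff terms. Their sum must stay below [d0 L^p]. *)
pose d := Num.min 1 (d0 * L `^ p / (3 * (Kp + 1))).
have dpos : 0 < d by rewrite lt_min ltr01 /=; apply: divr_gt0 => //; exact: mulr_gt0.
have d1 : d <= 1 by rewrite ge_min lexx.
have dK : 3 * (Kp + 1) * d <= d0 * L `^ p by rewrite mulrC -ler_pdivlMr// ge_min lexx orbT.
pose B := C * (L + 1).
have B0 : 0 < B by exact: mulr_gt0.
(* The first entry keeps the cube around [z] inside the region where the cutoff is 1; the second
   makes the gradient of the cutoff contribute at most [d]. *)
pose R0 := Num.max (Num.max r1 0 + rho) (M * B / d).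
have R00 : 0 < R0 by rewrite lt_max ltr_wpDl// le_max lexx orbT.
pose n := (Num.bound d0^-1).+1.
have n1 : n%:R^-1 <= d0.
  rewrite invf_ple ?posrE ?ltr0n//; apply/ltW/(lt_trans (archi_boundP _)); first by rewrite invr_ge0 ltW.
  by rewrite ltr_nat.
pose Rj j := R0 * 2 ^+ j.
have Rj0 j : 0 < Rj j by rewrite mulr_gt0// exprn_gt0.
have RjS j : Rj j.+1 = 2 * Rj j by rewrite /Rj exprS mulrCA.
have R0j j : R0 <= Rj j by rewrite /Rj ler_peMr ?(ltW R00)// exprn_ege1// ler1n.
have Rmono i j : (i <= j)%N -> Rj i <= Rj j.
  by move=> ij; rewrite /Rj ler_pM2l// ler_weXn2l// ler1n.
exists d, (Rj n); split=> // psi z tpsi npsi vpsi zr mz.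
have psiL := test_fun_Lp q0 tpsi.
have v1 : vnrm p (grad psi) <= L + 1 by apply: le_trans vpsi _; rewrite lerD2l.
pose D j : set V := [set x : V | `|x| <= Rj j].
pose F j := nrm leb q (fun x => \1_(D j) x * psi x) `^ q.
have F01 j : 0 <= F j <= 1.
  rewrite powR_ge0 /=; have [_ h] := indic_le (measurable_le_norm (Rj j)) psiL.
  by have := powR_le (ltW q0) (nrm_ge0 _ _ _) h; rewrite npsi powR1.
have [j jn Fj] := pigeonhole_increment (isT : (0 < n)%N) F01.
pose chi : V -> R := cutoff (Rj j).
have t1f : test_fun Om (chi \* psi) by apply: test_funMl => //; exact: smooth_cutoff.
have t2f : test_fun Om (psi \- (chi \* psi)) by exact: test_funB.
have f1L := test_fun_Lp q0 t1f; have f2L := test_fun_Lp q0 t2f.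
pose a := nrm leb q (chi \* psi); pose b := nrm leb q (psi \- (chi \* psi)).
have out x : 2 * Rj j <= `|x| -> chi x = 0 by exact: cutoff_out.
have inn x : `|x| <= Rj j -> chi x = 1 by exact: cutoff_in.
(* Inside the annulus and outside it one of the pieces is all of [psi]; only on the annulus, whose
   mass is small, can [q]-mass be lost. *)
have mass : 1 - d0 <= a `^ q + b `^ q.
  have := nrm_ineq3 q0 psiL (indic_le (measurable_le_norm (Rj j)) psiL).1 f1L f2L
    (indic_le (measurable_le_norm (Rj j.+1)) psiL).1.
  rewrite npsi powR1 -/(F j) -/(F j.+1) -/a -/b => h.
  suff : 1 + F j <= a `^ q + b `^ q + F j.+1 by move: Fj n1; lra.
  apply: h => x; have Z : `|0 : R| `^ q = 0 by rewrite normr0 powR0// gt_eqF.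
  have [x1|x1] := lerP `|x| (Rj j).
    rewrite !indicE !mem_set; [|by apply: le_trans x1 _; exact: Rmono|exact: x1].
    by rewrite !mul1r /= inn// mul1r subrr Z addr0.
  have [x2|x2] := lerP `|x| (Rj j.+1).
    rewrite [\1_(D j) x]indicE memNset; last by apply/negP; rewrite -ltNge.
    rewrite mul0r Z addr0 indicE mem_set// mul1r lerDr addr_ge0 ?powR_ge0//.
  rewrite !indicE !memNset; last 2 first.
  - by apply/negP; rewrite -ltNge.
  - by apply/negP; rewrite -ltNge.
  by rewrite !mul0r Z !addr0 /= out ?mul0r ?Z ?subr0 ?add0r//; rewrite -RjS ltW.
have energy_le : a `^ p + b `^ p <= 1 + d0.
  have nB : nrm leb p psi <= B.
    have [_ h] := W0_Lp adm (W0_test adm tpsi); apply: le_trans h _.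
    by apply: ler_wpM2l => //; exact: ltW.
  have td : M / Rj j * nrm leb p psi <= d.
    have : M * B / d <= Rj j by apply: le_trans (R0j j); rewrite le_max lexx orbT.
    rewrite ler_pdivrMr// => h; rewrite mulrAC ler_pdivrMr// mulrC [leRHS]mulrC.
    apply: le_trans h; rewrite mulrC; apply: ler_wpM2l => //; exact: ltW.
  have := split_energy tpsi (Rj0 j) (fun x => hM _ x (Rj0 j)) td v1 d1.
  rewrite -/chi -/a -/b -/Kp => se.
  have a0 : 0 <= a by exact: nrm_ge0.
  have b0 : 0 <= b by exact: nrm_ge0.
  rewrite !powRM ?(ltW L0)// -mulrDr in se.
  have lip := @powR_lip_shift _ p L L d p1 (ltW L0) (ltW dpos) d1 (ltW L0) (ltac:(by rewrite lerDl)).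
  have vp := powR_le (ltW pp0) (vnrm_ge0 _ _) vpsi.
  rewrite -(ler_pM2l Lp0) [leRHS]mulrDr mulr1 [_ * d0]mulrC.
  apply: le_trans se _; apply: (le_trans (lerD vp (lexx _))); apply: (le_trans (lerD lip (lexx _))).
  rewrite -/Kp -addrA lerD2l; apply: le_trans dK.
  rewrite -mulrDl; apply: ler_wpM2r; first exact: ltW.
  by rewrite mulrDr mulr1 -[X in X + _]mul1r -mulrDl -[1 + 2]/(3 : R) lerDl.
have aal : alpha <= a.
  have fz x : cbox z (\row__ rho) x -> m0 / 2 <= `|(chi \* psi) x|.
    move=> xb; have zx : `|z - x| < rho.
      apply: ltr_norm_coord => // i; have := xb i; rewrite !mxE => /andP[h1 h2].
      by rewrite ltr_norml; lra.
    have xr : `|x| <= Rj j.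
      apply: le_trans (R0j j); rewrite /R0 le_max; apply/orP; left.
      rewrite (_ : x = z - (z - x)); last by rewrite opprB addrC subrK.
      apply: le_trans (ler_normB _ _) _; apply: lerD; last exact: ltW.
      by rewrite le_max zr.
    rewrite /= inn// mul1r; have := hrho psi z x tpsi zx.
    have : m0 / 2 / (L + 1) * vnrm p (grad psi) <= m0 / 2.
      by rewrite mulrAC ler_pdivrMr// ler_pM2l.
    move: (_ * vnrm p _) => y y1 y2; have := lerB_dist (psi z) (psi x); move: mz y1 y2; lra.
  have rp i : 0 <= (\row__ rho : V) 0 i by rewrite mxE ltW.
  have := nrm_lower q0 f1L (measurable_cbox z (\row__ rho)) (lebesgue_cbox z rp) (ltW m2) fz.
  rewrite -/w -/a leNgt => /negP h; rewrite leNgt; apply/negP => lt; apply: h.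
  have -> : (m0 / 2) `^ q * w = alpha `^ q.
    rewrite /alpha [in RHS]powRM ?powR_ge0 ?(ltW m2)// -powRrM mulVf ?gt_eqF// powRr1//; exact: ltW.
  by apply: gt0_ltr_powR; rewrite ?nnegrE ?nrm_ge0// ltW.
apply: le_trans (split_ a b (nrm_ge0 _ _ _) (nrm_ge0 _ _ _) energy_le mass aal).
apply: (Lp_le q0 _ _ f2L).2.
  apply: measurable_funM; last by case: psiL.
  apply: measurable_indic; rewrite (_ : [set x : V | _] = ~` D n); first by apply: measurableC; exact: measurable_le_norm.
  by apply/seteqP; split=> x /=; [rewrite ltNge => /negP|move/negP; rewrite -ltNge].
move=> x; rewrite indicE; case: (asboolP (x \in [set x : V | Rj n < `|x|])) => [|/negP/negbTE ->].
  rewrite inE => xn; rewrite mem_set// mul1r /= out ?mul0r ?subr0//.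
  by rewrite -RjS; apply: le_trans (ltW xn); exact: Rmono.
by rewrite mul0r normr0.
Qed.

End tightness.

Lemma three_eps (R : realType) (e x1 x2 x3 x4 : R) : `|x1 - x3| <= e / 3 -> `|x2 - x4| <= e / 3 ->
  `|x3 - x4| < e / 3 -> `|x1 - x2| <= e.
Proof. rewrite ltr_norml !ler_norml; lra. Qed.

Lemma vnrm_limit_bound (R : realType) (e a b l : R) : `|a - b| <= e / 2 -> `|a - l| < e / 2 -> b <= l + e.
Proof. rewrite ler_norml ltr_norml; lra. Qed.

Lemma max_limit_bound (R : realType) (e a b c d f : R) : `|a - b| <= e / 3 -> `|c - d| <= e / 3 ->
  `|f - d| < e / 3 -> a <= c -> b <= f + e.
Proof. rewrite !ler_norml ltr_norml; lra. Qed.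

Section net.
Context {R : realType} {N : nat}.
Local Notation V := 'rV[R]_N.
Local Notation leb := (@lebesgue_rV R N).

Lemma finite_net (r rho : R) : 0 < r -> 0 < rho -> exists (I : finType) (P : I -> V),
  forall x : V, `|x| <= r -> exists i, `|x - P i| < rho.
Proof.
move=> r0 rho0; pose h := rho / 2; have h0 : 0 < h by rewrite divr_gt0.
pose m := (Num.bound (2 * r / h)).+1.
exists {ffun 'I_N -> 'I_m}, (fun f : {ffun 'I_N -> 'I_m} => \row_i (- r + (f i)%:R * h) : V) => x xr.
have fl i : exists n : nat, (n < m)%N /\ n%:R <= (x 0 i + r) / h < n%:R + 1.
  have := le_trans (ler_coord_norm x i) xr; rewrite ler_norml => /andP[x1 x2].
  have p0 : 0 <= (x 0 i + r) / h by rewrite divr_ge0 ?(ltW h0)//; lra.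
  exists (Num.truncn ((x 0 i + r) / h)).
  have := truncn_itv p0; rewrite -natr1 => /andP[a b]; rewrite a b; split=> //.
  rewrite ltnS -(ler_nat R); apply: le_trans a _; apply: (@le_trans _ _ (2 * r / h)).
    by rewrite ler_pM2r ?invr_gt0//; lra.
  apply/ltW/archi_boundP; apply: divr_ge0; last exact: ltW.
  by apply: mulr_ge0 => //; exact: ltW.
have /choice[n hn] := fl.
exists [ffun i => inord (n i)]; apply: ltr_norm_coord => // i; rewrite !mxE ffunE inordK; last by case: (hn i).
have [_ /andP[a b]] := hn i.
rewrite ler_pdivlMr// in a; rewrite ltr_pdivrMr// mulrDl mul1r in b.
have hr : h < rho by rewrite /h ltr_pdivrMr// ltr_pMr// ltr1n.
rewrite ltr_norml; apply/andP; split; lra.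
Qed.

End net.

(** * Convergence of centred minimizing sequences *)

Section existence.
Context {R : realType} {N : nat}.
Local Notation V := 'rV[R]_N.
Local Notation leb := (@lebesgue_rV R N).
Variables (Om : set V) (p C : R).
Hypothesis adm : admissible Om p C.
Hypothesis Om0 : exists x, Om x.
Variable q : R.
Hypothesis pq : p < q.
Local Notation L := (Lam Om p q%:E).
Variable Y : set V.
Hypothesis cY : compact Y.
Hypothesis shift : forall x, exists a, Y (a + x) /\ forall y, Om (a + y) <-> Om y.

Let p2 : 2 <= p. Proof. by case: adm. Qed.
Let p1 : 1 <= p. Proof. exact: le_trans (ler1n _ 2) p2. Qed.
Let pp0 : 0 < p. Proof. exact: lt_le_trans p1. Qed.
Let q0 : 0 < q. Proof. exact: lt_trans pq. Qed.
Let q1 : 1 <= q. Proof. exact: le_trans p1 (ltW pq). Qed.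
Let C0 : 0 < C. Proof. by case: adm. Qed.
Let L0 : 0 < L. Proof. by case: (LamP adm Om0 (ltW pq)). Qed.
Let LL u g : W0 Om p u g -> L * nrm leb q u <= vnrm p g.
Proof. by case: (LamP adm Om0 (ltW pq)) => _ _ _ h _; exact: h. Qed.

Let indicL (D : set V) : compact D -> Lp leb q (\1_D : V -> R).
Proof.
move=> cD; apply: (@bounded_csupp_Lp _ _ D _ 1 q q0) => //.
- by apply: measurable_indic; apply: measurable_closed_rV; exact: compact_closed_rV.
- by move=> x Dx; rewrite indicE memNset.
- by move=> x; rewrite indicE; case: (_ \in _); rewrite ?normr1 ?normr0.
Qed.

Lemma nonneg_near_minimizer (e : R) : 0 < e -> exists psi, [/\ test_fun Om psi, forall x, 0 <= psi x,
  nrm leb q psi = 1 & vnrm p (grad psi) < L + e].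
Proof.
move=> e0; have e2 : 0 < e / 2 by rewrite divr_gt0.
have [_ _ _ _ /(_ _ e2)[phi [tphi nphi gphi]]] := LamP adm Om0 (ltW pq).
have [sp [D [cD DO pD]]] := (test_funP _ _).1 tphi.
have iL := indicL cD; pose c := nrm leb q (\1_D : V -> R).
have c0 : 0 <= c by exact: nrm_ge0.
have Le : 0 < L + e by exact: addr_gt0.
have c1 : 0 < c + 1 by rewrite ltr_wpDl.
(* Smoothing the absolute value lowers the [L^q] norm by at most [eps c]; this choice keeps the
   energy below [L + e] after renormalization. *)
pose eps := e / 2 / ((L + e) * (c + 1)).
have eps0 : 0 < eps by rewrite divr_gt0// mulr_gt0.
have epc : (L + e) * (eps * c) <= e / 2.
  apply: (@le_trans _ _ ((L + e) * (eps * (c + 1)))).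
    by rewrite !ler_pM2l// lerDl.
  by rewrite mulrCA /eps divfK// mulf_neq0// gt_eqF.
have [psi [tpsi psi01 psie _ psig]] := smooth_abs tphi eps0.
have psiL := test_fun_Lp q0 tpsi.
pose s := nrm leb q psi.
have s1 : 1 - eps * c <= s.
  have [eL en] := LpZ eps q0 iL.
  have [sL sn] := LpD q1 psiL eL.
  have [_ h] : Lp leb q phi /\ nrm leb q phi <= nrm leb q (psi \+ (fun x => eps * \1_D x)).
    apply: Lp_le => //; first exact: smooth_measurable (test_fun_smooth tphi).
    move=> x /=; have [Dx|Dx] := pselect (D x); last by rewrite pD// normr0.
    rewrite indicE mem_set// mulr1; apply: le_trans (psie x) (ler_norm _).
  rewrite nphi in h; have := le_trans h sn; rewrite en (gtr0_norm eps0) -/c -/s.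
  by rewrite lerBlDr.
have Ls : L + e / 2 <= (L + e) * s.
  apply: (@le_trans _ _ ((L + e) * (1 - eps * c))); last by rewrite ler_pM2l.
  by rewrite mulrBr mulr1 lerBrDr; apply: le_trans (lerD (lexx _) epc) _; rewrite -addrA -splitr.
have s0 : 0 < s.
  rewrite -(pmulr_rgt0 _ Le); apply: lt_le_trans Ls; exact: addr_gt0.
exists (fun x => s^-1 * psi x); split.
- exact: test_funZ.
- by move=> x; rewrite mulr_ge0 ?invr_ge0 ?(ltW s0)//; case/andP: (psi01 x).
- by have [_ ->] := LpZ s^-1 q0 psiL; rewrite gtr0_norm ?invr_gt0// mulVf// gt_eqF.
rewrite gradZ; last exact: test_fun_smooth tpsi.
have [_ ->] := vLpZ s^-1 pp0 (test_fun_vLp pp0 tpsi).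
rewrite gtr0_norm ?invr_gt0// mulrC ltr_pdivrMr//; apply: lt_le_trans Ls.
apply: le_lt_trans gphi.
by have [_] := vnrm_le_pointwise pp0 (vmeas_grad (test_fun_smooth tpsi)) (test_fun_vLp pp0 tphi) psig.
Qed.

Lemma centered_near_minimizer (e : R) : 0 < e -> exists psi z, [/\ test_fun Om psi, forall x, 0 <= psi x,
  nrm leb q psi = 1, vnrm p (grad psi) < L + e & Y z /\ forall x, psi x <= psi z].
Proof.
move=> /nonneg_near_minimizer[psi [tpsi psi0 npsi gpsi]].
have [x hx] := test_fun_max tpsi; have [a [Ya Oa]] := shift x.
have spsi := test_fun_smooth tpsi.
exists (fun y => psi (- a + y)), (a + x); split.
- apply: test_fun_shift; apply: test_funS tpsi => y Oy; exists (a + y); first exact/Oa.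
  by rewrite addrA addNr add0r.
- by move=> y.
- by rewrite nrm_shift//; exact: smooth_measurable.
- have -> : vnrm p (grad (fun y => psi (- a + y))) = vnrm p (grad psi); last exact: gpsi.
  rewrite -[RHS](@nrm_shift _ _ p (fun x => enorm (grad psi x)) (- a)).
    have -> // : (fun x => enorm (grad psi (- a + x))) = (fun x => enorm (grad (fun y => psi (- a + y)) x)).
    by apply/funext => y; rewrite grad_shift.
  by apply: measurable_enorm; exact: vmeas_grad.
- by split=> // y; rewrite addrA addNr add0r; have := hx (- a + y); rewrite !ger0_norm.
Qed.

(** Interpolation gives [1 <= M^(q-p) B^p] with [B] bounding the [L^p] norm; since [p < q], a
    near-minimizer cannot be uniformly small. *)
Lemma sup_lower : exists2 m0 : R, 0 < m0 & forall psi M, test_fun Om psi -> nrm leb q psi = 1 ->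
  vnrm p (grad psi) <= L + 1 -> (forall x, `|psi x| <= M) -> m0 <= M.
Proof.
pose B := C * (L + 1); have B0 : 0 < B by rewrite mulr_gt0// addr_gt0.
have qp : 0 < q - p by rewrite subr_gt0.
exists ((B `^ p)^-1 `^ (q - p)^-1); first by rewrite powR_gt0// invr_gt0 powR_gt0.
move=> psi M tpsi npsi gpsi pM; rewrite leNgt; apply/negP => lt.
have M0 : 0 <= M by exact: le_trans (normr_ge0 _) (pM 0).
have W := W0_test adm tpsi; have [uL uC] := W0_Lp adm W.
have [_] := nrm_interp pp0 (ltW pq) M0 pM uL; rewrite npsi powR1 leNgt => /negP; apply.
have nB : nrm leb p psi `^ p <= B `^ p.
  apply: powR_le; [exact: ltW|exact: nrm_ge0|].
  by apply: le_trans uC _; apply: ler_wpM2l => //; exact: ltW.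
have MB : M `^ (q - p) < (B `^ p)^-1.
  have := gt0_ltr_powR qp _ _ lt; rewrite -powRrM mulVf ?gt_eqF// powRr1; last by rewrite invr_ge0 powR_ge0.
  by apply; rewrite nnegrE ?powR_ge0.
apply: (@le_lt_trans _ _ (M `^ (q - p) * B `^ p)); first by apply: ler_wpM2l => //; exact: powR_ge0.
by rewrite -ltr_pdivlMr ?powR_gt0// div1r.
Qed.

Section minimizing_sequence.
Variables (psi : nat -> V -> R) (z : nat -> V).
Hypotheses (tpsi : forall k, test_fun Om (psi k)) (psi0 : forall k x, 0 <= psi k x).
Hypotheses (npsi : forall k, nrm leb q (psi k) = 1).
Hypotheses (gpsi : forall k, vnrm p (grad (psi k)) < L + k.+1%:R^-1).
Hypotheses (Yz : forall k, Y (z k)) (psiz : forall k x, psi k x <= psi k (z k)).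
Variable U : set_system nat.
Hypothesis ultraU : UltraFilter U.
Hypothesis Uoo : forall S, (\oo : set_system nat) S -> U S.

Let g1 k : vnrm p (grad (psi k)) <= L + 1.
Proof. by apply: le_trans (ltW (gpsi k)) _; rewrite lerD2l invf_le1// ler1n. Qed.

Let psiB k x : `|psi k x| <= C * (L + 1).
Proof.
by apply: le_trans (W0_sup adm x (W0_test adm (tpsi k))) _; apply: ler_wpM2l; [exact: ltW|exact: g1].
Qed.

(** The bounded values lie in a compact interval, where the ultrafilter converges, at every point
    simultaneously; no diagonal extraction is made. *)
Let pointwise x (e : R) : 0 < e -> exists2 S, U S & forall k l, S k -> S l -> `|psi k x - psi l x| < e.
Proof.
move=> e0; have e2 : 0 < e / 2 by rewrite divr_gt0.
pose B := C * (L + 1).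
have cB : compact (`[- B, B]%classic : set R) by exact: segment_compact.
have FB : (fmap (fun k => psi k x) U) (`[- B, B]%classic : set R).
  apply: (@filterS _ U _ setT) => [k _|]; last exact: filterT.
  by have := psiB k x; rewrite /= in_itv /= ler_norml.
have [l [_ cl]] := cB _ (fmap_proper_filter (fun k => psi k x) _) FB.
have nb : nbhs l [set s : R | `|l - s| < e / 2] by apply/nbhs_normP; exists (e / 2).
pose A := (fun k => psi k x) @^-1` [set s : R | `|l - s| < e / 2].
have UA : U A.
  have [//|UnA] := in_ultra_setVsetC A ultraU.
  by have [y [y1 y2]] := cl (~` [set s : R | `|l - s| < e / 2]) _ UnA nb; case: y1.
exists A; first exact: UA.
move=> i j /= hi hj; rewrite (_ : psi i x - psi j x = (l - psi j x) - (l - psi i x)); last by ring.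
apply: le_lt_trans (ler_normB _ _) _; have -> : e = e / 2 + e / 2 by field.
exact: ltrD.
Qed.

(** Equicontinuity reduces the ball to a finite net, and a filter is stable under finite
    intersections. *)
Let locally_uniform (r e : R) : 0 < r -> 0 < e ->
  exists2 S, U S & forall k l x, S k -> S l -> `|x| <= r -> `|psi k x - psi l x| <= e.
Proof.
move=> r0 e0; have L1 : 0 < L + 1 by exact: addr_gt0.
have e3 : 0 < e / 3 by rewrite divr_gt0.
have e1 : 0 < e / 3 / (L + 1) by rewrite divr_gt0.
have [_ _ _ _ /(_ _ e1)[rho rho0 hrho]] := adm.
have osc k x y : `|x - y| < rho -> `|psi k x - psi k y| <= e / 3.
  move=> xy; apply: le_trans (hrho _ _ _ (tpsi k) xy) _.
  by rewrite mulrAC ler_pdivrMr// ler_pM2l.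
have [I [P hP]] := @finite_net R N _ _ r0 rho0.
have /choice[S hS] : forall i, exists S, U S /\ forall k l, S k -> S l -> `|psi k (P i) - psi l (P i)| < e / 3.
  by move=> i; have [S US hS] := pointwise (P i) e3; exists S.
exists [set k | forall i, S i k].
  by apply: (@filter_forall _ I S U _) => i; case: (hS i).
move=> k l x Sk Sl /hP[i xi].
have a := osc k _ _ xi; have b := osc l _ _ xi; have c := (hS i).2 _ _ (Sk i) (Sl i).
exact: three_eps a b c.
Qed.

(** On the ball of radius [r] the functions are uniformly close; outside, tightness makes each of
    them small. The shares of [e] are a half and two quarters. *)
Let Lq_cauchy (e : R) : 0 < e -> exists2 S, U S & forall k l, S k -> S l -> nrm leb q (psi k \- psi l) <= e.
Proof.
move=> e0; have [m0 m00 hm0] := sup_lower.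
have [r1 hr1] := compact_norm_bounded cY.
have e4 : 0 < e / 4 by rewrite divr_gt0.
have [d [r [d0 r0 ht]]] := tight adm Om0 pq r1 m00 e4.
pose D : set V := [set x : V | `|x| <= r].
have cD : compact D by have := @compact_ball_rV R N 0 r; under eq_fun do rewrite subr0.
have mD : measurable D by apply: measurable_closed_rV; exact: compact_closed_rV.
have iL := indicL cD; pose c := nrm leb q (\1_D : V -> R).
have c0 : 0 <= c by exact: nrm_ge0.
have c1 : 0 < 2 * (c + 1) by rewrite mulr_gt0// ltr_wpDl.
have ec : 0 < e / (2 * (c + 1)) by rewrite divr_gt0.
have [S US hS] := locally_uniform r0 ec.
have Ud : U [set k | k.+1%:R^-1 < d].
  apply: Uoo; have /seq_cvgP /(_ d d0)[n0 hn0] := @cvg_harmonic R.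
  by exists n0 => // n /= /hn0; rewrite subr0 ger0_norm// invr_ge0.
exists (S `&` [set k | k.+1%:R^-1 < d]); first exact: filterI.
move=> k l [Sk dk] [Sl dl].
have tail j : j.+1%:R^-1 < d -> nrm leb q (fun x => \1_[set x : V | r < `|x|] x * psi j x) <= e / 4.
  move=> dj; apply: (ht _ (z j)) => //; last 2 first.
  - exact: hr1.
  - by rewrite ger0_norm//; apply: (hm0 _ _ (tpsi j)) => // x; rewrite ger0_norm.
  by apply: le_trans (ltW (gpsi j)) _; rewrite lerD2l ltW.
have mDc : measurable [set x : V | r < `|x|].
  rewrite (_ : [set x : V | _] = ~` D); first exact: measurableC.
  by apply/seteqP; split=> x /=; [rewrite ltNge => /negP|move/negP; rewrite -ltNge].
have pL j : Lp leb q (psi j) by exact: test_fun_Lp (tpsi j).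
have tL j : Lp leb q (fun x => \1_[set x : V | r < `|x|] x * psi j x).
  apply: (Lp_le q0 _ _ (pL j)).1.
    by apply: measurable_funM; [exact: measurable_indic|case: (pL j)].
  by move=> x; rewrite normrM ler_piMl// indicE; case: (_ \in _); rewrite ?normr1 ?normr0.
have [inL inn] : Lp leb q (fun x => \1_D x * (psi k x - psi l x)) /\
    nrm leb q (fun x => \1_D x * (psi k x - psi l x)) <= e / (2 * (c + 1)) * c.
  have [ZL Zn] := LpZ (e / (2 * (c + 1))) q0 iL.
  rewrite (gtr0_norm ec) -/c in Zn; rewrite -Zn; apply: Lp_le => //.
    apply: measurable_funM; first exact: measurable_indic.
    by apply: measurable_funB; [case: (pL k)|case: (pL l)].
  move=> x; rewrite [leLHS]normrM [leRHS]normrM (gtr0_norm ec) indicE.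
  case: (boolP (x \in D)) => [|_]; last by rewrite normr0 mul0r mulr0.
  by rewrite inE => Dx; rewrite normr1 mul1r mulr1; exact: hS.
have [oL on] := LpB q1 (tL k) (tL l).
have [_ tn] := LpD q1 inL oL.
have E : (fun x => \1_D x * (psi k x - psi l x)) \+ ((fun x => \1_[set x : V | r < `|x|] x * psi k x) \-
    (fun x => \1_[set x : V | r < `|x|] x * psi l x)) = psi k \- psi l.
  apply/funext => x; rewrite /= -mulrBr -mulrDl !indicE.
  have [xr|xr] := lerP `|x| r.
    by rewrite mem_set// memNset ?addr0 ?mul1r//=; apply/negP; rewrite -leNgt.
  by rewrite memNset ?mem_set ?add0r ?mul1r//=; apply/negP; rewrite -ltNge.
rewrite E in tn; apply: le_trans tn _.
have ce : e / (2 * (c + 1)) * c <= e / 2.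
  rewrite mulrAC ler_pdivrMr// mulrA divfK// ler_pM2l// lerDl//.
have h1 := tail k dk; have h2 := tail l dl.
apply: le_trans (lerD (le_trans inn ce) (le_trans on (lerD h1 h2))) _.
by have -> : e / 2 + (e / 4 + e / 4) = e by field.
Qed.

Lemma minimizing_limit : exists u g z, [/\ W0 Om p u g, forall x, 0 <= u x, nrm leb q u = 1,
  vnrm p g = L & Y z /\ forall x, u x <= u z].
Proof.
have n0 (n : nat) : 0 < n.+1%:R^-1 :> R by rewrite invr_gt0.
have /choice[S hS] : forall n : nat, exists S, U S /\ forall k l, S k -> S l -> nrm leb q (psi k \- psi l) <= n.+1%:R^-1.
  by move=> n; have [S US hS] := Lq_cauchy (n0 n); exists S.
(* An ordinary sequence is drawn from the ultrafilter: its term [k n] is at least [n] and lies in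
   the good sets of all orders up to [n]. *)
pose T n : set nat := [set k | (n <= k)%N /\ forall i : 'I_n.+1, S i k].
have UT n : U (T n).
  apply: filterI; first by apply: Uoo; exists n.
  by apply: (@filter_forall _ 'I_n.+1 (fun i => S i) U _) => i; case: (hS i).
have /choice[k hk] : forall n, exists k, T n k by move=> n; exact: filter_ex (UT n).
have kn n : (n <= k n)%N by case: (hk n).
have small (e : R) : 0 < e -> exists n0, forall n, (n0 <= n)%N -> n.+1%:R^-1 < e.
  move=> e0; have /seq_cvgP /(_ e e0)[m hm] := @cvg_harmonic R; exists m => n /hm.
  by rewrite subr0 ger0_norm// invr_ge0.
have kC (e : R) : 0 < e -> exists n0, forall m n, (n0 <= m)%N -> (n0 <= n)%N ->
    nrm leb q (psi (k m) \- psi (k n)) <= e.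
  move=> /small[i hi]; exists i => m n im jn; apply: le_trans (ltW (hi i (leqnn i))).
  have [_ /(_ (Ordinal (im : (i < m.+1)%N))) a] := hk m; have [_ /(_ (Ordinal (jn : (i < n.+1)%N))) b] := hk n.
  by apply: (hS i).2.
have Llow j : L <= vnrm p (grad (psi j)).
  by have := LL (W0_test adm (tpsi j)); rewrite npsi mulr1.
have lim : vnrm p (grad (psi (k n))) @[n --> \oo] --> L.
  apply/seq_cvgP => e /small[i hi]; exists i => n hn.
  have := Llow (k n); have := gpsi (k n); have := hi (k n) (leq_trans hn (kn n)).
  move=> b1 b2 b3; rewrite ger0_norm ?subr_ge0// ltrBlDl; apply: lt_trans b2 _.
  by rewrite ltrD2l.
have pL j : Lp leb q (psi j) by exact: test_fun_Lp (tpsi j).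
(* Midpoints have [L^q] norm at least 1 minus half the distance, so the Rayleigh inequality bounds
   their energy norm below by almost [L], which is the hypothesis of [clarkson_cauchy]. *)
have mid (e : R) : 0 < e -> exists n0, forall m n, (n0 <= m)%N -> (n0 <= n)%N ->
    L - e <= vnrm p (fun x => 2^-1 *: (grad (psi (k m)) x + grad (psi (k n)) x)).
  move=> e0; have eL : 0 < e / L by exact: divr_gt0.
  have [i hi] := kC _ eL; exists i => m n im jn.
  have W := W0_mid adm (W0_test adm (tpsi (k m))) (W0_test adm (tpsi (k n))).
  apply: le_trans (LL W); have [ML _] := W0_Lq adm (ltW pq) W.
  have [dL _] := LpB q1 (pL (k m)) (pL (k n)).
  have [hL hn] := LpZ 2^-1 q0 dL; rewrite ger0_norm ?invr_ge0// in hn.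
  have [_ tri] := LpD q1 ML hL.
  have E : (fun x => 2^-1 * (psi (k m) x + psi (k n) x)) \+ (fun x => 2^-1 * (psi (k m) \- psi (k n)) x) = psi (k m).
    by apply/funext => x /=; field.
  rewrite E npsi hn in tri; have d := hi m n im jn.
  have h1 : 2^-1 * nrm leb q (psi (k m) \- psi (k n)) <= e / L.
    by apply: le_trans d; rewrite ler_piMl ?nrm_ge0// invf_le1// ler1n.
  have h2 := le_trans tri (lerD (lexx _) h1).
  rewrite -lerBlDr in h2.
  apply: le_trans (ler_wpM2l (ltW L0) h2).
  by rewrite mulrBr mulr1 mulrC divfK// gt_eqF.
have Cg : forall e : R, 0 < e -> exists n0, forall m n, (n0 <= m)%N -> (n0 <= n)%N ->
    vnrm p (fun x => grad (psi (k m)) x - grad (psi (k n)) x) < e.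
  apply: (@clarkson_cauchy _ _ _ _ _ adm (fun n => grad (psi (k n))) L) => //.
  by move=> n; exact: test_fun_vLp (tpsi (k n)).
have [u [g [ug glim]]] := W0_complete adm (fun n => W0_test adm (tpsi (k n))) Cg.
have sub n := W0_sub adm (W0_test adm (tpsi (k n))) ug.
have unif (e : R) : 0 < e -> exists n0, forall n x, (n0 <= n)%N -> `|psi (k n) x - u x| <= e.
  move=> e0; have eC : 0 < e / C by exact: divr_gt0.
  have [i hi] := glim _ eC; exists i => n x hn.
  apply: le_trans (W0_sup adm x (sub n)) _.
  by rewrite mulrC -ler_pdivlMr//; exact: hi.
have [uL _] := W0_Lq adm (ltW pq) ug.
have nu : nrm leb q u = 1.
  apply/eqP; rewrite -subr_eq0 -normr_le0; apply/ler_addgt0Pr => e e0; rewrite add0r.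
  have eC : 0 < e / C by exact: divr_gt0.
  have [i hi] := glim _ eC; have [dL dn] := W0_Lq adm (ltW pq) (sub i).
  have {}dn : nrm leb q (psi (k i) \- u) <= e.
    by apply: le_trans dn _; rewrite mulrC -ler_pdivlMr//; exact: hi.
  have [_ t1] := LpD q1 dL uL; have [_ t2] := LpB q1 (pL (k i)) dL.
  have E1 : (psi (k i) \- u) \+ u = psi (k i) by apply/funext => x /=; rewrite subrK.
  have E2 : psi (k i) \- (psi (k i) \- u) = u by apply/funext => x /=; rewrite opprB addrC subrK.
  rewrite E1 npsi in t1; rewrite E2 npsi in t2.
  rewrite ler_norml lerBlDl lerBrDl; apply/andP; split.
    by rewrite lerBlDr addrC; apply: le_trans t1 _; rewrite lerD2r.
  by apply: le_trans t2 _; rewrite lerD2l.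
have [z' [z's [Yz' zlim]]] : exists (z' : V) (s : nat -> nat), Y z' /\ ({homo s : m n / (m < n)%N} /\
    forall r : R, 0 < r -> exists n0, forall n, (n0 <= n)%N -> `|z (k (s n)) - z'| < r).
  by have [s [z' [sm Yz' zs]]] := compact_subseq cY (fun n => Yz (k n)); exists z', s.
case: zlim => sm zs.
have sn n : (n <= z's n)%N by elim: n => // n IH; exact: leq_ltn_trans IH (sm _ _ (ltnSn n)).
exists u, g, z'; split=> //.
- move=> x; apply/ler_addgt0Pr => e e0; have [i hi] := unif e e0.
  have := hi i x (leqnn i); rewrite ler_norml => /andP[_ h].
  by apply: le_trans (psi0 (k i) x) _; rewrite -lerBlDl.
- apply/le_anti/andP; split; last by have := LL ug; rewrite nu mulr1.
  apply/ler_addgt0Pr => e e0; have e2 : 0 < e / 2 by exact: divr_gt0.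
  have [i hi] := glim _ e2; move/seq_cvgP: lim => /(_ _ e2)[j hj].
  have a := hi _ (leq_maxl i j); have b := hj _ (leq_maxr i j).
  have c := vnrm_lerB p1 (test_fun_vLp pp0 (tpsi (k (maxn i j)))) (W0_vLp ug).
  exact: vnrm_limit_bound (le_trans c a) b.
- split=> // x; apply/ler_addgt0Pr => e e0; have e3 : 0 < e / 3 by exact: divr_gt0.
  have /continuous_at_normP /(_ _ e3)[r r0 hr] := W0_continuous adm ug (x := z').
  have [i hi] := unif _ e3; have [j hj] := zs r r0; pose n := maxn i j.
  have in' : (i <= z's n)%N by exact: leq_trans (leq_maxl _ _) (sn n).
  have a := hi (z's n) x in'; have b := hi (z's n) (z (k (z's n))) in'.
  have c := hj n (leq_maxr _ _); rewrite distrC in c; have {}c := hr _ c.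
  exact: max_limit_bound a b c (psiz _ x).
Qed.

End minimizing_sequence.

Lemma minimizer_exists : exists u g z, [/\ W0 Om p u g, forall x, 0 <= u x, nrm leb q u = 1,
  vnrm p g = L & Y z /\ forall x, u x <= u z].
Proof.
have n0 (n : nat) : 0 < n.+1%:R^-1 :> R by rewrite invr_gt0.
have /choice[pz hpz] : forall n, exists pz : (V -> R) * V, [/\ test_fun Om pz.1, forall x, 0 <= pz.1 x,
  nrm leb q pz.1 = 1, vnrm p (grad pz.1) < L + n.+1%:R^-1 & Y pz.2 /\ forall x, pz.1 x <= pz.1 pz.2].
  by move=> n; have [psi [z h]] := centered_near_minimizer (n0 n); exists (psi, z).
have [U [uU Uoo]] := ultraFilterLemma (F := \oo : set_system nat) _.
apply: (@minimizing_limit (fun n => (pz n).1) (fun n => (pz n).2) _ _ _ _ _ _ U uU Uoo).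
- by move=> n; case: (hpz n).
- by move=> n; case: (hpz n).
- by move=> n; case: (hpz n).
- by move=> n; case: (hpz n).
- by move=> n; case: (hpz n) => _ _ _ _ [].
- by move=> n; case: (hpz n) => _ _ _ _ [].
Qed.

End existence.

(** * Normalized minimizers in the reference cell *)

Section cell_minimizers.
Context {R : realType} {N : nat}.
Local Notation V := 'rV[R]_N.
Local Notation leb := (@lebesgue_rV R N).
Variables (p : R) (t : V) (K : set V) (C : R).
Hypotheses (t0 : forall i, 0 < t 0 i) (cK : compact K) (Kcube : K `<=` closure (cube 2^-1)).
Local Notation Om := (perforated t K).
Hypotheses (adm : admissible Om p C) (Om0 : exists x, Om x).

Let oOm : open Om. Proof. by case: adm. Qed.
Let p2 : 2 <= p. Proof. by case: adm. Qed.
Let p1 : 1 <= p. Proof. exact: le_trans (ler1n _ 2) p2. Qed.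
Let pp0 : 0 < p. Proof. exact: lt_le_trans p1. Qed.

(** The minimizers of the statement are specified on the domain only, while [W0] requires them to
    vanish off it. *)
Definition cut (u : V -> R) : V -> R := fun x => \1_Om x * u x.

Lemma cut_in u x : Om x -> u x = cut u x.
Proof. by move=> Ox; rewrite /cut indicE mem_set// mul1r. Qed.

Lemma cell_sup (v : V -> R) (M : R) : 0 <= M -> (forall x, Om x -> {for x, continuous v}) ->
  (forall x, Om x -> `|v x| <= M) -> (exists z, [/\ cell t z, Om z & `|v z| = M]) ->
  Lq_norm (dilation t @` (cube 2^-1 `\` K)) +oo v = M%:E /\ Lq_norm Om +oo v = M%:E.
Proof.
move=> M0 cv vM [z [zc Oz vz]]; have OC := open_cellE t0 Kcube.
have sub x : (dilation t @` (cube 2^-1 `\` K)) x -> Om x by rewrite OC => -[].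
split; apply/eqP; rewrite eq_le; apply/andP; split.
- by apply: Linfty_le => // x /sub; exact: vM.
- apply/lee_addgt0Pr => e e0.
  have /continuous_at_normP /(_ e e0)[r r0 hr] := cv z Oz.
  have [y yc zy] := cell_approx t0 cK Kcube r0 zc Oz.
  have := Linfty_ge (open_open_cell t0 cK Kcube) yc (cv y (sub y yc)).
  rewrite -(leeD2rE _ _ (isT : e%:E \is a fin_num)); apply: le_trans.
  rewrite -EFinD lee_fin -vz; have := hr y zy; have := lerB_dist (v z) (v y).
  move: `|v z| `|v y| `|v z - v y| => a b c; lra.
- exact: Linfty_le.
- by rewrite -vz; apply: Linfty_ge => //; exact: cv.
Qed.

(** The continuous function [cut u] attains a maximum on the compact closed cell. It bounds the
    essential supremum over the open cell, equal by normalization to the one over the domain, so the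
    point found is a global maximum. *)
Lemma cell_minimizer_data q u : p < q -> cell_minimizer t K p q u ->
  exists g z, [/\ W0 Om p (cut u) g /\ (forall x, 0 <= cut u x), nrm leb q (cut u) = 1,
    vnrm p g = Lam Om p q%:E, cell t z & forall x, cut u x <= cut u z].
Proof.
move=> pq [[cu [_ uoo]] u0 un uE uc]; have q0 : 0 < q by exact: lt_trans pq.
have [g [ug wg]] := csobolev0_W0 adm cu.
have cu0 x : 0 <= cut u x.
  by rewrite /cut indicE; case: (boolP (x \in _)) => [|_]; rewrite ?mul0r// inE mul1r => /u0.
have [uL _] := W0_Lq adm (ltW pq) ug.
have nu : nrm leb q (cut u) = 1.
  have [E _] := in_Lq_W0 q0 uL (fun x => @W0_off _ _ _ _ _ _ x ug) (fun x => @cut_in u x).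
  by move: E; rewrite un => -[].
have gu : vnrm p g = Lam Om p q%:E.
  have [_ _ E _] := W0_energy adm ug (fun x => @cut_in u x).
  have [L0 LE _ _ _] := LamP adm Om0 (ltW pq).
  move: uE; rewrite E LE => -[] h; have pK (a : R) : 0 <= a -> (a `^ p) `^ p^-1 = a.
    by move=> a0; rewrite -powRrM divff ?gt_eqF// powRr1.
  by rewrite -(pK _ (vnrm_ge0 p g)) h (pK _ (ltW L0)).
have cc : continuous (cut u) by exact: (W0_continuous adm ug).
have c0 : cell t 0 by move=> i; rewrite mxE normr0 divr_ge0// ltW.
have [|z zc hz] := EVT_max_rV (f := cut u) (ex_intro _ 0 c0) (@compact_cell R N t).
  exact: continuous_subspaceT.
exists g, z; split=> //; first by rewrite inE in zc.
move=> x; have [Ox|Ox] := pselect (Om x); last by rewrite [cut u x](W0_off ug Ox).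
have cv y : Om y -> {for y, continuous u} by case: cu => _ h; exact: h.
have OC := open_cellE t0 Kcube.
have := Linfty_ge oOm Ox (cv x Ox); rewrite -uc => h.
have : (Lq_norm (dilation t @` (cube 2^-1 `\` K)) +oo u <= (cut u z)%:E)%E.
  apply: Linfty_le => // y; rewrite OC => -[yc Oy].
  rewrite (cut_in u Oy) ger0_norm//; apply: hz; rewrite inE => i; exact: ltW.
move=> /(le_trans h); rewrite lee_fin (cut_in u Ox) ger0_norm//.
Qed.

Lemma data_cell_minimizer q u g z : p < q -> W0 Om p u g -> (forall x, 0 <= u x) ->
  nrm leb q u = 1 -> vnrm p g = Lam Om p q%:E -> cell t z -> (forall x, u x <= u z) ->
  cell_minimizer t K p q u.
Proof.
move=> pq ug u0 nu gu zc uz; have q0 : 0 < q by exact: lt_trans pq.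
have [uL _] := W0_Lq adm (ltW pq) ug.
have uu x : Om x -> u x = u x by [].
have Oz : Om z.
  apply: contrapT => Oz; have z0 := W0_off ug Oz.
  have u00 x : u x = 0 by apply/le_anti; rewrite u0 andbT -z0 uz.
  have := (@nrm0 R N q q0).2; have -> : cst 0 = u :> (V -> R) by apply/funext => x; rewrite u00.
  by rewrite nu => /eqP; rewrite oner_eq0.
have cu : csobolev0 p Om u by exact (W0_csobolev0 adm ug uu).
have [s1 s2] : Lq_norm (dilation t @` (cube 2^-1 `\` K)) +oo u = (u z)%:E /\ Lq_norm Om +oo u = (u z)%:E.
  apply: cell_sup => //; first by case: cu.
    by move=> x _; rewrite ger0_norm.
  by exists z; split=> //; rewrite ger0_norm.
split.
- split=> //; split; last by rewrite s2 ltry.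
  apply: measurable_funTS; apply: continuous_measurable_rV; exact: (W0_continuous adm ug).
- by move=> x _.
- by have [-> _] := in_Lq_W0 q0 uL (fun x => @W0_off _ _ _ _ _ _ x ug) uu; rewrite nu.
- have [_ _ -> _] := W0_energy adm ug uu.
  by have [_ -> _ _ _] := LamP adm Om0 (ltW pq); rewrite gu.
- by rewrite s1 s2.
Qed.

Lemma cell_minimizer_exists q : p < q -> exists v, cell_minimizer t K p q v.
Proof.
move=> pq; have sh x : exists a, cell t (a + x) /\ forall y, Om (a + y) <-> Om y.
  have [j hj] := cell_cover t0 x; exists (lattice t j); split=> // y.
  exact: lattice_shift.
have [u [g [z [ug u0 nu gu [zc uz]]]]] := minimizer_exists adm Om0 pq (@compact_cell R N t) sh.
by exists u; exact: data_cell_minimizer ug u0 nu gu zc uz.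
Qed.

Lemma cut_sobolev_norm u v g h : W0 Om p (cut u) g -> W0 Om p (cut v) h ->
  sobolev_norm p Om (u \- v) = ((nrm leb p (cut u \- cut v) `^ p + vnrm p (fun x => g x - h x) `^ p) `^ p^-1)%:E.
Proof.
move=> ug vh; have E x : Om x -> (u \- v) x = (cut u \- cut v) x.
  by move=> Ox /=; rewrite -!cut_in.
by have [_ _ _ ->] := W0_energy adm (W0_sub adm ug vh) E.
Qed.

(** By the Poincare inequality the Sobolev norm of the difference lies between its gradient norm and
    [k] times that norm. *)
Lemma cut_sobolev_cvg (u : nat -> V -> R) v (g : nat -> V -> V) h :
  (forall n, W0 Om p (cut (u n)) (g n)) -> W0 Om p (cut v) h ->
  sobolev_norm p Om (u n \- v) @[n --> \oo] --> 0%E <->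
  forall e : R, 0 < e -> exists n0, forall n, (n0 <= n)%N -> vnrm p (fun x => g n x - h x) <= e.
Proof.
move=> ug vh; have E n := cut_sobolev_norm (ug n) vh.
have C0 : 0 < C by case: adm.
have nb n : nrm leb p (cut (u n) \- cut v) <= C * vnrm p (fun x => g n x - h x).
  by have [] := W0_Lp adm (W0_sub adm (ug n) vh).
pose S n := (nrm leb p (cut (u n) \- cut v) `^ p + vnrm p (fun x => g n x - h x) `^ p) `^ p^-1.
have -> : (fun n => sobolev_norm p Om (u n \- v)%R) = EFin \o S by apply/funext => n; rewrite E.
have pi0 : 0 < p^-1 by rewrite invr_gt0.
have Sge n : vnrm p (fun x => g n x - h x) <= S n.
  rewrite -[leLHS](powRr1 (vnrm_ge0 _ _)) -(@divff _ p) ?gt_eqF// powRrM.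
  by apply: powR_le; [exact: ltW|exact: powR_ge0|rewrite lerDr powR_ge0].
pose k := (C `^ p + 1) `^ p^-1.
have Cp0 : 0 <= C `^ p + 1 by rewrite addr_ge0// powR_ge0.
have k0 : 0 < k by rewrite powR_gt0// ltr_wpDl// powR_ge0.
have Sle n : S n <= k * vnrm p (fun x => g n x - h x).
  have v0 := vnrm_ge0 p (fun x => g n x - h x).
  have -> : k * vnrm p (fun x => g n x - h x) = ((C `^ p + 1) * vnrm p (fun x => g n x - h x) `^ p) `^ p^-1.
    by rewrite powRM ?powR_ge0// -powRrM divff ?gt_eqF// powRr1.
  apply: powR_le; [exact: ltW|by rewrite addr_ge0 ?powR_ge0|].
  rewrite mulrDl mul1r lerD2r -powRM//; last exact: ltW.
  by apply: powR_le; [exact: ltW|exact: nrm_ge0|exact: nb].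
split=> [/fine_cvgP[_ /seq_cvgP lim] e /lim[n0 hn0]|lim].
  exists n0 => n /hn0; rewrite subr0 => hS; apply: le_trans (Sge n) _.
  by apply: le_trans (ltW hS); exact: ler_norm.
apply/cvg_EFin; first exact: nearW.
apply/seq_cvgP => e e0; have ek : 0 < e / 2 / k by rewrite !divr_gt0.
have [n0 hn0] := lim _ ek; exists n0 => n /hn0 hn; rewrite subr0.
rewrite [X in `|X|](_ : _ = S n)// ger0_norm ?powR_ge0//.
apply: le_lt_trans (Sle n) _; apply: (@le_lt_trans _ _ (e / 2)).
  by rewrite mulrC -ler_pdivlMr.
by rewrite ltr_pdivrMr// ltr_pMr// ltr1n.
Qed.

Section sequences.
Variables (u : R -> V -> R) (qn : nat -> R).
Hypothesis (hu : forall q, p < q -> cell_minimizer t K p q (u q)).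
Hypotheses (pq : forall n, p < qn n) (qoo : qn n @[n --> \oo] --> +oo).

Let data : exists gz : nat -> (V -> V) * V, forall n,
  [/\ W0 Om p (cut (u (qn n))) (gz n).1 /\ (forall x, 0 <= cut (u (qn n)) x),
    nrm leb (qn n) (cut (u (qn n))) = 1,
    vnrm p (gz n).1 = Lam Om p (qn n)%:E, cell t (gz n).2 &
    forall x, cut (u (qn n)) x <= cut (u (qn n)) (gz n).2].
Proof.
have /choice[gz h] : forall n, exists gz : (V -> V) * V,
  [/\ W0 Om p (cut (u (qn n))) gz.1 /\ (forall x, 0 <= cut (u (qn n)) x),
    nrm leb (qn n) (cut (u (qn n))) = 1,
    vnrm p gz.1 = Lam Om p (qn n)%:E, cell t gz.2 &
    forall x, cut (u (qn n)) x <= cut (u (qn n)) gz.2].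
  by move=> n; have [g [z h]] := cell_minimizer_data (pq n) (hu (pq n)); exists (g, z).
by exists gz.
Qed.

Lemma minimizers_precompact : exists2 s : nat -> nat, {homo s : m n / (m < n)%N} &
  exists2 v, csobolev0 p Om v & sobolev_norm p Om (u (qn (s n)) \- v) @[n --> \oo] --> 0%E.
Proof.
have [gz h] := data.
have W n : W0 Om p (cut (u (qn n))) (gz n).1 by case: (h n) => -[].
have u0 n x : 0 <= cut (u (qn n)) x by case: (h n) => -[].
have un n : nrm leb (qn n) (cut (u (qn n))) = 1 by case: (h n).
have gn n : vnrm p (gz n).1 = Lam Om p (qn n)%:E by case: (h n).
have Yz n : cell t (gz n).2 by case: (h n).
have uz n x : cut (u (qn n)) x <= cut (u (qn n)) (gz n).2 by case: (h n).
have [s [sm [v [k [vk lim]]]]] := precompact adm Om0 qoo W u0 un gn uz (@compact_cell R N t) Yz.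
exists s => //; exists v; first by exact (W0_csobolev0 adm vk (fun x _ => erefl)).
have vE : cut v = v.
  apply/funext => x; have [Ox|Ox] := pselect (Om x); first by rewrite -cut_in.
  by rewrite (W0_off vk Ox) /cut indicE memNset// mul0r.
have vk' : W0 Om p (cut v) k by rewrite vE.
apply/(cut_sobolev_cvg (fun n => W (s n)) vk').
exact: lim.
Qed.

Variable v : V -> R.
Hypotheses (cv : csobolev0 p Om v) (uv : sobolev_norm p Om (u (qn n) \- v) @[n --> \oo] --> 0%E).

Lemma limit_data : exists k z, [/\ W0 Om p (cut v) k /\ vnrm p k = Lam Om p +oo, Om z /\ cut v z = 1,
  forall x, 0 <= cut v x <= 1, forall y, cut v y = 1 -> y = z &
  forall phi, test_fun Om phi -> (\int[leb]_(x in Om)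
               (u (qn n) x `^ (qn n - 1) * phi x)%:E)%E @[n --> \oo] --> (phi z)%:E].
Proof.
have [gz h] := data; have [k [vk _]] := csobolev0_W0 adm cv.
have W n : W0 Om p (cut (u (qn n))) (gz n).1 by case: (h n) => -[].
have lim := (cut_sobolev_cvg W vk).1 uv.
have u0 n x : 0 <= cut (u (qn n)) x by case: (h n) => -[].
have un n : nrm leb (qn n) (cut (u (qn n))) = 1 by case: (h n).
have gn n : vnrm p (gz n).1 = Lam Om p (qn n)%:E by case: (h n).
have Yz n : cell t (gz n).2 by case: (h n).
have uz n x : cut (u (qn n)) x <= cut (u (qn n)) (gz n).2 by case: (h n).
have cY := @compact_cell R N t.
have [z zc vz] := limit_max adm Om0 qoo W u0 un gn uz cY Yz vk lim.
exists k, z; split.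
- by split=> //; exact: (limit_vnrm adm Om0 qoo W u0 un gn uz vk lim).
- split=> //; apply: contrapT => Oz; have : cut v z = 0 := W0_off vk Oz; rewrite /cut vz.
  by move/eqP; rewrite oner_eq0.
- move=> x; rewrite (limit_ge0 adm W u0 vk lim).
  exact: (limit_le1 adm Om0 qoo W u0 un gn uz vk lim).
- by move=> y vy; apply: (max_unique adm Om0 pq qoo W u0 un gn uz vk lim).
move=> phi tphi.
have := concentration adm Om0 pq qoo W u0 un gn uz vk lim vz tphi.
apply: cvg_trans; apply: near_eq_cvg; apply: nearW => n /=.
by apply: eq_integral => x; rewrite inE => Ox; rewrite -cut_in.
Qed.

Lemma limit_extremal : extremal_infty p Om v.
Proof.
have [k [z [[vk nk] [Oz vz] v01 _ _]]] := limit_data.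
have vin x : Om x -> v x = cut v x by exact: cut_in.
split=> //; first by exists z => //; rewrite vin// vz oner_eq0.
have [_ _ -> _] := W0_energy adm vk vin.
have [_ LE _ _ _] := LamooP adm Om0.
(* The maximum of the limit is exactly 1, so the extremality identity reduces to its energy being
   [Lam oo ^ p]. *)
have -> : Lq_norm Om +oo v = 1%E.
  apply/eqP; rewrite eq_le; apply/andP; split.
    apply: Linfty_le => // x /vin ->; rewrite ger0_norm; by case/andP: (v01 x).
  have := Linfty_ge oOm Oz (cv.2 z Oz); rewrite vin// vz normr1; exact.
by rewrite LE nk poweR_EFin powR1 mule1.
Qed.

Lemma limit_concentration : exists2 z, max_points Om v = [set z] &
  forall phi, test_fun Om phi -> (\int[leb]_(x in Om)
               (u (qn n) x `^ (qn n - 1) * phi x)%:E)%E @[n --> \oo] --> (phi z)%:E.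
Proof.
have [k [z [_ [Oz vz] v01 uniq cc]]] := limit_data.
exists z => //; apply/seteqP; split=> [y [Oy hy]|_ ->] /=.
  apply: uniq; apply/le_anti; case/andP: (v01 y) => _ -> /=.
  by have := hy z Oz; rewrite (cut_in v Oz) (cut_in v Oy) vz.
split=> // x Ox; rewrite (cut_in v Oz) (cut_in v Ox) vz.
by case/andP: (v01 x).
Qed.

End sequences.
End cell_minimizers.

Theorem theorem6p2 (R : realType) (N : nat) (N_ge2 : (2 <= N)%N)
    (p : R) (p_gtN : N%:R < p)
    (t : 'rV[R]_N) (t_gt0 : forall i, 0 < t 0 i)
    (K : set 'rV[R]_N) (K_compact : compact K)
    (K_proper : K `<` closure (cube 2^-1))
    (K_cap : (0 < cap p K (cube 1))%E) :
  let Omega := perforated t K in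
  (forall q : R, p < q -> exists v, cell_minimizer t K p q v) /\
  forall u : R -> 'rV[R]_N -> R,
  (forall q, p < q -> cell_minimizer t K p q (u q)) ->
  [/\ (* precompactness *)
      forall qn : nat -> R, (forall n, p < qn n) -> qn n @[n --> \oo] --> +oo ->
        exists2 s : nat -> nat, {homo s : m n / (m < n)%N} &
        exists2 v, csobolev0 p Omega v &
          sobolev_norm p Omega (u (qn (s n)) \- v) @[n --> \oo] --> 0%E,
      (* accumulation points *)
      forall (qn : nat -> R) v, (forall n, p < qn n) ->
        qn n @[n --> \oo] --> +oo -> csobolev0 p Omega v ->
        sobolev_norm p Omega (u (qn n) \- v) @[n --> \oo] --> 0%E ->
        extremal_infty p Omega v &
      (* concentration *)
      forall (qn : nat -> R) uoo, (forall n, p < qn n) ->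
        qn n @[n --> \oo] --> +oo -> csobolev0 p Omega uoo ->
        sobolev_norm p Omega (u (qn n) \- uoo) @[n --> \oo] --> 0%E ->
        exists2 z, max_points Omega uoo = [set z] &
          forall phi, test_fun Omega phi ->
            (\int[@lebesgue_rV R N]_(x in Omega)
               (u (qn n) x `^ (qn n - 1) * phi x)%:E)%E
              @[n --> \oo] --> (phi z)%:E].
Proof.
move=> Om; have Kc : K `<=` closure (cube 2^-1) by case: K_proper.
have p0 : 0 < p by apply: le_lt_trans p_gtN.
have Kne : exists x0, K x0.
  apply: contrapT => /forallNP K0; have KE : K = set0 by apply/seteqP; split=> // x /K0.
  by move: K_cap; rewrite KE cap_set0// ltxx.
have [C adm] := perforated_admissible N_ge2 p_gtN t_gt0 K_compact Kc Kne.
have Om0 := perforated_nonempty t_gt0 K_compact Kc K_proper.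
split; first by move=> q; exact: (cell_minimizer_exists t_gt0 K_compact Kc adm Om0).
move=> u hu; split.
- by move=> qn pq qoo; exact: (minimizers_precompact t_gt0 Kc adm Om0 hu pq qoo).
- by move=> qn v pq qoo cv uv; exact: (limit_extremal t_gt0 Kc adm Om0 hu pq qoo cv uv).
- by move=> qn v pq qoo cv uv; exact: (limit_concentration t_gt0 Kc adm Om0 hu pq qoo cv uv).
Qed.
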